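(* Let $\mathbf f\in\mathcal U$. The problem of finding $(\mathbf p_h,\xi_h)\in C^2([0,T];\mathbf V_h)\times C^0([0,T];W_h^G)$ such that for every $t\in[0,T]$ $$(\rho\ddot{\mathbf p}_h(t),\mathbf w)_\Omega+a((\mathbf p_h(t),\xi_h(t)),(\mathbf w,\varphi))=(\rho\,\mathbf f(t),\mathbf w)_\Omega\quad\forall(\mathbf w,\varphi)\in\mathbf V_h\times W_h^G,$$ $$\mathbf p_h(T)=\mathbf 0,\qquad\dot{\mathbf p}_h(T)=\mathbf 0,$$ is uniquely solvable, and there is a constant $C>0$, independent of $\mathbf f$, of $t$ and of the choice of the finite-dimensional subspaces $\mathbf V_h$, $W_h$, such that for all $t\in[0,T]$ $$\|\mathbf p_h(t)\|_{1,\Omega}+\|\xi_h(t)\|_{1,\Omega}\le C\int_t^T\|\mathbf f(\tau)\|_\Omega\,\mathrm d\tau.$$ Therefore the operator $R_h:\mathcal U\to\mathcal X$ given by $R_h\mathbf f=\gamma\xi_h$ is uniformly bounded (its operator norm is bounded independently of $\mathbf V_h$, $W_h$).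
   Context: Setting. $\Omega\subset\mathbb R^d$ is a bounded Lipschitz domain with boundary $\Gamma$, partitioned into two non-overlapping relatively open sets $\Gamma_D,\Gamma_N$ ($\Gamma_D=\emptyset$ is allowed), and $T>0$. $A:B$ is the Frobenius product of matrices and $\mathbb R^{d\times d}_{\mathrm{sym}}$ the symmetric matrices. The coefficients $\mathcal C\in L^\infty(\Omega;\mathbb R^{(d\times d)\times(d\times d)})$, $\mathcal E\in L^\infty(\Omega;\mathbb R^{(d\times d)\times d})$, $\boldsymbol\kappa\in L^\infty(\Omega;\mathbb R^{d\times d}_{\mathrm{sym}})$ satisfy, a.e. in $\Omega$ and with constants $c_0,k_0>0$: $\mathcal CA\in\mathbb R^{d\times d}_{\mathrm{sym}}$ and $(\mathcal CA):B=A:(\mathcal CB)$ for all $A,B\in\mathbb R^{d\times d}$; $(\mathcal CA):A\ge c_0A:A$ for $A\in\mathbb R^{d\times d}_{\mathrm{sym}}$; $\mathcal E\mathbf b\in\mathbb R^{d\times d}_{\mathrm{sym}}$ and $(\boldsymbol\kappa\mathbf b)\cdot\mathbf b\ge k_0|\mathbf b|^2$ for $\mathbf b\in\mathbb R^d$. $\mathcal E^\top$ is defined by $(\mathcal E^\top A)\cdot\mathbf b=A:(\mathcal E\mathbf b)$. The density $\rho\in L^\infty(\Omega)$ is strictly positive ($\rho\ge\rho_0>0$ a.e.). $\boldsymbol\varepsilon(\mathbf u)=\frac12(\nabla\mathbf u+\nabla\mathbf u^\top)$. Spaces. $(\cdot,\cdot)_\Omega$, $\|\cdot\|_\Omega$,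 $\|\cdot\|_\Gamma$ are $L^2$ inner product/norms on $\Omega$, $\Gamma$; $\|\cdot\|_{1,\Omega}$ is the $H^1(\Omega)$ norm; $\gamma$ is the trace operator to $\Gamma$. $\mathbf H^1_D(\Omega)$ is the space of $\mathbf u\in H^1(\Omega)^d$ with zero trace on $\Gamma_D$ (all of $H^1(\Omega)^d$ if $\Gamma_D=\emptyset$). $G:H^1(\Omega)\to\mathbb R$ is linear, bounded, with $G1\ne0$; $H^1_G(\Omega)=\{\psi\in H^1(\Omega):G\psi=0\}$. $\mathcal U=C^0([0,T];\mathbf H^1_D(\Omega))$ with norm $\left(\int_0^T\|\mathbf u(\tau)\|_{1,\Omega}^2\,\mathrm d\tau\right)^{1/2}$. $\mathcal X=L^2(0,T;L^2(\Gamma))$ with norm $\left(\int_0^T\|y(t)\|_\Gamma^2\,\mathrm dt\right)^{1/2}$. Semidiscretization. $\mathbf V_h\subset\mathbf H^1_D(\Omega)$ and $W_h\subset H^1(\Omega)$ are finite-dimensional subspaces, $W_h$ contains the constant functions, and $W_h^G=W_h\cap H^1_G(\Omega)$. The bilinear form is $a((\mathbf u,\psi),(\mathbf w,\varphi))=(\mathcal C\boldsymbol\varepsilon(\mathbf u)+\mathcal E\nabla\psi,\boldsymbol\varepsilon(\mathbf w))_\Omega+(-\mathcal E^\top\boldsymbol\varepsilon(\mathbf u)+\boldsymbol\kappa\nabla\psi,\nabla\varphi)_\Omega$. *)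

(* Defs.v *)
From HB Require Import structures.
From mathcomp Require Import all_boot all_order all_algebra.
From mathcomp Require Import all_classical all_reals all_analysis.

Set Implicit Arguments.
Unset Strict Implicit.
Unset Printing Implicit Defensive.

Import Order.TTheory GRing.Theory Num.Theory.
Import numFieldNormedType.Exports.

Local Open Scope classical_set_scope.
Local Open Scope ring_scope.

Section euclidean_measurable.
Context {R : realType} (n : nat).

Definition rV_coord (i : 'I_n) (x : 'rV[R]_n) : measurableTypeR R := x 0 i.

Definition rV_display : measure_display.
Proof. exact: default_measure_display. Qed.

Let rV_set0 : g_sigma_preimage rV_coord set0.
Proof. exact: sigma_algebra0. Qed.

Let rV_setC A : g_sigma_preimage rV_coord A -> g_sigma_preimage rV_coord (~` A).
Proof. exact: sigma_algebraC. Qed.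

Let rV_bigcup (F : _^nat) : (forall i, g_sigma_preimage rV_coord (F i)) ->
  g_sigma_preimage rV_coord (\bigcup_i (F i)).
Proof. exact: sigma_algebra_bigcup. Qed.

(* Generated by the coordinates: this is the Borel sigma-algebra. *)
HB.instance Definition _ := @isMeasurable.Build rV_display
  'rV[R]_n (g_sigma_preimage rV_coord) rV_set0 rV_setC rV_bigcup.

Lemma measurable_rV_coord i : measurable_fun [set: 'rV[R]_n] (rV_coord i).
Proof.
move=> _ A mA; apply: sub_sigma_algebra.
by rewrite (bigD1 i) //=; left; exists A.
Qed.

Lemma measurable_fun_rV d (T : measurableType d) (f : T -> 'rV[R]_n) :
  (forall i, measurable_fun setT (rV_coord i \o f)) -> measurable_fun setT f.
Proof.
move=> mf; apply: (@measurable_function.measurability _ _ _ _ setT f (\big[setU/set0]_(i < n)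
  preimage_set_system setT (rV_coord i) measurable) (erefl _)) => _ [B + <-].
elim/big_ind : _ => [//|C D IC ID [/IC|/ID]//|i _ [A mA <-]].
by have := mf i measurableT A mA; rewrite !setTI.
Qed.

End euclidean_measurable.

Section lebesgue_measure_rV.
Context {R : realType}.

(* Identification of R x R^n with R^(n+1). *)
Definition rV_cons n (p : measurableTypeR R * 'rV[R]_n) : 'rV[R]_n.+1 :=
  row_mx (p.1 : R)%:M p.2.

Definition rV_uncons n (x : 'rV[R]_n.+1) : measurableTypeR R * 'rV[R]_n :=
  (x 0 0, @rsubmx R 1 1 n x).

Lemma rV_consK n : cancel (@rV_cons n) (@rV_uncons n).
Proof.
move=> [a v]; rewrite /rV_uncons /rV_cons /= row_mxKr; congr pair.
have -> : (0 : 'I_n.+1) = lshift n (0 : 'I_1) by exact/val_inj.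
by apply: etrans (row_mxEl _ _ _ _) _; rewrite mxE eqxx mulr1n.
Qed.

Lemma measurable_rV_cons n : measurable_fun setT (@rV_cons n).
Proof.
apply: measurable_fun_rV => i.
case: (@split_ordP 1 n i) => j ->.
- rewrite (_ : _ \o _ = fst); first exact: measurable_fst.
  apply/funext => p; rewrite /= /rV_coord /rV_cons.
  by apply: etrans (row_mxEl _ _ _ _) _; rewrite ord1 mxE eqxx mulr1n.
- rewrite (_ : _ \o _ = rV_coord j \o snd).
    by apply: measurableT_comp => //; exact: measurable_rV_coord.
  by apply/funext => p; rewrite /= /rV_coord /rV_cons; exact: row_mxEr.
Qed.

Lemma measurable_rV_uncons n : measurable_fun setT (@rV_uncons n).
Proof.
apply: measurable_fun_pair; first exact: (measurable_rV_coord 0).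
apply: measurable_fun_rV => i.
rewrite (_ : _ \o _ = rV_coord (rshift 1 i)); first exact: measurable_rV_coord.
by apply/funext => x; rewrite /= /rV_coord mxE.
Qed.

Section step.
Variables (n : nat) (m : {sigma_finite_measure set 'rV[R]_n -> \bar R}).

Definition lebesgue_rV_step : set 'rV[R]_n.+1 -> \bar R :=
  pushforward (@lebesgue_measure R \x m)%E (@rV_cons n).

Let step0 : lebesgue_rV_step set0 = 0%E.
Proof. by rewrite /lebesgue_rV_step /pushforward preimage_set0 measure0. Qed.

Let step_ge0 A : (0 <= lebesgue_rV_step A)%E.
Proof. by rewrite /lebesgue_rV_step /pushforward; exact: measure_ge0. Qed.

Let step_sigma_additive : semi_sigma_additive lebesgue_rV_step.
Proof.
move=> F mF tF mUF; rewrite /lebesgue_rV_step /pushforward preimage_bigcup.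
have mcons A : measurable A -> measurable (@rV_cons n @^-1` A).
  by move=> mA; rewrite -[X in measurable X]setTI; exact: measurable_rV_cons.
apply: measure_semi_sigma_additive.
- by move=> k; exact: mcons.
- apply/trivIsetP => /= i j _ _ ij; rewrite -preimage_setI.
  by move/trivIsetP : tF => /(_ _ _ _ _ ij) ->//; rewrite preimage_set0.
- by rewrite -preimage_bigcup; exact: mcons.
Qed.

HB.instance Definition _ := isMeasure.Build _ _ _
  lebesgue_rV_step step0 step_ge0 step_sigma_additive.

Let step_sigma_finite : sigma_finite setT lebesgue_rV_step.
Proof.
have [F TF Foo] : sigma_finite setT (@lebesgue_measure R \x m)%E.
  have /sigma_finiteP[F [TF ndF Foo]] := sigma_finiteT (@lebesgue_measure R).
  have /sigma_finiteP[G [TG ndG Goo]] := sigma_finiteT m.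
  exists (fun k => F k `*` G k).
    rewrite -setXTT TF TG predeqE => -[x y]; split.
      move=> [/= [k _ Fx] [l _ Gy]]; exists (maxn k l) => //; split.
      + by move: x Fx; exact/subsetPset/ndF/leq_maxl.
      + by move: y Gy; exact/subsetPset/ndG/leq_maxr.
    by move=> [k _ []/= ? ?]; split; exists k.
  move=> k; have [? ?] := Foo k; have [? ?] := Goo k.
  split; first exact: measurableX.
  by rewrite product_measure1E// lte_mul_pinfty// ge0_fin_numE.
exists (fun k => @rV_uncons n @^-1` F k).
  by rewrite -preimage_bigcup -TF preimage_setT.
move=> k; have [mF Fk] := Foo k; split.
  by rewrite -[X in measurable X]setTI; exact: measurable_rV_uncons.
rewrite /lebesgue_rV_step /pushforward -comp_preimage (_ : _ \o _ = id) //.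
by apply/funext => p; exact: rV_consK.
Qed.

HB.instance Definition _ := Measure_isSigmaFinite.Build _ _ _
  lebesgue_rV_step step_sigma_finite.

End step.

(* n-fold product of the Lebesgue measure of the line. *)
Fixpoint lebesgue_rV (n : nat) : {sigma_finite_measure set 'rV[R]_n -> \bar R} :=
  match n with
  | 0%N => \d_(0 : 'rV[R]_0)
  | n'.+1 => lebesgue_rV_step (lebesgue_rV n')
  end.

End lebesgue_measure_rV.

Section euclidean_metric.
Context {R : realType} (n : nat).
Implicit Types (x y : 'rV[R]_n) (A : set 'rV[R]_n).

Definition dotv x y : R := \sum_i x 0 i * y 0 i.

(* The canonical norm of ['rV[R]_n] is the sup norm. *)
Definition enorm x : R := Num.sqrt (dotv x x).

Definition ediam A : \bar R :=
  ereal_sup [set (enorm (p.1 - p.2))%:E | p in A `*` A].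

End euclidean_metric.

Section hausdorff_measure.
Context {R : realType} (n : nat).
Implicit Types (A X : set 'rV[R]_n) (s : nat) (delta : R).

(* Volume of the unit ball of R^s divided by 2^s. *)
Definition hausdorff_const s : R :=
  fine (lebesgue_rV s [set x : 'rV[R]_s | enorm x <= 1]) / 2 ^+ s.

(* The value +oo rules the sets of diameter > delta out of the coverings. *)
Definition hausdorff_size s delta A : \bar R :=
  if `[< A = set0 >] then 0%E
  else if (ediam A <= delta%:E)%E then ((hausdorff_const s)%:E * ediam A ^+ s)%E
  else +oo%E.

(* Coverings by arbitrary sets: every set is measurable in the carrier type. *)
Definition hausdorff_delta s delta : set 'rV[R]_n -> \bar R :=
  @mu_ext _ (g_sigma_algebraType [set: set 'rV[R]_n]) R (hausdorff_size s delta).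

Definition hausdorff s X : \bar R :=
  ereal_sup [set hausdorff_delta s delta X | delta in [set delta | 0 < delta]].

Lemma hausdorff_const_ge0 s : 0 <= hausdorff_const s.
Proof. by rewrite divr_ge0 ?exprn_ge0// fine_ge0. Qed.

Lemma ediam_ge0 A : A !=set0 -> (0 <= ediam A)%E.
Proof.
move=> [x Ax]; apply: le_ereal_sup_tmp; exists (enorm (x - x))%:E.
  by exists (x, x).
by rewrite lee_fin sqrtr_ge0.
Qed.

Lemma hausdorff_size0 s delta : hausdorff_size s delta set0 = 0%E.
Proof. by rewrite /hausdorff_size; case: asboolP. Qed.

Lemma hausdorff_size_ge0 s delta A : (0 <= hausdorff_size s delta A)%E.
Proof.
rewrite /hausdorff_size; case: asboolP => // /eqP/set0P/ediam_ge0 A0.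
by case: ifP => // _; rewrite mule_ge0 ?lee_fin ?hausdorff_const_ge0 ?expe_ge0.
Qed.

Variable s : nat.

Let hausdorff_delta_le delta X : 0 < delta ->
  (hausdorff_delta s delta X <= hausdorff s X)%E.
Proof. by move=> d0; apply: ereal_sup_ubound; exists delta. Qed.

Let hausdorff0 : hausdorff s set0 = 0%E.
Proof.
apply/eqP; rewrite eq_le; apply/andP; split.
  apply: ge_ereal_sup => _ [delta d0 <-].
  by rewrite /hausdorff_delta mu_ext0//; [exact: hausdorff_size0|exact: hausdorff_size_ge0].
apply: le_trans (hausdorff_delta_le set0 ltr01).
by apply: mu_ext_ge0 => A; exact: hausdorff_size_ge0.
Qed.

Let hausdorff_ge0 X : (0 <= hausdorff s X)%E.
Proof.
apply: le_trans (hausdorff_delta_le X ltr01).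
by apply: mu_ext_ge0 => A; exact: hausdorff_size_ge0.
Qed.

Let le_hausdorff : {homo hausdorff s : A B / A `<=` B >-> (A <= B)%E}.
Proof.
move=> A B AB; apply: ge_ereal_sup => _ [delta d0 <-].
by apply: le_trans (hausdorff_delta_le B d0); exact: le_mu_ext.
Qed.

Let hausdorff_sigma_subadditive : sigma_subadditive (hausdorff s).
Proof.
move=> F; apply: ge_ereal_sup => _ [delta d0 <-].
apply: le_trans (mu_ext_sigma_subadditive _ _) _; first exact: hausdorff_size_ge0.
apply: lee_nneseries => [k _ _|k _]; last exact: hausdorff_delta_le.
by apply: mu_ext_ge0 => A; exact: hausdorff_size_ge0.
Qed.

HB.instance Definition _ := isOuterMeasure.Build R 'rV[R]_n (hausdorff s)
  hausdorff0 hausdorff_ge0 le_hausdorff hausdorff_sigma_subadditive.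

End hausdorff_measure.

Section L2_spaces.
Context {R : realType} d (T : measurableType d).
Variables (mu : {measure set T -> \bar R}) (D : set T).
Implicit Types f g : T -> R.

Definition L2 f : Prop :=
  measurable_fun D f /\ (\int[mu]_(x in D) ((f x) ^+ 2)%:E < +oo)%E.

Definition L2norm f : R := Num.sqrt (\int[mu]_(x in D) (f x) ^+ 2).

Definition Linfty f : Prop :=
  measurable_fun D f /\
  exists M : R, {ae mu, forall x, D x -> `|f x| <= M}.

Definition aeq (U : Type) (f g : T -> U) : Prop :=
  {ae mu, forall x, D x -> f x = g x}.

End L2_spaces.

(* The ambient dimension is n.+1, i.e. an arbitrary dimension d >= 1. Elements
   of function spaces are represented by functions, equality in the space being
   almost everywhere equality. *)
Section sobolev.
Context {R : realType} {n : nat}.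
Local Notation V := 'rV[R]_n.+1.
Implicit Types (Omega : set V) (u g phi : V -> R) (w : V -> V) (i j : 'I_n.+1).

Local Notation leb := (lebesgue_rV n.+1).

Definition boundary Omega : set V := closure Omega `\` Omega°.

(* In suitable orthonormal coordinates z, a neighbourhood of each boundary point
   meets Omega in a set z_n > phi(z_0, ..., z_(n-1)), phi Lipschitz. *)
Definition lipschitz_boundary Omega : Prop :=
  forall x, boundary Omega x ->
  exists (Q : 'M[R]_n.+1) (phi : 'rV[R]_n -> R) (L : R) (O : set V),
    [/\ Q *m Q^T = 1%:M,
        forall y z, `|phi y - phi z| <= L * enorm (y - z),
        open O, O x &
        Omega `&` O =
        [set y | O y /\
           let z := y *m Q in phi (col' ord_max z) < z 0 ord_max]].

Definition lipschitz_domain Omega : Prop :=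
  [/\ Omega !=set0, open Omega, connected Omega, bounded_set Omega &
      lipschitz_boundary Omega].

Definition pderiv i (f : V -> R) : V -> R := fun x => 'D_(delta_mx 0 i) f x.

Definition smooth (f : V -> R) : Prop :=
  forall s : seq 'I_n.+1, let g := foldr pderiv f s in
  continuous g /\ forall x i, derivable g x (delta_mx 0 i).

Definition test_function Omega phi : Prop :=
  smooth phi /\ exists K : set V,
    [/\ compact K, K `<=` Omega & forall x, ~ K x -> phi x = 0].

Definition weak_pderiv Omega i u g : Prop :=
  forall phi, test_function Omega phi ->
  \int[leb]_(x in Omega) (u x * pderiv i phi x) =
  - \int[leb]_(x in Omega) (g x * phi x).

Definition H1 Omega u : Prop :=
  L2 leb Omega u /\
  forall i, exists g, L2 leb Omega g /\ weak_pderiv Omega i u g.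

(* A representative of the weak derivative of an H^1 function. *)
Definition wder Omega i u : V -> R :=
  xget (cst 0) [set g | L2 leb Omega g /\ weak_pderiv Omega i u g].

Definition H1norm Omega u : R :=
  Num.sqrt (L2norm leb Omega u ^+ 2 +
            \sum_i L2norm leb Omega (wder Omega i u) ^+ 2).

Definition component w i : V -> R := fun x => w x 0 i.

Definition H1v Omega w : Prop := forall i, H1 Omega (component w i).

Definition L2normv Omega w : R :=
  Num.sqrt (\sum_i L2norm leb Omega (component w i) ^+ 2).

Definition H1normv Omega w : R :=
  Num.sqrt (\sum_i H1norm Omega (component w i) ^+ 2).

Definition grad Omega u : V -> V := fun x => \row_i wder Omega i u x.

Definition strain Omega w : V -> 'M[R]_n.+1 := fun x =>
  \matrix_(i, j) (2^-1 * (wder Omega j (component w i) x +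
                          wder Omega i (component w j) x)).

Definition surface_outer_measure : {outer_measure set V -> \bar R} :=
  @hausdorff R n.+1 n.

Definition surface_measure :
    {measure set (caratheodory_type surface_outer_measure) -> \bar R} :=
  surface_outer_measure.

Definition L2Gamma Omega u : Prop := L2 surface_measure (boundary Omega) u.

Definition L2normGamma Omega u : R :=
  L2norm surface_measure (boundary Omega) u.

Definition aeqGamma Omega u v : Prop :=
  aeq surface_measure (boundary Omega) u v.

(* gamma is the trace operator: the bounded linear map H^1(Omega) -> L^2(Gamma)
   extending the restriction to Gamma of functions smooth up to the boundary
   (unique, since such functions are dense in H^1). *)
Definition is_trace Omega (gamma : (V -> R) -> V -> R) : Prop :=
  [/\ forall u, H1 Omega u -> L2Gamma Omega (gamma u),
      forall (c : R) u v, H1 Omega u -> H1 Omega v ->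
        aeqGamma Omega (gamma (c *: u + v)) (c *: gamma u + gamma v),
      exists M : R, forall u, H1 Omega u ->
        L2normGamma Omega (gamma u) <= M * H1norm Omega u &
      forall u, smooth u -> aeqGamma Omega (gamma u) u].

Definition boundary_partition Omega (GammaD GammaN : set V) : Prop :=
  [/\ exists2 O, open O & GammaD = boundary Omega `&` O,
      exists2 O, open O & GammaN = boundary Omega `&` O,
      GammaD `&` GammaN = set0 &
      boundary Omega = closure GammaD `|` closure GammaN].

Definition H1D Omega (gamma : (V -> R) -> V -> R) (GammaD : set V) : set (V -> V) :=
  [set w | H1v Omega w /\
     forall i, aeq surface_measure GammaD (gamma (component w i)) (cst 0)].

Definition bounded_linear_H1 Omega (G : (V -> R) -> R) : Prop :=
  (forall (c : R) u v, H1 Omega u -> H1 Omega v ->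
     G (c *: u + v) = c * G u + G v) /\
  exists M : R, forall u, H1 Omega u -> `|G u| <= M * H1norm Omega u.

(* S is a finite-dimensional linear subspace of the function space H, seen as a
   set of functions stable under a.e. equality. *)
Definition findim_subspace (U : lmodType R) Omega (H S : set (V -> U)) : Prop :=
  [/\ S `<=` H, S 0,
      forall (c : R) (a b : V -> U), S a -> S b -> S (c *: a + b),
      forall a b : V -> U, S a -> H b -> aeq leb Omega a b -> S b &
      exists m (e : 'I_m -> V -> U), (forall k, S (e k)) /\
        forall a, S a -> exists c : 'I_m -> R,
          aeq leb Omega a (\sum_k c k *: e k)].

End sobolev.

Section time_dependent.
Context {R : realType} (U : lmodType R) (N : U -> R) (T : R).
Implicit Types u v : R -> U.

(* Continuity and differentiability on [0, T] (one-sided at the end points) for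
   the seminorm N. *)
Definition continuous_in_time u : Prop :=
  forall t, t \in `[0, T] ->
  N (u s - u t) @[s --> within [set` `[0, T]] (nbhs t)] --> (0 : R).

Definition derivative_in_time u v : Prop :=
  forall t, t \in `[0, T] ->
  N ((s - t)^-1 *: (u s - u t) - v t) @[s --> within [set` `[0, T]] t^']
    --> (0 : R).

Definition L2time_norm u : R :=
  Num.sqrt (\int[lebesgue_measure]_(t in `[0, T]) (N (u t)) ^+ 2).

End time_dependent.

Section piezoelectric.
Context {R : realType} {n : nat}.
Local Notation V := 'rV[R]_n.+1.
Local Notation M := 'M[R]_n.+1.
Local Notation leb := (lebesgue_rV n.+1).

Definition frob (A B : M) : R := \sum_i \sum_j A i j * B i j.

Definition symmetric_mx (A : M) : Prop := A^T = A.

Definition transpose_coef (E : V -> M) (A : M) : V :=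
  \row_k frob A (E (delta_mx 0 k)).

Variables (Omega : set V) (rho : V -> R).
Variables (C : V -> {linear M -> M}) (E : V -> {linear V -> M}) (kappa : V -> M).

Definition stiffness_coef (c0 : R) : Prop :=
  [/\ forall i j k l, Linfty leb Omega (fun x => C x (delta_mx k l) i j),
      {ae leb, forall x, Omega x -> forall A, symmetric_mx (C x A)},
      {ae leb, forall x, Omega x -> forall A B,
         frob (C x A) B = frob A (C x B)} &
      {ae leb, forall x, Omega x -> forall A, symmetric_mx A ->
         c0 * frob A A <= frob (C x A) A}].

Definition piezoelectric_coef : Prop :=
  (forall i j k, Linfty leb Omega (fun x => E x (delta_mx 0 k) i j)) /\
  {ae leb, forall x, Omega x -> forall b, symmetric_mx (E x b)}.

Definition permittivity_coef (k0 : R) : Prop :=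
  [/\ forall i j, Linfty leb Omega (fun x => kappa x i j),
      {ae leb, forall x, Omega x -> symmetric_mx (kappa x)} &
      {ae leb, forall x, Omega x -> forall b : V,
         k0 * enorm b ^+ 2 <= dotv (b *m (kappa x)^T) b}].

Definition density_coef (rho0 : R) : Prop :=
  Linfty leb Omega rho /\ {ae leb, forall x, Omega x -> rho0 <= rho x}.

Definition bilinear_a (u : V -> V) (psi : V -> R) (w : V -> V) (phi : V -> R) : R :=
  \int[leb]_(x in Omega)
    frob (C x (strain Omega u x) + E x (grad Omega psi x)) (strain Omega w x) +
  \int[leb]_(x in Omega)
    dotv (- transpose_coef (E x) (strain Omega u x) +
          grad Omega psi x *m (kappa x)^T) (grad Omega phi x).

Definition weighted_inner (u w : V -> V) : R :=
  \int[leb]_(x in Omega) (rho x * dotv (u x) (w x)).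

Variables (gamma : (V -> R) -> V -> R) (GammaD : set V).
Variables (G : (V -> R) -> R) (T : R).

Definition source_space (f : R -> V -> V) : Prop :=
  (forall t, t \in `[0, T] -> H1D Omega gamma GammaD (f t)) /\
  continuous_in_time (H1normv Omega) T f.

Definition kerG (Wh : set (V -> R)) : set (V -> R) := Wh `&` [set psi | G psi = 0].

Definition semidiscrete_solution (Vh : set (V -> V)) (Wh : set (V -> R))
    (f p : R -> V -> V) (xi : R -> V -> R) : Prop :=
  exists p1 p2 : R -> V -> V,
  [/\ forall t, t \in `[0, T] ->
        [/\ Vh (p t), Vh (p1 t), Vh (p2 t) & kerG Wh (xi t)],
      [/\ derivative_in_time (H1normv Omega) T p p1,
          derivative_in_time (H1normv Omega) T p1 p2,
          continuous_in_time (H1normv Omega) T p2 &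
          continuous_in_time (H1norm Omega) T xi],
      forall t, t \in `[0, T] -> forall w phi, Vh w -> kerG Wh phi ->
        weighted_inner (p2 t) w + bilinear_a (p t) (xi t) w phi =
        weighted_inner (f t) w,
      aeq leb Omega (p T) 0 &
      aeq leb Omega (p1 T) 0].

Definition discrete_spaces (Vh : set (V -> V)) (Wh : set (V -> R)) : Prop :=
  [/\ findim_subspace Omega (H1D Omega gamma GammaD) Vh,
      findim_subspace Omega (H1 Omega) Wh &
      forall c : R, Wh (cst c)].

(* L^2(0, T; L^2(Gamma)): Bochner measurable (a.e. limit of simple functions)
   and square integrable in time. *)
Definition trace_space (y : R -> V -> R) : Prop :=
  [/\ {ae lebesgue_measure, forall t : R, t \in `[0, T] -> L2Gamma Omega (y t)},
      exists (m : nat -> nat) (A : forall k, 'I_(m k) -> set R)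
        (g : forall k, 'I_(m k) -> V -> R),
        (forall k j, measurable (A k j) /\ L2Gamma Omega (g k j)) /\
        {ae lebesgue_measure, forall t : R, t \in `[0, T] ->
          L2normGamma Omega ((\sum_j \1_(A k j) t *: g k j) - y t)
            @[k --> \oo] --> (0 : R)} &
      (\int[lebesgue_measure]_(t in `[0%R, T])
         ((L2normGamma Omega (y t)) ^+ 2)%:E < +oo)%E].

Definition is_solution_operator (Vh : set (V -> V)) (Wh : set (V -> R))
    (Rh : (R -> V -> V) -> R -> V -> R) : Prop :=
  forall f p xi, source_space f -> semidiscrete_solution Vh Wh f p xi ->
  forall t, t \in `[0, T] -> aeqGamma Omega (Rh f t) (gamma (xi t)).

(* Rh is a linear operator from the source space to L^2(0, T; L^2(Gamma)) with
   operator norm at most B. *)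
Definition bounded_linear_operator (Rh : (R -> V -> V) -> R -> V -> R) (B : R) : Prop :=
  [/\ forall f, source_space f -> trace_space (Rh f),
      forall (c : R) f g, source_space f -> source_space g ->
        {ae lebesgue_measure, forall t : R, t \in `[0, T] ->
          aeqGamma Omega (Rh (c *: f + g) t) (c *: Rh f t + Rh g t)} &
      forall f, source_space f ->
        L2time_norm (L2normGamma Omega) T (Rh f) <=
        B * L2time_norm (H1normv Omega) T f].

End piezoelectric.

(* Main.v *)
(* Testing the equation of motion with (dp/dt, 0) and Gauss's law with xi(t)
   shows that the energy e = m(p', p') + a(p, p) + k(xi, xi) satisfies
   e' = 2 m(f, p'), whence sqrt (e t) is at most a multiple of the integral of
   |f| over [t, T]. Korn's inequality for p and Poincare's inequality for xi
   (whose functional G does not vanish on constants) turn this into the H^1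
   bound, with constants that do not see the finite-dimensional spaces.
   Uniqueness follows by linearity. For existence, xi is eliminated by the
   Riesz representative of b(., p) and the coordinates of p in an
   m-orthonormal family solve a linear system of ODEs.

   Both inequalities are obtained from translations alone. With D_h the
   difference operator along h, the L^2 norm of D_h psi is bounded by that of
   the gradient, and that of h.(D_h u) by that of the strain. Korn's inequality
   is elementary for differences of fields on the whole space, since the D_h
   commute; it is localized by averaging over cut-offs. Second differences of u
   are combinations of first differences of the symmetric parts, so increments
   of the gradient are controlled by the strain; near the boundary this makes
   the gradient on a dyadic layer at most a fraction of the gradient on the
   next inner layer, up to the strain, and one sums over the layers. *)

From HB Require Import structures.
Require Import Defs.
From mathcomp Require Import all_boot all_order all_algebra.
From mathcomp Require Import all_classical all_reals all_analysis.
From mathcomp Require Import measurable_realfun ring lra.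

Set Implicit Arguments.
Unset Strict Implicit.
Unset Printing Implicit Defensive.

Import Order.TTheory GRing.Theory Num.Theory.
Import numFieldNormedType.Exports.

Local Open Scope classical_set_scope.
Local Open Scope ring_scope.

(** * Lebesgue measure on row vectors *)

(** Weak derivatives exist only on [Omega], while the argument is about translations; functions are
    therefore extended by zero, and integration by parts is required only against test functions
    supported in [Omega]. Each translation estimate then asks that the segments travelled stay in
    [Omega].

    In Korn's inequality near the boundary, the increments of u obey an interior estimate with no
    lower order term and with a constant independent of the scale; only this makes the estimates on
    dyadic layers summable.

    Three obstacles shape the evolution part. The potential xi is merely continuous in time; its
    energy is differentiated by comparing Gauss's law at two times, so that only p is
    differentiated. The square root of the energy is not differentiable where the energy vanishes,
    and is regularized. Finally, as Gamma_D may be empty, rigid motions are not excluded and Korn's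
    inequality keeps the L^2 norm of p, recovered by integrating the bound on dp/dt back from T;
    this puts T into the constant.

    Elements of the spaces are representatives, so all norms are seminorms and identities hold up to
    null vectors. *)

Section measurable_rV.
Context {R : realType} (n : nat).
Local Notation V := 'rV[R]_n.

Lemma rV_ballE (c : V) r x : 0 < r ->
  ball c r x <-> forall i, `|c 0 i - x 0 i| < r.
Proof.
move=> r0; rewrite mx_norm_ball /ball_ /=; split.
  move=> cx i; apply: le_lt_trans cx.
  have -> : c 0 i - x 0 i = (c - x) 0 i by rewrite !mxE.
  rewrite /Num.Def.normr/= mx_normrE.
  exact: (le_bigmax _ (fun k : 'I_1 * 'I_n => `|(c - x) k.1 k.2|) (0, i)).
move=> h; rewrite /Num.Def.normr/= mx_normrE.
apply: bigmax_lt => // -[j i] _ /=; rewrite ord1 !mxE; exact: h.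
Qed.

Lemma measurable_ball_rV (c : V) (r : R) : measurable (ball c r).
Proof.
have [r0|r0] := leP r 0.
  rewrite (_ : ball c r = set0)//; apply/seteqP; split => // x.
  rewrite mx_norm_ball /ball_ /= => /(le_lt_trans (normr_ge0 _)).
  by rewrite ltNge r0.
rewrite (_ : ball c r = \bigcap_(i in [set: 'I_n]) (rV_coord i @^-1` ball (c 0 i : R) r)); last first.
  apply/seteqP; split => x.
    by move=> /(rV_ballE _ _ r0) h i _ /=; exact: h.
  by move=> h; apply/(rV_ballE _ _ r0) => i; exact: h.
apply: fin_bigcap_measurable => // i _.
rewrite -[X in measurable X]setTI; apply: measurable_rV_coord => //.
by apply: open_measurable; exact: ball_open.
Qed.

(** Balls with rational centres and radii 1/(k+1) are countably many. Keeping the ball of twice the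
    radius inside [A] leaves room for a closed box between each ball and [A], as [approx_set]
    requires. *)
Lemma open_bigcup_ball (A : set V) : open A ->
  exists F : nat -> set V, A = \bigcup_k F k /\
    forall k, F k = set0 \/ exists c r, [/\ 0 < r, F k = ball c r & ball c (2 * r) `<=` A].
Proof.
move=> oA.
pose F (p : 'rV[rat]_n * nat) : set V :=
  if `[< ball (map_mx (@ratr R) p.1) (2 * p.2.+1%:R^-1) `<=` A >]
  then ball (map_mx (@ratr R) p.1) p.2.+1%:R^-1 else set0.
exists (fun m => if unpickle m is Some p then F p else set0); split; last first.
  move=> m; case: unpickle => [p|]; last by left.
  rewrite /F; case: asboolP => h; last by left.
  by right; eexists _, _; split; [|reflexivity|exact: h]; rewrite invr_gt0.
apply/seteqP; split=> x; last first.
  move=> [m _]; case: unpickle => [p|//]; rewrite /F; case: asboolP => // h hx.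
  apply: h; apply: le_ball hx; by rewrite ler_peMl// ler1n.
move=> Ax; have /nbhs_ballP[e /= e0 xeA] : nbhs x A by exact: open_nbhs_nbhs.
(* For a centre within e/3 of [x], the ball of doubled radius stays within e/3 + 2 (e/3) = e of
   [x]. *)
have [k hk] : exists k : nat, k.+1%:R^-1 < e / 3.
  have /ltr_add_invr[k] : 0 < e / 3 by rewrite divr_gt0.
  by rewrite add0r => hk; exists k.
have k0 : 0 < (k.+1%:R : R)^-1 by rewrite invr_gt0.
have /choice[q hq] : forall i : 'I_n, exists q : rat, `|x 0 i - ratr q| < (k.+1%:R : R)^-1.
  move=> i.
  have [|q] := @rat_in_itvoo R (x 0 i - k.+1%:R^-1) (x 0 i + k.+1%:R^-1).
    by move: k0; set c := _^-1; lra.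
  by rewrite in_itv/= => /andP[q1 q2]; exists q; rewrite ltr_norml; apply/andP; move: q1 q2; set c := _^-1; lra.
exists (pickle (\row_i q i, k)) => //; rewrite pickleK /F /=.
have bx : ball (map_mx (@ratr R) (\row_i q i)) k.+1%:R^-1 x.
  by apply/rV_ballE => // i; rewrite !mxE distrC.
case: asboolP => // -[] y yb; apply: xeA.
have -> : e = e / 3 + 2 * (e / 3) by field.
apply: (ball_triangle (y := map_mx (@ratr R) (\row_i q i))).
  apply: ball_sym; apply: le_ball bx; exact: ltW.
by apply: le_ball yb; rewrite ler_pM2l// ltW.
Qed.

Lemma open_measurable_rV (A : set V) : open A -> measurable A.
Proof.
move=> /open_bigcup_ball[F [-> hF]]; apply: bigcupT_measurable => k.
by have [->//|[c [r [_ -> _]]]] := hF k; exact: measurable_ball_rV.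
Qed.

Lemma continuous_measurable_rV (f : V -> R) : continuous f -> measurable_fun setT f.
Proof.
move=> cf; apply: (measurability _ (RGenOpens.measurableE R)) => _ [_ [a [b ->] <-]].
rewrite setTI; apply: open_measurable_rV; apply: open_comp.
  by move=> x _; exact: cf.
exact: interval_open.
Qed.

End measurable_rV.

Lemma measurable_addl_rV {R : realType} n (h : 'rV[R]_n) :
  measurable_fun setT (fun x : 'rV[R]_n => x + h).
Proof.
apply: measurable_fun_rV => i.
rewrite (_ : _ \o _ = (fun x => rV_coord i x + h 0 i)); last first.
  by apply/funext => x; rewrite /rV_coord /= mxE.
by apply: measurable_funD => //; exact: measurable_rV_coord.
Qed.

Lemma measurable_addp_rV {R : realType} n :
  measurable_fun setT (fun p : 'rV[R]_n * 'rV[R]_n => p.1 + p.2).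
Proof.
apply: measurable_fun_rV => i.
rewrite (_ : _ \o _ = (fun x => rV_coord i x.1 + rV_coord i x.2)); last first.
  by apply/funext => x; rewrite /rV_coord /= mxE.
by apply: measurable_funD; apply: measurableT_comp => //; exact: measurable_rV_coord.
Qed.

Section lebesgue_rV_integral.
Context {R : realType}.
Local Notation leb := (@lebesgue_measure R).

Lemma rV_cons0 n (p : measurableTypeR R * 'rV[R]_n) : rV_cons p 0 ord0 = p.1.
Proof.
rewrite (_ : ord0 = @lshift 1 n 0); last exact/val_inj.
by apply: etrans (row_mxEl _ _ _ _) _; rewrite mxE.
Qed.

Lemma rV_consS n (p : measurableTypeR R * 'rV[R]_n) j :
  rV_cons p 0 (lift ord0 j) = p.2 0 j.
Proof.
rewrite (_ : lift ord0 j = @rshift 1 n j); last exact/val_inj.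
exact: row_mxEr.
Qed.

Lemma ge0_integral_lebesgue_rVS n (f : 'rV[R]_n.+1 -> \bar R) :
  measurable_fun setT f -> (forall x, 0 <= f x)%E ->
  (\int[lebesgue_rV n.+1]_x f x =
   \int[leb]_a \int[lebesgue_rV n]_v f (rV_cons (a, v)))%E.
Proof.
move=> mf f0.
have mg : measurable_fun setT (f \o @rV_cons R n).
  by apply: measurableT_comp => //; exact: measurable_rV_cons.
transitivity (\int[(leb \x lebesgue_rV n)%E]_p (f \o @rV_cons R n) p)%E.
  have := @ge0_integral_pushforward _ _ _ _ R _ (@measurable_rV_cons R n)
    (@lebesgue_measure R \x lebesgue_rV n)%E setT f measurableT mf.
  by rewrite preimage_setT => <-//.
by rewrite fubini_tonelli1// => p; exact: f0.
Qed.

Let tr (h : R) : measurableTypeR R -> measurableTypeR R := fun x => (x : R) + h.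

(** The translated measure has the right values on half-open intervals, and these determine the
    Lebesgue measure. *)
Lemma lebesgue_measureD (h : R) (A : set R) : measurable A ->
  pushforward leb (tr h) A = leb A.
Proof.
move=> mA; apply/esym/lebesgue_measure_unique => //=.
  exact: measurable_funD.
move=> mh _ [[a b] _ <-]; rewrite /pushforward /=.
rewrite (_ : _ @^-1` _ = [set` `](a - h), (b - h)]]); last first.
  by apply/seteqP; split => x /=; rewrite !in_itv/= ltrBlDr lerBrDr.
rewrite !lebesgue_measure_itv/= !lte_fin ltrD2r.
by case: ifP => // _; rewrite -!EFinB; congr EFin; ring.
Qed.

Lemma ge0_integral_translation1 (h : R) (f : R -> \bar R) :
  measurable_fun setT f -> (forall x, 0 <= f x)%E ->
  (\int[leb]_x f (x + h)%R = \int[leb]_x f x)%E.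
Proof.
move=> mf f0.
have mh : measurable_fun setT (tr h) by exact: measurable_funD.
have := @ge0_integral_pushforward _ _ _ _ R _ mh leb setT f measurableT mf.
rewrite preimage_setT => <-//.
by apply: eq_measure_integral => A mA _; exact/lebesgue_measureD.
Qed.

Let measurable_fun_section n (f : 'rV[R]_n.+1 -> \bar R) (a : R) :
  measurable_fun setT f -> measurable_fun setT (fun v : 'rV[R]_n => f (rV_cons (a, v))).
Proof.
move=> mf; have mgc := measurableT_comp mf (@measurable_rV_cons R n).
exact: (measurableT_comp mgc (pair1_measurable (a : measurableTypeR R))).
Qed.

(** By induction on the dimension: Tonelli splits off the first coordinate, the induction hypothesis
    removes the shift of the others, and invariance on the line removes the shift of the first. *)
Lemma ge0_integral_translation n (h : 'rV[R]_n) (f : 'rV[R]_n -> \bar R) :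
  measurable_fun setT f -> (forall x, 0 <= f x)%E ->
  (\int[lebesgue_rV n]_x f (x + h)%R = \int[lebesgue_rV n]_x f x)%E.
Proof.
elim: n h f => [|n ih] h f mf f0.
  by apply: eq_integral => x _; congr f; apply/rowP => -[].
have mfh : measurable_fun setT (fun x : 'rV[R]_n.+1 => f (x + h)).
  by apply: measurableT_comp => //; exact: measurable_addl_rV.
rewrite (ge0_integral_lebesgue_rVS mf f0) (ge0_integral_lebesgue_rVS mfh (fun=> f0 _)).
pose h0 := h 0 0; pose h' : 'rV[R]_n := \row_j h 0 (lift ord0 j).
have hE a (v : 'rV[R]_n) : rV_cons (a, v) + h = rV_cons ((a : R) + h0, v + h').
  apply/rowP => i; case: (unliftP ord0 i) => [j|] ->; rewrite mxE.
    by rewrite !rV_consS !mxE.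
  by rewrite !rV_cons0.
have mgc : measurable_fun setT (f \o @rV_cons R n).
  by apply: measurableT_comp => //; exact: measurable_rV_cons.
transitivity (\int[leb]_a
    \int[lebesgue_rV n]_v f (rV_cons ((a + h0)%R, v)))%E.
  apply: eq_integral => a _.
  under eq_integral do rewrite hE.
  rewrite (ih h' (fun v => f (rV_cons ((a + h0)%R, v))))//.
  exact: measurable_fun_section.
apply: (@ge0_integral_translation1 h0
  (fun a => \int[lebesgue_rV n]_v f (rV_cons (a, v)))%E).
  have := @measurable_fun_fubini_tonelli_F _ _ _ _ R (lebesgue_rV n) _ mgc (fun=> f0 _).
  exact.
by move=> a; apply: integral_ge0.
Qed.

Lemma lebesgue_rV_cube n (r : R) : 0 < r ->
  lebesgue_rV n (ball (0 : 'rV[R]_n) r) = ((2 * r) ^+ n)%:E.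
Proof.
move=> r0; elim: n => [|n ih].
  by rewrite /= diracE mem_set ?expr0//; exact: ballxx.
have mb m : measurable (ball (0 : 'rV[R]_m) r) by exact: measurable_ball_rV.
transitivity ((leb \x lebesgue_rV n)%E (ball (0 : R) r `*` ball (0 : 'rV[R]_n) r)).
  congr ((leb \x lebesgue_rV n)%E _); apply/seteqP; split => -[a v] /=.
    move/(rV_ballE _ _ r0) => h; split.
      by have := h ord0; rewrite rV_cons0 mxE.
    by apply/(rV_ballE _ _ r0) => i; have := h (lift ord0 i); rewrite rV_consS !mxE.
  move=> [/= h0 /(rV_ballE _ _ r0) h1]; apply/(rV_ballE _ _ r0) => i.
  case: (unliftP ord0 i) => [j|] ->; rewrite mxE ?rV_consS ?rV_cons0//.
  by have := h1 j; rewrite mxE.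
rewrite product_measure1E//; last 2 first.
- by apply: open_measurable; exact: ball_open.
- exact: mb.
rewrite ih; apply: etrans (congr1 (fun z => z * _)%E (lebesgue_measure_ball 0 (ltW r0))) _.
by rewrite -EFinM exprS mulr_natl.
Qed.

End lebesgue_rV_integral.

(** * Smooth bump functions *)

Section smooth_line.
Context {R : realType}.
Implicit Types f g : R -> R.

(* Coinductive form of "all derivatives exist". *)
Definition smooth1 f := exists S : set (R -> R), S f /\
  forall g, S g -> (forall x, derivable g x 1) /\ S (derive1 g).

Lemma smooth1_derivable f x : smooth1 f -> derivable f x 1.
Proof. by move=> [S [Sf h]]; have [] := h _ Sf. Qed.

Lemma smooth1_derive f : smooth1 f -> smooth1 (derive1 f).
Proof. by move=> [S [Sf h]]; exists S; split => //; have [] := h _ Sf. Qed.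

Lemma smooth1_is_derive f (x : R) : smooth1 f -> is_derive x (1 : R) f ((derive1 f) x).
Proof. by move=> /smooth1_derivable h; rewrite derive1E; exact/derivableP/h. Qed.

Lemma smooth1_continuous f : smooth1 f -> continuous f.
Proof.
by move=> /smooth1_derivable h x; apply: differentiable_continuous; exact/derivable1_diffP/h.
Qed.

(** By Leibniz's rule, sums of products of an element of [A] and an element of [B] are stable under
    derivation; they are the class that witnesses the smoothness of a product. *)
Inductive prod_closure (A B : set (R -> R)) : set (R -> R) :=
| prod_closure_mul f g : A f -> B g -> prod_closure A B (f \* g)
| prod_closure_add f g : prod_closure A B f -> prod_closure A B g ->
    prod_closure A B (f \+ g).

Lemma smooth1M f g : smooth1 f -> smooth1 g -> smooth1 (f \* g).
Proof.
move=> [A [Af hA]] [B [Bg hB]]; exists (prod_closure A B).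
split; first exact: prod_closure_mul.
move=> h; elim=> {f g Af Bg h} [f g Af Bg|f g _ [df Sf] _ [dg Sg]].
  have [df Af'] := hA _ Af; have [dg Bg'] := hB _ Bg.
  split; first by move=> x; exact: derivableM.
  rewrite (_ : derive1 _ = ((derive1 f) \* g) \+ (f \* (derive1 g))).
    by apply: prod_closure_add; exact: prod_closure_mul.
  apply/funext => x; rewrite derive1E deriveM//= !derive1E addrC.
  by rewrite /GRing.scale/= [g x * _]mulrC.
split; first by move=> x; exact: derivableD.
rewrite (_ : derive1 _ = (derive1 f) \+ (derive1 g)); first exact: prod_closure_add.
by apply/funext => x; rewrite derive1E deriveD//= !derive1E.
Qed.

Lemma smooth1_affine f (a b : R) : smooth1 f -> smooth1 (fun x => f (a * x + b)).
Proof.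
move=> [S [Sf hS]].
exists [set h | exists c g, S g /\ h = (fun x => c * g (a * x + b))].
split; first by exists 1, f; split => //; apply/funext => x; rewrite mul1r.
move=> _ [c [g [Sg ->]]]; have [dg Sg'] := hS _ Sg.
have D (x : R) : is_derive x (1 : R) (fun x => c * g (a * x + b)) (c * a * (derive1 g) (a * x + b)).
  have dgx : is_derive (a * x + b) (1 : R) g ((derive1 g) (a * x + b)).
    by rewrite derive1E; exact/derivableP.
  have da : is_derive x (1 : R) (fun x : R => a * x + b) a.
    have := is_deriveD (is_deriveZ a (is_derive_id x (1 : R))) (is_derive_cst b x (1 : R)).
    by move=> dd; apply: (is_derive_eq dd); rewrite addr0 /GRing.scale/= mulr1.
  have dc := @is_derive1_comp R g (fun x => a * x + b) x _ _ dgx da.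
  have := @is_deriveZ _ _ _ (g \o (fun x => a * x + b)) c x 1 _ dc.
  by move=> dd; apply: (is_derive_eq dd); rewrite /GRing.scale/=; ring.
split; first by move=> x; have [] := D x.
exists (c * a), (derive1 g); split => //; apply/funext => x.
by rewrite derive1E; have [_ ->] := D x.
Qed.

Lemma is_derive_flat f (C : R) : (forall h, `|f h| <= C * h ^+ 2) -> is_derive (0 : R) (1 : R) f 0.
Proof.
move=> hf.
have f0 : f 0 = 0.
  by apply/eqP; rewrite -normr_le0 (le_trans (hf 0))// expr0n mulr0.
suff h : (fun h => h^-1 *: ((f \o shift 0) (h *: 1) - f 0)) @ 0^' --> (0 : R).
  by apply: DeriveDef; [apply: cvgP h|exact: cvg_lim h].
apply/cvgrPdist_le => e e0.
have CC0 : 0 < `|C| + 1 by rewrite ltr_wpDl.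
near=> h; rewrite sub0r normrN /= f0 subr0 addr0 /GRing.scale/= mulr1 normrM normfV.
have h0 : 0 < `|h| by rewrite normr_gt0; near: h; exact: nbhs_dnbhs_neq.
rewrite ler_pdivrMl// (le_trans (hf h))//.
have -> : h ^+ 2 = `|h| ^+ 2 by rewrite real_normK ?num_real.
rewrite expr2 mulrCA ler_wpM2l//.
apply: (@le_trans _ _ ((`|C| + 1) * `|h|)).
  by rewrite ler_wpM2r// ler_wpDr// ler_norm.
rewrite -ler_pdivlMl// mulrC; near: h.
by apply: dnbhs0_le; exact: divr_gt0.
Unshelve. all: by end_near. Qed.

Variable l : R.
Hypothesis l0 : 0 < l.

(** The case k = 0 is the classical flat function exp(-l/x). The powers of 1/x are carried along
    because the derivative of the k-th function is a combination of the functions of index k+1 and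
    k+2. *)
Definition flat_pow (k : nat) (x : R) : R :=
  if 0 < x then x^-1 ^+ k * expR (- (l * x^-1)) else 0.

(** With y = 1/x, the Taylor term of order k+2 of exp(l y) dominates y^k y^2. A quadratic bound is
    what [is_derive_flat] needs at the origin. *)
Lemma flat_pow_le k : exists C, forall x, `|flat_pow k x| <= C * x ^+ 2.
Proof.
exists ((k.+2)`!%:R / l ^+ k.+2) => x; rewrite /flat_pow.
have C0 : 0 <= (k.+2)`!%:R / l ^+ k.+2 by rewrite divr_ge0// exprn_ge0// ltW.
case: ifP => x0; last by rewrite normr0 mulr_ge0// sqr_ge0.
rewrite ger0_norm; last first.
  by rewrite mulr_ge0 ?expR_ge0// exprn_ge0// invr_ge0 ltW.
set y := x^-1; have y0 : 0 < y by rewrite invr_gt0.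
have -> : x ^+ 2 = (y ^+ 2)^-1 by rewrite exprVn invrK.
rewrite expRN ler_pdivlMr ?exprn_gt0// mulrAC ler_pdivrMr ?expR_gt0//.
have := expR_ge1Dxn k.+1 (ltW (mulr_gt0 l0 y0)).
rewrite exprMn -exprD addn2 => h.
have {h} : l ^+ k.+2 * y ^+ k.+2 / (k.+2)`!%:R <= expR (l * y).
  by apply: le_trans h; rewrite lerDr.
rewrite ler_pdivrMr ?ltr0n ?fact_gt0// => h.
by rewrite mulrAC ler_pdivlMr ?exprn_gt0// mulrC [leRHS]mulrC.
Qed.

Lemma is_derive_flat_pow k x :
  is_derive (x : R) (1 : R) (flat_pow k) (l * flat_pow k.+2 x - k%:R * flat_pow k.+1 x).
Proof.
have [x0|x0|->] := ltgtP x 0.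
- have -> : l * flat_pow k.+2 x - k%:R * flat_pow k.+1 x = 0.
    by rewrite /flat_pow ltNge (ltW x0) !mulr0 subr0.
  suff E : \near x, cst 0 x = flat_pow k x by exact: near_eq_is_derive E (is_derive_cst _ _ _).
  near=> y; rewrite /flat_pow /= ltNge ltW//.
  by near: y; exact: lt_nbhsl.
- have -> : l * flat_pow k.+2 x - k%:R * flat_pow k.+1 x =
      (l * x ^- k.+2 - k%:R * x ^- k.+1) * expR (- (l * x^-1)).
    by rewrite /flat_pow x0 !exprVn; ring.
  have E : \near x, (fun x => x^-1 ^+ k * expR (- (l * x^-1))) x = flat_pow k x.
    near=> y; rewrite /flat_pow /=.
    suff -> : 0 < y by [].
    by near: y; exact: lt_nbhsr.
  apply: near_eq_is_derive E _.
  have xn0 : x != 0 by rewrite gt_eqF.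
  have dV : is_derive x 1 (fun x : R => x^-1) (- x ^- 2).
    have := @is_deriveV R id x 1 1 xn0 (is_derive_id _ _).
    by move=> dd; apply: (is_derive_eq dd); rewrite /GRing.scale/= mulr1.
  have dE : is_derive x (1 : R) (fun x : R => expR (- (l * x^-1)))
      (expR (- (l * x^-1)) * (- (l * - x ^- 2))).
    apply: (@is_derive1_comp R expR (fun x : R => - (l * x^-1))).
  have dP : is_derive x (1 : R) (fun x : R => x^-1 ^+ k) (k%:R * x^-1 ^+ k.-1 * (- x ^- 2)).
    have dd := is_deriveX k dV; rewrite exprfctE in dd; apply: (is_derive_eq dd).
    by [].
  apply: (is_derive_eq (is_deriveM dP dE)); rewrite /GRing.scale/= !exprVn.
  by case: (k) => [|m] /=; rewrite -?exprVn ?exprS; ring.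
- have [C hC] := flat_pow_le k.
  rewrite {2 3}/flat_pow ltxx !mulr0 subr0.
  exact: is_derive_flat hC.
Unshelve. all: by end_near. Qed.

Inductive flat_closure : set (R -> R) :=
| flat_closure_pow k c : flat_closure (fun x => c * flat_pow k x)
| flat_closure_add f g : flat_closure f -> flat_closure g -> flat_closure (f \+ g).

Lemma smooth1_flat : smooth1 (flat_pow 0).
Proof.
exists flat_closure; split.
  rewrite (_ : flat_pow 0 = (fun x => 1 * flat_pow 0 x)); first exact: flat_closure_pow.
  by apply/funext => x; rewrite mul1r.
move=> f; elim=> {f} [k c|f g _ [df Sf] _ [dg Sg]].
  have D x := @is_deriveZ _ _ _ _ c _ _ _ (is_derive_flat_pow k x).
  split=> [x|]; first by have [] := D x.
  rewrite (_ : derive1 _ = (fun x => (c * l) * flat_pow k.+2 x) \+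
    (fun x => (- (c * k%:R)) * flat_pow k.+1 x)).
    by apply: flat_closure_add; exact: flat_closure_pow.
  by apply/funext => x; rewrite derive1E; have [_ ->] := D x; rewrite /GRing.scale/=; ring.
split; first by move=> x; exact: derivableD.
rewrite (_ : derive1 _ = (derive1 f) \+ (derive1 g)); first exact: flat_closure_add.
by apply/funext => x; rewrite derive1E deriveD//= !derive1E.
Qed.

(** The parameter [l] is kept because it will tend to 0: on ]a, b[ the bump, with values in [0, 1],
    then tends pointwise to 1. *)
Definition bump1 (a b x : R) : R := flat_pow 0 (x - a) * flat_pow 0 (b - x).

Lemma smooth1_bump a b : smooth1 (bump1 a b).
Proof.
apply: smooth1M.
  have := smooth1_affine 1 (- a) smooth1_flat.
  by congr smooth1; apply/funext => x; rewrite mul1r.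
have := smooth1_affine (- 1) b smooth1_flat.
by congr smooth1; apply/funext => x; rewrite mulN1r addrC.
Qed.

Lemma bump1_out a b x : ~~ (a < x < b) -> bump1 a b x = 0.
Proof.
rewrite negb_and /bump1 /flat_pow !subr_gt0.
by case/orP => /negbTE ->; rewrite ?mul0r ?mulr0.
Qed.

Lemma bump1_in a b x : a < x < b ->
  bump1 a b x = expR (- (l * ((x - a)^-1 + (b - x)^-1))).
Proof.
case/andP=> ax xb; rewrite /bump1 /flat_pow !subr_gt0 ax xb !expr0 !mul1r -expRD.
by congr expR; ring.
Qed.

Lemma bump1_itv a b x : 0 <= bump1 a b x <= 1.
Proof.
have [axb|axb] := boolP (a < x < b); last by rewrite bump1_out// lexx ler01.
rewrite bump1_in// expR_ge0 expR_le1 oppr_le0 mulr_ge0 ?(ltW l0)//.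
by move: axb => /andP[ax xb]; rewrite addr_ge0// invr_ge0 subr_ge0 ltW.
Qed.

End smooth_line.

Lemma is_derive_line {R : realType} {V : normedModType R} (phi : V -> R) (x v : V) df :
  is_derive (0 : R) (1 : R) (fun s => phi (x + s *: v)) df -> is_derive x v phi df.
Proof.
move=> [d <-]; rewrite /derivable /derive in d *.
have e : (fun t : R => t^-1 *: (((fun s : R => phi (x + s *: v)) \o shift 0) (t *: (1 : R))
      - phi (x + 0 *: v))) =
    (fun t : R => t^-1 *: ((phi \o shift x) (t *: v) - phi x)).
  by apply/funext => t /=; rewrite addr0 scale0r addr0 [x + _]addrC /GRing.scale/= mulr1.
by rewrite e in d *; apply: DeriveDef.
Qed.

Section smooth_rV.
Context {R : realType} (n : nat).
Local Notation V := 'rV[R]_n.+1.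
Implicit Types (phi psi : V -> R).

Lemma smooth_derivable phi (x : V) i : smooth phi -> derivable phi x (delta_mx 0 i).
Proof. by move=> /(_ [::])/= [_]. Qed.

Lemma smooth_pderiv phi i : smooth phi -> smooth (pderiv i phi).
Proof. by move=> h s; have := h (rcons s i); rewrite foldr_rcons. Qed.

Lemma smooth_continuous phi : smooth phi -> continuous phi.
Proof. by move=> /(_ [::])/= []. Qed.

Lemma continuous_shift_rV (h : V) : continuous (fun y : V => y + h).
Proof. by move=> x; exact: (cvgD (@cvg_id _ (nbhs x)) (cvg_cst h)). Qed.

(** Coinduction principle: a class stable under [pderiv] contains all the iterated partial
    derivatives of its members. *)
Lemma smooth_coind (S : set (V -> R)) phi : S phi ->
  (forall f, S f -> [/\ continuous f, forall x i, derivable f x (delta_mx 0 i) &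
     forall i, S (pderiv i f)]) -> smooth phi.
Proof.
move=> Sphi h s.
have hs : S (foldr pderiv phi s) by elim: s => //= i s /h[_ _]; exact.
by have [] := h _ hs.
Qed.

Lemma pderiv_lin c phi psi i : smooth phi -> smooth psi ->
  pderiv i (c *: phi + psi) = c *: pderiv i phi + pderiv i psi.
Proof.
move=> sf sg; apply/funext => x; rewrite /pderiv deriveD//.
- by rewrite deriveZ//; exact: smooth_derivable.
- by apply: derivableZ; exact: smooth_derivable.
- exact: smooth_derivable.
Qed.

Lemma smooth_lin c phi psi : smooth phi -> smooth psi -> smooth (c *: phi + psi).
Proof.
move=> sf sg.
apply: (@smooth_coind [set h | exists f g, [/\ smooth f, smooth g & h = c *: f + g]]).
  by exists phi, psi.
move=> _ [f [g [smf smg ->]]]; split.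
- move=> x; apply: continuousD; last exact: smooth_continuous.
  by apply: continuousZr; exact: smooth_continuous.
- move=> x i; apply: derivableD; last exact: smooth_derivable.
  by apply: derivableZ; exact: smooth_derivable.
- move=> i; exists (pderiv i f), (pderiv i g); split; try exact: smooth_pderiv.
  exact: pderiv_lin.
Qed.

Lemma is_derive_shift_rV phi (x v h : V) df : is_derive (x + h) v phi df ->
  is_derive x v (fun y => phi (y + h)) df.
Proof.
move=> [d <-]; rewrite /derivable /derive in d *.
have e : (fun t : R => t^-1 *: (((fun y => phi (y + h)) \o shift x) (t *: v) - phi (x + h))) =
         (fun t : R => t^-1 *: ((phi \o shift (x + h)) (t *: v) - phi (x + h))).
  by apply/funext => t /=; rewrite addrA.
by apply: DeriveDef; rewrite /derivable /derive e.
Qed.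

Lemma pderiv_translation phi (h : V) i : smooth phi ->
  pderiv i (fun y => phi (y + h)) = (fun y => pderiv i phi (y + h)).
Proof.
move=> sphi; apply/funext => x; rewrite /pderiv.
by have [_ ->] := is_derive_shift_rV (derivableP (@smooth_derivable phi (x + h) i sphi)).
Qed.

Lemma smooth_translation phi (h : V) : smooth phi -> smooth (fun y => phi (y + h)).
Proof.
move=> sphi.
apply: (@smooth_coind [set f | exists g, smooth g /\ f = (fun y => g (y + h))]).
  by exists phi.
move=> _ [g [sg ->]]; split.
- move=> x; apply: (@continuous_comp V V R (fun y : V => y + h) g); last exact: smooth_continuous.
  exact: continuous_shift_rV.
- move=> x i; have [//] := is_derive_shift_rV (derivableP (@smooth_derivable g (x + h) i sg)).
- by move=> i; exists (pderiv i g); split; [exact: smooth_pderiv|exact: pderiv_translation].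
Qed.

Definition tensor (b : 'I_n.+1 -> R -> R) : V -> R := fun x => \prod_i b i (x 0 i).

Definition derive_factor (b : 'I_n.+1 -> R -> R) j : 'I_n.+1 -> R -> R :=
  fun i => if i == j then derive1 (b i) else b i.

Lemma is_derive_prod (I : eqType) (r : seq I) (f : I -> R -> R) (df : I -> R) (t : R) :
  uniq r -> (forall i, is_derive t 1 (f i) (df i)) ->
  is_derive t 1 (fun s => \prod_(i <- r) f i s)
    (\sum_(j <- r) \prod_(i <- r) (if i == j then df i else f i t)).
Proof.
move=> + hf; elim: r => [_|a r ih /= /andP[ar ur]].
  rewrite big_nil (_ : (fun s => _) = cst 1); last by apply/funext => s; rewrite big_nil.
  exact: is_derive_cst.
rewrite (_ : (fun s => _) = (f a \* (fun s => \prod_(i <- r) f i s))); last first.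
  by apply/funext => s; rewrite big_cons.
apply: (is_derive_eq (is_deriveM (hf a) (ih ur))).
rewrite big_cons /= [X in _ = X + _]big_cons eqxx addrC /GRing.scale/=; congr (_ + _).
  rewrite mulrC; congr (_ * _); apply: eq_big_seq => i ir.
  by case: eqP => // ia; rewrite -ia ir in ar.
rewrite mulr_sumr; apply: eq_big_seq => j jr; rewrite big_cons.
by case: eqP => // ja; rewrite ja jr in ar.
Qed.

(** The chain rule along an arbitrary line, obtained from the product rule in the single variable t;
    [smooth] speaks only of derivatives along the coordinate axes. *)
Lemma tensor_line_derive b (x h : V) (t : R) : (forall i, smooth1 (b i)) ->
  is_derive t 1 (fun s => tensor b (x + s *: h))
    (\sum_j h 0 j * tensor (derive_factor b j) (x + t *: h)).
Proof.
move=> sb.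
have D i : is_derive t 1 (fun s => b i ((x + s *: h) 0 i))
    (h 0 i * derive1 (b i) ((x + t *: h) 0 i)).
  have da : is_derive t (1 : R) (fun s : R => (x + s *: h) 0 i) (h 0 i).
    rewrite (_ : (fun s => _) = (fun s => x 0 i + h 0 i * s)).
      have := is_deriveD (is_derive_cst (x 0 i) t (1 : R))
        (is_deriveZ (h 0 i) (is_derive_id t (1 : R))).
      by move=> dd; apply: (is_derive_eq dd); rewrite add0r /GRing.scale/= mulr1.
    by apply/funext => s; rewrite !mxE mulrC.
  have := is_derive1_comp (smooth1_is_derive ((x + t *: h) 0 i) (sb i)) da.
  by move=> dd; apply: (is_derive_eq dd); rewrite mulrC.
apply: (is_derive_eq (is_derive_prod (index_enum_uniq _) D)).
apply: eq_bigr => j _; rewrite (bigD1 j)//= eqxx -mulrA; congr (_ * _).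
rewrite /tensor [RHS](bigD1 j)//= /derive_factor eqxx; congr (_ * _).
by apply: eq_bigr => i /negbTE ->.
Qed.

Lemma tensor_is_derive b (x : V) j : (forall i, smooth1 (b i)) ->
  is_derive x (delta_mx 0 j) (tensor b) (tensor (derive_factor b j) x).
Proof.
move=> sb.
have E : \sum_k (delta_mx 0 j : V) 0 k * tensor (derive_factor b k) (x + 0 *: delta_mx 0 j)
    = tensor (derive_factor b j) x.
  rewrite (bigD1 j)//= big1 ?addr0; last first.
    by move=> k /negbTE kj; rewrite mxE eqxx kj mul0r.
  by rewrite mxE !eqxx mul1r scale0r addr0.
by rewrite -E; apply: is_derive_line; exact: tensor_line_derive.
Qed.

Lemma smooth_tensor b : (forall i, smooth1 (b i)) -> smooth (tensor b).
Proof.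
move=> sb.
apply: (@smooth_coind [set f | exists b, (forall i, smooth1 (b i)) /\ f = tensor b]).
  by exists b.
move=> _ [{sb}b [sb ->]].
have sd j i : smooth1 (derive_factor b j i).
  by rewrite /derive_factor; case: eqP => // _; exact: smooth1_derive.
split.
- rewrite /tensor => x.
  elim: (index_enum _) => [|i r ih].
    have -> : (fun y : V => \prod_(j <- [::]) b j (y 0 j)) = cst 1.
      by apply/funext => y; rewrite big_nil.
    exact: cst_continuous.
  have -> : (fun y : V => \prod_(j <- i :: r) b j (y 0 j)) =
      (fun y => b i (y 0 i) * \prod_(j <- r) b j (y 0 j)).
    by apply/funext => y; rewrite big_cons.
  apply: continuousM => //.
  apply: (@continuous_comp V R R (fun y : V => y 0 i) (b i)); first exact: coord_continuous.
  exact: smooth1_continuous.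
- by move=> x j; have [] := tensor_is_derive x j sb.
- move=> j; exists (derive_factor b j); split => //.
  by apply/funext => x; have [_ <-] := tensor_is_derive x j sb.
Qed.

End smooth_rV.

(** * Square-integrable functions *)

Section semi_inner.
Context {R : realType} (U : lmodType R).
Implicit Types (P : set U) (b : U -> U -> R).

Definition lin_closed P := P 0 /\ forall (c : R) u v, P u -> P v -> P (c *: u + v).

(** Semidefinite because vectors are representatives of classes, and restricted to a subspace [P]
    because integrals obey the algebraic rules only on integrable data. *)
Definition semi_inner P b :=
  [/\ forall (c : R) u v w, P u -> P v -> P w -> b (c *: u + v) w = c * b u w + b v w,
      forall u v, P u -> P v -> b u v = b v u &
      forall u, P u -> 0 <= b u u].

Definition snorm b u := Num.sqrt (b u u).

Lemma lin_closedZ P c u : lin_closed P -> P u -> P (c *: u).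
Proof. by move=> [P0 h] Pu; rewrite -[_ *: _]addr0; exact: h. Qed.

Lemma lin_closedD P u v : lin_closed P -> P u -> P v -> P (u + v).
Proof. by move=> [P0 h] Pu Pv; rewrite -[u]scale1r; exact: h. Qed.

Lemma lin_closedB P u v : lin_closed P -> P u -> P v -> P (u - v).
Proof. by move=> [P0 h] Pu Pv; rewrite addrC -scaleN1r; exact: h. Qed.

Lemma lin_closed_sum P (I : Type) (r : seq I) (p : pred I) (F : I -> U) :
  lin_closed P -> (forall i, p i -> P (F i)) -> P (\sum_(i <- r | p i) F i).
Proof.
move=> hP h; elim/big_ind : _ => [|x y|//]; first by case: hP.
exact: lin_closedD.
Qed.

Variables (P : set U) (b : U -> U -> R).
Hypotheses (hP : lin_closed P) (hb : semi_inner P b).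

Lemma semi_inner0l v : P v -> b 0 v = 0.
Proof.
move=> Pv; have [bl _ _] := hb; have [P0 _] := hP.
by have := bl 1 0 0 v P0 P0 Pv; rewrite scale1r addr0 mul1r => /eqP; rewrite eq_sym addrC -subr_eq0 addrK => /eqP.
Qed.

Lemma semi_innerDl u v w : P u -> P v -> P w -> b (u + v) w = b u w + b v w.
Proof. by move=> Pu Pv Pw; have [bl _ _] := hb; rewrite -[u in LHS]scale1r bl// mul1r. Qed.

Lemma semi_innerZl c u w : P u -> P w -> b (c *: u) w = c * b u w.
Proof.
move=> Pu Pw; have [bl _ _] := hb; have [P0 _] := hP.
by rewrite -[c *: u]addr0 bl// semi_inner0l// addr0.
Qed.

Lemma semi_innerC u v : P u -> P v -> b u v = b v u.
Proof. by have [_ bs _] := hb; exact: bs. Qed.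

Lemma semi_inner_ge0 u : P u -> 0 <= b u u.
Proof. by have [_ _] := hb; apply. Qed.

Lemma semi_inner_lin2 c u v : P u -> P v ->
  b (c *: u + v) (c *: u + v) = c ^+ 2 * b u u + 2 * c * b u v + b v v.
Proof.
move=> Pu Pv; have [bl bs _] := hb; have Pcuv := proj2 hP c _ _ Pu Pv.
rewrite bl// [b u _]bs// [b v _]bs// !bl// [b v u]bs//; ring.
Qed.

Lemma semi_inner_cs u v : P u -> P v -> b u v ^+ 2 <= b u u * b v v.
Proof.
move=> Pu Pv.
have h c : 0 <= c ^+ 2 * b u u + 2 * c * b u v + b v v.
  by rewrite -semi_inner_lin2// semi_inner_ge0//; exact: (proj2 hP).
have u0 := semi_inner_ge0 Pu; have v0 := semi_inner_ge0 Pv.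
have [uu|uu] := eqVneq (b u u) 0.
  have [->|uv] := eqVneq (b u v) 0; first by rewrite expr0n mulr_ge0.
  (* When [b u u] vanishes the polynomial is affine in c, and this c would give it the value -1. *)
  have := h (- (b v v + 1) / (2 * b u v)); rewrite uu mulr0 add0r.
  have -> : 2 * (- (b v v + 1) / (2 * b u v)) * b u v = - (b v v + 1) by field.
  lra.
have {}u0 : 0 < b u u by rewrite lt_neqAle eq_sym uu.
have := h (- b u v / b u u).
have -> : (- b u v / b u u) ^+ 2 * b u u + 2 * (- b u v / b u u) * b u v + b v v
  = (b u u * b v v - b u v ^+ 2) / b u u by field.
by rewrite pmulr_lge0 ?invr_gt0// subr_ge0.
Qed.

Lemma snorm_ge0 u : 0 <= snorm b u. Proof. exact: sqrtr_ge0. Qed.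

Lemma sqr_snorm u : P u -> snorm b u ^+ 2 = b u u.
Proof. by move=> Pu; rewrite sqr_sqrtr// semi_inner_ge0. Qed.

Lemma semi_inner_le u v : P u -> P v -> `|b u v| <= snorm b u * snorm b v.
Proof.
move=> Pu Pv; rewrite -sqrtrM ?semi_inner_ge0// -sqrtr_sqr ler_sqrt ?semi_inner_cs//.
by rewrite mulr_ge0// semi_inner_ge0.
Qed.

Lemma snormD u v : P u -> P v -> snorm b (u + v) <= snorm b u + snorm b v.
Proof.
move=> Pu Pv; rewrite -(@ler_pXn2r _ 2)// ?nnegrE ?addr_ge0 ?snorm_ge0//.
rewrite sqr_snorm; last exact: lin_closedD.
rewrite -[u in b (u + v) _]scale1r -[u in b _ (u + v)]scale1r semi_inner_lin2// sqrrD !sqr_snorm//.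
have := le_trans (ler_norm _) (semi_inner_le Pu Pv).
by rewrite expr1n !mul1r mulr1 -mulr_natl; lra.
Qed.

Lemma snormZ c u : P u -> snorm b (c *: u) = `|c| * snorm b u.
Proof.
move=> Pu; rewrite /snorm semi_innerZl//; last exact: lin_closedZ.
rewrite semi_innerC//; last exact: lin_closedZ.
by rewrite semi_innerZl// mulrA -expr2 sqrtrM ?sqr_ge0// sqrtr_sqr.
Qed.

Lemma snormN u : P u -> snorm b (- u) = snorm b u.
Proof. by move=> Pu; rewrite -scaleN1r snormZ// normrN normr1 mul1r. Qed.

Lemma snormB u v : P u -> P v -> snorm b (u - v) <= snorm b u + snorm b v.
Proof.
move=> Pu Pv; rewrite -(snormN Pv); apply: snormD => //.
by rewrite -scaleN1r; exact: lin_closedZ.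
Qed.

Lemma semi_innerZr c u w : P u -> P w -> b w (c *: u) = c * b w u.
Proof.
move=> Pu Pw; rewrite semi_innerC ?semi_innerZl//; last exact: lin_closedZ.
by rewrite [b u w]semi_innerC.
Qed.

Lemma semi_innerBl u v w : P u -> P v -> P w -> b (u - v) w = b u w - b v w.
Proof. by move=> Pu Pv Pw; have [bl _ _] := hb; rewrite addrC -scaleN1r bl// mulN1r addrC. Qed.

Lemma semi_innerBr u v w : P u -> P v -> P w -> b w (u - v) = b w u - b w v.
Proof.
move=> Pu Pv Pw; rewrite semi_innerC ?semi_innerBl//; last exact: lin_closedB.
by rewrite [b u w]semi_innerC// [b v w]semi_innerC.
Qed.

End semi_inner.

Section L2_theory.
Context {R : realType} d (T : measurableType d).
Variables (mu : {measure set T -> \bar R}) (D : set T).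
Hypothesis mD : measurable D.
Implicit Types f g : T -> R.

Lemma L2_integrable_sqr f : L2 mu D f -> mu.-integrable D (fun x => ((f x) ^+ 2)%:E).
Proof.
move=> [mf f2]; apply/integrableP; split.
  by apply/measurable_EFinP; exact: measurable_funX.
apply: le_lt_trans f2; apply: ge0_le_integral => //.
- by apply/measurable_EFinP/measurableT_comp => //; exact: measurable_funX.
- by apply/measurable_EFinP; exact: measurable_funX.
- by move=> x _; rewrite /= ger0_norm ?sqr_ge0.
Qed.

Lemma L2_integrableM f g : L2 mu D f -> L2 mu D g ->
  mu.-integrable D (EFin \o (f \* g)).
Proof.
move=> Lf Lg; have [mf _] := Lf; have [mg _] := Lg.
apply: (@le_integrable _ _ _ _ _ mD _ (fun x => ((f x) ^+ 2)%:E + ((g x) ^+ 2)%:E)%E).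
- by apply/measurable_EFinP; exact: measurable_funM.
- move=> x _ /=; rewrite lee_fin [leRHS]ger0_norm ?addr_ge0 ?sqr_ge0// normrM.
  rewrite -[f x ^+ 2]real_normK ?num_real// -[g x ^+ 2]real_normK ?num_real//.
  have := sqr_ge0 (`|f x| - `|g x|); have := sqr_ge0 (`|f x| + `|g x|); nra.
- by apply: integrableD => //; exact: L2_integrable_sqr.
Qed.

Lemma L2_lin (c : R) f g : L2 mu D f -> L2 mu D g -> L2 mu D (c *: f + g).
Proof.
move=> Lf Lg; have [mf f2] := Lf; have [mg g2] := Lg.
have m : measurable_fun D (c *: f + g).
  by apply: measurable_funD => //; exact: measurable_funM.
split => //.
have I : mu.-integrable D (fun x => (2 * c ^+ 2)%:E * ((f x) ^+ 2)%:E + 2%:E * ((g x) ^+ 2)%:E)%E.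
  by apply: integrableD => //; apply: integrableZl => //; exact: L2_integrable_sqr.
apply: le_lt_trans (integrable_lty mD I).
apply: ge0_le_integral => //.
- by move=> x _; rewrite lee_fin sqr_ge0.
- by apply/measurable_EFinP; exact: measurable_funX.
- by apply: measurable_int I.
- move=> x _; rewrite lee_fin /=.
  have -> : (c *: f + g) x = c * f x + g x by [].
  by have := sqr_ge0 (c * f x - g x); nra.
Qed.

Lemma L20 : L2 mu D (0 : T -> R).
Proof.
split; first exact: measurable_cst.
rewrite (eq_integral (cst 0%E)) ?integral0 ?ltry// => x _.
by congr EFin; rewrite /= expr0n.
Qed.

Lemma L2_closed : lin_closed [set f | L2 mu D f].
Proof. by split; [exact: L20|exact: L2_lin]. Qed.

Definition L2inner f g : R := \int[mu]_(x in D) (f x * g x).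

Lemma L2inner_semi : semi_inner [set f | L2 mu D f] L2inner.
Proof.
split.
- move=> c u v w Lu Lv Lw; rewrite /L2inner -RintegralZl//; last exact: L2_integrableM.
  rewrite -RintegralD//.
  + by apply: eq_Rintegral => x _; rewrite mulrDl -mulrA.
  + exact: (integrableZl mD c (L2_integrableM Lu Lw)).
  + exact: L2_integrableM.
- by move=> u v _ _; apply: eq_Rintegral => x _; rewrite mulrC.
- by move=> u _; apply: Rintegral_ge0 => x _; rewrite -expr2 sqr_ge0.
Qed.

Lemma L2normE f : L2norm mu D f = snorm L2inner f.
Proof. by rewrite /L2norm /snorm; congr Num.sqrt; apply: eq_Rintegral => x _; rewrite expr2. Qed.

Lemma sqr_L2norm f : L2 mu D f ->
  (L2norm mu D f ^+ 2)%:E = (\int[mu]_(x in D) ((f x) ^+ 2)%:E)%E.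
Proof.
move=> Lf; rewrite /L2norm sqr_sqrtr; last by apply: Rintegral_ge0 => x _; rewrite sqr_ge0.
by rewrite fineK//; apply: integrable_fin_num => //; exact: L2_integrable_sqr.
Qed.

Lemma L2norm_ge0 f : 0 <= L2norm mu D f.
Proof. exact: sqrtr_ge0. Qed.

Lemma aeq_L2inner f1 f2 g : L2 mu D f1 -> L2 mu D f2 -> L2 mu D g ->
  aeq mu D f1 f2 -> L2inner f1 g = L2inner f2 g.
Proof.
move=> Lf1 Lf2 Lg f12; rewrite /L2inner /Rintegral; congr fine.
apply: ae_eq_integral => //.
- by have := L2_integrableM Lf1 Lg; apply: measurable_int.
- by have := L2_integrableM Lf2 Lg; apply: measurable_int.
- by apply: filterS f12 => x h Dx; rewrite h.
Qed.

Lemma aeq_L2norm f1 f2 : L2 mu D f1 -> L2 mu D f2 ->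
  aeq mu D f1 f2 -> L2norm mu D f1 = L2norm mu D f2.
Proof.
move=> Lf1 Lf2 f12; have [_ s _] := L2inner_semi; rewrite !L2normE /snorm; congr Num.sqrt.
by rewrite (aeq_L2inner Lf1 Lf2)// s// (aeq_L2inner Lf1 Lf2).
Qed.

Lemma L2norm0_aeq f : L2 mu D f -> L2norm mu D f = 0 -> aeq mu D f (cst 0).
Proof.
move=> Lf f0; have [mf _] := Lf.
have : (\int[mu]_(x in D) `|(((f x) ^+ 2)%:E)|)%E = 0%E.
  rewrite (eq_integral (fun x => ((f x) ^+ 2)%:E)); last first.
    by move=> x _; rewrite gee0_abs// lee_fin sqr_ge0.
  by rewrite -sqr_L2norm// f0 expr0n.
move/(ae_eq_integral_abs mu mD) => h.
have {}h : ae_eq mu D (fun x => ((f x) ^+ 2)%:E) (cst 0%E).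
  by apply: h; apply/measurable_EFinP; exact: measurable_funX.
apply: filterS h => x h Dx; have [/eqP] := h Dx.
by rewrite sqrf_eq0 => /eqP.
Qed.

End L2_theory.

Arguments L2inner : simpl never.

Section qint.
Context {R : realType} (n : nat).
Local Notation V := 'rV[R]_n.+1.
Local Notation leb := (lebesgue_rV n.+1).
Implicit Types (A : set V) (f g h : V -> R).

(** An extended real, so that functions can be compared before square integrability is known. *)
Definition qint A f : \bar R := (\int[leb]_(x in A) ((f x) ^+ 2)%:E)%E.

Lemma qint_ge0 A f : (0 <= qint A f)%E.
Proof. by apply: integral_ge0 => x _; rewrite lee_fin sqr_ge0. Qed.

Lemma measurable_sqrE A f : measurable_fun A f ->
  measurable_fun A (fun x => ((f x) ^+ 2)%:E).
Proof. by move=> mf; apply/measurable_EFinP; exact: measurable_funX. Qed.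

Lemma qint_le2 A h f g (a b : R) : measurable A -> measurable_fun A h ->
  measurable_fun A f -> measurable_fun A g -> 0 <= a -> 0 <= b ->
  (forall x, A x -> h x ^+ 2 <= a * f x ^+ 2 + b * g x ^+ 2) ->
  (qint A h <= a%:E * qint A f + b%:E * qint A g)%E.
Proof.
move=> mA mh mf mg a0 b0 hfg.
have mf2 := measurable_sqrE mf; have mg2 := measurable_sqrE mg.
rewrite /qint -!ge0_integralZl_EFin//.
- rewrite -ge0_integralD//.
  + apply: ge0_le_integral => //.
    * by move=> x _; rewrite lee_fin sqr_ge0.
    * exact: measurable_sqrE.
    * by apply: emeasurable_funD; exact: measurable_funeM.
  + by move=> x _; rewrite -EFinM lee_fin mulr_ge0 ?sqr_ge0.
  + exact: measurable_funeM.
  + by move=> x _; rewrite -EFinM lee_fin mulr_ge0 ?sqr_ge0.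
  + exact: measurable_funeM.
- by move=> x _; rewrite lee_fin sqr_ge0.
- by move=> x _; rewrite lee_fin sqr_ge0.
Qed.

Lemma qint_le A h f (a : R) : measurable A -> measurable_fun A h ->
  measurable_fun A f -> 0 <= a -> (forall x, A x -> h x ^+ 2 <= a * f x ^+ 2) ->
  (qint A h <= a%:E * qint A f)%E.
Proof.
move=> mA mh mf a0 hf; have := qint_le2 mA mh mf mf a0 (lexx 0).
rewrite mul0e adde0; apply => x Ax; rewrite mul0r addr0; exact: hf.
Qed.

Lemma qint_le1 A h f : measurable A -> measurable_fun A h ->
  measurable_fun A f -> (forall x, A x -> h x ^+ 2 <= f x ^+ 2) ->
  (qint A h <= qint A f)%E.
Proof.
move=> mA mh mf hf; have := qint_le mA mh mf ler01; rewrite mul1e; apply => x Ax.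
by rewrite mul1r; exact: hf.
Qed.

Lemma qint_subset A B f : measurable A -> measurable B -> measurable_fun B f ->
  A `<=` B -> (qint A f <= qint B f)%E.
Proof.
move=> mA mB mf AB; apply: ge0_subset_integral => //; first exact: measurable_sqrE.
by move=> x _; rewrite lee_fin sqr_ge0.
Qed.

Lemma qint_mkcond A f : qint A f = qint setT (f \_ A).
Proof.
rewrite /qint integral_mkcond; apply: eq_integral => x _.
by rewrite !patchE; case: ifP => // _; rewrite expr0n.
Qed.

Lemma qint_indic A : measurable A -> qint setT (\1_A) = leb A.
Proof.
move=> mA; rewrite -[in RHS](setIT A) -integral_indic//; apply: eq_integral => x _.
by congr EFin; rewrite indicE; case: (x \in A); rewrite ?expr1n ?expr0n.
Qed.

Lemma lebesgue_ball_lty (r : R) : (leb (ball (0%R : V) r) < +oo)%E.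
Proof.
have h : (leb (ball (0%R : V) (`|r| + 1)%R) < +oo)%E by rewrite lebesgue_rV_cube ?ltry// ltr_wpDl.
apply: le_lt_trans h; apply: le_measure.
- by rewrite inE; exact: measurable_ball_rV.
- by rewrite inE; exact: measurable_ball_rV.
- by apply: le_ball; rewrite ler_wpDr// ler_norm.
Qed.

Lemma lebesgue_sub_ball_lty A r : measurable A -> A `<=` ball (0 : V) r -> (leb A < +oo)%E.
Proof.
move=> mA h; apply: le_lt_trans (lebesgue_ball_lty r); apply: le_measure => //.
- by rewrite inE.
- by rewrite inE; exact: measurable_ball_rV.
Qed.

Lemma compact_sub_ball A : compact A -> exists2 r, 0 < r & A `<=` ball (0 : V) r.
Proof.
move=> /compact_bounded[M [_ hM]]; exists (`|M| + 2) => [|x Ax]; first by rewrite ltr_wpDl.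
rewrite mx_norm_ball /ball_ /= sub0r normrN.
apply: (@le_lt_trans _ _ (`|M| + 1)); last by rewrite ltrD2l ltr1n.
by apply: hM => //; rewrite ltr_pwDr// ler_norm.
Qed.

End qint.

(** * Density of test functions *)

Section test_functions.
Context {R : realType} (n : nat).
Local Notation V := 'rV[R]_n.+1.
Local Notation leb := (lebesgue_rV n.+1).
Implicit Types (A : set V) (phi psi : V -> R).

(** Test functions equipped with the chain rule along every line. Bumps have this property by direct
    computation and it is stable under linear combinations and translations, so the dense class used
    for duality arguments can be taken inside [line_test]. *)
Definition line_test A phi := test_function A phi /\
  forall (x h : V) (t : R), is_derive t (1 : R) (fun s => phi (x + s *: h))
    (\sum_j h 0 j * pderiv j phi (x + t *: h)).

Lemma test_function_lin A (c : R) phi psi :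
  test_function A phi -> test_function A psi -> test_function A (c *: phi + psi).
Proof.
move=> [sf [K [cK KA hK]]] [sg [L [cL LA hL]]]; split; first exact: smooth_lin.
exists (K `|` L); split; [exact: compactU|by move=> x [/KA|/LA]|].
move=> x /not_orP[Kx Lx]; have -> : (c *: phi + psi) x = c * phi x + psi x by [].
by rewrite hK// hL// mulr0 addr0.
Qed.

Lemma line_test_lin A (c : R) phi psi :
  line_test A phi -> line_test A psi -> line_test A (c *: phi + psi).
Proof.
move=> [tf lf] [tg lg]; split; first exact: test_function_lin.
move=> x h t.
have dd := is_deriveD (is_deriveZ c (lf x h t)) (lg x h t).
apply: (is_derive_eq dd); rewrite /GRing.scale/= mulr_sumr -big_split/=.
apply: eq_bigr => j _; rewrite pderiv_lin//; [|by case: tf|by case: tg].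
rewrite [RHS](_ : _ = h 0 j * (c * pderiv j phi (x + t *: h) + pderiv j psi (x + t *: h)))//.
ring.
Qed.

Lemma test_function0 A : test_function A (0 : V -> R).
Proof.
have P0 i : pderiv i (0 : V -> R) = 0.
  by apply/funext => x; rewrite /pderiv (derive_cst (0 : R)).
split; last by exists set0; split => //; exact: compact0.
move=> s; have -> : foldr pderiv (0 : V -> R) s = 0 by elim: s => //= i s ->.
by split => [x|x i]; [exact: cst_continuous|exact: derivable_cst].
Qed.

Lemma line_test0 A : line_test A (0 : V -> R).
Proof.
have P0 i : pderiv i (0 : V -> R) = 0.
  by apply/funext => x; rewrite /pderiv (derive_cst (0 : R)).
split; first exact: test_function0.
move=> x h t; have dd := is_derive_cst (0 : R) t (1 : R).
by apply: (is_derive_eq dd); rewrite big1// => j _; rewrite P0 mulr0.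
Qed.

Lemma line_test_sub A B phi : A `<=` B -> line_test A phi -> line_test B phi.
Proof.
move=> AB [[sf [K [cK KA hK]]] lf]; split => //; split => //.
by exists K; split => //; exact: subset_trans AB.
Qed.

Lemma line_test_translation A B phi (h : V) : (forall x, A (x + h) -> B x) ->
  line_test A phi -> line_test B (fun x => phi (x + h)).
Proof.
move=> AB [[sf [K [cK KA hK]]] lf]; split.
  split; first exact: smooth_translation.
  exists ((fun x : V => x + - h) @` K); split.
  - apply: continuous_compact => //; apply: continuous_subspaceT.
    exact: continuous_shift_rV.
  - by move=> _ [x Kx <-]; apply: AB; rewrite subrK; exact: KA.
  - move=> x Kx; apply: hK => Kxh; apply: Kx.
    by exists (x + h) => //; rewrite addrK.
move=> x k t; have dd := lf (x + h) k t.
have E s : x + s *: k + h = x + h + s *: k by rewrite addrAC.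
under eq_fun do rewrite E.
apply: (is_derive_eq dd); apply: eq_bigr => j _.
by rewrite pderiv_translation// E.
Qed.

Lemma test_function_bounded A phi : test_function A phi ->
  exists M r, forall x, `|phi x| <= M * \1_(ball (0 : V) r) x.
Proof.
move=> [sf [K [cK KA hK]]]; have [r r0 Kr] := compact_sub_ball cK.
have : compact (phi @` K).
  by apply: continuous_compact => //; apply: continuous_subspaceT; exact: smooth_continuous.
move=> /compact_bounded[M [_ hM]]; exists (`|M| + 1), r => x.
rewrite indicE; have [Kx|Kx] := pselect (K x).
  rewrite mem_set ?mulr1; last exact: Kr.
  by apply: (hM (`|M| + 1)); [rewrite ltr_pwDr// ler_norm|exists x].
by rewrite hK// normr0 mulr_ge0// addr_ge0.
Qed.

Lemma test_function_measurable A phi D : test_function A phi -> measurable_fun D phi.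
Proof.
by move=> [sf _]; apply: measurable_funTS; apply: continuous_measurable_rV; exact: smooth_continuous.
Qed.

Lemma bounded_support_L2 phi (M r : R) D : measurable D -> measurable_fun D phi ->
  (forall x, `|phi x| <= M * \1_(ball (0 : V) r) x) -> L2 leb D phi.
Proof.
move=> mD mphi hM; split => //.
have mb : measurable (ball (0 : V) r) by exact: measurable_ball_rV.
apply: (@le_lt_trans _ _ (\int[leb]_(x in D) ((M ^+ 2)%:E * (\1_(ball (0 : V) r) x)%:E))%E).
  apply: ge0_le_integral => //.
  - by move=> x _; rewrite lee_fin sqr_ge0.
  - exact: measurable_sqrE.
  - by apply: measurable_funeM; apply/measurable_EFinP; exact: measurable_indic.
  - move=> x _; rewrite -EFinM lee_fin -[phi x ^+ 2]real_normK ?num_real//.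
    have := hM x; rewrite indicE; case: (_ \in _) => /=.
      by rewrite !mulr1 => h; rewrite lerXn2r// ?nnegrE// (le_trans _ h).
    by rewrite !mulr0 => h; have -> : `|phi x| = 0; [apply/eqP; rewrite eq_le h normr_ge0|rewrite expr0n].
rewrite ge0_integralZl_EFin ?sqr_ge0//; last first.
  by apply/measurable_EFinP; exact: measurable_indic.
rewrite integral_indic// lte_mul_pinfty ?lee_fin ?sqr_ge0//.
apply: le_lt_trans (lebesgue_ball_lty n r); apply: le_measure; rewrite ?inE//.
exact: measurableI.
Qed.

Lemma test_function_L2 A phi D : measurable D -> test_function A phi -> L2 leb D phi.
Proof.
move=> mD tf; have [M [r h]] := test_function_bounded tf.
by apply: bounded_support_L2 h => //; exact: test_function_measurable tf.
Qed.

Lemma test_function_pderiv A phi i : test_function A phi -> test_function A (pderiv i phi).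
Proof.
move=> [sf [K [cK KA hK]]]; split; first exact: smooth_pderiv.
exists K; split => // x Kx; rewrite /pderiv.
have cl : closed K by apply: compact_closed => //; exact: norm_hausdorff.
have E : \near x, cst 0 x = phi x.
  have : nbhs x (~` K) by apply: open_nbhs_nbhs; split => //; exact: closed_openC.
  by apply: filterS => y Ky; rewrite hK.
by rewrite -(near_eq_derive _ E) derive_cst.
Qed.

End test_functions.

Lemma integrable_indic_lty {R : realType} d (T : measurableType d)
    (mu : {measure set T -> \bar R}) (A : set T) : measurable A -> (mu A < +oo)%E ->
  mu.-integrable setT (EFin \o (\1_A : T -> R)).
Proof.
move=> mA Aoo; apply/integrableP; split.
  by apply/measurable_EFinP; exact: measurable_indic.
rewrite (eq_integral (fun x => (\1_A x)%:E)); last first.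
  by move=> t _; rewrite gee0_abs// lee_fin.
by rewrite integral_indic// setIT.
Qed.

Lemma cvge0_small {R : realType} (u : nat -> \bar R) (e : R) :
  u @ \oo --> 0%E -> 0 < e -> exists k, (u k <= e%:E)%E.
Proof.
move=> /fine_cvgP[fu cu] e0.
have [k [fk hk]] : exists k, u k \is a fin_num /\ `|fine (u k)| <= e.
  apply: (@filter_ex _ \oo).
  have {}cu := (@cvgr0_norm_le _ R^o _ _ _ _ cu _ e0 : \forall t \near \oo, `|(fine \o u) t| <= e).
  exact: (@filterS2 _ \oo _ _ _ _ (fun k a b => conj a b) fu (cu _)).
by exists k; rewrite -(fineK fk) lee_fin (le_trans (ler_norm _)).
Qed.

Lemma indicUE {R : realType} (T : Type) (A B : set T) : A `&` B = set0 ->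
  (\1_(A `|` B) : T -> R) = \1_A + \1_B.
Proof.
move=> AB; apply/funext => x; rewrite /GRing.add/= !indicE in_setU.
have [xA|xA] := boolP (x \in A); last by rewrite add0r.
have /negbTE -> : x \notin B.
  apply/negP => xB; have : (A `&` B) x by split; exact/set_mem.
  by rewrite AB.
by rewrite addr0.
Qed.

Import HBNNSimple.

Section boxes.
Context {R : realType} (n : nat).
Local Notation V := 'rV[R]_n.+1.
Local Notation leb := (lebesgue_rV n.+1).
Implicit Types (A X : set V) (a b : V).

Definition open_box a b : set V := [set x | forall i, a 0 i < x 0 i < b 0 i].
Definition closed_box a b : set V := [set x | forall i, a 0 i <= x 0 i <= b 0 i].
Definition boxes : set (set V) := [set X | exists a b, X = open_box a b].

Lemma ball_open_box a (r : R) : 0 < r ->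
  ball a r = open_box (a - const_mx r) (a + const_mx r).
Proof.
move=> r0; apply/seteqP; split => x.
  move=> /(rV_ballE _ _ r0) h i; have := h i; rewrite !mxE ltr_norml => /andP[h1 h2].
  by apply/andP; split; lra.
move=> h; apply/(rV_ballE _ _ r0) => i; have := h i; rewrite !mxE ltr_norml => /andP[h1 h2].
by apply/andP; split; lra.
Qed.

Lemma open_boxI a b c d : open_box a b `&` open_box c d =
  open_box (\row_i Num.max (a 0 i) (c 0 i)) (\row_i Num.min (b 0 i) (d 0 i)).
Proof.
apply/seteqP; split => x.
  move=> [h1 h2] i; rewrite !mxE gt_max lt_min.
  by have /andP[-> ->] := h1 i; have /andP[-> ->] := h2 i.
move=> h; split => i; have := h i; rewrite !mxE gt_max lt_min.
  by move=> /andP[/andP[-> _] /andP[-> _]].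
by move=> /andP[/andP[_ ->] /andP[_ ->]].
Qed.

Lemma boxes_setI : setI_closed boxes.
Proof. by move=> _ _ [a [b ->]] [c [d ->]]; rewrite open_boxI; eexists _, _. Qed.

Lemma open_box_measurable a b : measurable (open_box a b).
Proof.
rewrite (_ : open_box a b = \bigcap_(i in [set: 'I_n.+1]) (rV_coord i @^-1` `]a 0 i, b 0 i[)); last first.
  apply/seteqP; split => x h i; last first.
    by have := h i Logic.I; rewrite /= in_itv.
  by move=> _; rewrite /= in_itv; exact: h.
apply: fin_bigcap_measurable => // i _.
by rewrite -[X in measurable X]setTI; apply: measurable_rV_coord.
Qed.

(** An open set is a countable union of balls of the sup norm, which are boxes; so the sigma-algebra
    generated by boxes makes the coordinates measurable. *)
Lemma measurable_boxes : @measurable _ V = <<s boxes >>.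
Proof.
apply/seteqP; split; last first.
  apply: smallest_sub; first exact: sigma_algebra_measurable.
  by move=> _ [a [b ->]]; exact: open_box_measurable.
pose T := g_sigma_algebraType boxes.
have oT (A : set V) : open A -> (@measurable _ T) A.
  move=> /open_bigcup_ball[F [-> hF]]; apply: bigcupT_measurable => k.
  have [->|[c [r [r0 -> _]]]] := hF k; first exact: measurable0.
  by apply: sub_sigma_algebra; rewrite ball_open_box//; eexists _, _; reflexivity.
suff mid : measurable_fun setT (id : T -> V).
  by move=> A mA; have := mid measurableT A mA; rewrite setTI.
apply: (@measurable_fun_rV R n.+1 _ T) => i.
apply: (measurability _ (RGenOpens.measurableE R)) => _ [_ [c [d ->] <-]].
rewrite setTI; apply: oT; apply: open_comp; last exact: interval_open.
by move=> x _; exact: (@coord_continuous R 1 n.+1 0 i).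
Qed.

Lemma closed_box_compact a b : compact (closed_box a b).
Proof.
have := @rV_compact R n.+1 (fun i => `[a 0 i, b 0 i]%classic) (fun i => @segment_compact R _ _).
by congr compact; apply/seteqP; split => x h i; have := h i; rewrite /= in_itv.
Qed.

Lemma open_sub_closed_box a b : open_box a b `<=` closed_box a b.
Proof. by move=> x h i; have /andP[/ltW -> /ltW ->] := h i. Qed.

Definition box_bump l a b : V -> R := tensor (fun i => bump1 l (a 0 i) (b 0 i)).

Lemma bump_line_test l a b A : 0 < l -> closed_box a b `<=` A -> line_test A (box_bump l a b).
Proof.
move=> l0 abA; have sb i : smooth1 (bump1 l (a 0 i) (b 0 i)) by exact: smooth1_bump.
split.
  split; first exact: smooth_tensor.
  exists (closed_box a b); split => //; first exact: closed_box_compact.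
  move=> x hx; have /existsNP[i hi] : ~ open_box a b x.
    by move=> h; apply: hx; exact: open_sub_closed_box.
  by rewrite /box_bump /tensor (bigD1 i)//= bump1_out ?mul0r//; exact/negP.
move=> x h t; have dd := tensor_line_derive x h t sb; apply: (is_derive_eq dd).
apply: eq_bigr => j _; congr (_ * _).
by have [_ <-] := tensor_is_derive (x + t *: h) j sb.
Qed.

Lemma bump_itv l a b x : 0 < l -> 0 <= box_bump l a b x <= 1.
Proof.
move=> l0; rewrite /box_bump /tensor; apply/andP; split.
  by apply: prodr_ge0 => i _; have /andP[] := bump1_itv l0 (a 0 i) (b 0 i) (x 0 i).
by apply: prodr_ile1 => i _; exact: bump1_itv.
Qed.

Lemma bump_out l a b x : ~ open_box a b x -> box_bump l a b x = 0.
Proof.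
move=> /existsNP[i hi]; rewrite /box_bump /tensor (bigD1 i)//= bump1_out ?mul0r//; exact/negP.
Qed.

Lemma bump_cvg a b x : open_box a b x ->
  (fun k : nat => box_bump (k.+1%:R^-1) a b x) @ \oo --> (1 : R).
Proof.
move=> hx; pose C := \sum_i ((x 0 i - a 0 i)^-1 + (b 0 i - x 0 i)^-1).
have -> : (fun k : nat => box_bump (k.+1%:R^-1) a b x) = (fun k : nat => expR (- (k.+1%:R^-1 * C))).
  apply/funext => k; rewrite /box_bump /tensor /C mulr_sumr -sumrN expR_sum.
  by apply: eq_bigr => i _; rewrite bump1_in.
rewrite -[X in _ --> X](expR0 R); apply: continuous_cvg; first exact: continuous_expR.
rewrite -oppr0; apply: cvgN; rewrite -(mul0r C); apply: cvgMr_tmp; exact: cvg_harmonic.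
Qed.

Lemma bounded_box a b : exists r, open_box a b `<=` ball (0 : V) r.
Proof.
have [r r0 h] := compact_sub_ball (@closed_box_compact a b).
by exists r; apply: subset_trans h; exact: open_sub_closed_box.
Qed.

Definition approx A (f : V -> R) := measurable_fun setT f /\
  forall e : R, 0 < e -> exists phi, line_test A phi /\ (qint setT (f - phi)%R <= e%:E)%E.

(** Dominated convergence for the bumps with [l] = 1/(k+1), which lie between 0 and the indicator
    and tend to it. *)
Lemma approx_box a b A : closed_box a b `<=` A -> approx A (\1_(open_box a b) : V -> R).
Proof.
move=> abA; have mB := open_box_measurable a b.
split; first exact: measurable_indic.
move=> e e0.
pose F (k : nat) x := (((\1_(open_box a b) x : R) - box_bump (k.+1%:R^-1) a b x) ^+ 2)%:E.
have mF k : measurable_fun setT (F k).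
  apply: measurable_sqrE; apply: measurable_funB; first exact: measurable_indic.
  by apply: (test_function_measurable (A := A)); apply: (proj1 (bump_line_test _ abA)).
have iB : leb.-integrable setT (EFin \o (\1_(open_box a b) : V -> R)).
  have [r hr] := bounded_box a b.
  by apply: integrable_indic_lty => //; exact: lebesgue_sub_ball_lty hr.
have H : (fun k => \int[leb]_x F k x)%E @ \oo --> (\int[leb]_x (cst 0 x))%E.
  have [] // := @dominated_convergence _ _ R leb setT measurableT F (cst 0%E)
    (EFin \o (\1_(open_box a b))) mF (measurable_cst _) _ iB.
  - apply: aeW => x _; rewrite /F; have [xB|xB] := pselect (open_box a b x).
      apply: cvg_EFin; first exact: nearW.
      rewrite -[X in _ --> X](expr0n _ 2) -[X in (X ^+ 2)](subrr 1).
      rewrite indicE mem_set//=; apply: (@continuous_cvg _ _ _ _ _ _ (fun y : R => y ^+ 2)).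
        exact: exprn_continuous.
      by apply: cvgB; [exact: cvg_cst|exact: bump_cvg].
    rewrite indicE memNset//= (_ : (fun k : nat => _) = cst 0%E); first exact: cvg_cst.
    by apply/funext => k; rewrite bump_out// subrr expr0n.
  - apply: aeW => x k _; rewrite /F /= ger0_norm ?sqr_ge0// lee_fin indicE.
    have [xB|xB] := pselect (open_box a b x); last first.
      by rewrite memNset// bump_out// subrr expr0n.
    rewrite mem_set//= expr_le1//; last first.
      by rewrite subr_ge0; have /andP[] := bump_itv a b x (l := k.+1%:R^-1) ltac:(by rewrite invr_gt0).
    by rewrite lerBlDr lerDl; have /andP[] := bump_itv a b x (l := k.+1%:R^-1) ltac:(by rewrite invr_gt0).
rewrite integral0 in H.
have [k hk] := cvge0_small H e0.
exists (box_bump k.+1%:R^-1 a b); split; first by apply: bump_line_test => //; rewrite invr_gt0.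
exact: hk.
Qed.

Lemma approx_lim A (f : V -> R) : measurable_fun setT f ->
  (forall e : R, 0 < e -> exists g, approx A g /\ (qint setT (f - g)%R <= e%:E)%E) -> approx A f.
Proof.
move=> mf h; split => // e e0.
have [g [[mg ag] fg]] := h (e / 4) ltac:(by rewrite divr_gt0).
have [phi [tphi gphi]] := ag (e / 4) ltac:(by rewrite divr_gt0).
have mphi := test_function_measurable (D := setT) (proj1 tphi).
exists phi; split => //.
apply: (@le_trans _ _ (2%:E * qint setT (f - g)%R + 2%:E * qint setT (g - phi)%R)%E).
  apply: qint_le2 => //; try exact: measurable_funB.
  move=> x _; have -> : (f - phi) x = (f - g) x + (g - phi) x by rewrite !fctE; ring.
  by move: ((f - g) x) ((g - phi) x) => a b; have := sqr_ge0 (a - b); nra.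
apply: (@le_trans _ _ (2%:E * (e / 4)%:E + 2%:E * (e / 4)%:E)%E).
  by apply: leeD; apply: lee_wpmul2l.
by rewrite -!EFinM -EFinD lee_fin; lra.
Qed.

Lemma approx_lin A c (f g : V -> R) : approx A f -> approx A g -> approx A (c *: f + g).
Proof.
move=> [mf af] [mg ag].
have mcfg : measurable_fun setT (c *: f + g).
  by apply: measurable_funD => //; exact: measurable_funM.
split => // e e0.
have c0 : 0 < 4 * (c ^+ 2 + 1) by rewrite mulr_gt0// ltr_wpDl ?sqr_ge0.
have [phi [tphi fphi]] := af (e / (4 * (c ^+ 2 + 1))) ltac:(by rewrite divr_gt0).
have [psi [tpsi gpsi]] := ag (e / 4) ltac:(by rewrite divr_gt0).
have mphi := test_function_measurable (D := setT) (proj1 tphi).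
have mpsi := test_function_measurable (D := setT) (proj1 tpsi).
exists (c *: phi + psi); split; first exact: line_test_lin.
apply: (@le_trans _ _ ((2 * c ^+ 2)%:E * qint setT (f - phi)%R + 2%:E * qint setT (g - psi)%R)%E).
  apply: qint_le2 => //; try exact: measurable_funB.
  - by apply: measurable_funB => //; apply: measurable_funD => //; exact: measurable_funM.
  - by rewrite mulr_ge0// sqr_ge0.
  - move=> x _; have -> : ((c *: f + g) - (c *: phi + psi)) x = c * (f - phi) x + (g - psi) x.
      by rewrite !fctE /GRing.scale/=; ring.
    by move: ((f - phi) x) ((g - psi) x) => a b; have := sqr_ge0 (c * a - b); nra.
apply: (@le_trans _ _ ((2 * c ^+ 2)%:E * (e / (4 * (c ^+ 2 + 1)))%:E + 2%:E * (e / 4)%:E)%E).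
  apply: leeD; apply: lee_wpmul2l => //.
  by rewrite lee_fin mulr_ge0// sqr_ge0.
rewrite -!EFinM -EFinD lee_fin.
have -> : 2 * c ^+ 2 * (e / (4 * (c ^+ 2 + 1))) = (e / 2) * (c ^+ 2 / (c ^+ 2 + 1)).
  by field; rewrite gt_eqF// -(pmulr_rgt0 _ (ltr0n _ 4)).
have : c ^+ 2 / (c ^+ 2 + 1) <= 1.
  by rewrite ler_pdivrMr ?mul1r ?lerDl// ltr_wpDl ?sqr_ge0.
by move: (_ / (_ + 1)) => t; nra.
Qed.

Lemma approx0 A : approx A (0 : V -> R).
Proof.
split; first exact: measurable_cst.
move=> e e0; exists 0; split; first exact: line_test0.
rewrite subrr /qint (eq_integral (cst 0%E)) ?integral0 ?lee_fin ?ltW// => x _.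
by rewrite /= expr0n.
Qed.

Lemma approxZ A c (f : V -> R) : approx A f -> approx A (c *: f).
Proof. by move=> af; rewrite -[c *: f]addr0; apply: approx_lin => //; exact: approx0. Qed.

Lemma approxD A (f g : V -> R) : approx A f -> approx A g -> approx A (f + g).
Proof. by move=> af; rewrite -[f]scale1r; exact: approx_lin. Qed.

Lemma approxB A (f g : V -> R) : approx A f -> approx A g -> approx A (f - g).
Proof. by move=> af ag; rewrite addrC -scaleN1r; exact: approx_lin. Qed.

(** Finite unions are handled by linearity, and the measure of what they leave out tends to 0
    because the union has finite measure. *)
Lemma approx_bigcup A (F : nat -> set V) : (forall k, measurable (F k)) ->
  trivIset setT F -> (leb (\bigcup_k F k) < +oo)%E ->
  (forall k, approx A (\1_(F k) : V -> R)) -> approx A (\1_(\bigcup_k F k) : V -> R).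
Proof.
move=> mF tF Foo aF.
have mU : measurable (\bigcup_k F k) by exact: bigcupT_measurable.
apply: approx_lim => [|e e0]; first exact: measurable_indic.
pose G k := \big[setU/set0]_(i < k) F i.
have mG k : measurable (G k) by apply: bigsetU_measurable.
have aG k : approx A (\1_(G k) : V -> R).
  elim: k => [|k ih]; first by rewrite /G big_ord0 indic0; exact: approx0.
  rewrite /G big_ord_recr/= indicUE; first exact: approxD.
  apply: (@trivIset_bigsetUI _ predT) => //.
  by move: tF; congr trivIset; apply/seteqP; split.
have GU k : G k `<=` \bigcup_k F k by exact: bigsetU_bigcup.
have mUG k : measurable (\bigcup_k F k `\` G k) by exact: measurableD.
have cvG : (fun k => leb (\bigcup_k F k `\` G k)) @ \oo --> 0%E.
  rewrite -(measure0 leb) (_ : set0 = \bigcap_k (\bigcup_k F k `\` G k)).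
    apply: nonincreasing_cvg_mu => //.
    - by apply: le_lt_trans Foo; apply: le_measure; rewrite ?inE.
    - exact: bigcapT_measurable.
    - move=> i j ij; apply/subsetPset; apply: setDS; exact: subset_bigsetU.
  apply/esym; rewrite -subset0 => x h.
  have [[i _ Fix] _] := h 0%N Logic.I.
  have [_] := h i.+1 Logic.I; apply; rewrite /G big_ord_recr/=; by right.
have [k hk] := cvge0_small cvG e0.
exists (\1_(G k)); split => //.
rewrite (_ : _ - _ = \1_(\bigcup_k F k `\` G k)); last first.
  apply/funext => x; rewrite /GRing.add/= /GRing.opp/= !indicE in_setD.
  have [xG|xG] := boolP (x \in G k); last by rewrite subr0 andbT.
  by rewrite andbF mem_set ?subrr//; apply: (GU k); exact/set_mem.
by rewrite qint_indic.
Qed.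

(** Dynkin's theorem: boxes are stable under intersection and generate the sigma-algebra, and the
    sets whose trace on the fixed box is approximable form a Dynkin class. *)
Lemma approx_subset_box a b A X : closed_box a b `<=` A -> measurable X ->
  approx A (\1_(X `&` open_box a b) : V -> R).
Proof.
move=> abA mX; have mB := open_box_measurable a b.
have Boo : (leb (open_box a b) < +oo)%E.
  by have [r hr] := bounded_box a b; exact: lebesgue_sub_ball_lty hr.
have := @dynkin_induction _ V boxes
  [set X | approx A (\1_(X `&` open_box a b) : V -> R)] measurable_boxes boxes_setI.
rewrite -measurable_boxes; apply => //.
- by rewrite /= setTI; exact: approx_box.
- move=> _ [c [d ->]] /=.
  rewrite open_boxI; apply: approx_box => x hx; apply: abA => i.
  by have := hx i; rewrite !mxE ge_max le_min => /andP[/andP[_ ->] /andP[_ ->]].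
- move=> S mS aS /=.
  rewrite (_ : (\1_ _ : V -> R) = \1_(open_box a b) - \1_(S `&` open_box a b)).
    by apply: approxB => //; exact: approx_box.
  apply/funext => x; rewrite /GRing.add/= /GRing.opp/= !indicE !in_setI in_setC.
  by case: (x \in S); case: (x \in open_box a b) => /=; rewrite ?subrr ?subr0.
- move=> F mF tF aF /=; rewrite setI_bigcupl; apply: approx_bigcup => //.
  + by move=> k; exact: measurableI.
  + exact: trivIset_setIr.
  + rewrite -setI_bigcupl; apply: le_lt_trans Boo; apply: le_measure; rewrite ?inE//.
    by apply: measurableI => //; exact: bigcupT_measurable.
Qed.

(** A countable cover of [A] by balls is made disjoint; each piece of [X] then lies in one box whose
    closure is inside [A]. *)
Lemma approx_set A X : open A -> measurable X -> X `<=` A -> (leb X < +oo)%E ->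
  approx A (\1_X : V -> R).
Proof.
move=> /open_bigcup_ball[F [AF hF]] mX XA Xoo.
have mF k : measurable (F k).
  by have [->//|[c [r [_ -> _]]]] := hF k; exact: measurable_ball_rV.
have mD k : measurable (seqDU F k) by apply: measurableD => //; exact: bigsetU_measurable.
have XE : X = \bigcup_k (X `&` seqDU F k).
  by rewrite -setI_bigcupr -seqDU_bigcup_eq -AF; apply/esym/setIidPl.
rewrite XE; apply: approx_bigcup.
- by move=> k; exact: measurableI.
- by apply: trivIset_setIl; exact: trivIset_seqDU.
- by rewrite -XE.
move=> k; have [F0|[c [r [r0 Fk hr]]]] := hF k.
  rewrite (_ : _ `&` _ = set0) ?indic0; first exact: approx0.
  by apply/seteqP; split => // x [_ [+ _]]; rewrite F0.
rewrite (_ : X `&` _ = (X `&` seqDU F k) `&` open_box (c - const_mx r) (c + const_mx r)).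
  apply: approx_subset_box; last exact: measurableI.
  move=> x hx; apply: hr; apply/rV_ballE; first by rewrite mulr_gt0.
  move=> i; have := hx i; rewrite !mxE ltr_norml => /andP[h1 h2].
  by apply/andP; split; lra.
rewrite -ball_open_box// -Fk; apply/seteqP; split => x; last by case.
by move=> [Xx [Fx ?]].
Qed.

(** Simple functions increasing to [f] converge to it in L^2, with f^2 as dominating function, and
    each is a finite combination of indicators of subsets of [A]. *)
Lemma approx_ge0 A (f : V -> R) : open A -> L2 leb setT f -> (forall x, 0 <= f x) ->
  (forall x, ~ A x -> f x = 0) -> approx A f.
Proof.
move=> oA Lf f0 fA; have [mf f2] := Lf.
have mEf : measurable_fun setT (EFin \o f) by exact/measurable_EFinP.
pose F := nnsfun_approx measurableT mEf.
have cF (x : V) : (fun k => F k x) @ \oo --> f x.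
  have := @cvg_nnsfun_approx _ _ _ _ measurableT _ mEf (fun x _ => f0 x) x Logic.I.
  by move/fine_cvgP => [].
have ndF (x : V) : nondecreasing_seq (fun k => F k x).
  by move=> i j ij; have /lefP := nd_nnsfun_approx measurableT mEf ij; exact.
have leF k (x : V) : F k x <= f x.
  rewrite -(cvg_lim (@Rhausdorff R) (cF x)); apply: nondecreasing_cvgn_le => //.
  by apply/cvg_ex; exists (f x).
have F0 k (x : V) : 0 <= F k x by exact: fun_ge0.
have mFk k : measurable_fun setT (F k : V -> R) by [].
apply: approx_lim => // e e0.
have [k hk] : exists k, (qint setT (f - (F k : V -> R))%R <= e%:E)%E.
  suff H : (fun k => qint setT (f - (F k : V -> R))%R) @ \oo --> 0%E by exact: cvge0_small H e0.
  pose H k x := (((f - (F k : V -> R)) x) ^+ 2)%:E.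
  have mH k : measurable_fun setT (H k) by apply: measurable_sqrE; exact: measurable_funB.
  rewrite -(integral0 leb setT).
  have [] // := @dominated_convergence _ _ R leb setT measurableT H (cst 0%E)
    (fun x => (f x ^+ 2)%:E) mH (measurable_cst _) _ (L2_integrable_sqr measurableT Lf).
  - apply: aeW => x _; apply: cvg_EFin; first exact: nearW.
    rewrite -[X in _ --> X](expr0n _ 2) -[X in (X ^+ 2)](subrr (f x)).
    apply: (@continuous_cvg _ _ _ _ _ _ (fun y : R => y ^+ 2)); first exact: exprn_continuous.
    by apply: cvgB; [exact: cvg_cst|exact: cF].
  - apply: aeW => x k _; rewrite /H /= ger0_norm ?sqr_ge0// lee_fin.
    have -> : (f - (F k : V -> R)) x = f x - F k x by [].
    by have := leF k x; have := F0 k x; nra.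
exists (F k); split => //.
have -> : (F k : V -> R) = \sum_(y <- finmap.enum_fset (fset_set (range (F k)))) y *: (\1_(F k @^-1` [set y]) : V -> R).
  by apply/funext => x; rewrite fimfunE fsbig_finite//= fct_sumE.
elim/big_ind : _ => [|g h|y _]; [exact: approx0|exact: approxD|].
have [y0|y0] := ltP 0 y; last first.
  rewrite (_ : _ *: _ = 0); first exact: approx0.
  apply/funext => x; apply: (@etrans _ _ (y * \1_(F k @^-1` [set y]) x)) => //; rewrite indicE.
  have [xy|xy] := boolP (x \in _); last by rewrite mulr0.
  rewrite mulr1; apply/eqP; rewrite eq_le y0 /=.
  by have /set_mem/= <- := xy.
have mX : measurable (F k @^-1` [set y]) by exact: measurable_sfunP.
apply: approxZ; apply: approx_set => //.
- move=> x /= Fxy; apply: contrapT => /fA fx; move: y0.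
  by rewrite -Fxy ltNge (le_trans (leF k x))// fx.
(* Chebyshev: on the level set of value y > 0 one has f >= y, so its measure is at most y^-2 times
   the integral of f^2. *)
- rewrite -qint_indic//; apply: (@le_lt_trans _ _ ((y ^- 2)%:E * qint setT f)%E).
    apply: qint_le => //; first by rewrite invr_ge0 sqr_ge0.
    move=> x _; rewrite ler_pdivlMl ?exprn_gt0// indicE.
    have [/set_mem/= xy|_] := boolP (x \in _).
      by rewrite expr1n mulr1 lerXn2r// ?nnegrE// -?xy//; exact: ltW.
    by rewrite expr0n mulr0 sqr_ge0.
  by rewrite lte_mul_pinfty// lee_fin invr_ge0 sqr_ge0.
Qed.

Lemma approx_L2 A (f : V -> R) : open A -> L2 leb setT f ->
  (forall x, ~ A x -> f x = 0) -> approx A f.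
Proof.
move=> oA Lf fA; have [mf f2] := Lf.
have L2M (g : V -> R) : measurable_fun setT g -> (forall x, g x ^+ 2 <= f x ^+ 2) -> L2 leb setT g.
  by move=> mg gf; split => //; apply: le_lt_trans f2; exact: qint_le1.
have fE : f = (fun x => Num.max (f x) 0) - (fun x => Num.max (- f x) 0).
  apply/funext => x; rewrite [RHS](_ : _ = Num.max (f x) 0 - Num.max (- f x) 0)//.
  by have [h|h] := leP (f x) 0; have [h'|h'] := leP (- f x) 0; lra.
rewrite fE; apply: approxB.
  apply: approx_ge0 => //.
  - apply: L2M; first by apply: measurable_maxr => //.
    by move=> x; have [h|h] := leP (f x) 0; rewrite ?expr0n ?sqr_ge0.
  - by move=> x; rewrite le_max lexx orbT.
  - by move=> x /fA ->; rewrite maxxx.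
apply: approx_ge0 => //.
- apply: L2M; first by apply: measurable_maxr => //; exact: measurableT_comp.
  by move=> x; have [h|h] := leP (- f x) 0; rewrite ?expr0n ?sqrrN ?sqr_ge0.
- by move=> x; rewrite le_max lexx orbT.
- by move=> x /fA ->; rewrite oppr0 maxxx.
Qed.

(* By density, an L^2 bound of the functional [phi |-> int g phi] on test
   functions bounds the norm of [g]. *)
Lemma test_dual A (g : V -> R) (c : R) : open A -> L2 leb setT g -> 0 <= c ->
  (forall phi, line_test A phi ->
    L2inner leb setT g phi ^+ 2 <= c * L2inner leb setT phi phi) ->
  (qint A g <= c%:E)%E.
Proof.
move=> oA Lg c0 hg; have mA := open_measurable_rV oA; have [mg g2] := Lg.
pose f : V -> R := g \_ A.
have mf : measurable_fun setT f by apply/(measurable_restrictT _ mA); exact: measurable_funTS.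
have Lf : L2 leb setT f.
  split => //; apply: le_lt_trans g2; apply: qint_le1 => // x _.
  by rewrite /f patchE; case: ifP => // _; rewrite expr0n sqr_ge0.
have fA x : ~ A x -> f x = 0 by move=> Ax; rewrite /f patchE memNset.
have [_ af] := approx_L2 oA Lf fA.
have hL := @L2_closed R _ _ (lebesgue_rV n.+1) _ measurableT; have hs := @L2inner_semi R _ _ (lebesgue_rV n.+1) _ measurableT.
set inn := L2inner leb setT in hg hs *; pose x := snorm inn f; pose s := Num.sqrt c.
have fg phi : line_test A phi -> inn f phi = inn g phi.
  move=> [[_ [K [_ KA hK]]] _]; apply: eq_Rintegral => y _.
  rewrite /f patchE; case: ifPn => // /negP Ay.
  by rewrite hK ?mulr0// => /KA Ay'; apply: Ay; rewrite inE.
have x0 : 0 <= x by exact: snorm_ge0.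
have s0 : 0 <= s by exact: sqrtr_ge0.
(* With [phi] within d of [f], the square of the norm is [inn (f - phi) f + inn phi f]: the first
   term is at most x d, and the hypothesis bounds the second by s times the norm of [phi]. *)
have H d : 0 < d -> x ^+ 2 <= x * d + s * (x + d).
  move=> d0; have [phi [tphi hphi]] := af (d ^+ 2) ltac:(by rewrite exprn_gt0).
  have Lphi := test_function_L2 measurableT (proj1 tphi).
  have Lfp : L2 leb setT (f - phi) by exact: (@lin_closedB _ _ _ f phi hL Lf Lphi).
  have nfp : snorm inn (f - phi) <= d.
    rewrite -(ger0_norm (ltW d0)) -sqrtr_sqr /snorm ler_sqrt ?sqr_ge0//.
    by rewrite -lee_fin -(sqr_snorm hs Lfp) -L2normE// sqr_L2norm.
  have np : snorm inn phi <= x + d.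
    have -> : phi = f - (f - phi) by rewrite opprB addrC subrK.
    by apply: (le_trans (snormB hL hs Lf Lfp)); rewrite lerD2l.
  have -> : x ^+ 2 = inn (f - phi) f + inn phi f.
    by rewrite /x (sqr_snorm hs Lf) -(semi_innerDl hs Lfp Lphi Lf) subrK.
  apply: lerD.
    apply: le_trans (ler_norm _) _; apply: le_trans (semi_inner_le hL hs Lfp Lf) _.
    by rewrite mulrC ler_wpM2l.
  rewrite (semi_innerC hs)// fg//; apply: le_trans (ler_norm _) _.
  apply: (@le_trans _ _ (s * snorm inn phi)); last by rewrite ler_wpM2l.
  by rewrite -sqrtr_sqr -sqrtrM// ler_sqrt ?hg// mulr_ge0// (semi_inner_ge0 hs).
have xs : x <= s.
  rewrite leNgt; apply/negP => sx.
  have xs0 : 0 < x + s by lra.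
  (* For this d the inequality [H] reads x^2 - s x <= (x^2 - s x) / 2, which is absurd when x >
     s. *)
  have d0 : 0 < (x ^+ 2 - s * x) / (2 * (x + s)) by rewrite divr_gt0; nra.
  have := H _ d0; set d := (_ / _).
  have : d * (x + s) = (x ^+ 2 - s * x) / 2 by rewrite /d; field; lra.
  by nra.
rewrite qint_mkcond -/f -[qint _ _]sqr_L2norm// L2normE// lee_fin -[c]sqr_sqrtr//.
by rewrite lerXn2r// ?nnegrE ?snorm_ge0.
Qed.

End boxes.

(** * Difference quotients and weak derivatives *)

Section translation_integrals.
Context {R : realType} (n : nat).
Local Notation V := 'rV[R]_n.+1.
Local Notation leb := (lebesgue_rV n.+1).

Lemma Rintegral_translation (f : V -> R) (h : V) : measurable_fun setT f ->
  \int[leb]_x f (x + h) = \int[leb]_x f x.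
Proof.
move=> mf; rewrite /Rintegral; congr fine.
have mE : measurable_fun setT (EFin \o f) by exact/measurable_EFinP.
rewrite integralE [RHS]integralE; congr (_ - _)%E.
  rewrite -(@ge0_integral_translation R n.+1 h ((EFin \o f)^\+)%E)//.
    by apply: eq_integral => x _; rewrite !funeposE.
  exact: measurable_funepos.
rewrite -(@ge0_integral_translation R n.+1 h ((EFin \o f)^\-)%E)//.
  by apply: eq_integral => x _; rewrite !funenegE.
exact: measurable_funeneg.
Qed.

Lemma qint_translation (f : V -> R) (A B : set V) (h : V) : measurable A -> measurable B ->
  (forall x, B (x + h) <-> A x) -> measurable_fun setT f ->
  qint A (fun x => f (x + h)) = qint B f.
Proof.
move=> mA mB AB mf; rewrite qint_mkcond [RHS]qint_mkcond.
have mfB : measurable_fun setT (f \_ B).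
  by apply/(measurable_restrictT _ mB); exact: measurable_funTS.
rewrite /qint -(@ge0_integral_translation R n.+1 h (fun x => ((f \_ B) x ^+ 2)%:E)).
- apply: eq_integral => x _; congr ((_ ^+ 2)%:E); rewrite !patchE.
  have [Ax|Ax] := pselect (A x); first by rewrite !mem_set//; exact/AB.
  by rewrite !memNset// => /AB.
- exact: measurable_sqrE.
- by move=> x; rewrite lee_fin sqr_ge0.
Qed.

Lemma measurable_translation (f : V -> R) (h : V) : measurable_fun setT f ->
  measurable_fun setT (fun x : V => f (x + h)).
Proof. by move=> mf; apply: measurableT_comp => //; exact: measurable_addl_rV. Qed.

Lemma L2_translation (f : V -> R) (h : V) : L2 leb setT f ->
  L2 leb setT (fun x : V => f (x + h)).
Proof.
move=> [mf f2]; split; first exact: measurable_translation.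
by rewrite -[X in (X < _)%E]/(qint setT (fun x => f (x + h))) (@qint_translation f setT setT).
Qed.

End translation_integrals.

Section difference_estimate.
Context {R : realType} (n : nat).
Local Notation V := 'rV[R]_n.+1.
Local Notation leb := (lebesgue_rV n.+1).
Local Notation inn := (L2inner leb setT).
Implicit Types (u : V -> R) (g : 'I_n.+1 -> V -> R) (A B Omega : set V) (h : V).

(** The integrals run over the whole space so that [u] and [g] can be translated freely; only the
    support of the test function confines the identity to [Omega]. *)
Definition weak_grad Omega u g := forall j phi, test_function Omega phi ->
  inn u (pderiv j phi) = - inn (g j) phi.

Let hL := @L2_closed R _ _ (lebesgue_rV n.+1) _ measurableT.
Let hs := @L2inner_semi R _ _ (lebesgue_rV n.+1) _ measurableT.

Let dirder (h : V) (phi : V -> R) : V -> R := \sum_j h 0 j *: pderiv j phi.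

Let dirderE h phi x : dirder h phi x = \sum_j h 0 j * pderiv j phi x.
Proof. by rewrite /dirder fct_sumE. Qed.

Let test_sum Omega (F : 'I_n.+1 -> V -> R) (h : V) : (forall j, test_function Omega (F j)) ->
  test_function Omega (\sum_j h 0 j *: F j).
Proof.
move=> tF; elim/big_ind : _ => [|f g tf tg|j _]; first exact: test_function0.
  by rewrite -[f]scale1r; exact: test_function_lin.
rewrite -[_ *: _]addr0; apply: test_function_lin => //; exact: test_function0.
Qed.

(** Differentiation under the integral sign; the derivative falls on the test function, so that
    nothing beyond L^2 is asked of [u]. *)
Lemma inner_line_derive Omega u phi psi (k : V) (t : R) : L2 leb setT u ->
  test_function Omega phi -> test_function Omega psi ->
  (forall (x : V) (t : R), is_derive t (1 : R) (fun s => phi (x + s *: k)) (psi (x + t *: k))) ->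
  is_derive t (1 : R) (fun s => inn u (fun x => phi (x + s *: k)))
    (inn u (fun x => psi (x + t *: k))).
Proof.
move=> Lu tphi tD dphi; have [mu _] := Lu.
have [M [r hM]] := test_function_bounded tD.
pose f (s : R) (x : V) := u x * phi (x + s *: k).
have M0 : 0 <= `|M| by [].
(* A ball of this radius contains the supports of all translates of [psi] with |s - t| < 1, which
   gives a dominating function independent of s. *)
pose r' := r + (`|t| + 1) * `|k|.
pose G (x : V) := `|u x| * (`|M| * \1_(ball (0 : V) r') x).
have df (s : R) (x : V) : is_derive s (1 : R) (f ^~ x) (u x * psi (x + s *: k)).
  by have dd := is_deriveZ (u x) (dphi x s); apply: (is_derive_eq dd).
have Lphi s : L2 leb setT (fun x : V => phi (x + s *: k)).
  by apply: L2_translation; exact: test_function_L2 tphi.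
have I1 (s : R) : leb.-integrable setT (EFin \o f s) by exact: L2_integrableM.
have LG : leb.-integrable setT (EFin \o G).
  have : L2 leb setT (fun x : V => `|u x|).
    split; first exact: measurableT_comp.
    rewrite (eq_integral (fun x => (u x ^+ 2)%:E)); first by case: Lu.
    by move=> x _; rewrite real_normK ?num_real.
  move/L2_integrableM; apply => //.
  apply: (@bounded_support_L2 _ _ _ `|M| r') => //.
    by apply: measurable_funM => //; apply: measurable_indic; exact: measurable_ball_rV.
  move=> x; rewrite ger0_norm// mulr_ge0//.
have Gub (s : R) (x : V) : s \in `]t - 1, t + 1[ -> `|u x * psi (x + s *: k)| <= G x.
  rewrite in_itv/= => /andP[s1 s2]; rewrite normrM ler_wpM2l//.
  apply: le_trans (hM _) _; rewrite !indicE.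
  have [/set_mem xb|_] := boolP (_ \in _); last by rewrite mulr0 mulr_ge0.
  rewrite mem_set ?mulr1 ?ler_norm//.
  move: xb; rewrite !mx_norm_ball /ball_ /= !sub0r !normrN => xb.
  have -> : x = (x + s *: k) - s *: k by rewrite addrK.
  apply: le_lt_trans (ler_normD _ _) _; rewrite /r'; apply: ltr_leD => //.
  rewrite normrN normrZ ler_wpM2r//.
  have : s <= `|t| + 1 by have := ler_norm t; lra.
  have : - s <= `|t| + 1 by have := ler_norm (- t); rewrite normrN; lra.
  by rewrite ler_norml => ? ?; apply/andP; split; lra.
have It : [set` `]t - 1, t + 1[] t by rewrite /= in_itv/=; apply/andP; split; lra.
have I1' (s : R) : [set` `]t - 1, t + 1[] s -> leb.-integrable setT (EFin \o f s) by [].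
have df1 (s : R) (x : V) : [set` `]t - 1, t + 1[] s -> setT x -> derivable (f ^~ x) s 1.
  by move=> _ _; have [] := df s x.
have G0 (x : V) : 0 <= G x by rewrite mulr_ge0// mulr_ge0.
have Gub' (s : R) (x : V) : [set` `]t - 1, t + 1[] s -> setT x -> `|partial1of2 f s x| <= G x.
  move=> Is _; rewrite partial1of2E; have [_ ->] := df s x.
  exact: Gub.
apply: DeriveDef.
  exact: (@derivable_under_integral _ _ _ leb f setT measurableT t _ _ It I1' df1 G G0 LG Gub').
rewrite -derive1E.
have -> := @differentiation_under_integral _ _ _ leb f setT measurableT t _ _ It I1' df1 G G0 LG Gub'.
by apply: eq_Rintegral => x _; rewrite partial1of2E; have [_ ->] := df t x.
Qed.

Lemma inner_suml (I : Type) (r : seq I) (c : I -> R) (F : I -> V -> R) v :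
  (forall i, L2 leb setT (F i)) -> L2 leb setT v ->
  inn (\sum_(i <- r) c i *: F i) v = \sum_(i <- r) c i * inn (F i) v.
Proof.
move=> LF Lv; elim: r => [|i r ih]; first by rewrite !big_nil (semi_inner0l hL hs).
rewrite !big_cons; have [bl _ _] := hs; rewrite bl ?ih//; first exact: LF.
by apply: (lin_closed_sum _ hL) => j _; exact: (lin_closedZ _ hL (LF j)).
Qed.

(** By duality it suffices to pair the increment with a test function [phi] on [A]. Moving the
    translation to [phi] turns the pairing into F(1) - F(0), where F(s) pairs [u] with [phi] shifted
    by s h; integrating by parts, F'(s) pairs the derivative of [u] along h with that shift. The
    mean value theorem leaves a single s, and Cauchy-Schwarz on [B], which contains the shifted
    support, gives the constant 1. *)
Theorem difference_estimate Omega A B u g h : open A -> measurable B ->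
  L2 leb setT u -> (forall j, L2 leb setT (g j)) -> weak_grad Omega u g ->
  B `<=` Omega -> (forall x (t : R), A x -> 0 <= t <= 1 -> B (x + t *: h)) ->
  (qint A (fun x => u (x + h) - u x)%R <= qint B (\sum_j h 0 j *: g j)%R)%E.
Proof.
move=> oA mB Lu Lg wg BO seg.
pose w : V -> R := \sum_j h 0 j *: g j.
have Lw : L2 leb setT w by apply: (lin_closed_sum _ hL) => j _; exact: (lin_closedZ _ hL (Lg j)).
have [mw w2] := Lw; have [mu u2] := Lu.
pose wB : V -> R := w \_ B.
have LwB : L2 leb setT wB.
  split; first by apply/(measurable_restrictT _ mB); exact: measurable_funTS.
  by rewrite -[X in (X < _)%E]qint_mkcond; apply: le_lt_trans w2; exact: qint_subset.
have qE : qint B w = (L2norm leb setT wB ^+ 2)%:E.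
  by rewrite sqr_L2norm// -[RHS]qint_mkcond.
rewrite -/w qE.
pose uh : V -> R := fun x => u (x + h).
have Luh : L2 leb setT uh by exact: L2_translation.
have -> : (fun x => u (x + h) - u x) = uh - u by [].
apply: test_dual => //; first exact: (@lin_closedB _ _ _ uh u hL Luh Lu).
  by rewrite sqr_ge0.
move=> phi lt; have [tphi dphi] := lt.
have Lphi D : measurable D -> L2 leb D phi by move=> mD; exact: test_function_L2 tphi.
pose F (s : R) := inn u (fun x => phi (x + s *: - h)).
have tD : test_function A (dirder (- h) phi).
  by apply: test_sum => j; exact: test_function_pderiv.
have dF (s : R) : is_derive s (1 : R) F (- inn u (fun x => dirder h phi (x + s *: - h))).
  have dphi' x t : is_derive t (1 : R) (fun s => phi (x + s *: - h)) (dirder (- h) phi (x + t *: - h)).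
    by rewrite dirderE; exact: dphi.
  apply: (is_derive_eq (inner_line_derive s Lu tphi tD dphi')).
  rewrite -[RHS]mulN1r /L2inner -RintegralZl//.
    apply: eq_Rintegral => x _; rewrite !dirderE mulrA mulN1r mulNr -mulrN -sumrN; congr (_ * _).
    by apply: eq_bigr => j _; rewrite mxE mulNr.
  apply: L2_integrableM => //; apply: L2_translation.
  apply: (test_function_L2 (A := A)) => //; apply: test_sum => j; exact: test_function_pderiv.
have E : inn (uh - u) phi = F 1 - F 0.
  rewrite (semi_innerBl hs)//; last exact: Lphi; congr (_ - _).
    transitivity (\int[leb]_x (u x * phi (x - h))); last first.
      by apply: eq_Rintegral => x _; rewrite scale1r.
    rewrite -(@Rintegral_translation R n (fun x => u x * phi (x - h)) h).
      by apply: eq_Rintegral => x _; rewrite addrK.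
    by apply: measurable_funM => //; apply: measurable_translation; exact: test_function_measurable tphi.
  by rewrite /F; apply: eq_Rintegral => x _; rewrite scale0r addr0.
have bound (s : R) : 0 <= s <= 1 ->
    (inn u (fun x => dirder h phi (x + s *: - h))) ^+ 2 <=
    L2norm leb setT wB ^+ 2 * inn phi phi.
  move=> s01.
  pose psi : V -> R := fun x => phi (x + s *: - h).
  have lpsi : line_test Omega psi.
    apply: (@line_test_translation _ _ A) => // x Ax; apply: BO.
    by have := seg _ s Ax s01; rewrite scalerN subrK.
  have [tpsi _] := lpsi.
  have Lpsi : L2 leb setT psi by apply: L2_translation; exact: Lphi.
  have -> : (fun x => dirder h phi (x + s *: - h)) = \sum_j h 0 j *: pderiv j psi.
    apply/funext => x; rewrite dirderE fct_sumE; apply: eq_bigr => j _.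
    by rewrite /psi pderiv_translation//; case: tphi.
  have -> : inn u (\sum_j h 0 j *: pderiv j psi) = - inn w psi.
    have Lpp j : L2 leb setT (pderiv j psi).
      by apply: (test_function_L2 (A := Omega)) => //; exact: test_function_pderiv.
    rewrite (semi_innerC hs)//; last first.
      by apply: (lin_closed_sum _ hL) => j _; exact: (lin_closedZ _ hL (Lpp j)).
    rewrite inner_suml// /w inner_suml// -sumrN; apply: eq_bigr => j _.
    by rewrite (semi_innerC hs (Lpp j) Lu) wg// mulrN.
  have -> : inn w psi = inn wB psi.
    apply: eq_Rintegral => x _; rewrite /wB patchE; case: ifPn => // /negP xB.
    have [_ [K [_ KA hK]]] := tphi.
    rewrite /psi hK ?mulr0// => /KA Ax; apply: xB; rewrite inE.
    by have := seg _ s Ax s01; rewrite scalerN subrK.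
  rewrite sqrrN L2normE (sqr_snorm hs)//.
  have -> : inn phi phi = inn psi psi.
    apply/esym; apply: (@Rintegral_translation R n (fun x => phi x * phi x)).
    by apply: measurable_funM; exact: test_function_measurable tphi.
  exact: (semi_inner_cs hL hs).
have [c c01 Fc] : exists2 c, c \in `[0, 1]%R &
    F 1 - F 0 = - inn u (fun x => dirder h phi (x + c *: - h)) * (1 - 0).
  apply: MVT_segment => //; apply: continuous_subspaceT => s.
  have [d _] := dF s; apply: differentiable_continuous; exact/derivable1_diffP.
rewrite E Fc subr0 mulr1 sqrrN; apply: bound.
by move: c01; rewrite in_itv.
Qed.

End difference_estimate.

Section weak_gradient.
Context {R : realType} (n : nat).
Local Notation V := 'rV[R]_n.+1.
Local Notation leb := (lebesgue_rV n.+1).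
Local Notation inn := (L2inner leb setT).
Implicit Types (u : V -> R) (g : 'I_n.+1 -> V -> R) (A B Omega : set V) (h : V).

Let hL := @L2_closed R _ _ (lebesgue_rV n.+1) _ measurableT.
Let hs := @L2inner_semi R _ _ (lebesgue_rV n.+1) _ measurableT.

Lemma weak_grad_sub A Omega u g : A `<=` Omega -> weak_grad Omega u g -> weak_grad A u g.
Proof.
move=> AO wg j phi [sf [K [cK KA hK]]]; apply: wg; split => //.
by exists K; split => //; exact: subset_trans AO.
Qed.

Lemma test_function_translation A B phi (h : V) : (forall x, A (x + h) -> B x) ->
  test_function A phi -> test_function B (fun x => phi (x + h)).
Proof.
move=> AB [sf [K [cK KA hK]]]; split; first exact: smooth_translation.
exists ((fun x : V => x + - h) @` K); split.
- apply: continuous_compact => //; apply: continuous_subspaceT.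
  exact: continuous_shift_rV.
- by move=> _ [x Kx <-]; apply: AB; rewrite subrK; exact: KA.
- move=> x Kx; apply: hK => Kxh; apply: Kx.
  by exists (x + h) => //; rewrite addrK.
Qed.

Lemma L2inner_translation u v h : measurable_fun setT u -> measurable_fun setT v ->
  inn (fun x => u (x + h)) v = inn u (fun x => v (x - h)).
Proof.
move=> mu mv; rewrite /L2inner -[RHS](@Rintegral_translation R n _ h).
  by apply: eq_Rintegral => x _; rewrite addrK.
by apply: measurable_funM => //; exact: measurable_translation.
Qed.

Lemma weak_grad_translation A Omega u g h : L2 leb setT u -> (forall j, L2 leb setT (g j)) ->
  weak_grad Omega u g -> (forall x, A x -> Omega (x + h)) ->
  weak_grad A (fun x => u (x + h)) (fun j x => g j (x + h)).
Proof.
move=> [mu _] Lg wg AO j phi tphi.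
have tpsi : test_function Omega (fun x => phi (x - h)).
  by apply: (test_function_translation _ tphi) => x /AO; rewrite subrK.
rewrite L2inner_translation//; last first.
  by apply: (test_function_measurable (A := A)); exact: test_function_pderiv.
rewrite L2inner_translation//; [|by case: (Lg j)|exact: test_function_measurable tphi].
have [sphi _] := tphi; rewrite -(pderiv_translation (- h) j sphi); exact: wg.
Qed.

Lemma weak_grad_lin A (c : R) u v g k : L2 leb setT u -> L2 leb setT v ->
  (forall j, L2 leb setT (g j)) -> (forall j, L2 leb setT (k j)) ->
  weak_grad A u g -> weak_grad A v k ->
  weak_grad A (c *: u + v) (fun j => c *: g j + k j).
Proof.
move=> Lu Lv Lg Lk wg wk j phi tphi; have [bl _ _] := hs.
have Lphi : L2 leb setT phi by exact: test_function_L2 tphi.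
have Ldphi : L2 leb setT (pderiv j phi).
  by apply: (test_function_L2 (A := A)) => //; exact: test_function_pderiv.
rewrite (bl c u v _ Lu Lv Ldphi) (bl c _ _ _ (Lg j) (Lk j) Lphi) wg// wk//; ring.
Qed.

Lemma derive_norm_le (F : R -> R) (D N t0 : R) : is_derive (0 : R) (1 : R) F D -> 0 < t0 ->
  (forall t, 0 < t < t0 -> `|F t - F 0| <= t * N) -> `|D| <= N.
Proof.
move=> [dF eD] t00 hF; rewrite leNgt; apply/negP => ND.
have e0 : 0 < `|D| - N by rewrite subr_gt0.
move: dF; rewrite /derivable => /cvgrPdist_lt/(_ _ e0).
rewrite -/(derive F 0 1) eD => -[/= d d0 hd].
pose t := Num.min d t0 / 2.
have m0 : 0 < Num.min d t0 by rewrite lt_min d0.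
have t_gt0 : 0 < t by rewrite divr_gt0.
have tm : t < Num.min d t0 by rewrite /t ltr_pdivrMr// ltr_pMr// ltr1n.
have [td tt0] : t < d /\ t < t0 by move: tm; rewrite lt_min => /andP.
have := hd t; rewrite /ball /= sub0r normrN (gtr0_norm t_gt0) => /(_ td (lt0r_neq0 t_gt0)).
rewrite addr0 /GRing.scale/= mulr1 => h.
have : `|t^-1 * (F t - F 0)| <= N.
  rewrite normrM normfV (gtr0_norm t_gt0) ler_pdivrMl//; apply: hF.
  by rewrite t_gt0.
move: h; set q := _ * _ => h qN.
have : `|D| <= `|D - q| + `|q| by rewrite -[in leLHS](subrK q D) ler_normD.
by move: h qN; rewrite ltrBrDr; lra.
Qed.

(* Lower semicontinuity: uniformly bounded difference quotients bound the weak derivative. *)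
Lemma weak_grad_lsc A Omega u g i (c t0 : R) : open A -> A `<=` Omega ->
  L2 leb setT u -> (forall j, L2 leb setT (g j)) -> weak_grad Omega u g -> 0 < t0 -> 0 <= c ->
  (forall t, 0 < t < t0 ->
    (qint A (fun x => u (x + t *: delta_mx 0 i) - u x)%R <= (t ^+ 2 * c)%:E)%E) ->
  (qint A (g i) <= c%:E)%E.
Proof.
move=> oA AO Lu Lg wg t00 c0 hq; apply: test_dual => // phi lt.
have [tphi dphi] := lt; pose e : V := delta_mx 0 i.
have mA := open_measurable_rV oA.
have tO : test_function Omega phi by case: (line_test_sub AO lt).
have tD : test_function A (- pderiv i phi).
  rewrite -scaleN1r -[_ *: _]addr0; apply: test_function_lin; last exact: test_function0.
  exact: test_function_pderiv.
(* The increments of F pair the increments of [u] with [phi], while its derivative at 0 pairs [g i]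
   with [phi]. *)
pose F (s : R) := inn u (fun x => phi (x + s *: - e)).
have dF (s : R) : is_derive s (1 : R) F (inn u (fun x => - pderiv i phi (x + s *: - e))).
  apply: (inner_line_derive s Lu tphi tD) => x t; apply: (is_derive_eq (dphi x (- e) t)).
  rewrite (bigD1 i)//= big1 ?addr0; last by move=> j /negbTE ji; rewrite !mxE eqxx ji mulr0n oppr0 mul0r.
  by rewrite !mxE !eqxx mulN1r.
have Lphi : L2 leb setT phi by exact: test_function_L2 tphi.
have Lpd : L2 leb setT (pderiv i phi).
  by apply: (test_function_L2 (A := A)) => //; exact: test_function_pderiv.
have dF0 : inn u (fun x => - pderiv i phi (x + 0 *: - e)) = inn (g i) phi.
  rewrite -[RHS]opprK -wg// -[RHS]mulN1r /L2inner -RintegralZl//; last exact: L2_integrableM.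
  by apply: eq_Rintegral => x _; rewrite scale0r addr0 mulrN mulN1r.
pose N := Num.sqrt (c * inn phi phi).
have bd (t : R) : 0 < t < t0 -> `|F t - F 0| <= t * N.
  move=> t0t; have [t_gt0 _] := andP t0t.
  pose ut : V -> R := fun x => u (x + t *: e).
  have Lut : L2 leb setT ut by exact: L2_translation.
  have -> : F t - F 0 = inn (ut - u) phi.
    rewrite (semi_innerBl hs Lut Lu Lphi); congr (_ - _).
      rewrite /ut (@L2inner_translation u phi (t *: e)); [|by case: Lu|by case: Lphi].
      by apply: eq_Rintegral => x _; rewrite scalerN.
    by apply: eq_Rintegral => x _; rewrite scale0r addr0.
  have Lw : L2 leb setT (ut - u) by exact: (@lin_closedB _ _ _ ut u hL Lut Lu).
  pose w : V -> R := (ut - u) \_ A.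
  have Lwr : L2 leb setT w.
    split; first by apply/(measurable_restrictT _ mA); apply: measurable_funTS; case: Lw.
    rewrite -[X in (X < _)%E]qint_mkcond; case: Lw => mw; apply: le_lt_trans; exact: qint_subset.
  have -> : inn (ut - u) phi = inn w phi.
    apply: eq_Rintegral => x _; rewrite /w patchE; case: ifPn => // /negP xA.
    have [_ [K [_ KA hK]]] := tphi.
    by rewrite hK ?mulr0// => /KA Ax; apply: xA; rewrite inE.
  apply: le_trans (semi_inner_le hL hs Lwr Lphi) _.
  have -> : t * N = Num.sqrt (t ^+ 2 * c) * snorm inn phi.
    rewrite /N /snorm [in RHS]sqrtrM ?sqr_ge0// sqrtr_sqr ger0_norm ?(ltW t_gt0)//.
    by rewrite -mulrA sqrtrM.
  rewrite ler_wpM2r ?snorm_ge0// /snorm ler_sqrt; last by rewrite mulr_ge0 ?sqr_ge0.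
  rewrite -lee_fin -(sqr_snorm hs Lwr) -L2normE sqr_L2norm// -[X in (X <= _)%E]qint_mkcond.
  exact: hq.
have : `|inn (g i) phi| <= N.
  have h0 : is_derive (0 : R) (1 : R) F (inn (g i) phi) by rewrite -dF0.
  exact: (derive_norm_le h0 t00 bd).
move=> h; rewrite -[_ ^+ 2]real_normK ?num_real//.
rewrite -[c * _]sqr_sqrtr ?lerXn2r ?nnegrE ?sqrtr_ge0//.
by rewrite mulr_ge0// (semi_inner_ge0 hs).
Qed.

End weak_gradient.

Lemma sum_linE (R : realType) (I : finType) (f a b : I -> R) (c : R) :
  (forall i, f i = c * a i + b i) -> \sum_i f i = c * \sum_i a i + \sum_i b i.
Proof. by move=> h; rewrite mulr_sumr -big_split; apply: eq_bigr => i _; exact: h. Qed.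

Lemma sum_eqE (R : realType) (I : finType) (f a : I -> R) :
  (forall i, f i = a i) -> \sum_i f i = \sum_i a i.
Proof. by move=> h; apply: eq_bigr => i _; exact: h. Qed.

(** * Calculus of weak derivatives in H^1 *)

Section H1_calculus.
Context {R : realType} (n : nat).
Local Notation V := 'rV[R]_n.+1.
Local Notation leb := (lebesgue_rV n.+1).
Variable Omega : set V.
Hypothesis oO : open Omega.
Implicit Types (u v : V -> R) (w : V -> V).

Let mO : measurable Omega. Proof. exact: open_measurable_rV. Qed.
Let hL := @L2_closed R _ _ (lebesgue_rV n.+1) _ mO.
Let hs := @L2inner_semi R _ _ (lebesgue_rV n.+1) _ mO.
Local Notation innO := (L2inner leb Omega).

Lemma wderP i u : H1 Omega u -> L2 leb Omega (wder Omega i u) /\ weak_pderiv Omega i u (wder Omega i u).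
Proof.
move=> [_ /(_ i) [g hg]]; rewrite /wder.
by apply: (@xgetPex _ _ [set g | L2 leb Omega g /\ weak_pderiv Omega i u g]); exists g.
Qed.

(* Keeps unification from unfolding the choice of a weak derivative. *)
#[local] Opaque wder.

Lemma L2_restrict f : L2 leb Omega f -> L2 leb setT (f \_ Omega : V -> R).
Proof.
move=> [mf f2]; split; first by apply/(measurable_restrictT _ mO).
by rewrite -[X in (X < _)%E]qint_mkcond.
Qed.

Lemma L2inner_restrict f v : L2inner leb setT (f \_ Omega) v = innO f v.
Proof.
rewrite /L2inner [RHS]Rintegral_mkcond; apply: eq_Rintegral => x _.
by rewrite !patchE; case: ifP => // _; rewrite mul0r.
Qed.

Lemma test_L2 A phi : test_function A phi -> L2 leb Omega phi.
Proof. exact: test_function_L2. Qed.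

(** The fundamental lemma of the calculus of variations, as [test_dual] with constant 0. *)
Lemma test_null_aeq g : L2 leb Omega g ->
  (forall phi, line_test Omega phi -> innO g phi = 0) -> aeq leb Omega g (cst 0).
Proof.
move=> Lg g0; apply: L2norm0_aeq => //.
apply/eqP; rewrite -sqrf_eq0 -eqe sqr_L2norm// eq_le integral_ge0 ?andbT; last first.
  by move=> x _; rewrite lee_fin sqr_ge0.
have := @test_dual R n Omega (g \_ Omega) 0 oO (L2_restrict Lg) (lexx 0).
have -> : qint Omega (g \_ Omega) = qint Omega g.
  by apply: eq_integral => x xO; rewrite patchE xO.
apply => phi lt.
by rewrite L2inner_restrict g0// expr0n mul0r.
Qed.

Lemma wder_unique i u g1 g2 : L2 leb Omega g1 -> L2 leb Omega g2 ->
  weak_pderiv Omega i u g1 -> weak_pderiv Omega i u g2 -> aeq leb Omega g1 g2.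
Proof.
move=> L1 L2' w1 w2.
have : aeq leb Omega (g1 - g2) (cst 0).
  apply: test_null_aeq; first exact: (@lin_closedB _ _ _ g1 g2 hL).
  move=> phi [tphi _]; rewrite (semi_innerBl hs L1 L2' (test_L2 tphi)).
  have := w1 _ tphi; rewrite w2// => /oppr_inj e.
  by rewrite /L2inner e subrr.
by apply: filterS => x h Ox; apply/eqP; rewrite -subr_eq0; apply/eqP; exact: h.
Qed.

Lemma weak_pderiv_lin i (c : R) u v g k : L2 leb Omega u -> L2 leb Omega v ->
  L2 leb Omega g -> L2 leb Omega k -> weak_pderiv Omega i u g -> weak_pderiv Omega i v k ->
  weak_pderiv Omega i (c *: u + v) (c *: g + k).
Proof.
move=> Lu Lv Lg Lk wg wk phi tphi; have [bl _ _] := hs.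
have Ld := test_L2 (test_function_pderiv i tphi).
have := bl c u v _ Lu Lv Ld; rewrite /L2inner => ->.
have := bl c g k _ Lg Lk (test_L2 tphi); rewrite /L2inner => ->.
by rewrite wg// wk//; ring.
Qed.

Lemma H1_lin (c : R) u v : H1 Omega u -> H1 Omega v -> H1 Omega (c *: u + v).
Proof.
move=> Hu Hv; have [Lu _] := Hu; have [Lv _] := Hv; split; first exact: L2_lin.
move=> i; have [L1 w1] := wderP i Hu; have [L2' w2] := wderP i Hv.
exists (c *: wder Omega i u + wder Omega i v); split; first exact: L2_lin.
exact: weak_pderiv_lin.
Qed.

Lemma H1_0 : H1 Omega (0 : V -> R).
Proof.
split; first exact: L20.
move=> i; exists 0; split; first exact: L20.
move=> phi tphi; rewrite /Rintegral; have z (f : V -> R) : (\int[leb]_(x in Omega) (((0 : V -> R) x * f x)%:E) = 0)%E.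
  by rewrite (eq_integral (cst 0%E)) ?integral0// => x _; rewrite mul0r.
by rewrite !z oppr0.
Qed.

Lemma H1_closed : lin_closed [set u | H1 Omega u].
Proof. by split; [exact: H1_0|exact: H1_lin]. Qed.

(** The weak derivative of each function is chosen separately, so linearity comes from uniqueness
    and holds almost everywhere. *)
Lemma wder_lin i (c : R) u v : H1 Omega u -> H1 Omega v ->
  aeq leb Omega (wder Omega i (c *: u + v)) (c *: wder Omega i u + wder Omega i v).
Proof.
move=> Hu Hv; have [Lu _] := Hu; have [Lv _] := Hv.
have [L1 w1] := wderP i Hu; have [L2' w2] := wderP i Hv.
have [L3 w3] := wderP i (H1_lin c Hu Hv).
apply: (wder_unique L3 _ w3); first exact: L2_lin.
exact: weak_pderiv_lin.
Qed.

Lemma wder_aeq i u v : H1 Omega u -> H1 Omega v -> aeq leb Omega u v ->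
  aeq leb Omega (wder Omega i u) (wder Omega i v).
Proof.
move=> Hu Hv uv; have [Lu _] := Hu; have [Lv _] := Hv.
have [L1 w1] := wderP i Hu; have [L2' w2] := wderP i Hv.
apply: (wder_unique L1 L2' w1) => phi tphi; rewrite -w2//.
exact: (aeq_L2inner mO Lu Lv (test_L2 (test_function_pderiv i tphi)) uv).
Qed.

Definition H1inner u v : R :=
  innO u v + \sum_i innO (wder Omega i u) (wder Omega i v).

Lemma L2_wder i u : H1 Omega u -> L2 leb Omega (wder Omega i u).
Proof. by move=> /(wderP i)[]. Qed.

Lemma H1_L2 u : H1 Omega u -> L2 leb Omega u. Proof. by case. Qed.

Lemma innO_wder_lin i (c : R) u v f : H1 Omega u -> H1 Omega v -> L2 leb Omega f ->
  innO (wder Omega i (c *: u + v)) f = c * innO (wder Omega i u) f + innO (wder Omega i v) f.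
Proof.
move=> Hu Hv Lf; have [bl _ _] := hs.
rewrite (aeq_L2inner mO _ _ Lf (wder_lin i c Hu Hv)); last 2 first.
- by apply: L2_wder; exact: H1_lin.
- by apply: L2_lin => //; exact: L2_wder.
by apply: bl => //; exact: L2_wder.
Qed.

Lemma H1inner_semi : semi_inner [set u | H1 Omega u] H1inner.
Proof.
have [bl bs bp] := hs; split.
- move=> c u v w Hu Hv Hw; rewrite /H1inner (bl c u v w (H1_L2 Hu) (H1_L2 Hv) (H1_L2 Hw)).
  have E i := innO_wder_lin i c Hu Hv (L2_wder i Hw).
  rewrite [X in _ + X = _](sum_linE E).
  by rewrite mulrDr !addrA; congr (_ + _); rewrite addrAC.
- move=> u v Hu Hv; rewrite /H1inner (bs u v (H1_L2 Hu) (H1_L2 Hv)).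
  have E i := bs _ _ (L2_wder i Hu) (L2_wder i Hv).
  by rewrite [X in _ + X = _](sum_eqE E).
- move=> u Hu; rewrite /H1inner addr_ge0//; first exact: (bp u (H1_L2 Hu)).
  by apply: sumr_ge0 => i _; apply: bp; exact: L2_wder.
Qed.

Lemma H1normE u : H1 Omega u -> H1norm Omega u = snorm H1inner u.
Proof.
move=> Hu; rewrite /H1norm /snorm /H1inner L2normE (sqr_snorm hs (H1_L2 Hu)).
congr (Num.sqrt (_ + _)); apply: eq_bigr => i _.
by rewrite L2normE (sqr_snorm hs (L2_wder i Hu)).
Qed.

Lemma sqr_H1norm u : H1 Omega u -> H1norm Omega u ^+ 2 =
  L2norm leb Omega u ^+ 2 + \sum_i L2norm leb Omega (wder Omega i u) ^+ 2.
Proof.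
move=> Hu; rewrite /H1norm sqr_sqrtr// addr_ge0 ?sqr_ge0//.
by apply: sumr_ge0 => i _; rewrite sqr_ge0.
Qed.

Lemma aeq_H1inner u1 u2 v : H1 Omega u1 -> H1 Omega u2 -> H1 Omega v ->
  aeq leb Omega u1 u2 -> H1inner u1 v = H1inner u2 v.
Proof.
move=> H1u H2u Hv uu; rewrite /H1inner.
rewrite (aeq_L2inner mO (H1_L2 H1u) (H1_L2 H2u) (H1_L2 Hv) uu).
have E i := aeq_L2inner mO (L2_wder i H1u) (L2_wder i H2u) (L2_wder i Hv) (wder_aeq i H1u H2u uu).
by rewrite [X in _ + X = _](sum_eqE E).
Qed.

Lemma H1norm0_aeq u : H1 Omega u -> H1norm Omega u = 0 -> aeq leb Omega u 0.
Proof.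
move=> Hu u0; apply: L2norm0_aeq => //; first exact: H1_L2.
apply/eqP; rewrite -sqrf_eq0 eq_le sqr_ge0 andbT.
have s0 : 0 <= \sum_i L2norm leb Omega (wder Omega i u) ^+ 2.
  by apply: sumr_ge0 => i _; rewrite sqr_ge0.
by have := sqr_H1norm Hu; rewrite u0 expr0n /=; move: s0; lra.
Qed.

Lemma aeq0_H1norm u : H1 Omega u -> aeq leb Omega u 0 -> H1norm Omega u = 0.
Proof.
move=> Hu u0; rewrite H1normE// /snorm (aeq_H1inner Hu H1_0 Hu u0).
by rewrite (semi_inner0l H1_closed H1inner_semi)// sqrtr0.
Qed.

End H1_calculus.

(** * The Poincare inequality *)

Section compact_patching.
Context {R : realType} (n : nat).
Local Notation V := 'rV[R]_n.+1.

(** Passage from local to global by a finite subcover, shared by the Poincare and Korn inequalities: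
    there [K] is the closure of [Om], so boundary points need a neighbourhood too. *)
Lemma compact_patch (K Om : set V) (Pr : set V -> Prop) : compact K -> Pr set0 ->
  (forall A B, Pr A -> Pr B -> Pr (A `|` B)) ->
  (forall x, K x -> exists r, 0 < r /\ Pr (Om `&` ball x r)) ->
  exists X, Pr X /\ K `&` Om `<=` X.
Proof.
move=> cK P0 PU hP.
have /choice[r hr] : forall x, exists r, K x -> 0 < r /\ Pr (Om `&` ball x r).
  by move=> x; have [/hP[r ?]|Kx] := pselect (K x); [exists r|exists 1].
move: cK; rewrite compact_cover => /(_ V K (fun x => ball x (r x)))[].
- by move=> x Kx; exact: ball_open.
- by move=> x Kx; exists x => //; apply: ballxx; exact: (hr x Kx).1.
move=> D DK cov.
exists (\big[setU/set0]_(x <- finmap.enum_fset D) (Om `&` ball x (r x))); split.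
  rewrite big_seq; elim/big_ind : _ => // x xD.
  by have /set_mem Kx := DK _ xD; exact: (hr x Kx).2.
move=> y [Ky Oy]; have [x /= xD xy] := cov y Ky.
by rewrite -bigcup_seq; exists x.
Qed.

End compact_patching.

Section poincare.
Context {R : realType} (n : nat).
Local Notation V := 'rV[R]_n.+1.
Local Notation leb := (lebesgue_rV n.+1).
Local Notation N := (n.+1%:R : R).
Implicit Types (u : V -> R) (g : 'I_n.+1 -> V -> R) (A B X Omega : set V) (h : V).

Lemma sqr_sum_le (I : finType) (a : I -> R) :
  (\sum_i a i) ^+ 2 <= #|I|%:R * \sum_i a i ^+ 2.
Proof.
rewrite expr2 big_distrlr /=.
apply: (@le_trans _ _ (\sum_i \sum_j (2^-1 * a i ^+ 2 + 2^-1 * a j ^+ 2))).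
  apply: ler_sum => i _; apply: ler_sum => j _.
  by have := sqr_ge0 (a i - a j); nra.
pose S := \sum_j a j ^+ 2.
have E i : \sum_j (2^-1 * a i ^+ 2 + 2^-1 * a j ^+ 2) = (#|I|%:R * 2^-1) * a i ^+ 2 + 2^-1 * S.
  by rewrite big_split/= sumr_const -mulr_sumr -mulr_natl -/S; ring.
rewrite (eq_bigr _ (fun i _ => E i)) big_split/= -mulr_sumr sumr_const -mulr_natl -/S.
by rewrite [X in X + _](_ : _ = 2^-1 * (#|I|%:R * S)); [lra|ring].
Qed.

Lemma qint_sum_le (I : finType) A f (h : V -> R) (F : I -> V -> R) (a : I -> R) :
  f = h -> measurable A -> measurable_fun A h -> (forall j, measurable_fun A (F j)) ->
  (forall j, 0 <= a j) -> (forall x, A x -> h x ^+ 2 <= \sum_j a j * F j x ^+ 2) ->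
  (qint A f <= \sum_j (a j)%:E * qint A (F j))%E.
Proof.
move=> -> mA mh mF a0 hF.
have mF2 j := measurable_sqrE (mF j).
have E j : ((a j)%:E * qint A (F j) = \int[leb]_(x in A) ((a j)%:E * ((F j x) ^+ 2)%:E))%E.
  by rewrite /qint ge0_integralZl_EFin// => x _; rewrite lee_fin sqr_ge0.
rewrite (eq_bigr _ (fun j _ => E j)) -ge0_integral_sum//.
- apply: ge0_le_integral => //.
  + by move=> x _; rewrite lee_fin sqr_ge0.
  + exact: measurable_sqrE.
  + by apply: emeasurable_sum => j; exact: measurable_funeM.
  + move=> x Ax; apply: (@le_trans _ _ (\sum_j a j * F j x ^+ 2)%:E); first by rewrite lee_fin hF.
    by rewrite -sumEFin.
- by move=> j; exact: measurable_funeM.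
- by move=> j x _; rewrite -EFinM lee_fin mulr_ge0// sqr_ge0.
Qed.

Definition H1g Omega u g := [/\ L2 leb setT u, forall j, L2 leb setT (g j) & weak_grad Omega u g].

Definition Gq B g : \bar R := (\sum_j qint B (g j))%E.

Lemma Gq_ge0 B g : (0 <= Gq B g)%E.
Proof. by apply: sume_ge0 => j _; exact: qint_ge0. Qed.

Lemma norm_coord_le (h : V) j : `|h 0 j| <= `|h|.
Proof.
rewrite [leRHS]/Num.Def.normr/= mx_normrE.
exact: (le_bigmax _ (fun k : 'I_1 * 'I_n.+1 => `|h k.1 k.2|) (0, j)).
Qed.

Lemma translation_estimate Omega A B u g h : open A -> measurable B -> H1g Omega u g ->
  B `<=` Omega -> (forall x (t : R), A x -> 0 <= t <= 1 -> B (x + t *: h)) ->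
  (qint A (fun x => u (x + h) - u x)%R <= (N * `|h| ^+ 2)%:E * Gq B g)%E.
Proof.
move=> oA mB [Lu Lg wg] BO seg.
apply: (le_trans (difference_estimate oA mB Lu Lg wg BO seg)).
have c0 : 0 <= N * `|h| ^+ 2 by rewrite mulr_ge0// sqr_ge0.
rewrite /Gq ge0_sume_distrr; last by move=> j _; exact: qint_ge0.
have mg j : measurable_fun B (g j) by apply: measurable_funTS; case: (Lg j).
apply: qint_sum_le => //.
  elim/big_ind : _ => [|f k mf mk|j _]; first exact: measurable_cst.
    exact: measurable_funD.
  exact: measurable_funM.
move=> x Bx; rewrite fct_sumE; apply: le_trans (sqr_sum_le _) _.
rewrite card_ord mulr_sumr; apply: ler_sum => j _.
have -> : (h 0 j *: g j) x = h 0 j * g j x by [].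
rewrite exprMn mulrA ler_wpM2r ?sqr_ge0// ler_wpM2l//.
by rewrite -[h 0 j ^+ 2]real_normK ?num_real// lerXn2r ?nnegrE// norm_coord_le.
Qed.

Lemma measurable_shift_pair : measurable_fun setT (fun p : V * V => (p.1 + p.2, p.1)).
Proof.
apply: measurable_fun_pair; first exact: measurable_addp_rV.
exact: measurable_fst.
Qed.

(** The substitution x = y + k: for fixed k, the inner integral becomes the square of an increment
    when [H] measures a difference between x and y, and translation estimates apply. *)
Lemma tonelli_shift (H : V -> V -> \bar R) :
  measurable_fun setT (fun p : V * V => H p.1 p.2) -> (forall x y, 0 <= H x y)%E ->
  (\int[leb]_y \int[leb]_x H x y = \int[leb]_k \int[leb]_y H (y + k)%R y)%E.
Proof.
move=> mH H0.
have mx y : measurable_fun setT (fun x => H x y).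
  by have := measurableT_comp mH (@pair2_measurable _ _ V V y).
transitivity (\int[leb]_y \int[leb]_k H (y + k)%R y)%E.
  apply: eq_integral => y _; rewrite -(@ge0_integral_translation R n.+1 y)//.
  by apply: eq_integral => k _; rewrite addrC.
apply: (fubini_tonelli (fun p : V * V => H (p.1 + p.2) p.1)) => //.
by have := measurableT_comp mH measurable_shift_pair.
Qed.

(** A function of mean at most M somewhere takes a value at most 2M, the factor 2 giving room for a
    strict inequality. *)
Lemma small_value (B : set V) (f : V -> \bar R) (M : R) : measurable B -> measurable_fun setT f ->
  (forall x, 0 <= f x)%E -> (0 < leb B)%E -> (leb B < +oo)%E -> 0 <= M ->
  (\int[leb]_(x in B) f x <= M%:E * leb B)%E -> exists2 y, B y & (f y <= (2 * M)%:E)%E.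
Proof.
move=> mB mf f0 B0 Boo M0 hf; apply: contrapT => hn.
have fM y : B y -> ((2 * M)%:E < f y)%E.
  by move=> By; rewrite ltNge; apply/negP => fy; apply: hn; exists y.
have fB : leb B \is a fin_num by rewrite ge0_fin_numE.
(* The factor 2 gives no room when M = 0; then f vanishes almost everywhere on [B], which has
   positive measure. *)
have [M00|Mn0] := eqVneq M 0.
  have If0 : (\int[leb]_(x in B) `|f x| = 0)%E.
    rewrite (eq_integral f); last by move=> x _; rewrite gee0_abs.
    by apply/eqP; rewrite eq_le integral_ge0// andbT; move: hf; rewrite M00 mul0e.
  have /(ae_eq_integral_abs leb mB (measurable_funTS mf))[Z [mZ Z0 hZ]] := If0.
  have : (leb B <= leb Z)%E.
    apply: le_measure; rewrite ?inE// => y By; apply: hZ => /(_ By) fy.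
    by have := fM y By; rewrite fy M00 mulr0 ltxx.
  by rewrite Z0 leNgt B0.
have {}M0 : 0 < M by rewrite lt_neqAle eq_sym Mn0.
have : ((2 * M)%:E * leb B <= M%:E * leb B)%E.
  apply: le_trans hf; rewrite -integral_cst//; apply: ge0_le_integral => //.
  - by move=> x _; rewrite lee_fin mulr_ge0// ltW.
  - exact: measurable_funTS.
  - by move=> x Bx; exact/ltW/fM.
rewrite -(fineK fB) -!EFinM lee_fin leNgt => /negP; apply.
have : 0 < fine (leb B) by rewrite fine_gt0// B0.
by move=> ?; nra.
Qed.

Lemma lebesgue_ball (x : V) r : 0 < r -> leb (ball x r) = ((2 * r) ^+ n.+1)%:E.
Proof.
move=> r0; rewrite -(lebesgue_rV_cube n.+1 r0) -!qint_indic; try exact: measurable_ball_rV.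
have mI : measurable_fun setT (\1_(ball x r) : V -> R).
  by apply: measurable_indic; exact: measurable_ball_rV.
have E := @qint_translation R n (\1_(ball x r)) setT setT x measurableT measurableT (fun=> iff_refl _) mI.
apply: etrans (esym E) _.
apply: eq_integral => y _; congr (EFin (_ ^+ 2)); rewrite !indicE; congr (_%:R).
apply: (congr1 nat_of_bool); apply/idP/idP; rewrite !inE !mx_norm_ball /ball_ /=.
  by rewrite opprD addrCA subrr addr0 sub0r.
by rewrite opprD addrCA subrr addr0 sub0r.
Qed.

Lemma ball0P (k : V) r : ball (0 : V) r k <-> `|k| < r.
Proof. by rewrite mx_norm_ball /ball_ /= sub0r normrN. Qed.

(** The constant is the value u(y) at a well-chosen point of the ball: the mean over y of the
    integral of |u(x) - u(y)|^2 is an integral over shifts k = x - y with |k| < 2r, each bounded by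
    [translation_estimate]. The segments used stay within r + 2r of [x0]. *)
Lemma mean_oscillation Omega (x0 : V) r : open Omega -> 0 < r -> ball x0 (3 * r) `<=` Omega ->
  exists2 K, 0 <= K & forall u g, H1g Omega u g ->
  exists c, (qint (ball x0 r) (fun x => u x - c)%R <= K%:E * Gq Omega g)%E.
Proof.
move=> oO r0 bO; set B : set V := ball x0 r.
have mB : measurable B by exact: measurable_ball_rV.
have mO := open_measurable_rV oO.
(* The bracket is the factor in [translation_estimate] for a shift of length 2r; the power of 2 is
   the ratio of the volume of the ball of shifts to that of [B]. *)
pose M0 : R := 2 ^+ n.+1 * (N * (2 * r) ^+ 2).
have M00 : 0 <= M0 by rewrite !mulr_ge0 ?exprn_ge0 ?ltW// ltW.
exists (2 * M0); first by rewrite mulr_ge0.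
move=> u g Hug; have [Lu Lg wg] := Hug; have [mu _] := Lu.
have Gfin : Gq Omega g \is a fin_num.
  rewrite sum_fin_num; apply/allP => /= _ /mapP[j _ ->].
  rewrite ge0_fin_numE ?qint_ge0//; have [mg g2] := Lg j.
  by apply: le_lt_trans g2; exact: qint_subset.
pose H (x y : V) : \bar R := ((\1_B x * (\1_B y * (u x - u y))) ^+ 2)%:E.
have mI : measurable_fun setT (\1_B : V -> R) by exact: measurable_indic.
have mH : measurable_fun setT (fun p : V * V => H p.1 p.2).
  apply/measurable_EFinP; apply: measurable_funX; apply: measurable_funM.
    exact: (measurableT_comp mI measurable_fst).
  apply: measurable_funM; first exact: (measurableT_comp mI measurable_snd).
  apply: measurable_funB; first exact: (measurableT_comp mu measurable_fst).
  exact: (measurableT_comp mu measurable_snd).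
have H0 x y : (0 <= H x y)%E by rewrite lee_fin sqr_ge0.
pose Phi (y : V) := (\int[leb]_x H x y)%E.
have mPhi : measurable_fun setT Phi.
  have := @measurable_fun_fubini_tonelli_G _ _ _ _ R leb
      (fun p : V * V => H p.1 p.2) mH (fun p => H0 p.1 p.2).
  exact.
have lebB : leb B = ((2 * r) ^+ n.+1)%:E by exact: lebesgue_ball.
have IPhi : (\int[leb]_(y in B) Phi y <= (M0 * fine (Gq Omega g))%:E * leb B)%E.
  apply: (@le_trans _ _ (\int[leb]_y Phi y)%E).
    by apply: ge0_subset_integral => // y _; exact: integral_ge0.
  rewrite tonelli_shift//.
  have -> : ((M0 * fine (Gq Omega g))%:E * leb B =
      \int[leb]_(k in ball (0%R : V) (2 * r)%R) (N * (2 * r) ^+ 2 * fine (Gq Omega g))%:E)%E.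
    rewrite integral_cst; last exact: measurable_ball_rV.
    rewrite [X in (_ * X)%E = _]lebB [X in _ = (_ * X)%E](_ : _ = ((2 * (2 * r)) ^+ n.+1)%:E); last first.
      by apply: lebesgue_ball; rewrite mulr_gt0.
    rewrite -!EFinM /M0; congr EFin.
    by rewrite [(2 * (2 * r)) ^+ _]exprMn; ring.
  rewrite [leRHS]integral_mkcond.
  have mK : measurable_fun setT (fun k : V => \int[leb]_y H (y + k)%R y)%E.
    have := @measurable_fun_fubini_tonelli_G _ _ _ _ R leb
      (fun p : V * V => H (p.1 + p.2) p.1) _ (fun p => H0 _ _).
    by apply; have := measurableT_comp mH measurable_shift_pair.
  apply: ge0_le_integral => //.
  - by move=> k _; apply: integral_ge0.
  - have m2r : measurable (ball (0 : V) (2 * r)) by exact: measurable_ball_rV.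
    by apply/(measurable_restrictT _ m2r); exact: measurable_cst.
  move=> k _; rewrite patchE; case: ifPn => [/set_mem/ball0P kr|/negP nkr]; last have {nkr} kr : ~ `|k| < 2 * r by move=> /ball0P/mem_set.
    apply: (@le_trans _ _ (qint B (fun y => u (y + k) - u y)%R)).
      rewrite qint_mkcond; apply: ge0_le_integral => //.
      + have mk : measurable_fun setT (fun y : V => (y + k, y)).
          by apply: measurable_fun_pair => //; exact: measurable_addl_rV.
        by have := measurableT_comp mH mk.
      + apply: measurable_sqrE; apply/(measurable_restrictT _ mB); apply: measurable_funTS.
        by apply: measurable_funB => //; exact: measurable_translation.
      move=> y _; rewrite /H lee_fin patchE !indicE; case: (y \in B); last first.
        by rewrite mul0r mulr0.
      by case: (_ \in B) => /=; rewrite ?mul1r// mul0r expr0n sqr_ge0.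
    apply: (@le_trans _ _ ((N * `|k| ^+ 2)%:E * Gq Omega g)%E).
      apply: (@translation_estimate Omega B Omega) => //; first exact: ball_open.
      move=> x t Bx /andP[t0 t1]; apply: bO; move: Bx.
      rewrite /B !mx_norm_ball /ball_ /= opprD addrA => Bx.
      apply: le_lt_trans (ler_normB _ _) _.
      have : `|t *: k| <= `|k| by rewrite normrZ ger0_norm// ler_piMl.
      by move: Bx kr; set a := `|x0 - x|; set b := `|k|; set c := `|t *: k|; lra.
    rewrite -{1}(fineK Gfin) -EFinM lee_fin ler_wpM2r ?fine_ge0 ?Gq_ge0//.
    by rewrite ler_wpM2l// lerXn2r ?nnegrE// ?mulr_ge0// ltW.
  rewrite integral0_eq// => y _; rewrite /H !indicE.
  have [yB|yB] := boolP (y \in B); last by rewrite mul0r mulr0 expr0n.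
  have /negbTE -> : y + k \notin B; last by rewrite mul0r expr0n.
  apply/negP; rewrite inE => ykB; apply: kr; move: yB ykB; rewrite inE /B !mx_norm_ball /ball_ /= => h1 h2.
  have -> : (k : V) = (x0 - y) - (x0 - (y + k)) by apply/rowP => i; rewrite !mxE; ring.
  by apply: le_lt_trans (ler_normB _ _) _; lra.
have [||||y By hy] := small_value mB mPhi _ _ _ _ IPhi.
- by move=> x; exact: integral_ge0.
- by rewrite lebB lte_fin exprn_gt0// mulr_gt0.
- by rewrite lebB ltry.
- by rewrite mulr_ge0// fine_ge0// Gq_ge0.
exists (u y); rewrite -(fineK Gfin) -EFinM -mulrA.
apply: le_trans hy; rewrite qint_mkcond; apply: ge0_le_integral => //.
- by move=> x _; rewrite lee_fin sqr_ge0.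
- apply: measurable_sqrE; apply/(measurable_restrictT _ mB); apply: measurable_funTS.
  by apply: measurable_funB.
- by have := measurableT_comp mH (@pair2_measurable _ _ V V y).
- move=> x _; rewrite /H lee_fin patchE !indicE (mem_set By); case: (x \in B) => //=.
    by rewrite !mul1r.
  by rewrite mul0r.
Qed.

End poincare.

(** * Lipschitz charts of the boundary *)

Section chart.
Context {R : realType} (n : nat).
Local Notation V := 'rV[R]_n.+1.
Implicit Types (Omega : set V) (x y : V).

Lemma ballP m (x y : 'rV[R]_m.+1) r : ball x r y <-> `|x - y| < r.
Proof. by rewrite mx_norm_ball. Qed.

Lemma enorm_le m (v : 'rV[R]_m) s : 0 <= s -> (forall j, `|v 0 j| <= s) -> enorm v <= m%:R * s.
Proof.
move=> s0 vs; rewrite /enorm -(ger0_norm (mulr_ge0 (ler0n _ m) s0)) -sqrtr_sqr ler_wsqrtr//.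
apply: (@le_trans _ _ (\sum_(j < m) s ^+ 2)).
  apply: ler_sum => j _; rewrite -expr2 -[v 0 j ^+ 2]real_normK ?num_real//.
  by rewrite lerXn2r ?nnegrE.
have -> : \sum_(j < m) s ^+ 2 = m%:R * s ^+ 2 by rewrite sumr_const card_ord mulr_natl.
have : (m%:R : R) <= m%:R ^+ 2.
  by case: m {v vs} => [|m]; rewrite ?expr0n// expr2 ler_peMl// ler1n.
have := sqr_ge0 s; nra.
Qed.

Lemma mulmx_coord_le (Q : 'M[R]_n.+1) x j :
  `|(x *m Q) 0 j| <= (\sum_i \sum_k `|Q i k|) * `|x|.
Proof.
rewrite mxE; apply: le_trans (ler_norm_sum _ _ _) _.
rewrite mulr_suml; apply: ler_sum => i _; rewrite normrM mulrC.
apply: ler_pM => //; last exact: norm_coord_le.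
rewrite (bigD1 j)//= lerDl; exact: sumr_ge0.
Qed.

(* The function [d] is the height above the graph in the direction [e]. *)
Record is_chart Omega x0 (d : V -> R) (e : V) (L r : R) : Prop := IsChart {
  chart_Lge1 : 1 <= L;
  chart_rgt0 : 0 < r;
  chart_line : forall x t, d (x + t *: e) = d x + t;
  chart_lip : forall x y, `|d x - d y| <= L * `|x - y|;
  chart_dir : `|e| <= L;
  chart_center : d x0 = 0;
  chart_iff : forall x, ball x0 r x -> (Omega x <-> 0 < d x) }.

Lemma chart_exists Omega x0 : open Omega -> lipschitz_boundary Omega ->
  boundary Omega x0 -> exists d e L r, is_chart Omega x0 d e L r.
Proof.
move=> oO lO bx0; have [Q [phi [L0 [W [QQ phiL oOO Ox0 OE]]]]] := lO _ bx0.
have QTQ : Q^T *m Q = 1%:M by exact: mulmx1C.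
(* In the rotated coordinates, [d] is the last coordinate minus the graph function, and [e] is the
   vector that the rotation sends to the last axis. *)
pose d x := (x *m Q) 0 ord_max - phi (col' ord_max (x *m Q)).
pose e : V := delta_mx 0 ord_max *m Q^T.
have eQ : e *m Q = delta_mx 0 ord_max by rewrite -mulmxA QTQ mulmx1.
have dline x t : d (x + t *: e) = d x + t.
  rewrite /d mulmxDl -scalemxAl eQ.
  have -> : col' ord_max (x *m Q + t *: delta_mx 0 ord_max) = col' ord_max (x *m Q).
    apply/rowP => j; rewrite !mxE eqxx /= (_ : (lift ord_max j == ord_max) = false) ?mulr0 ?addr0//.
    by apply/negbTE; rewrite eq_sym neq_lift.
  rewrite [X in X - _]mxE [X in _ + X - _]mxE [X in _ + _ * X - _]mxE !eqxx /= mulr1.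
  by rewrite addrAC.
pose Mq := \sum_i \sum_k `|Q i k|.
have Mq0 : 0 <= Mq by apply: sumr_ge0 => i _; apply: sumr_ge0.
pose L1 := Mq + `|L0| * (n%:R * Mq).
have L10 : 0 <= L1 by rewrite addr_ge0// mulr_ge0// mulr_ge0.
have dlip x y : `|d x - d y| <= L1 * `|x - y|.
  have -> : d x - d y = ((x - y) *m Q) 0 ord_max -
      (phi (col' ord_max (x *m Q)) - phi (col' ord_max (y *m Q))).
    by rewrite /d mulmxBl [in RHS]mxE [(- (y *m Q)) 0 _]mxE; ring.
  apply: le_trans (ler_normB _ _) _; rewrite mulrDl lerD ?mulmx_coord_le//.
  apply: le_trans (phiL _ _) _.
  apply: (@le_trans _ _ (`|L0| * enorm (col' ord_max (x *m Q) - col' ord_max (y *m Q)))).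
    by rewrite ler_wpM2r ?sqrtr_ge0// ler_norm.
  rewrite -mulrA ler_wpM2l// -mulrA; apply: enorm_le; first by rewrite mulr_ge0.
  move=> j; have -> : (col' ord_max (x *m Q) - col' ord_max (y *m Q)) 0 j =
      ((x - y) *m Q) 0 (lift ord_max j) by rewrite mulmxBl !mxE.
  exact: mulmx_coord_le.
(* One constant for three purposes: it is at least 1, bounds the Lipschitz constant of [d] and
   bounds the length of [e]. *)
pose L := L1 + `|e| + 1.
have L0' : 0 < L by rewrite ltr_wpDl// addr_ge0.
have dlip' x y : `|d x - d y| <= L * `|x - y|.
  by apply: le_trans (dlip x y) _; rewrite ler_wpM2r// /L -addrA lerDl addr_ge0.
have hO y : W y -> (Omega y <-> 0 < d y).
  move=> Oy; rewrite /d subr_gt0; split.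
    by move=> oy; have : (Omega `&` W) y by []; rewrite OE => -[].
  by move=> hy; have [] : (Omega `&` W) y by rewrite OE; split.
have [rO /= rO0 brO] : nbhs_ball x0 W by apply/nbhs_ballP; exact: open_nbhs_nbhs.
(* A positive height would put [x0] in the open set [Omega], which does not meet its boundary. A
   negative height would persist in a neighbourhood by the Lipschitz bound, against [x0] being in
   the closure. *)
have d0 : d x0 = 0.
  have nOx0 : ~ Omega x0.
    by move=> ox0; apply: bx0.2; rewrite ((interior_id _).1 oO).
  have [dx0|dx0|//] := ltgtP (d x0) 0; last first.
    by exfalso; apply: nOx0; apply/(hO _ Ox0).
  have s0 : 0 < Num.min rO (- d x0 / L).
    by rewrite lt_min rO0 divr_gt0// oppr_gt0.
  have [z [Oz bz]] := bx0.1 _ (nbhsx_ballx x0 _ s0).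
  move/ballP: bz; rewrite lt_min ltr_pdivlMr// => /andP[z1 z2].
  have Oz' : W z by apply: brO; exact/ballP.
  have := (hO _ Oz').1 Oz; have := le_trans (ler_norm _) (dlip' z x0).
  by rewrite mulrC distrC => h1 h2; lra.
exists d, e, L, rO; split => //.
  by have := L10; have := normr_ge0 e; rewrite /L; lra.
  by have := L10; rewrite /L; lra.
by move=> x bx; apply: hO; exact: brO.
Qed.

End chart.

Section poincare_inequality.
Context {R : realType} (n : nat).
Local Notation V := 'rV[R]_n.+1.
Local Notation leb := (lebesgue_rV n.+1).
Implicit Types (u : V -> R) (g : 'I_n.+1 -> V -> R) (A B X Y : set V) (h : V).

Section control.
Variables (Omega B0 : set V).
Hypotheses (oO : open Omega) (mB0 : measurable B0) (B0O : B0 `<=` Omega).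
Let mO : measurable Omega := open_measurable_rV oO.

(* The constant [c] is left free so that the estimate propagates along chains. *)
Definition ctrl X := [/\ measurable X, X `<=` Omega & exists2 K : R, 0 <= K &
  forall u g (c : R), H1g Omega u g ->
    (qint X (fun x => u x - c)%R <= K%:E * (qint B0 (fun x => u x - c)%R + Gq Omega g))%E].

Let mshift u c : measurable_fun setT u -> measurable_fun setT (fun x : V => u x - c).
Proof. by move=> mu; apply: measurable_funB. Qed.

Lemma ctrl0 : ctrl set0.
Proof.
split => //; exists 0 => // u g c _.
by rewrite /qint integral_set0 mul0e.
Qed.

Lemma ctrlS X Y : ctrl Y -> measurable X -> X `<=` Y -> ctrl X.
Proof.
move=> [mY YO [K K0 hK]] mX XY; split => //; first exact: subset_trans YO.
exists K => // u g c Hu; apply: le_trans (hK u g c Hu); apply: qint_subset => //.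
by apply: measurable_funTS; apply: mshift; case: Hu => -[].
Qed.

Lemma ctrlU X Y : ctrl X -> ctrl Y -> ctrl (X `|` Y).
Proof.
move=> [mX XO [K K0 hK]] [mY YO [K' K0' hK']]; split.
- exact: measurableU.
- by rewrite subUset.
exists (K + K'); first exact: addr_ge0.
move=> u g c Hu; have mu : measurable_fun setT (fun x : V => u x - c).
  by apply: mshift; case: Hu => -[].
rewrite EFinD ge0_muleDl ?lee_fin//.
apply: le_trans (leeD (hK u g c Hu) (hK' u g c Hu)).
have -> : X `|` Y = X `|` (Y `\` X).
  apply/seteqP; split=> z; last by case=> [|[]]; [left|right].
  by have [Xz|nXz] := pselect (X z); [left|case=> // Yz; right].
rewrite /qint ge0_integral_setU//.
- rewrite leeD2l//; apply: qint_subset => //; first exact: measurableD.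
  exact: measurable_funTS.
- exact: measurableD.
- by apply: measurable_sqrE; apply: measurable_funTS.
- by move=> x _; rewrite lee_fin sqr_ge0.
- by apply/disj_setPRL; apply: subDsetr.
Qed.

(** The value u(x) - c is u(x + h) - c, controlled on [Y], minus an increment of u, controlled by
    the gradient because the segment from x to x + h stays in [Omega]. *)
Lemma ctrl_translation X Y h : open X -> ctrl Y -> (forall x, X x -> Y (x + h)) ->
  (forall x (t : R), X x -> 0 <= t <= 1 -> Omega (x + t *: h)) -> ctrl X.
Proof.
move=> oX [mY YO [K K0 hK]] XY seg; have mX := open_measurable_rV oX.
split => //.
  by move=> x Xx; have := seg x 0 Xx; rewrite scale0r addr0; apply; rewrite lexx ler01.
exists (2 * K + 2 * (n.+1%:R * `|h| ^+ 2)).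
  by rewrite addr_ge0// mulr_ge0// mulr_ge0// sqr_ge0.
move=> u g c Hu; have [[mu _] Lg _] := Hu.
have muc := mshift c mu.
have mY' : measurable [set x | Y (x + h)].
  by have := measurable_addl_rV h measurableT mY; rewrite setTI.
apply: (@le_trans _ _ (2%:E * qint X (fun x => u (x + h)%R - c)%R +
                       2%:E * qint X (fun x => u (x + h)%R - u x)%R)%E).
  apply: qint_le2 => //.
  - exact: measurable_funTS.
  - by apply: measurable_funTS; exact: (measurable_translation h muc).
  - apply: measurable_funTS; apply: measurable_funB => //; exact: measurable_translation.
  - by move=> x _; have := sqr_ge0 ((u (x + h) - c) + (u (x + h) - u x)); lra.
have E1 : (qint X (fun x => u (x + h)%R - c)%R <= K%:E * (qint B0 (fun x => u x - c)%R + Gq Omega g))%E.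
  apply: le_trans (hK u g c Hu).
  rewrite -(@qint_translation R n (fun x => u x - c) [set x | Y (x + h)] Y h)//.
  apply: qint_subset => //; apply: measurable_funTS; exact: (measurable_translation h muc).
have E2 : (qint X (fun x => u (x + h)%R - u x)%R <= (n.+1%:R * `|h| ^+ 2)%:E * Gq Omega g)%E.
  exact: (@translation_estimate _ _ Omega X Omega).
have q0 : (0 <= qint B0 (fun x => u x - c)%R + Gq Omega g)%E.
  by rewrite adde_ge0 ?qint_ge0 ?Gq_ge0.
rewrite [X in (_ <= X * _)%E]EFinD ge0_muleDl ?lee_fin ?mulr_ge0 ?sqr_ge0//.
apply: leeD.
  by rewrite EFinM -muleA lee_wpmul2l// lee_fin.
rewrite EFinM -muleA lee_wpmul2l ?lee_fin//; apply: le_trans E2 _.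
rewrite lee_wpmul2l ?lee_fin ?mulr_ge0// ?sqr_ge0//.
by rewrite leeDr// qint_ge0.
Qed.

Lemma ctrl_base : ctrl B0.
Proof.
split => //; exists 1 => // u g c _; rewrite mul1e leeDl//; exact: Gq_ge0.
Qed.

Lemma ctrl_near x y r : 0 < r -> ball y (3 * r) `<=` Omega -> ball y r x ->
  (exists2 s, 0 < s & ctrl (ball x s)) -> exists2 s, 0 < s & ctrl (ball y s).
Proof.
move=> r0 yO yx [s s0 hs]; exists (Num.min s r); first by rewrite lt_min s0.
apply: (@ctrl_translation _ (ball x s) (x - y)) => //.
- exact: ball_open.
- move=> z /ballP; rewrite lt_min => /andP[zs _]; apply/ballP.
  by rewrite (_ : x - (z + (x - y)) = y - z)//; apply/rowP => i; rewrite !mxE; ring.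
- move=> z t /ballP; rewrite lt_min => /andP[_ zr] /andP[t0 t1]; apply: yO; apply/ballP.
  rewrite opprD addrA; apply: le_lt_trans (ler_normB _ _) _.
  have : `|t *: (x - y)| <= `|y - x| by rewrite normrZ ger0_norm// distrC ler_piMl.
  by move/ballP: yx zr; set a := `|y - x|; set b := `|y - z|; set c := `|t *: _|; lra.
Qed.

(** The points with a controlled ball form a non-empty relatively open subset of [Omega]; it is
    relatively closed because control passes to any nearby point by translation. *)
Lemma ctrl_interior a r : connected Omega -> 0 < r -> ctrl (ball a r) ->
  forall x, Omega x -> exists2 s, 0 < s & ctrl (ball x s).
Proof.
move=> cO r0 ca.
pose Z := [set x | Omega x /\ exists2 s, 0 < s & ctrl (ball x s)].
have Oa : Omega a by case: ca => _ + _; apply; exact: ballxx.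
have room x : Omega x -> exists2 r, 0 < r & ball x (3 * r) `<=` Omega.
  move=> Ox; have : nbhs x Omega by exact: open_nbhs_nbhs.
  move=> /nbhs_ballP[q /= q0 hq]; exists (q / 3); first by rewrite divr_gt0.
  by rewrite mulrC divfK.
suff ZO : Z = Omega by move=> x Ox; have [] : Z x by rewrite ZO.
apply: cO.
- by exists a; split => //; exists r.
- exists [set x | exists2 s, 0 < s & ctrl (ball x s)].
    rewrite openE => x [s s0 hs]; apply/nbhs_ballP; exists (s / 2) => /=; first by rewrite divr_gt0.
    move=> y /ballP xy; exists (s / 2); first by rewrite divr_gt0.
    apply: (ctrlS hs); first exact: measurable_ball_rV.
    move=> z /ballP yz; apply/ballP.
    rewrite (_ : x - z = (x - y) + (y - z)); last by rewrite addrA subrK.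
    by apply: le_lt_trans (ler_normD _ _) _; lra.
  by [].
- exists (closure Z); first exact: closed_closure.
  apply/seteqP; split => [x Zx|x [Ox cZx]]; first by split; [case: Zx|exact: subset_closure].
  split => //; have [q q0 hq] := room x Ox.
  have [y [[_ cy] xy]] := cZx _ (nbhsx_ballx x _ q0).
  exact: (ctrl_near q0 hq xy cy).
Qed.

(** A translation along [e] carries a neighbourhood of the boundary point into an interior ball that
    is already controlled; the segments stay in [Omega] since the height increases along [e]. *)
Lemma ctrl_boundary x0 : lipschitz_boundary Omega -> boundary Omega x0 ->
  (forall x, Omega x -> exists2 s, 0 < s & ctrl (ball x s)) ->
  exists r, 0 < r /\ ctrl (Omega `&` ball x0 r).
Proof.
move=> lO bx0 cint; have [d [e [L [r [L1 r0 dl dL eL d0 dO]]]]] := chart_exists oO lO bx0.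
have L0 : 0 < L by exact: lt_le_trans L1.
(* Since |e| <= L, the shift by t0 e is at most r/2 long and keeps the ball of radius r/2 within the
   chart. *)
pose t0 := r / (2 * L); have t00 : 0 < t0 by rewrite divr_gt0// mulr_gt0.
have t0L : t0 * L = r / 2 by rewrite /t0; field; rewrite gt_eqF.
have near x t q : q <= r / 2 -> ball x0 q x -> 0 <= t <= t0 -> ball x0 r (x + t *: e).
  move=> qr /ballP xq /andP[t1 t2]; apply/ballP; rewrite opprD addrA.
  apply: le_lt_trans (ler_normB _ _) _.
  have : `|t *: e| <= t0 * L by rewrite normrZ ger0_norm// ler_pM.
  by rewrite t0L; lra.
pose y0 := x0 + t0 *: e.
have Oy0 : Omega y0.
  apply/dO; last by rewrite dl d0 add0r.
  apply: (@near x0 t0 (r / 2)) => //; last by rewrite lexx ltW.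
  by apply: ballxx; rewrite divr_gt0.
have [s s0 hs] := cint _ Oy0.
exists (Num.min s (r / 2)); split; first by rewrite lt_min s0 divr_gt0.
apply: (@ctrl_translation _ (ball y0 s) (t0 *: e)) => //.
- by apply: openI => //; exact: ball_open.
- move=> x [_ /ballP]; rewrite lt_min => /andP[xs _]; apply/ballP.
  by rewrite (_ : y0 - (x + t0 *: e) = x0 - x)// /y0 opprD addrACA subrr addr0.
- move=> x t [Ox bx] /andP[t1 t2]; rewrite scalerA.
  have tt : 0 <= t * t0 <= t0 by rewrite mulr_ge0 ?(ltW t00)//= ler_piMl// ltW.
  have := bx => /ballP; rewrite lt_min => /andP[_ xr].
  have br : ball x0 r x by apply/ballP; lra.
  apply/dO; last by rewrite dl; have := (dO _ br).1 Ox; case/andP: tt; lra.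
  by apply: (@near x _ (r / 2)) => //; exact/ballP.
Qed.

End control.

Lemma compact_closure Omega : bounded_set Omega -> compact (closure Omega : set V).
Proof.
move=> [M [_ hM]]; apply: bounded_closed_compact; last exact: closed_closure.
exists (M + 1); split; first exact: num_real.
move=> N MN x cx.
suff : closed_ball_ (fun x : V => `|x|) 0 N x by rewrite /closed_ball_/= sub0r normrN.
have cl : closed (closed_ball_ (fun x : V => `|x|) 0 N : set V) by exact: closed_closed_ball_.
rewrite ((closure_id _).1 cl); apply: closure_subset cx.
move=> y Oy; rewrite /closed_ball_/= sub0r normrN; apply: (hM N) => //; lra.
Qed.

(** The constant c that [mean_oscillation] finds on one small ball serves for the whole domain,
    control being propagated from that ball. *)
Theorem poincare Omega : lipschitz_domain Omega -> exists2 K : R, 0 <= K &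
  forall u g, H1g Omega u g ->
  exists c, (qint Omega (fun x => u x - c)%R <= K%:E * Gq Omega g)%E.
Proof.
move=> [[a Oa] oO cO bO lO].
have : nbhs a Omega by exact: open_nbhs_nbhs.
move=> /nbhs_ballP[q /= q0 hq].
have r0 : 0 < q / 3 by rewrite divr_gt0.
have h3 : ball a (3 * (q / 3)) `<=` Omega by rewrite mulrC divfK.
have [K1 K10 hK1] := mean_oscillation oO r0 h3.
pose B0 : set V := ball a (q / 3).
have mB0 : measurable B0 by exact: measurable_ball_rV.
have B0O : B0 `<=` Omega.
  by apply: subset_trans h3; apply: le_ball; lra.
have cB0 := ctrl_base mB0 B0O.
have cint := ctrl_interior oO cO r0 cB0.
have [X [[mX XO [K K0 hK]] clX]] : exists X, ctrl Omega B0 X /\ closure Omega `&` Omega `<=` X.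
  apply: compact_patch.
  - exact: compact_closure.
  - exact: ctrl0.
  - by move=> A B; exact: ctrlU.
  move=> x cx; have [Ox|nOx] := pselect (Omega x).
    have [s s0 hs] := cint x Ox; exists s; split => //; apply: ctrlS hs _ _.
      by apply: measurableI; [exact: open_measurable_rV|exact: measurable_ball_rV].
    by move=> y [].
  apply: ctrl_boundary => //; split => //.
  by rewrite ((interior_id _).1 oO).
have XE : X = Omega.
  by apply/seteqP; split => // x Ox; apply: clX; split => //; exact: subset_closure.
exists (K * (K1 + 1)); first by rewrite mulr_ge0// addr_ge0.
move=> u g Hu; have [c hc] := hK1 u g Hu; exists c.
have := hK u g c Hu; rewrite XE => /le_trans; apply.
rewrite EFinM -muleA lee_wpmul2l ?lee_fin// EFinD ge0_muleDl ?lee_fin// mul1e.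
by rewrite leeD2r.
Qed.

End poincare_inequality.

(** * Korn's inequality *)

Section real_quadratic.
Context {R : realType} (n : nat).
Local Notation V := 'rV[R]_n.+1.
Local Notation leb := (lebesgue_rV n.+1).
Implicit Types (f g u : V -> R) (A B : set V) (h : V).

Let hL := @L2_closed R _ _ (lebesgue_rV n.+1) _ measurableT.
Let hs := @L2inner_semi R _ _ (lebesgue_rV n.+1) _ measurableT.

Definition rq A f : R := fine (qint A f).

Definition dif h f : V -> R := fun x => f (x + h) - f x.

Lemma rqE A f : measurable A -> L2 leb setT f -> qint A f = (rq A f)%:E.
Proof.
move=> mA [mf f2]; rewrite /rq fineK// ge0_fin_numE ?qint_ge0//.
by apply: le_lt_trans f2; exact: qint_subset.
Qed.

Lemma rq_ge0 A f : 0 <= rq A f.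
Proof. by rewrite fine_ge0// qint_ge0. Qed.

Lemma rq_subset A B f : measurable A -> measurable B -> L2 leb setT f -> A `<=` B ->
  rq A f <= rq B f.
Proof.
move=> mA mB Lf AB; rewrite -lee_fin -!rqE//; have [mf _] := Lf.
by apply: qint_subset => //; exact: measurable_funTS.
Qed.

Lemma rq_sum_le (I : finType) A f (F : I -> V -> R) (a : I -> R) :
  measurable A -> L2 leb setT f -> (forall j, L2 leb setT (F j)) -> (forall j, 0 <= a j) ->
  (forall x, A x -> f x ^+ 2 <= \sum_j a j * F j x ^+ 2) ->
  rq A f <= \sum_j a j * rq A (F j).
Proof.
move=> mA Lf LF a0 hF; rewrite -lee_fin -rqE//.
have [mf _] := Lf; have mF j : measurable_fun A (F j) by have [? _] := LF j; exact: measurable_funTS.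
apply: le_trans (qint_sum_le (erefl f) mA (measurable_funTS mf) mF a0 hF) _.
by rewrite -sumEFin; apply: lee_sum => j _; rewrite rqE.
Qed.

Lemma rq_le2 A f g k (a b : R) : measurable A -> L2 leb setT f -> L2 leb setT g ->
  L2 leb setT k -> 0 <= a -> 0 <= b ->
  (forall x, A x -> f x ^+ 2 <= a * g x ^+ 2 + b * k x ^+ 2) ->
  rq A f <= a * rq A g + b * rq A k.
Proof.
move=> mA Lf Lg Lk a0 b0 h; have [mf _] := Lf; have [mg _] := Lg; have [mk _] := Lk.
have := @qint_le2 R n A f g k a b mA (measurable_funTS mf) (measurable_funTS mg) (measurable_funTS mk) a0 b0 h.
by rewrite !rqE// -!EFinM -EFinD lee_fin.
Qed.

Lemma rq_le A f g (a : R) : measurable A -> L2 leb setT f -> L2 leb setT g -> 0 <= a ->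
  (forall x, A x -> f x ^+ 2 <= a * g x ^+ 2) -> rq A f <= a * rq A g.
Proof.
move=> mA Lf Lg a0 h; have := @rq_le2 A f g g a 0 mA Lf Lg Lg a0 (lexx 0).
by rewrite mul0r addr0; apply => x /h; rewrite mul0r addr0.
Qed.

Lemma L2_add f g : L2 leb setT f -> L2 leb setT g -> L2 leb setT (f + g).
Proof. by move=> Lf Lg; exact: (@lin_closedD _ _ _ f g hL Lf Lg). Qed.

Lemma L2_sub f g : L2 leb setT f -> L2 leb setT g -> L2 leb setT (f - g).
Proof. by move=> Lf Lg; exact: (@lin_closedB _ _ _ f g hL Lf Lg). Qed.

Lemma L2_scale (c : R) f : L2 leb setT f -> L2 leb setT (c *: f).
Proof. by move=> Lf; exact: (@lin_closedZ _ _ _ c f hL Lf). Qed.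

Lemma L2_dif h f : L2 leb setT f -> L2 leb setT (dif h f).
Proof.
move=> Lf; have Lh := L2_translation h Lf.
exact: (@lin_closedB _ _ _ (fun x => f (x + h)) f hL Lh Lf).
Qed.

Lemma measurable_shift A h : measurable A -> measurable [set x : V | A (x + h)].
Proof. by move=> mA; have := measurable_addl_rV h measurableT mA; rewrite setTI. Qed.

Lemma rq_shift A B f h : measurable A -> measurable B -> L2 leb setT f ->
  (forall x, A x -> B (x + h)) -> rq A (fun x => f (x + h)) <= rq B f.
Proof.
move=> mA mB Lf AB; have [mf _] := Lf; rewrite -lee_fin -!rqE//; last exact: L2_translation.
rewrite -(@qint_translation R n f [set x | B (x + h)] B h)//; last exact: measurable_shift.
apply: qint_subset => //; first exact: measurable_shift.
by apply: measurable_funTS; exact: measurable_translation.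
Qed.

Lemma rq_dif_le A B f h : measurable A -> measurable B -> L2 leb setT f ->
  A `<=` B -> (forall x, A x -> B (x + h)) -> rq A (dif h f) <= 4 * rq B f.
Proof.
move=> mA mB Lf AB ABh; have Lh := L2_translation h Lf.
have h1 := rq_shift mA mB Lf ABh; have h2 := rq_subset mA mB Lf AB.
have : rq A (dif h f) <= 2 * rq A (fun x => f (x + h)) + 2 * rq A f.
  apply: rq_le2 => //; first exact: L2_dif.
  by move=> x _; rewrite /dif; have := sqr_ge0 (f (x + h) + f x); lra.
lra.
Qed.

Lemma rq_inner f : L2 leb setT f -> rq setT f = L2inner leb setT f f.
Proof. by move=> Lf; apply: eq_Rintegral => x _; rewrite expr2. Qed.

Lemma difD h f g x : dif h (f + g) x = dif h f x + dif h g x.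
Proof. by rewrite /dif /= [(f + g) (x + h)](_ : _ = f (x + h) + g (x + h))// [(f + g) x](_ : _ = f x + g x)//; ring. Qed.

End real_quadratic.

(** * Differences on the whole space, and cut-offs *)

Section discrete_korn.
Context {R : realType} (n : nat).
Local Notation V := 'rV[R]_n.+1.
Local Notation leb := (lebesgue_rV n.+1).
Local Notation II := ('I_n.+1 * 'I_n.+1)%type.
Local Notation N := (n.+1%:R : R).
Implicit Types (f g u : V -> R) (A B : set V) (h : V) (v w : 'I_n.+1 -> V -> R) (t : R).

Let hL := @L2_closed R _ _ (lebesgue_rV n.+1) _ measurableT.
Let hs := @L2inner_semi R _ _ (lebesgue_rV n.+1) _ measurableT.
Local Notation inn := (L2inner leb setT).

Definition edir t i : V := t *: delta_mx 0 i.

Lemma norm_edir t i : `|edir t i| = `|t|.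
Proof.
rewrite /edir normrZ; suff -> : `|delta_mx 0 i : V| = 1 by rewrite mulr1.
apply/eqP; rewrite eq_le; apply/andP; split.
  rewrite [leLHS]/Num.Def.normr/= mx_normrE; apply: bigmax_le => //= -[a b] _ /=.
  by rewrite mxE; case: (_ && _); rewrite ?normr1 ?normr0.
by have := norm_coord_le (delta_mx 0 i : V) i; rewrite mxE !eqxx normr1.
Qed.

Lemma inner_shift f g h k : L2 leb setT f -> L2 leb setT g ->
  inn (fun x => f (x + h)) (fun x => g (x + k)) =
  inn (fun x => f (x - k)) (fun x => g (x - h)).
Proof.
move=> [mf _] [mg _]; rewrite /L2inner -[RHS](@Rintegral_translation R n _ (h + k)).
  by apply: eq_Rintegral => x _; rewrite addrA addrK addrAC addrK.
by apply: measurable_funM; exact: measurable_translation.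
Qed.

(** By invariance of the integral, each shift can be moved to the other factor with the opposite
    sign. *)
Lemma inner_dif_adjoint f g h k : L2 leb setT f -> L2 leb setT g ->
  inn (dif h f) (dif k g) = inn (dif (- k) f) (dif (- h) g).
Proof.
move=> Lf Lg; have Lt u m : L2 leb setT u -> L2 leb setT (fun x : V => u (x + m)) by exact: L2_translation.
have E u m : dif m u = (fun x => u (x + m)) - u by [].
rewrite !E !(semi_innerBl hs) ?(semi_innerBr hL hs)//; try exact: Lt;
  try (by apply: (@lin_closedB _ _ _ _ _ hL) => //; exact: Lt).
have z u : (fun x : V => u (x + 0)) = u by apply/funext => x; rewrite addr0.
have E1 := inner_shift h k Lf Lg.
have E2 := inner_shift h 0 Lf Lg; have E3 := inner_shift 0 k Lf Lg.
rewrite !oppr0 !z in E2 E3.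
by rewrite E1 E2 E3; ring.
Qed.

(* Translations commute, so the cross terms add up to the square of a discrete
   divergence. *)
Lemma discrete_korn v t : (forall j, L2 leb setT (v j)) ->
  2 * \sum_(p : II) rq setT (dif (edir t p.1) (v p.2)) <=
  \sum_(p : II) rq setT (dif (edir t p.1) (v p.2) + dif (edir t p.2) (v p.1)).
Proof.
move=> Lv; pose a i j := dif (edir t i) (v j).
have La i j : L2 leb setT (a i j) by exact: L2_dif.
pose b j := dif (- edir t j) (v j).
have Lb j : L2 leb setT (b j) by exact: L2_dif.
have E p : rq setT (a p.1 p.2 + a p.2 p.1) =
    rq setT (a p.1 p.2) + 2 * inn (b p.2) (b p.1) + rq setT (a p.2 p.1).
  rewrite !rq_inner//; last exact: lin_closedD.
  have := semi_inner_lin2 hL hs 1 (La p.1 p.2) (La p.2 p.1).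
  have E1 : inn (a p.1 p.2) (a p.2 p.1) = inn (b p.2) (b p.1) by exact: inner_dif_adjoint.
  by rewrite scale1r expr1n mul1r mulr1 => ->; rewrite E1.
rewrite (eq_bigr _ (fun p _ => E p)) !big_split/= -mulr_sumr.
have -> : \sum_(p : II) rq setT (a p.2 p.1) = \sum_(p : II) rq setT (a p.1 p.2).
  rewrite -(pair_bigA _ (fun i j => rq setT (a j i)))/= exchange_big/=.
  by rewrite (pair_bigA _ (fun i j => rq setT (a i j))).
have : 0 <= \sum_(p : II) inn (b p.2) (b p.1).
  rewrite -(pair_bigA _ (fun i j => inn (b j) (b i)))/=.
  have Ls : L2 leb setT (\sum_j 1 *: b j).
    by apply: (lin_closed_sum _ hL) => j _; exact: (lin_closedZ _ hL (Lb j)).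
  have := semi_inner_ge0 hs Ls; rewrite inner_suml//.
  rewrite (_ : \sum_i 1 * _ = \sum_i \sum_j inn (b j) (b i))//.
  apply: eq_bigr => i _; rewrite mul1r (semi_innerC hs (Lb i) Ls) inner_suml//.
  by apply: eq_bigr => j _; rewrite mul1r.
lra.
Qed.

Definition tent (r : R) (z : V) : R := Num.max 0 (1 - `|z| / r).

Section tent.
Variable r : R.
Hypothesis r0 : 0 < r.

Lemma tent_ge0 z : 0 <= tent r z.
Proof. by rewrite le_max lexx. Qed.

Lemma tent_le1 z : tent r z <= 1.
Proof. by rewrite ge_max ler01 gerBl divr_ge0// ltW. Qed.

Lemma tent_out z : r <= `|z| -> tent r z = 0.
Proof. by move=> rz; apply/max_idPl; rewrite subr_le0 ler_pdivlMr// mul1r. Qed.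

Lemma tentN z : tent r (- z) = tent r z.
Proof. by rewrite /tent normrN. Qed.

Lemma tent_lip x y : `|tent r x - tent r y| <= `|x - y| / r.
Proof.
have : `| `|x| / r - `|y| / r | <= `|x - y| / r.
  rewrite -mulrBl normrM [`|r^-1|]gtr0_norm ?invr_gt0// ler_pM2r ?invr_gt0//.
  exact: ler_dist_dist.
rewrite /tent; set a := `|x| / r; set b := `|y| / r; set c := _ / r.
have a0 : 0 <= a by rewrite divr_ge0// ltW.
rewrite !ler_norml => /andP[h1 h2].
by case: (leP 0 (1 - a)) => ha; case: (leP 0 (1 - b)) => hb; apply/andP; split; lra.
Qed.

Lemma measurable_tent : measurable_fun setT (tent r).
Proof.
apply: measurable_maxr; first exact: measurable_cst.
apply: measurable_funB; first exact: measurable_cst.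
apply: measurable_funM; last exact: measurable_cst.
by apply: continuous_measurable_rV; exact: norm_continuous.
Qed.

Lemma tent_L2 : L2 leb setT (tent r).
Proof.
apply: (@bounded_support_L2 _ _ _ 1 r) => //; first exact: measurable_tent.
move=> z; rewrite mul1r indicE ger0_norm ?tent_ge0//.
have [_|/negP zb] := boolP (_ \in _); first exact: tent_le1.
rewrite tent_out// leNgt; apply/negP => zr; apply: zb; rewrite inE; exact/ball0P.
Qed.

(** The tent is at least 1/2 on the ball of radius r/2, a cube of volume r^(n+1). *)
Lemma tent_mass : r ^+ n.+1 <= 4 * rq setT (tent r).
Proof.
have b0 : 0 < r / 2 by rewrite divr_gt0.
have mB : measurable (ball (0 : V) (r / 2)) by exact: measurable_ball_rV.
have LI : L2 leb setT (\1_(ball (0 : V) (r / 2)) : V -> R).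
  apply: (@bounded_support_L2 _ _ _ 1 (r / 2)) => //.
  by move=> x; rewrite mul1r ger0_norm.
have -> : r ^+ n.+1 = rq setT (\1_(ball (0 : V) (r / 2)) : V -> R).
  rewrite /rq qint_indic// (_ : leb _ = ((2 * (r / 2)) ^+ n.+1)%:E)/=; last exact: lebesgue_ball.
  by rewrite mulrC divfK.
apply: rq_le => //; first exact: tent_L2.
move=> x _; rewrite indicE; have [/set_mem/ball0P xb|_] := boolP (_ \in _); last first.
  by rewrite expr0n/= mulr_ge0// sqr_ge0.
have : 2^-1 <= tent r x.
  rewrite le_max; apply/orP; right.
  have : `|x| / r <= 2^-1 by rewrite ler_pdivrMr// mulrC ltW.
  lra.
by rewrite expr1n; nra.
Qed.

End tent.

Lemma measurable_subp : measurable_fun setT (fun p : V * V => p.2 - p.1).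
Proof.
apply: measurable_fun_rV => i.
have -> : rV_coord i \o (fun p : V * V => p.2 - p.1) = fun p => (rV_coord i p.2 : R) - rV_coord i p.1.
  by apply/funext => p; rewrite /rV_coord /= !mxE.
apply: measurable_funB.
  by apply: (measurableT_comp _ measurable_snd); exact: measurable_rV_coord.
by apply: (measurableT_comp _ measurable_fst); exact: measurable_rV_coord.
Qed.

Section cutoff.
Variables (r : R) (A : set V).
Hypotheses (r0 : 0 < r) (mA : measurable A).

(** A continuous family of cut-offs indexed by their centre y in [A]; integrating over y replaces a
    partition of unity. *)
Definition cutoff (y x : V) : R := \1_A y * tent r (x - y).

Lemma measurable_cutoff : measurable_fun setT (fun p : V * V => cutoff p.1 p.2).
Proof.
apply: measurable_funM.
  by apply: (measurableT_comp _ measurable_fst); exact: measurable_indic.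
by apply: (measurableT_comp _ measurable_subp); exact: measurable_tent.
Qed.

Lemma cutoff_ge0 y x : 0 <= cutoff y x.
Proof. by rewrite mulr_ge0// tent_ge0. Qed.

Lemma cutoff_le y x : cutoff y x <= tent r (y - x).
Proof.
rewrite /cutoff -(tentN r (x - y)) opprB indicE.
by case: (_ \in _); rewrite ?mul1r// mul0r tent_ge0.
Qed.

Lemma cutoff_norm_le1 y x : `|cutoff y x| <= 1.
Proof. by rewrite ger0_norm ?cutoff_ge0// (le_trans (cutoff_le _ _))// tent_le1. Qed.

Lemma measurable_cutoff2 y : measurable_fun setT (cutoff y).
Proof. by have := measurableT_comp measurable_cutoff (@pair1_measurable _ _ V V y). Qed.

Lemma measurable_cutoff1 x : measurable_fun setT (cutoff^~ x).
Proof. by have := measurableT_comp measurable_cutoff (@pair2_measurable _ _ V V x). Qed.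

Lemma tent_massE x : qint setT (fun y => tent r (y - x)) = (rq setT (tent r))%:E.
Proof.
rewrite -rqE//; last exact: tent_L2.
by apply: (@qint_translation R n (tent r) setT setT (- x)) => //; exact: measurable_tent.
Qed.

Lemma cutoff_mass_le x : (qint setT (cutoff^~ x) <= (rq setT (tent r))%:E)%E.
Proof.
rewrite -(tent_massE x); apply: qint_le1 => //.
- exact: measurable_cutoff1.
- by apply: measurable_translation; exact: measurable_tent.
- by move=> y _; rewrite lerXn2r ?nnegrE ?cutoff_ge0 ?tent_ge0// cutoff_le.
Qed.

Lemma cutoff_massE x : (forall y, `|x - y| < r -> A y) ->
  qint setT (cutoff^~ x) = (rq setT (tent r))%:E.
Proof.
move=> hx; rewrite -(tent_massE x); apply: eq_integral => y _; congr (EFin (_ ^+ 2)).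
rewrite /cutoff -(tentN r (x - y)) opprB indicE.
have [_|/negP yA] := boolP (_ \in _); first by rewrite mul1r.
rewrite mul0r tent_out// leNgt; apply/negP => xy; apply: yA; rewrite inE; apply: hx.
by rewrite distrC.
Qed.

Let mJ f : measurable_fun setT f ->
  measurable_fun setT (fun p : V * V => ((cutoff p.1 p.2 * f p.2) ^+ 2)%:E).
Proof.
move=> mf; apply/measurable_EFinP; apply: measurable_funX.
apply: measurable_funM; first exact: measurable_cutoff.
exact: (measurableT_comp mf measurable_snd).
Qed.

Lemma measurable_cutoff_qint f : measurable_fun setT f ->
  measurable_fun setT (fun y => qint setT (fun x => cutoff y x * f x)).
Proof.
move=> mf; have := @measurable_fun_fubini_tonelli_F _ _ _ _ R leb _ (mJ mf).
by apply => p; rewrite lee_fin sqr_ge0.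
Qed.

Lemma cutoff_tonelli f : measurable_fun setT f ->
  (\int[leb]_y qint setT (fun x => cutoff y x * f x)%R =
   \int[leb]_x ((f x ^+ 2)%:E * qint setT (cutoff^~ x)))%E.
Proof.
move=> mf.
transitivity (\int[leb]_x \int[leb]_y ((cutoff y x * f x) ^+ 2)%:E)%E.
  apply: (fubini_tonelli (fun p : V * V => ((cutoff p.1 p.2 * f p.2) ^+ 2)%:E)).
  - exact: mJ.
  - by move=> p; rewrite lee_fin sqr_ge0.
apply: eq_integral => x _; rewrite /qint -ge0_integralZl_EFin ?sqr_ge0//.
- by apply: eq_integral => y _; rewrite -EFinM exprMn mulrC.
- by move=> y _; rewrite lee_fin sqr_ge0.
- by apply: measurable_sqrE; exact: measurable_cutoff1.
Qed.

Lemma measurable_cutoff_mass f : measurable_fun setT f ->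
  measurable_fun setT (fun x => ((f x ^+ 2)%:E * qint setT (cutoff^~ x)))%E.
Proof.
move=> mf; apply: emeasurable_funM; first exact: measurable_sqrE.
have := @measurable_fun_fubini_tonelli_G _ _ _ _ R leb (fun p : V * V => ((cutoff p.1 p.2) ^+ 2)%:E).
apply; last by move=> p; rewrite lee_fin sqr_ge0.
by apply/measurable_EFinP; apply: measurable_funX; exact: measurable_cutoff.
Qed.

(** After Tonelli, f(x)^2 carries as weight the mass of the cut-offs over all centres, which is
    complete as soon as the ball of radius r around x lies in [A]. *)
Lemma cutoff_lower A0 f : measurable A0 -> L2 leb setT f ->
  (forall x y, A0 x -> `|x - y| < r -> A y) ->
  ((rq setT (tent r) * rq A0 f)%:E <= \int[leb]_y qint setT (fun x => cutoff y x * f x)%R)%E.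
Proof.
move=> mA0 Lf hA; have [mf _] := Lf; rewrite cutoff_tonelli//.
apply: (@le_trans _ _ (\int[leb]_(x in A0) ((f x ^+ 2)%:E * qint setT (cutoff^~ x)))%E); last first.
  apply: ge0_subset_integral => //; first exact: measurable_cutoff_mass.
  by move=> x _; rewrite mule_ge0 ?qint_ge0// lee_fin sqr_ge0.
rewrite (eq_integral (fun x => (rq setT (tent r))%:E * (f x ^+ 2)%:E))%E; last first.
  by move=> x /set_mem Ax; rewrite muleC cutoff_massE// => y; exact: hA.
rewrite ge0_integralZl_EFin ?rq_ge0//; last 2 first.
- by move=> x _; rewrite lee_fin sqr_ge0.
- by apply: measurable_sqrE; exact: measurable_funTS.
by rewrite -/(qint A0 f) rqE// EFinM.
Qed.

Lemma cutoff_upper A' f : measurable A' -> L2 leb setT f ->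
  (forall y x, A y -> `|x - y| < r -> A' x) ->
  (\int[leb]_y qint setT (fun x => cutoff y x * f x)%R <= (rq setT (tent r) * rq A' f)%:E)%E.
Proof.
move=> mA' Lf hA; have [mf _] := Lf; rewrite cutoff_tonelli// EFinM -(rqE mA' Lf) qint_mkcond.
have mfA : measurable_fun setT (f \_ A' : V -> R).
  by apply/(measurable_restrictT _ mA'); exact: measurable_funTS.
rewrite -ge0_integralZl_EFin ?rq_ge0//; last 2 first.
- by move=> x _; rewrite lee_fin sqr_ge0.
- exact: measurable_sqrE.
apply: ge0_le_integral => //.
- by move=> x _; rewrite mule_ge0 ?qint_ge0// lee_fin sqr_ge0.
- exact: measurable_cutoff_mass.
- by apply: measurable_funeM; exact: measurable_sqrE.
move=> x _; rewrite patchE; case: ifPn => [_|/negP xA].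
  by rewrite muleC lee_wpmul2r// ?lee_fin ?sqr_ge0// cutoff_mass_le.
have -> : qint setT (cutoff^~ x) = 0%E; last by rewrite mule0 mule_ge0 ?lee_fin ?rq_ge0 ?sqr_ge0.
apply: integral0_eq => y _; rewrite /cutoff indicE.
have [/set_mem yA|_] := boolP (_ \in _); last by rewrite mul0r expr0n.
rewrite tent_out ?mulr0 ?expr0n// leNgt; apply/negP => xy; apply: xA; rewrite inE.
exact: (hA y).
Qed.

End cutoff.

Lemma integral_sum_le (I : finType) (a b c : I -> V -> \bar R) :
  (forall i, measurable_fun setT (a i)) -> (forall i, measurable_fun setT (b i)) ->
  (forall i, measurable_fun setT (c i)) ->
  (forall i y, 0 <= a i y)%E -> (forall i y, 0 <= b i y)%E -> (forall i y, 0 <= c i y)%E ->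
  (forall y, \sum_i a i y <= 3%:E * \sum_i b i y + 8%:E * \sum_i c i y)%E ->
  (\sum_i \int[leb]_y a i y <=
   3%:E * \sum_i \int[leb]_y b i y + 8%:E * \sum_i \int[leb]_y c i y)%E.
Proof.
move=> ma mb mc a0 b0 c0 h.
have ms (f : I -> V -> \bar R) : (forall i, measurable_fun setT (f i)) ->
  measurable_fun setT (fun y => \sum_i f i y)%E by move=> mf; exact: emeasurable_sum.
have s0 (f : I -> V -> \bar R) y : (forall i y, 0 <= f i y)%E -> (0 <= \sum_i f i y)%E.
  by move=> f0; apply: sume_ge0.
rewrite -!ge0_integral_sum// -!ge0_integralZl_EFin//; try exact: ms; try by move=> y _; exact: s0.
rewrite -ge0_integralD//; first last.
- by apply: measurable_funeM; exact: ms.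
- by move=> y _; rewrite mule_ge0// s0.
- by apply: measurable_funeM; exact: ms.
- by move=> y _; rewrite mule_ge0// s0.
apply: ge0_le_integral => //.
- by move=> y _; exact: s0.
- exact: ms.
- by apply: emeasurable_funD; apply: measurable_funeM; exact: ms.
Qed.

End discrete_korn.

(** * Localization of the discrete Korn inequality *)

Section localized_korn.
Context {R : realType} (n : nat).
Local Notation V := 'rV[R]_n.+1.
Local Notation leb := (lebesgue_rV n.+1).
Local Notation II := ('I_n.+1 * 'I_n.+1)%type.
Implicit Types (f g u : V -> R) (A B : set V) (h : V) (v w : 'I_n.+1 -> V -> R) (t : R).

Let hL := @L2_closed R _ _ (lebesgue_rV n.+1) _ measurableT.

Section fixed.
Variables (r t M : R) (A0 A A' : set V) (w : 'I_n.+1 -> V -> R).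
Hypotheses (t0 : 0 < t) (tr : t <= r).
Hypotheses (mA0 : measurable A0) (mA : measurable A) (mA' : measurable A').
Hypothesis Lw : forall j, L2 leb setT (w j).
Hypothesis A0A : forall x y, A0 x -> `|x - y| < r -> A y.
Hypothesis AA' : forall y x, A y -> `|x - y| < r -> A' x.
Hypothesis M0 : 0 <= M.
Hypothesis wM : forall j k, `|k| < 3 * r -> rq A (dif k (w j)) <= M.

Let r0 : 0 < r := lt_le_trans t0 tr.
Let z := cutoff r A.
Let D (p : II) := dif (edir t p.1) (w p.2).
Let D' (p : II) := dif (edir t p.2) (w p.1).

(* The defect of the product rule for [z y * (w j - w j y)]. *)
Let rem (p : II) (y x : V) : R :=
  (z y (x + edir t p.1) - z y x) * (w p.2 (x + edir t p.1) - w p.2 y).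

Let Lzf y f : L2 leb setT f -> L2 leb setT (fun x => z y x * f x).
Proof.
move=> [mf f2]; have mz : measurable_fun setT (fun x => z y x * f x).
  by apply: measurable_funM => //; exact: measurable_cutoff2.
split => //; apply: le_lt_trans f2; apply: qint_le1 => // x _.
rewrite exprMn ler_piMl ?sqr_ge0// -[z y x ^+ 2]real_normK ?num_real//.
by rewrite expr_le1// cutoff_norm_le1.
Qed.

Let Lz y : L2 leb setT (z y).
Proof.
have mz : measurable_fun setT (z y) by exact: measurable_cutoff2.
have L1 := tent_L2 n r0; have L2' := L2_translation (- y) L1; have [_ L2''] := L2'.
split => //; apply: le_lt_trans L2''; apply: qint_le1 => //.
  by case: L2'.
move=> x _; rewrite lerXn2r ?nnegrE ?cutoff_ge0 ?tent_ge0//.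
by apply: le_trans (cutoff_le r A y x) _; rewrite -tentN opprB.
Qed.

Let Lv y j : L2 leb setT (fun x => z y x * (w j x - w j y)).
Proof.
have -> : (fun x => z y x * (w j x - w j y)) = (- w j y) *: z y + (fun x => z y x * w j x).
  by apply/funext => x; rewrite mulrBr addrC mulrC -mulNr.
by apply: L2_lin => //; exact: Lzf.
Qed.

Let LD p : L2 leb setT (D p). Proof. exact: L2_dif. Qed.
Let LD' p : L2 leb setT (D' p). Proof. exact: L2_dif. Qed.
Let LDD p : L2 leb setT (D p + D' p). Proof. exact: L2_add. Qed.

Let Lrem p y : L2 leb setT (rem p y).
Proof.
have -> : rem p y = dif (edir t p.1) (fun x => z y x * (w p.2 x - w p.2 y)) - (fun x => z y x * D p x).
  by apply/funext => x; rewrite /rem /D /dif !fctE; ring.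
by apply: L2_sub; [apply: L2_dif; exact: Lv|exact: Lzf].
Qed.

(** Let X, Y, Z be the sums for the differences of the cut-off field, for the cut-off symmetric
    differences and for the defects. The discrete inequality and a three-term square give 2X <= 3Y +
    6Z, and the left-hand side is at most 2X + 2Z. *)
Let fiber_ineq y :
  \sum_(p : II) rq setT (fun x => z y x * D p x) <=
  3 * \sum_(p : II) rq setT (fun x => z y x * (D p + D' p) x) + 8 * \sum_(p : II) rq setT (rem p y).
Proof.
pose v j x := z y x * (w j x - w j y).
have K := discrete_korn t (Lv y).
have h1 p : rq setT (fun x => z y x * D p x) <=
    2 * rq setT (dif (edir t p.1) (v p.2)) + 2 * rq setT (rem p y).
  apply: rq_le2 => //; [exact: Lzf|by apply: L2_dif; exact: Lv|].
  move=> x _; have -> : z y x * D p x = dif (edir t p.1) (v p.2) x - rem p y x.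
    by rewrite /v /rem /D /dif; ring.
  by set a := dif _ _ _; set b := rem _ _ _; have := sqr_ge0 (a + b); lra.
have h2 p : rq setT (dif (edir t p.1) (v p.2) + dif (edir t p.2) (v p.1)) <=
    3 * rq setT (fun x => z y x * (D p + D' p) x) +
    (3 * rq setT (rem p y) + 3 * rq setT (rem (p.2, p.1) y)).
  pose F (i : 'I_3) : V -> R := match val i with
    | 0%N => fun x => z y x * (D p + D' p) x | 1%N => rem p y | _ => rem (p.2, p.1) y end.
  have LF i : L2 leb setT (F i).
    by rewrite /F; case: (val i) => [|[|_]]; [exact: Lzf|exact: Lrem|exact: Lrem].
  have := @rq_sum_le R n 'I_3 setT (dif (edir t p.1) (v p.2) + dif (edir t p.2) (v p.1)) F (fun=> 3) measurableT.
  rewrite !big_ord_recl big_ord0 addr0 /F /=; apply => //.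
  - by apply: L2_add; apply: L2_dif; exact: Lv.
  move=> x _; rewrite !big_ord_recl big_ord0 addr0 /=.
  have -> : (dif (edir t p.1) (v p.2) + dif (edir t p.2) (v p.1)) x =
      z y x * (D p + D' p) x + rem p y x + rem (p.2, p.1) y x.
    by rewrite !fctE /v /rem /D /D' /dif /=; ring.
  set a := _ * _; set b := rem _ _ _; set c := rem _ _ _.
  by have := sqr_ge0 (a - b); have := sqr_ge0 (a - c); have := sqr_ge0 (b - c); lra.
have h3 : \sum_(p : II) rq setT (rem (p.2, p.1) y) = \sum_(p : II) rq setT (rem p y).
  rewrite -(pair_bigA _ (fun i j => rq setT (rem (j, i) y)))/= exchange_big/=.
  by rewrite (pair_bigA _ (fun i j => rq setT (rem (i, j) y)))/=; apply: eq_bigr => -[i j].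
have S (F G : II -> R) : (forall p, F p <= G p) -> \sum_p F p <= \sum_p G p.
  by move=> h; apply: ler_sum => p _; exact: h.
have := S _ _ h1; have := S _ _ h2.
rewrite !big_split/= -!mulr_sumr h3.
by move: K; rewrite /v; lra.
Qed.

Let mrem p : measurable_fun setT (fun q : V * V => ((rem p q.1 q.2) ^+ 2)%:E).
Proof.
have [mw _] := Lw p.2; have mwh := measurable_translation (edir t p.1) mw.
have mz : measurable_fun setT (fun q : V * V => z q.1 q.2) by exact: measurable_cutoff.
have ms : measurable_fun setT (fun q : V * V => (q.1, q.2 + edir t p.1)).
  apply: measurable_fun_pair => //.
  by have := measurableT_comp (measurable_addl_rV (edir t p.1)) (@measurable_snd _ _ V V).
apply/measurable_EFinP; apply: measurable_funX; apply: measurable_funM.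
  apply: measurable_funB => //.
  by have := measurableT_comp mz ms.
apply: measurable_funB.
  exact: (measurableT_comp mwh measurable_snd).
exact: (measurableT_comp mw measurable_fst).
Qed.

(** With x = y + k, both cut-offs vanish when |k| >= 2r, because t <= r. Otherwise the cut-off
    varies by at most t/r, and the field is incremented by k plus a step of length t, shorter than
    3r. The power of 4r is the volume of the ball of shifts. *)
Let rem_bound p :
  (\int[leb]_y qint setT (rem p y) <= ((t / r) ^+ 2 * M * (4 * r) ^+ n.+1)%:E)%E.
Proof.
pose H (x y : V) : \bar R := ((rem p y x) ^+ 2)%:E.
have mH : measurable_fun setT (fun q : V * V => H q.1 q.2).
  have ms : measurable_fun setT (fun q : V * V => (q.2, q.1)).
    by apply: measurable_fun_pair; [exact: measurable_snd|exact: measurable_fst].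
  by have := measurableT_comp (mrem p) ms.
have H0 x y : (0 <= H x y)%E by rewrite lee_fin sqr_ge0.
have := tonelli_shift mH H0; rewrite /qint => ->.
have r2 : 0 < 2 * r by rewrite mulr_gt0.
have -> : (((t / r) ^+ 2 * M * (4 * r) ^+ n.+1)%:E =
    \int[leb]_(k in ball (0%R : V) (2 * r)%R) ((t / r) ^+ 2 * M)%:E)%E.
  rewrite integral_cst; last exact: measurable_ball_rV.
  rewrite [X in _ = (_ * X)%E](_ : _ = ((2 * (2 * r)) ^+ n.+1)%:E); last exact: lebesgue_ball.
  by rewrite -EFinM mulrA -natrM.
rewrite [leRHS]integral_mkcond.
have m2r : measurable (ball (0 : V) (2 * r)) by exact: measurable_ball_rV.
have c0 : 0 <= (t / r) ^+ 2 * M by rewrite mulr_ge0// sqr_ge0.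
have mK : measurable_fun setT (fun k : V => \int[leb]_y H (y + k)%R y)%E.
  have := @measurable_fun_fubini_tonelli_G _ _ _ _ R leb
    (fun p : V * V => H (p.1 + p.2) p.1) _ (fun p => H0 _ _).
  by apply; have := measurableT_comp mH (@measurable_shift_pair R n).
apply: ge0_le_integral => //.
- by move=> k _; apply: integral_ge0.
- by apply/(measurable_restrictT _ m2r); exact: measurable_cst.
move=> k _; rewrite patchE; case: ifPn => [/set_mem/ball0P kr|/negP nkr]; last first.
  have {nkr} kr : 2 * r <= `|k| by rewrite leNgt; apply/negP => /ball0P/mem_set.
  rewrite integral0_eq// => y _; rewrite /H /rem /z /cutoff.
  have -> : y + k - y = k by rewrite addrAC subrr add0r.
  have -> : y + k + edir t p.1 - y = k + edir t p.1 by rewrite addrAC [y + k]addrC addrK.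
  rewrite [tent r k]tent_out//; last by apply: le_trans kr; lra.
  rewrite tent_out ?mulr0 ?subrr ?mul0r ?expr0n//.
  have h := ler_normB (k + edir t p.1) (edir t p.1); rewrite addrK norm_edir gtr0_norm// in h.
  rewrite -(lerD2r t); apply: le_trans (le_trans kr h).
  by rewrite mulr_natl mulr2n lerD2l.
pose k' := k + edir t p.1.
have kk : `|k'| < 3 * r.
  apply: le_lt_trans (ler_normD _ _) _; rewrite norm_edir gtr0_norm//.
  apply: (@lt_le_trans _ _ (2 * r + t)); first by rewrite ltrD2r.
  by move: tr; lra.
apply: (@le_trans _ _ (((t / r) ^+ 2)%:E * qint A (dif k' (w p.2)))%E); last first.
  rewrite rqE//; last exact: L2_dif.
  by rewrite -EFinM lee_fin ler_wpM2l ?sqr_ge0// wM.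
have [mf _] := L2_dif k' (Lw p.2).
have mA1 := measurable_restrictT _ mA.
rewrite qint_mkcond -ge0_integralZl_EFin ?sqr_ge0//; last 2 first.
- by move=> x _; rewrite lee_fin sqr_ge0.
- by apply: measurable_sqrE; apply/(measurable_restrictT _ mA); exact: measurable_funTS.
apply: ge0_le_integral => //.
- have mk : measurable_fun setT (fun y : V => (y + k, y)).
    by apply: measurable_fun_pair => //; exact: measurable_addl_rV.
  by have := measurableT_comp mH mk.
- apply: measurable_funeM; apply: measurable_sqrE.
  by apply/(measurable_restrictT _ mA); exact: measurable_funTS.
move=> y _; rewrite /H -EFinM lee_fin patchE.
rewrite /rem /z /cutoff indicE; case: (_ \in _); last first.
  by rewrite !mul0r subrr mul0r expr0n mulr0.
rewrite !mul1r -exprMn -[leLHS]real_normK ?num_real// -[leRHS]real_normK ?num_real//.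
rewrite lerXn2r ?nnegrE// normrM [leRHS]normrM /dif /k' addrA ler_wpM2r//.
rewrite [leRHS]ger0_norm ?divr_ge0 ?(ltW t0) ?(ltW r0)//.
apply: le_trans (tent_lip r0 _ _) _.
rewrite ler_pM2r ?invr_gt0//.
rewrite (_ : _ - _ = edir t p.1) ?norm_edir ?gtr0_norm//.
by apply/rowP => i; rewrite !mxE; ring.
Qed.

(** The inequality on the whole space is applied, for each centre y, to the field w - w(y) cut off
    around y, and integrated over y. Subtracting the constant w(y) makes the error of the product
    rule an increment of w. The result is divided by the mass of the tent: 32 is 8 from [fiber_ineq]
    times 4 from [tent_mass], and the power of 4 is left from that of 4r in [rem_bound]. *)
Lemma localized_korn :
  \sum_(p : II) rq A0 (D p) <= 3 * \sum_(p : II) rq A' (D p + D' p) +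
    32 * 4 ^+ n.+1 * #|{: II}|%:R * ((t / r) ^+ 2 * M).
Proof.
have mD p : measurable_fun setT (D p) by case: (LD p).
have mDD p : measurable_fun setT (D p + D' p) by case: (LDD p).
have mF p : measurable_fun setT (fun y => qint setT (rem p y)).
  have := @measurable_fun_fubini_tonelli_F _ _ _ _ R leb _ (mrem p).
  by apply => q; rewrite lee_fin sqr_ge0.
have := @integral_sum_le R n _ (fun p y => qint setT (fun x => z y x * D p x))
  (fun p y => qint setT (fun x => z y x * (D p + D' p) x)) (fun p y => qint setT (rem p y)).
move=> /(_ (fun p => measurable_cutoff_qint r mA (mD p)) (fun p => measurable_cutoff_qint r mA (mDD p)) mF).
move=> /(_ (fun p y => qint_ge0 _ _) (fun p y => qint_ge0 _ _) (fun p y => qint_ge0 _ _)).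
have fib y : (\sum_(p : II) qint setT (fun x => z y x * D p x)%R <=
   3%:E * \sum_(p : II) qint setT (fun x => z y x * (D p + D' p) x)%R + 8%:E * \sum_(p : II) qint setT (rem p y))%E.
  have E (F : II -> V -> R) : (forall p, L2 leb setT (F p)) ->
      (\sum_(p : II) qint setT (F p) = (\sum_(p : II) rq setT (F p))%:E)%E.
    by move=> LF; rewrite -sumEFin; apply: eq_bigr => p _; rewrite rqE.
  rewrite !E; [|by move=> p; exact: Lrem|by move=> p; exact: Lzf|by move=> p; exact: Lzf].
  by rewrite -!EFinM -EFinD lee_fin; exact: fiber_ineq.
move=> /(_ fib) hmain.
pose H := rq setT (tent r : V -> R).
have L1 : ((\sum_(p : II) H * rq A0 (D p))%:E <=
    \sum_(p : II) \int[leb]_y qint setT (fun x => z y x * D p x)%R)%E.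
  rewrite -sumEFin; apply: lee_sum => p _; exact: cutoff_lower.
have U1 : (\sum_(p : II) \int[leb]_y qint setT (fun x => z y x * (D p + D' p) x)%R <=
    (\sum_(p : II) H * rq A' (D p + D' p))%:E)%E.
  rewrite -sumEFin; apply: lee_sum => p _; exact: cutoff_upper.
pose Cr := (t / r) ^+ 2 * M * (4 * r) ^+ n.+1.
have U2 : (\sum_(p : II) \int[leb]_y qint setT (rem p y) <= (#|{: II}|%:R * Cr)%:E)%E.
  apply: (@le_trans _ _ (\sum_(p : II) Cr%:E)%E); first by apply: lee_sum => p _; exact: rem_bound.
  by rewrite sumEFin sumr_const mulr_natl.
have : ((\sum_(p : II) H * rq A0 (D p))%:E <=
    3%:E * (\sum_(p : II) H * rq A' (D p + D' p))%:E + 8%:E * (#|{: II}|%:R * Cr)%:E)%E.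
  apply: le_trans L1 (le_trans hmain _); apply: leeD; exact: lee_wpmul2l.
rewrite -!EFinM -EFinD lee_fin -!mulr_sumr.
set S0 := \sum_(p : II) rq A0 _; set S1 := \sum_(p : II) rq A' _.
have Hm : r ^+ n.+1 <= 4 * H by exact: tent_mass.
have rn : 0 < r ^+ n.+1 by rewrite exprn_gt0.
have H0 : 0 < H by lra.
move=> hh; rewrite -(ler_pM2l H0).
apply: le_trans hh _; rewrite mulrDr [H * (3 * _)]mulrCA lerD2l.
rewrite /Cr [(4 * r) ^+ _]exprMn.
have q0 : 0 <= 8 * (#|{: II}|%:R * ((t / r) ^+ 2 * M * 4 ^+ n.+1)) :> R.
  have a0 : 0 <= (t / r) ^+ 2 by exact: sqr_ge0.
  have b0 : 0 <= 4 ^+ n.+1 :> R by exact: exprn_ge0.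
  by do 3 apply: mulr_ge0 => //; exact: mulr_ge0.
have := ler_wpM2l q0 Hm; move: (#|_|%:R : R) ((t / r) ^+ 2) (4 ^+ n.+1 : R) (r ^+ n.+1) => a b c d.
by lra.
Qed.

End fixed.

End localized_korn.

Section neighbourhoods.
Context {R : realType} (n : nat).
Local Notation V := 'rV[R]_n.+1.
Implicit Types (A B : set V) (x z h : V) (s t a : R).

Definition nb A s : set V := \bigcup_(x in A) ball x s.

Lemma nb_open A s : open (nb A s).
Proof. by apply: bigcup_open => x _; exact: ball_open. Qed.

Lemma nb_measurable A s : measurable (nb A s).
Proof. by apply: open_measurable_rV; exact: nb_open. Qed.

Lemma nb_in A x z s : A x -> `|x - z| < s -> nb A s z.
Proof. by move=> Ax xz; exists x => //; exact/ballP. Qed.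

Lemma nb_self A s : 0 < s -> A `<=` nb A s.
Proof. by move=> s0 x Ax; exists x => //; exact: ballxx. Qed.

Lemma nb_move A s a s' z z' : nb A s z -> `|z - z'| <= a -> s + a <= s' -> nb A s' z'.
Proof.
move=> [x Ax /ballP xz] za ss; apply: (nb_in Ax).
rewrite (_ : x - z' = (x - z) + (z - z')); last by rewrite addrA subrK.
by apply: le_lt_trans (ler_normD _ _) _; apply: lt_le_trans ss; exact: ltr_leD.
Qed.

Lemma nb_shift A s s' h z : nb A s z -> s + `|h| <= s' -> nb A s' (z + h).
Proof. by move=> nz; apply: nb_move nz _; rewrite opprD addrA subrr add0r normrN. Qed.

Lemma nb_le A s s' : s <= s' -> nb A s `<=` nb A s'.
Proof. by move=> ss z [x Ax xz]; exists x => //; exact: le_ball xz. Qed.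

Lemma nb_nb A s s' t : s + t <= s' -> nb (nb A s) t `<=` nb A s'.
Proof. by move=> st z [y nby /ballP/ltW yz]; exact: nb_move nby yz st. Qed.

End neighbourhoods.

(** * Increments controlled by the strain *)

Section strain_estimates.
Context {R : realType} (n : nat).
Local Notation V := 'rV[R]_n.+1.
Local Notation leb := (lebesgue_rV n.+1).
Local Notation II := ('I_n.+1 * 'I_n.+1)%type.
Local Notation NN := (#|{: II}|%:R : R).
Implicit Types (A B : set V) (h k p : V) (s t : R).

Let hL := @L2_closed R _ _ (lebesgue_rV n.+1) _ measurableT.

Section korn_step.
Variables (Omega A : set V) (w : 'I_n.+1 -> V -> R) (g : 'I_n.+1 -> 'I_n.+1 -> V -> R).
Variables (r c M : R).
Hypotheses (r0 : 0 < r) (mA : measurable A) (c0 : 0 <= c) (M0 : 0 <= M).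
Hypothesis Lw : forall j, L2 leb setT (w j).
Hypothesis Lg : forall i j, L2 leb setT (g i j).
Hypothesis wg : forall i, weak_grad Omega (w i) (g i).
Hypothesis AO : nb A r `<=` Omega.
Hypothesis wM : forall j k, `|k| < 3 * r -> rq (nb A (2 * r)) (dif k (w j)) <= M.
Hypothesis wc : forall i j t, 0 < t < r ->
  rq (nb A (3 * r)) (dif (edir t i) (w j) + dif (edir t j) (w i)) <= t ^+ 2 * c.

(** The localized inequality with step t, divided by t^2, passes to the limit t -> 0 by
    semicontinuity; the entries of the gradient are bounded one at a time, whence the outer factor.
    It is used for the displacement and again for its increments, which is why the bounds [M] and
    [c] are left abstract. *)
Lemma korn_step : \sum_(p : II) rq A (g p.2 p.1) <=
  NN * (3 * NN * c + 32 * 4 ^+ n.+1 * NN * (M / r ^+ 2)).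
Proof.
set K := 3 * NN * c + _.
have K0 : 0 <= K.
  have h1 : 0 <= M / r ^+ 2 by rewrite divr_ge0// sqr_ge0.
  have h2 : 0 <= 4 ^+ n.+1 :> R by exact: exprn_ge0.
  by rewrite addr_ge0//; [rewrite !mulr_ge0|do 3 apply: mulr_ge0 => //].
rewrite [leRHS](_ : _ = \sum_(p : II) K); last by rewrite sumr_const mulr_natl.
apply: ler_sum => p _.
have mA1 : measurable (nb A r) by exact: nb_measurable.
apply: (@le_trans _ _ (rq (nb A r) (g p.2 p.1))).
  by apply: rq_subset => //; exact: nb_self.
rewrite -lee_fin -rqE//.
apply: (@weak_grad_lsc R n (nb A r) Omega (w p.2) (g p.2) p.1 K r) => //.
  exact: nb_open.
move=> t /andP[t0 tr].
have Ld := L2_dif (edir t p.1) (Lw p.2).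
rewrite -[X in (X <= _)%E]/(qint (nb A r) (dif (edir t p.1) (w p.2))) rqE// lee_fin.
have := @localized_korn R n r t M (nb A r) (nb A (2 * r)) (nb A (3 * r)) w t0 (ltW tr) mA1
  (nb_measurable _ _) (nb_measurable _ _) Lw.
have e1 x y : nb A r x -> `|x - y| < r -> nb A (2 * r) y.
  by move=> nx /ltW xy; apply: nb_move nx xy _; lra.
have e2 y x : nb A (2 * r) y -> `|x - y| < r -> nb A (3 * r) x.
  by move=> nx /ltW xy; rewrite distrC in xy; apply: nb_move nx xy _; lra.
move=> /(_ e1 e2 M0 wM) H.
apply: (@le_trans _ _ (\sum_(p : II) rq (nb A r) (dif (edir t p.1) (w p.2)))).
  by rewrite (bigD1 p)//= lerDl sumr_ge0// => q _; exact: rq_ge0.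
apply: le_trans H _; rewrite /K mulrDr; apply: lerD.
  have : \sum_(p : II) rq (nb A (3 * r)) (dif (edir t p.1) (w p.2) + dif (edir t p.2) (w p.1)) <=
      \sum_(p : II) t ^+ 2 * c.
    by apply: ler_sum => q _; apply: wc; rewrite t0.
  by rewrite sumr_const -mulr_natl; move: (_ ^+ 2) => t2; lra.
rewrite le_eqVlt; apply/orP; left; apply/eqP.
rewrite expr_div_n; move: (4 ^+ _) (t ^+ 2) (NN) => a b d; field.
by rewrite gt_eqF.
Qed.

End korn_step.

Section displacement.
Variables (Omega : set V) (u : 'I_n.+1 -> V -> R) (g : 'I_n.+1 -> 'I_n.+1 -> V -> R).
Hypothesis oO : open Omega.
Hypothesis Hu : forall i, H1g Omega (u i) (g i).

Let Lu i : L2 leb setT (u i). Proof. by case: (Hu i). Qed.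
Let Lg i j : L2 leb setT (g i j). Proof. by case: (Hu i). Qed.
Let wg i : weak_grad Omega (u i) (g i). Proof. by case: (Hu i). Qed.

Definition along (h : V) : V -> R := \sum_i h 0 i *: u i.

Lemma alongE h x : along h x = \sum_i h 0 i * u i x.
Proof. by rewrite /along fct_sumE. Qed.

Lemma along_edir t i x : along (edir t i) x = t * u i x.
Proof.
rewrite alongE (bigD1 i)//= big1 ?addr0; last first.
  by move=> j ji; rewrite /edir !mxE eqxx (negbTE ji) mulr0 mul0r.
by rewrite /edir !mxE !eqxx mulr1.
Qed.

Lemma alongD h k x : along (h + k) x = along h x + along k x.
Proof. by rewrite !alongE -big_split/=; apply: eq_bigr => i _; rewrite mxE mulrDl. Qed.

Lemma L2_along h : L2 leb setT (along h).
Proof. by apply: (lin_closed_sum _ hL) => i _; exact: L2_scale. Qed.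

(** As [g i j] is the j-th derivative of the i-th component, this is four times the square of the
    L^2 norm of the strain. *)
Definition strain_sq B : R := \sum_(p : II) rq B (g p.1 p.2 + g p.2 p.1).

Lemma strain_sq_ge0 B : 0 <= strain_sq B.
Proof. by apply: sumr_ge0 => p _; exact: rq_ge0. Qed.

Lemma strain_sq_subset A B : measurable A -> measurable B -> A `<=` B -> strain_sq A <= strain_sq B.
Proof. by move=> mA mB AB; apply: ler_sum => p _; apply: rq_subset => //; exact: L2_add. Qed.

Lemma weak_grad_along h : weak_grad Omega (along h) (fun j => \sum_i h 0 i *: g i j).
Proof.
rewrite /along; have : forall s : seq 'I_n.+1, weak_grad Omega (\sum_(i <- s) h 0 i *: u i)
    (fun j => \sum_(i <- s) h 0 i *: g i j).
  elim=> [|i s ih].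
    move=> j phi tphi; rewrite !big_nil.
    have hs := @L2inner_semi R _ _ (lebesgue_rV n.+1) _ measurableT.
    have Lphi : L2 leb setT phi by exact: test_function_L2 tphi.
    have Ldphi : L2 leb setT (pderiv j phi).
      by apply: (test_function_L2 (A := Omega)) => //; exact: test_function_pderiv.
    by rewrite !(semi_inner0l hL hs)// oppr0.
  have -> : (fun j => \sum_(i <- i :: s) h 0 i *: g i j) =
      (fun j => h 0 i *: g i j + (\sum_(i <- s) h 0 i *: g i j)).
    by apply/funext => j; rewrite big_cons.
  rewrite big_cons; apply: weak_grad_lin => //.
  - by apply: (lin_closed_sum _ hL) => j _; exact: L2_scale.
  - by move=> j; apply: (lin_closed_sum _ hL) => k _; exact: L2_scale.
exact.
Qed.

(** The derivative along h of the scalar function h.u is the quadratic form of the gradient at h,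
    which sees only the symmetric part. *)
Lemma strain_dif A B h : open A -> measurable B -> B `<=` Omega ->
  (forall x (t : R), A x -> 0 <= t <= 1 -> B (x + t *: h)) ->
  rq A (dif h (along h)) <= NN * `|h| ^+ 4 * strain_sq B.
Proof.
move=> oA mB BO seg; have mA := open_measurable_rV oA.
pose gh j := \sum_i h 0 i *: g i j.
have Lgh j : L2 leb setT (gh j) by apply: (lin_closed_sum _ hL) => i _; exact: L2_scale.
pose f := \sum_j h 0 j *: gh j.
have Lf : L2 leb setT f by apply: (lin_closed_sum _ hL) => i _; exact: L2_scale.
apply: (@le_trans _ _ (rq B f)).
  have Ld := L2_dif h (L2_along h).
  rewrite -lee_fin -!rqE//.
  exact: (difference_estimate oA mB (L2_along h) Lgh (weak_grad_along h) BO seg).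
have fE x : f x = \sum_(p : II) 2^-1 * (h 0 p.1 * h 0 p.2) * (g p.1 p.2 + g p.2 p.1) x.
  have S1 : f x = \sum_(p : II) h 0 p.1 * h 0 p.2 * g p.2 p.1 x.
    rewrite /f fct_sumE -(pair_bigA _ (fun i j => h 0 i * h 0 j * g j i x))/=.
    apply: eq_bigr => j _; rewrite -[LHS]/(h 0 j * gh j x) /gh fct_sumE mulr_sumr.
    by apply: eq_bigr => i _; rewrite -mulrA.
  have S2 : f x = \sum_(p : II) h 0 p.1 * h 0 p.2 * g p.1 p.2 x.
    rewrite S1 -(pair_bigA _ (fun i j => h 0 i * h 0 j * g j i x))/= exchange_big/=.
    rewrite (pair_bigA _ (fun j i => h 0 i * h 0 j * g j i x))/=.
    by apply: eq_bigr => p _; rewrite [h 0 p.2 * _]mulrC.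
  rewrite [LHS](_ : _ = 2^-1 * (f x + f x)); last by field.
  rewrite {1}S1 S2 -big_split/= mulr_sumr; apply: eq_bigr => p _.
  by rewrite [(g p.1 p.2 + g p.2 p.1) x](_ : _ = g p.1 p.2 x + g p.2 p.1 x)//; ring.
rewrite /strain_sq mulr_sumr; apply: rq_sum_le => //.
- by move=> p; exact: L2_add.
move=> x _; rewrite fE; apply: le_trans (sqr_sum_le _) _.
rewrite mulr_sumr; apply: ler_sum => p _; rewrite exprMn mulrA ler_wpM2r ?sqr_ge0//.
rewrite ler_wpM2l// exprMn.
have h1 : `|h 0 p.1 * h 0 p.2| <= `|h| ^+ 2.
  by rewrite normrM expr2 ler_pM// norm_coord_le.
have h2 : (h 0 p.1 * h 0 p.2) ^+ 2 <= `|h| ^+ 4.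
  rewrite -[leLHS]real_normK ?num_real// (_ : 4 = 2 * 2)%N// exprM.
  by rewrite lerXn2r// nnegrE sqr_ge0.
have := sqr_ge0 (h 0 p.1 * h 0 p.2); move: h2; move: (_ ^+ 2) (_ ^+ 4) => a b.
lra.
Qed.

Definition mixed (h p : V) := dif p (along h) + dif h (along p).

Lemma L2_mixed h p : L2 leb setT (mixed h p).
Proof. by apply: L2_add; apply: L2_dif; exact: L2_along. Qed.

(* Polarization of h |-> D_h (h.u). *)
Lemma mixedE h p x : mixed h p x = dif (h + p) (along (h + p)) x -
  (dif h (along h) (x + p) + dif p (along p) (x + h)).
Proof.
rewrite /mixed -[LHS]/(dif p (along h) x + dif h (along p) x) /dif !alongD.
rewrite (_ : x + p + h = x + (h + p)); last by rewrite -addrA [p + h]addrC.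
by rewrite -[x + h + p]addrA; ring.
Qed.

(** Polarization leaves three instances of [strain_dif], one with a step of length at most 2s and
    two with steps of length at most s; 54 is 3 (16 + 1 + 1). *)
Lemma mixed_bound A B s h p : 0 < s -> open A -> measurable B -> B `<=` Omega ->
  `|h| <= s -> `|p| <= s -> nb A (4 * s) `<=` B ->
  rq A (mixed h p) <= 54 * NN * s ^+ 4 * strain_sq B.
Proof.
move=> s0 oA mB BO hs ps nB; have mA := open_measurable_rV oA.
have EB0 := strain_sq_ge0 B.
have LS k : L2 leb setT (dif k (along k)) by apply: L2_dif; exact: L2_along.
have S1 k a D : open D -> `|k| <= a -> (forall x, D x -> nb A (2 * s) x) -> a <= 2 * s ->
    rq D (dif k (along k)) <= NN * a ^+ 4 * strain_sq B.
  move=> oD ka DA as2; apply: le_trans (strain_dif oD mB BO _) _.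
    move=> x t Dx /andP[t0 t1]; apply: nB; apply: (nb_shift (DA x Dx)).
    rewrite normrZ ger0_norm//; have : t * `|k| <= `|k| by rewrite ler_piMl.
    by move: ka as2; move: `|k| => nk; lra.
  rewrite ler_wpM2r// ler_wpM2l//; apply: lerXn2r => //; rewrite nnegrE//.
  exact: le_trans ka.
have s2 : 0 < 2 * s by lra.
have h1 : rq A (dif (h + p) (along (h + p))) <= NN * (2 * s) ^+ 4 * strain_sq B.
  apply: S1 => //; last by move=> x Ax; exact: (nb_self s2 Ax).
  by apply: le_trans (ler_normD _ _) _; lra.
have h2 a b : `|a| <= s -> `|b| <= s ->
    rq A (fun x => dif a (along a) (x + b)) <= NN * s ^+ 4 * strain_sq B.
  move=> as' bs; apply: (@le_trans _ _ (rq (nb A (2 * s)) (dif a (along a)))).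
    apply: rq_shift => //; first exact: nb_measurable.
    move=> x Ax; apply: (nb_in Ax); rewrite opprD addrA subrr add0r normrN.
    by apply: le_lt_trans bs _; lra.
  by apply: S1 => //; [exact: nb_open|lra].
pose F (i : 'I_3) : V -> R := match val i with
  | 0%N => dif (h + p) (along (h + p)) | 1%N => fun x => dif h (along h) (x + p)
  | _ => fun x => dif p (along p) (x + h) end.
have LF i : L2 leb setT (F i).
  by rewrite /F; case: (val i) => [|[|_]] //; exact: L2_translation.
have := @rq_sum_le R n 'I_3 A (mixed h p) F (fun=> 3) mA (L2_mixed h p) LF.
rewrite !big_ord_recl big_ord0 addr0 /F /= => H.
have {}H := H (fun=> ler0n _ 3); apply: le_trans (H _) _.
  move=> x _; rewrite !big_ord_recl big_ord0 addr0 /= mixedE.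
  set a := dif _ _ _; set b := dif _ _ _; set c := dif _ _ _.
  by have := sqr_ge0 (a + b); have := sqr_ge0 (a + c); have := sqr_ge0 (b - c); lra.
have h3 := h2 h p hs ps; have h4 := h2 p h ps hs.
move: h1; rewrite exprMn => h1.
have e16 : 2 ^+ 4 = 16 :> R by rewrite -natrX.
rewrite e16 in h1; lra.
Qed.

(* With E(h, p) = D_p (h.u) + D_h (p.u),
   2 D_k D_h (p.u) = D_k E(h, p) - D_p E(k, h) + D_h E(p, k). *)
Lemma second_dif_bound A B s k h j : 0 < s -> open A -> measurable B -> B `<=` Omega ->
  `|k| <= s -> `|h| <= s -> nb A (6 * s) `<=` B ->
  rq A (dif k (dif h (u j))) <= 486 * NN * s ^+ 2 * strain_sq B.
Proof.
move=> s0 oA mB BO ks hs nB; have mA := open_measurable_rV oA.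
(* For this p, the function p.u is s times u_j, so the identity computes 2 s times the second
   difference of u_j. Each of the three terms costs 3 for the square of the sum and 4 for the outer
   difference: 486 is 3 * 3 * 4 * 54 / 4. *)
pose p := edir s j; have ps : `|p| <= s by rewrite norm_edir gtr0_norm.
pose A2 := nb A (2 * s); have mA2 : measurable A2 by exact: nb_measurable.
have EB0 := strain_sq_ge0 B.
have AA2 : A `<=` A2 by apply: nb_self; lra.
have hE a b c : `|a| <= s -> `|b| <= s -> `|c| <= s ->
    rq A (dif c (mixed a b)) <= 4 * (54 * NN * s ^+ 4 * strain_sq B).
  move=> as' bs cs; apply: le_trans (rq_dif_le mA mA2 (L2_mixed a b) AA2 _) _.
    move=> x Ax; apply: (nb_in Ax); rewrite opprD addrA subrr add0r normrN.
    by apply: le_lt_trans cs _; lra.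
  rewrite ler_wpM2l//; apply: mixed_bound => //; first exact: nb_open.
  by apply: subset_trans nB; apply: nb_nb; lra.
have Ldd : L2 leb setT (dif k (dif h (u j))) by do 2 apply: L2_dif.
have Lddp : L2 leb setT ((2 * s) *: dif k (dif h (u j))) by exact: L2_scale.
pose F (i : 'I_3) : V -> R := match val i with
  | 0%N => dif k (mixed h p) | 1%N => dif p (mixed k h) | _ => dif h (mixed p k) end.
have LF i : L2 leb setT (F i).
  by rewrite /F; case: (val i) => [|[|_]]; apply: L2_dif; exact: L2_mixed.
have := @rq_sum_le R n 'I_3 A _ F (fun=> 3) mA Lddp LF.
rewrite !big_ord_recl big_ord0 addr0 /F /= => H.
have {}H := H (fun=> ler0n _ 3).
have {}H : rq A ((2 * s) *: dif k (dif h (u j))) <=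
    3 * rq A (dif k (mixed h p)) + (3 * rq A (dif p (mixed k h)) + 3 * rq A (dif h (mixed p k))).
  apply: H => x _; rewrite !big_ord_recl big_ord0 addr0 /=.
  have -> : ((2 * s) *: dif k (dif h (u j))) x =
      dif k (mixed h p) x - dif p (mixed k h) x + dif h (mixed p k) x.
    rewrite -[LHS]/(2 * s * dif k (dif h (u j)) x).
    have mE a b y : mixed a b y = dif b (along a) y + dif a (along b) y by [].
    have -> : 2 * s * dif k (dif h (u j)) x = 2 * dif k (dif h (along p)) x.
      by rewrite /dif !along_edir; ring.
    rewrite /dif !mE /dif.
    rewrite (_ : x + k + p = x + p + k); last by rewrite addrAC.
    rewrite (_ : x + h + p = x + p + h); last by rewrite addrAC.
    rewrite (_ : x + h + k = x + k + h); last by rewrite addrAC.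
    by ring.
  set a := dif _ _ _; set b := dif _ _ _; set c := dif _ _ _.
  by have := sqr_ge0 (a + b); have := sqr_ge0 (a - c); have := sqr_ge0 (b + c); lra.
have h1 := hE h p k hs ps ks; have h2 := hE k h p ks hs ps; have h3 := hE p k h ps ks hs.
have h4 : (2 * s) ^+ 2 * rq A (dif k (dif h (u j))) <= rq A ((2 * s) *: dif k (dif h (u j))).
  have s20 : 2 * s != 0 by rewrite gt_eqF// mulr_gt0.
  have h5 : rq A (dif k (dif h (u j))) <= ((2 * s) ^- 2) * rq A ((2 * s) *: dif k (dif h (u j))).
    apply: rq_le => //; first by rewrite invr_ge0 sqr_ge0.
    move=> x _; rewrite -[((2 * s) *: _) x]/(2 * s * dif k (dif h (u j)) x).
    move: (dif k _ x) (2 * s) s20 => a b b0.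
    by rewrite [(b * a) ^+ 2]exprMn mulrA mulVf ?mul1r// expf_neq0.
  by rewrite -ler_pdivlMl// exprn_gt0// mulr_gt0.
have s2 : 0 < s ^+ 2 by rewrite exprn_gt0.
have {}h4 : (2 * s) ^+ 2 * rq A (dif k (dif h (u j))) <= 36 * (54 * NN * s ^+ 4 * strain_sq B) by lra.
rewrite exprMn (_ : s ^+ 4 = s ^+ 2 * s ^+ 2) in h4; last by rewrite -exprD.
rewrite -(ler_pM2l s2).
have e4 : 2 ^+ 2 = 4 :> R by rewrite -natrX.
rewrite e4 in h4; lra.
Qed.

Lemma mixed_edir_bound A B t i j : 0 < t -> open A -> measurable B -> B `<=` Omega ->
  nb A (4 * t) `<=` B ->
  rq A (dif (edir t i) (u j) + dif (edir t j) (u i)) <= t ^+ 2 * (54 * NN * strain_sq B).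
Proof.
move=> t0 oA mB BO nB; have mA := open_measurable_rV oA.
have nt (l : 'I_n.+1) : `|edir t l : V| <= t by rewrite norm_edir gtr0_norm.
have H := mixed_bound t0 oA mB BO (nt j) (nt i) nB.
have t2 : 0 < t ^+ 2 by rewrite exprn_gt0.
have LX : L2 leb setT (dif (edir t i) (u j) + dif (edir t j) (u i)).
  by apply: L2_add; exact: L2_dif.
have : rq A (dif (edir t i) (u j) + dif (edir t j) (u i)) <=
    t ^- 2 * rq A (mixed (edir t j) (edir t i)).
  apply: rq_le => //; first exact: L2_mixed.
    by rewrite invr_ge0 ltW.
  move=> x _; have -> : mixed (edir t j) (edir t i) x =
      t * (dif (edir t i) (u j) + dif (edir t j) (u i)) x.
    rewrite /mixed -[LHS]/(dif (edir t i) (along (edir t j)) x + dif (edir t j) (along (edir t i)) x).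
    rewrite -[X in _ = _ * X]/(dif (edir t i) (u j) x + dif (edir t j) (u i) x).
    by rewrite /dif !along_edir; ring.
  by rewrite exprMn mulrA mulVf ?mul1r// gt_eqF.
move=> /le_trans; apply; rewrite -ler_pdivlMl ?invr_gt0// invrK.
by apply: le_trans H _; rewrite (_ : t ^+ 4 = t ^+ 2 * t ^+ 2) -?exprD//; lra.
Qed.

Let C0 : R := 32 * 4 ^+ n.+1 * NN.

(** Here [korn_step] is applied to u, with its increments bounded crudely by u itself; this is the
    source of the lower order term and of the factor r^-2. *)
Lemma interior_korn A B r : 0 < r -> measurable A -> measurable B -> B `<=` Omega ->
  nb A (8 * r) `<=` B ->
  \sum_(p : II) rq A (g p.2 p.1) <=
  NN * (3 * NN * (54 * NN * strain_sq B) + C0 * (4 * (\sum_j rq B (u j)) / r ^+ 2)).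
Proof.
move=> r0 mA mB BO nB; have u0 : 0 <= \sum_j rq B (u j) by apply: sumr_ge0 => j _; exact: rq_ge0.
apply: (@korn_step Omega) => //.
- by rewrite !mulr_ge0// strain_sq_ge0.
- by rewrite mulr_ge0.
- by apply: subset_trans BO; apply: subset_trans nB; apply: nb_le; lra.
- move=> j k kr.
  apply: (@le_trans _ _ (4 * rq B (u j))); last first.
    by rewrite ler_wpM2l// (bigD1 j)//= lerDl sumr_ge0// => i _; exact: rq_ge0.
  apply: rq_dif_le => //; first exact: nb_measurable.
    by apply: subset_trans nB; apply: nb_le; lra.
  by move=> x nx; apply: nB; apply: nb_shift nx _; lra.
- move=> i j t /andP[t0 tr]; apply: mixed_edir_bound => //; first exact: nb_open.
  by apply: subset_trans nB; apply: nb_nb; lra.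
Qed.

(** Here [korn_step] is applied to the increment of u along h. Its own increments are second
    differences, bounded by the strain with a factor s^2 that cancels the s^-2 of the cut-off: no
    lower order term appears and the constant does not depend on s. The numbers are 216 = 4 * 54 and
    4374 = 9 * 486. *)
Lemma layer_korn A B h s : 0 < s -> `|h| <= s -> measurable A -> measurable B -> B `<=` Omega ->
  nb A (20 * s) `<=` B ->
  \sum_(p : II) rq A (dif h (g p.2 p.1)) <=
  NN * (3 * NN * (216 * NN) + C0 * (4374 * NN)) * strain_sq B.
Proof.
move=> s0 hs mA mB BO nB; have E0 := strain_sq_ge0 B.
have s2 : 0 < s ^+ 2 by rewrite exprn_gt0.
pose M := 486 * NN * (3 * s) ^+ 2 * strain_sq B.
apply: le_trans (_ : _ <= NN * (3 * NN * (216 * NN * strain_sq B) + C0 * (M / s ^+ 2))) _; last first.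
  rewrite /M exprMn (_ : 3 ^+ 2 = 9 :> R); last by rewrite -natrX.
  rewrite le_eqVlt; apply/orP; left; apply/eqP.
  by move: (NN) => d; field; rewrite gt_eqF.
apply: (@korn_step (nb A s) A (fun j => dif h (u j)) (fun i j => dif h (g i j))) => //.
- by rewrite !mulr_ge0.
- have s32 : 0 <= (3 * s) ^+ 2 by exact: sqr_ge0.
  rewrite /M; move: (ler0n R 486) (ler0n R #|{: II}|) s32 E0.
  move: (486 : R) (NN) ((3 * s) ^+ 2) (strain_sq B) => a b c d a0 b0 c0 d0.
  by rewrite !mulr_ge0.
- by move=> j; exact: L2_dif.
- by move=> i j; exact: L2_dif.
- move=> i.
  have sub : nb A s `<=` Omega.
    by apply: subset_trans BO; apply: subset_trans nB; apply: nb_le; lra.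
  have w1 := weak_grad_sub sub (wg i).
  have sub2 x : nb A s x -> Omega (x + h).
    by move=> nx; apply: BO; apply: nB; apply: nb_shift nx _; lra.
  have w2 := weak_grad_translation (Lu i) (Lg i) (wg i) sub2.
  have := weak_grad_lin (-1) (Lu i) (L2_translation h (Lu i)) (Lg i)
    (fun j => L2_translation h (Lg i j)) w1 w2.
  have E f : -1 *: f + (fun x : V => f (x + h)) = dif h f.
    by apply/funext => x; rewrite scaleN1r /dif addrC.
  rewrite E; congr weak_grad; by apply/funext => j; rewrite E.
- move=> j k ks; apply: second_dif_bound => //; [by lra|exact: nb_open|exact: ltW|by lra|].
  by apply: subset_trans nB; apply: nb_nb; lra.
- move=> i j t /andP[t0 ts].
  have Lx : L2 leb setT (dif (edir t i) (u j) + dif (edir t j) (u i)).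
    by apply: L2_add; exact: L2_dif.
  have -> : dif (edir t i) (dif h (u j)) + dif (edir t j) (dif h (u i)) =
      dif h (dif (edir t i) (u j) + dif (edir t j) (u i)).
    apply/funext => x; rewrite difD.
    rewrite -[LHS]/(dif (edir t i) (dif h (u j)) x + dif (edir t j) (dif h (u i)) x) /dif.
    rewrite (_ : x + edir t i + h = x + h + edir t i); last by rewrite addrAC.
    rewrite (_ : x + edir t j + h = x + h + edir t j); last by rewrite addrAC.
    by ring.
  have n5 : nb A (3 * s) `<=` nb A (5 * s) by apply: nb_le; lra.
  apply: le_trans (rq_dif_le (nb_measurable _ _) (nb_measurable A (5 * s)) Lx n5 _) _.
    by move=> x nx; apply: nb_shift nx _; lra.
  have nB' : nb (nb A (5 * s)) (4 * t) `<=` B.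
    by apply: subset_trans nB; apply: nb_nb; lra.
  have := mixed_edir_bound i j t0 (@nb_open _ _ A (5 * s)) mB BO nB'.
  lra.
Qed.

End displacement.

End strain_estimates.

Section korn_inequality.
Context {R : realType} (n : nat).
Local Notation V := 'rV[R]_n.+1.
Local Notation leb := (lebesgue_rV n.+1).
Local Notation II := ('I_n.+1 * 'I_n.+1)%type.
Local Notation NN := (#|{: II}|%:R : R).
Implicit Types (A B X Y Omega : set V) (f : V -> R) (h : V) (s t a b : R).
Implicit Types (u : 'I_n.+1 -> V -> R) (g : 'I_n.+1 -> 'I_n.+1 -> V -> R).

Lemma rq_setU X Y f : measurable X -> measurable Y -> L2 leb setT f -> X `&` Y = set0 ->
  rq (X `|` Y) f = rq X f + rq Y f.
Proof.
move=> mX mY Lf XY; apply: EFin_inj; rewrite EFinD -!rqE//; last exact: measurableU.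
have [mf _] := Lf; rewrite /qint ge0_integral_setU//.
- by apply: measurable_sqrE; exact: measurable_funTS.
- by move=> x _; rewrite lee_fin sqr_ge0.
- exact/disj_set2P.
Qed.

Definition grad_sq g X : R := \sum_(p : II) rq X (g p.2 p.1).

Lemma grad_sq_ge0 g X : 0 <= grad_sq g X.
Proof. by apply: sumr_ge0 => p _; exact: rq_ge0. Qed.

Lemma grad_sq_subset g X Y : (forall i j, L2 leb setT (g i j)) -> measurable X -> measurable Y ->
  X `<=` Y -> grad_sq g X <= grad_sq g Y.
Proof. by move=> Lg mX mY XY; apply: ler_sum => p _; exact: rq_subset. Qed.

Lemma grad_sq_setU g X Y : (forall i j, L2 leb setT (g i j)) -> measurable X -> measurable Y ->
  X `&` Y = set0 -> grad_sq g (X `|` Y) = grad_sq g X + grad_sq g Y.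
Proof. by move=> Lg mX mY XY; rewrite /grad_sq -big_split/=; apply: eq_bigr => p _; exact: rq_setU. Qed.

Lemma strain_sq_setU g X Y : (forall i j, L2 leb setT (g i j)) -> measurable X -> measurable Y ->
  X `&` Y = set0 -> strain_sq g (X `|` Y) = strain_sq g X + strain_sq g Y.
Proof.
move=> Lg mX mY XY; rewrite /strain_sq -big_split/=; apply: eq_bigr => p _; apply: rq_setU => //.
exact: L2_add.
Qed.

Lemma dif_iter f h m x : dif (m%:R *: h) f x = \sum_(l < m) dif h f (x + l%:R *: h).
Proof.
elim: m => [|m ih]; first by rewrite big_ord0 /dif scale0r addr0 subrr.
rewrite big_ord_recr/= -ih /dif.
have -> : x + m.+1%:R *: h = x + m%:R *: h + h by rewrite -natr1 scalerDl scale1r addrA.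
ring.
Qed.

Lemma rq_dif_iter A B f h m : measurable A -> measurable B -> L2 leb setT f ->
  (forall l x, (l < m)%N -> A x -> B (x + l%:R *: h)) ->
  rq A (dif (m%:R *: h) f) <= m%:R ^+ 2 * rq B (dif h f).
Proof.
move=> mA mB Lf AB.
have := @rq_sum_le R n 'I_m A (dif (m%:R *: h) f) (fun l x => dif h f (x + l%:R *: h)) (fun=> m%:R) mA.
move=> /(_ (L2_dif _ Lf) (fun l => L2_translation _ (L2_dif h Lf)) (fun=> ler0n _ _)) H.
apply: le_trans (H _) _.
  move=> x _; rewrite dif_iter; apply: le_trans (sqr_sum_le _) _.
  by rewrite card_ord mulr_sumr.
rewrite expr2 -mulrA -mulr_sumr ler_wpM2l//.
apply: (@le_trans _ _ (\sum_(l < m) rq B (dif h f))); last by rewrite sumr_const card_ord mulr_natl.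
apply: ler_sum => l _; apply: rq_shift => //; first exact: L2_dif.
by move=> x Ax; exact: AB.
Qed.

(** * Dyadic layers at the boundary *)

Section boundary_layer.
Variables (Omega : set V) (x0 : V) (d : V -> R) (e : V) (L r : R).
Hypothesis oO : open Omega.
Hypothesis ch : is_chart Omega x0 d e L r.

Let L1 : 1 <= L := chart_Lge1 ch.
Let L0 : 0 < L := lt_le_trans ltr01 L1.
Let r0 : 0 < r := chart_rgt0 ch.
Let mO : measurable Omega := open_measurable_rV oO.

Let foot (x : V) : V := x - d x *: e.

Let footl x t : foot (x + t *: e) = foot x.
Proof. by rewrite /foot (chart_line ch); apply/rowP => i; rewrite !mxE; ring. Qed.

Let md : measurable_fun setT d.
Proof.
apply: continuous_measurable_rV => x A /nbhs_ballP[eps /= eps0 hA].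
apply/nbhs_ballP; exists (eps / L) => /=; first by rewrite divr_gt0.
move=> y /ballP xy; apply: hA; rewrite /ball /=.
by apply: le_lt_trans (chart_lip ch x y) _; rewrite mulrC -ltr_pdivlMr.
Qed.

Let mfoot : measurable_fun setT foot.
Proof.
apply: measurable_fun_rV => i.
have -> : rV_coord i \o foot = fun x => (rV_coord i x : R) - d x * e 0 i.
  by apply/funext => x; rewrite /rV_coord /foot /= !mxE.
apply: measurable_funB; first exact: measurable_rV_coord.
by apply: measurable_funM.
Qed.

(** The foot of x is its projection along [e] on the graph, invariant under motions along [e].
    Cutting slabs out by the foot point makes them exact translates of one another; the bands, cut
    out by the chart ball, contain neighbourhoods of slabs. *)
Definition slab a b : set V := [set x | `|foot x - x0| < r / 4 /\ a < d x <= b].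
Definition band a b : set V := [set x | ball x0 r x /\ a < d x <= b].

Let m_between a b : measurable [set x | a < d x <= b].
Proof.
have := md measurableT (measurable_itv `]a, b]); rewrite setTI.
by congr measurable; apply/seteqP; split => x /=; rewrite in_itv.
Qed.

Lemma measurable_slab a b : measurable (slab a b).
Proof.
have -> : slab a b = foot @^-1` (ball x0 (r / 4)) `&` [set x | a < d x <= b].
  by apply/seteqP; split => x [h1 h2]; split => //; [apply/ballP|move/ballP: h1]; rewrite distrC.
apply: measurableI; last exact: m_between.
have := mfoot measurableT (measurable_ball_rV x0 (r / 4)).
by rewrite setTI.
Qed.

Lemma measurable_band a b : measurable (band a b).
Proof. by apply: measurableI; [exact: measurable_ball_rV|exact: m_between]. Qed.

Lemma band_sub a b : 0 <= a -> band a b `<=` Omega.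
Proof. by move=> a0 x [bx /andP[ad _]]; apply/(chart_iff ch bx); exact: le_lt_trans ad. Qed.

Lemma slab_shift a b a' b' t x : slab a b x -> a' <= a + t -> b + t <= b' ->
  slab a' b' (x + t *: e).
Proof.
by move=> [fx /andP[ax xb]] h1 h2; split; rewrite ?footl// (chart_line ch); apply/andP; split; lra.
Qed.

(** Slabs are used up to height 4 s0, where a point is at distance at most 4 s0 L = r/4 from its
    foot and hence well inside the chart ball. *)
Let s0 := r / (16 * L).
Let s00 : 0 < s0. Proof. by rewrite divr_gt0// mulr_gt0. Qed.
Let s0L : s0 * L = r / 16. Proof. by rewrite /s0; field; rewrite gt_eqF. Qed.

Lemma slab_nb a : 0 < a <= s0 -> nb (slab a (4 * a)) (a / (2 * L)) `<=` band (a / 2) (8 * a).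
Proof.
move=> /andP[a0 as0] z [x [fx /andP[ax xa]] /ballP xz].
have E : L * (a / (2 * L)) = a / 2 by field; rewrite gt_eqF.
have h1 : `|d x - d z| <= a / 2.
  apply: le_trans (chart_lip ch x z) _; rewrite -E.
  by apply: ler_wpM2l; [exact: ltW|exact: ltW].
have : a / (2 * L) <= a / 2.
  by rewrite ler_pM2l// lef_pV2 ?posrE ?mulr_gt0//; move: L1; lra.
move=> aL; split; last first.
  by move: h1; rewrite ler_norml => /andP[h1 h2]; apply/andP; split; lra.
apply/ballP.
have -> : x0 - z = - (foot x - x0) - d x *: e + (x - z).
  by rewrite /foot; apply/rowP => i; rewrite !mxE; ring.
have h2 : `|d x *: e| <= r / 4.
  rewrite normrZ; apply: (@le_trans _ _ (4 * s0 * L)); last by rewrite -mulrA s0L; lra.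
  apply: ler_pM => //; last exact: chart_dir ch.
  by rewrite gtr0_norm; lra.
have as16 : a <= r / 16.
  by rewrite -s0L; apply: le_trans as0 _; rewrite ler_peMr// ltW.
apply: le_lt_trans (ler_normD _ _) _.
have := ler_normB (- (foot x - x0)) (d x *: e); rewrite normrN.
move: fx h2 xz as16 aL.
move: `|foot x - x0| `|_ *: e| `|x - z| `|_ - _| (a / (2 * L)) => q1 q2 q3 q4 q5.
by move: r0; lra.
Qed.

(** The number of steps into which a motion by a e is divided: each step is at most a L / m <= a /
    (40 L) long, and 20 times this is the radius of the neighbourhood in [slab_nb]. *)
Let m : nat := Num.Def.archi_bound (40 * L ^+ 2).
Let mL : 40 * L ^+ 2 <= m%:R.
Proof. by apply/ltW/archi_boundP; rewrite mulr_ge0// sqr_ge0. Qed.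
Let m0 : 0 < m%:R :> R.
Proof. by apply: lt_le_trans mL; rewrite mulr_gt0// exprn_gt0. Qed.

Let CL : R := NN * (3 * NN * (216 * NN) + 32 * 4 ^+ n.+1 * NN * (4374 * NN)).

Let CL0 : 0 <= CL.
Proof.
rewrite /CL; move: (ler0n R #|{: II}|) (ler0n R 216) (ler0n R 4374) (ler0n R 32).
have := exprn_ge0 n.+1 (ler0n R 4); move: (216 : R) (4374 : R) (32 : R) (NN) (4 ^+ n.+1).
move=> a b c q w w0 q0 a0 b0 c0; rewrite mulr_ge0// addr_ge0// !mulr_ge0//.
Qed.

Section fields.
Variables (u : 'I_n.+1 -> V -> R) (g : 'I_n.+1 -> 'I_n.+1 -> V -> R).
Hypothesis Hu : forall i, H1g Omega (u i) (g i).
Let Lu i : L2 leb setT (u i). Proof. by case: (Hu i). Qed.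
Let Lg i j : L2 leb setT (g i j). Proof. by case: (Hu i). Qed.

(** A motion by up to 2 a e is too long for [layer_korn] at height a; it is divided into short steps
    inside the slab of heights a to 4a, at the price of the square of their number. *)
Let Em a : 0 < a <= s0 -> forall M, (M <= 2 * m)%N ->
  \sum_(p : II) rq (slab a (2 * a)) (dif (M%:R *: ((a / m%:R) *: e)) (g p.2 p.1)) <=
  (2 * m)%:R ^+ 2 * (CL * strain_sq g (band (a / 2) (8 * a))).
Proof.
move=> as0 M Mm; have /andP[a0 _] := as0.
pose h := (a / m%:R) *: e.
pose sl := slab a (4 * a); have msl : measurable sl by exact: measurable_slab.
have am0 : 0 < a / m%:R by rewrite divr_gt0.
have H : \sum_(p : II) rq sl (dif h (g p.2 p.1)) <= CL * strain_sq g (band (a / 2) (8 * a)).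
  apply: (@layer_korn R n Omega u g Hu sl (band (a / 2) (8 * a)) h (a / (40 * L))) => //.
  - by rewrite divr_gt0// mulr_gt0.
  - rewrite /h normrZ gtr0_norm//.
    have h1 : a / m%:R * `|e| <= a / m%:R * L by rewrite ler_pM2l// (chart_dir ch).
    apply: le_trans h1 _.
    rewrite -mulrA ler_wpM2l ?(ltW a0)// mulrC ler_pdivrMr// [leRHS]mulrC ler_pdivlMr ?mulr_gt0//.
    rewrite (_ : L * (40 * L) = 40 * L ^+ 2); last by rewrite expr2; ring.
    exact: mL.
  - exact: measurable_band.
  - by apply: band_sub; rewrite divr_ge0// ltW.
  - have := slab_nb as0; rewrite (_ : 20 * (a / (40 * L)) = a / (2 * L))//.
    by field; rewrite gt_eqF.
apply: (@le_trans _ _ ((2 * m)%:R ^+ 2 * \sum_(p : II) rq sl (dif h (g p.2 p.1)))); last first.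
  by rewrite ler_wpM2l// sqr_ge0.
rewrite mulr_sumr; apply: ler_sum => p _.
apply: le_trans (@rq_dif_iter (slab a (2 * a)) sl (g p.2 p.1) h M _ _ _ _) _ => //.
- exact: measurable_slab.
- move=> l x lM sx; rewrite /h scalerA; apply: (slab_shift sx).
    by rewrite lerDl mulr_ge0// ltW.
  have : l%:R * (a / m%:R) <= 2 * a.
    rewrite mulrCA mulrC; apply: ler_wpM2r; first exact: ltW.
    by rewrite ler_pdivrMr// -natrM ler_nat (leq_trans (ltnW lM)).
  by lra.
by rewrite ler_wpM2r ?rq_ge0// lerXn2r ?nnegrE// ler_nat.
Qed.

Let CE : R := 3 * ((2 * m)%:R ^+ 2 * CL).

Let CE0 : 0 <= CE.
Proof. by rewrite /CE mulr_ge0// mulr_ge0// sqr_ge0. Qed.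

(* The layer moved along [e] by a and by 2 a fills the two halves of the next one. *)
Lemma layer_decay a : 0 < a <= s0 ->
  grad_sq g (slab a (2 * a)) <=
  3 / 4 * grad_sq g (slab (2 * a) (4 * a)) + CE * strain_sq g (band (a / 2) (8 * a)).
Proof.
move=> as0; have /andP[a0 _] := as0.
have mS := measurable_slab.
have onestep (M : nat) c b : (M * m <= 2 * m)%N -> c = M%:R * a + a -> b = M%:R * a + 2 * a ->
    grad_sq g (slab a (2 * a)) <= 3 / 2 * grad_sq g (slab c b) + CE * strain_sq g (band (a / 2) (8 * a)).
  move=> Mm cE bE; have := Em as0 Mm.
  have hE : (M * m)%:R *: ((a / m%:R) *: e) = (M%:R * a) *: e.
    by rewrite scalerA natrM; congr (_ *: _); field; rewrite gt_eqF.
  rewrite hE => H.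
  apply: (@le_trans _ _ (3 / 2 * grad_sq g (slab c b) +
      3 * \sum_(p : II) rq (slab a (2 * a)) (dif ((M%:R * a) *: e) (g p.2 p.1)))); last first.
    by rewrite lerD2l /CE -mulrA ler_wpM2l// -mulrA.
  rewrite /grad_sq !mulr_sumr -big_split/=; apply: ler_sum => p _.
  have Lt := L2_translation ((M%:R * a) *: e) (Lg p.2 p.1).
  apply: (@le_trans _ _ (3 / 2 * rq (slab a (2 * a)) (fun x => g p.2 p.1 (x + (M%:R * a) *: e)) +
      3 * rq (slab a (2 * a)) (dif ((M%:R * a) *: e) (g p.2 p.1)))).
    apply: rq_le2 => //; first exact: L2_dif.
    (* The inequality is z^2 <= 3/2 y^2 + 3 (y - z)^2; the weights are chosen so that half of 3/2 is
       below 1. *)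
    move=> x _; rewrite /dif; set y := g _ _ (x + _); set z := g _ _ x.
    by have := sqr_ge0 (y + 2 * (y - z)); lra.
  rewrite lerD2r ler_wpM2l//; apply: rq_shift => //.
  by move=> x sx; apply: (slab_shift sx); lra.
(* The mean of the two estimates halves 3/2 to 3/4, since the target slabs are disjoint; a single
   translate would not give a factor below 1. *)
have h1 := onestep 1%N (2 * a) (3 * a) _ _ _; have h2 := onestep 2%N (3 * a) (4 * a) _ _ _.
have {}h1 : grad_sq g (slab a (2 * a)) <=
    3 / 2 * grad_sq g (slab (2 * a) (3 * a)) + CE * strain_sq g (band (a / 2) (8 * a)).
  by apply: h1; [rewrite leq_mul2r orbT|ring|ring].
have {}h2 : grad_sq g (slab a (2 * a)) <=
    3 / 2 * grad_sq g (slab (3 * a) (4 * a)) + CE * strain_sq g (band (a / 2) (8 * a)).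
  by apply: h2; [rewrite leq_mul2r orbT|ring|ring].
have -> : slab (2 * a) (4 * a) = slab (2 * a) (3 * a) `|` slab (3 * a) (4 * a).
  apply/seteqP; split => [x [fx /andP[x1 x2]]|x [[fx /andP[x1 x2]]|[fx /andP[x1 x2]]]].
  - by case: (leP (d x) (3 * a)) => hx; [left|right]; split => //; apply/andP; split.
  - by split => //; apply/andP; split; lra.
  - by split => //; apply/andP; split; lra.
rewrite grad_sq_setU//; first by lra.
by apply/seteqP; split => // x [[_ /andP[_ h3]] [_ /andP[h4 _]]]; lra.
Qed.

Let dy (k : nat) : R := s0 / 2 ^+ k.

Let dy0 k : 0 < dy k. Proof. by rewrite divr_gt0// exprn_gt0. Qed.
Let dyS k : dy k = 2 * dy k.+1.
Proof. by rewrite /dy exprS; field; rewrite expf_neq0. Qed.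
Let dy_le k : dy k <= s0.
Proof. by rewrite /dy ler_pdivrMr ?exprn_gt0// ler_peMr ?(ltW s00)// exprn_ege1// ler1n. Qed.

(** A band spans a factor 16 in height, so at most four dyadic bands overlap. The induction
    telescopes: a band and the region above it make up the region above the level four indices
    further. *)
Let strain_layers K :
  \sum_(k < K) strain_sq g (band (dy k / 2) (8 * dy k)) <= 4 * strain_sq g Omega.
Proof.
pose Phi (j : nat) := strain_sq g (band (16 * dy j) (8 * s0 + 1)).
have Phi0 j : 0 <= Phi j by exact: strain_sq_ge0.
have PhiO j : Phi j <= strain_sq g Omega.
  by apply: strain_sq_subset => //; [exact: measurable_band|apply: band_sub; rewrite mulr_ge0// ltW].
suff H : \sum_(k < K) strain_sq g (band (dy k / 2) (8 * dy k)) <=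
    Phi K.+1 + Phi K.+2 + Phi K.+3 + Phi K.+4.
  apply: le_trans H _; have := PhiO K.+1; have := PhiO K.+2; have := PhiO K.+3; have := PhiO K.+4.
  lra.
elim: K => [|K ih].
  by rewrite big_ord0 !addr_ge0.
rewrite big_ord_recr/=.
have : strain_sq g (band (dy K / 2) (8 * dy K)) + Phi K.+1 = Phi K.+1.+4.
  have e1 : 16 * dy K.+1 = 8 * dy K by rewrite (dyS K); lra.
  have e2 : 16 * dy K.+1.+4 = dy K / 2.
    by rewrite (dyS K) (dyS K.+1) (dyS K.+2) (dyS K.+3) (dyS K.+4); lra.
  rewrite /Phi e1 e2 -strain_sq_setU//; try exact: measurable_band.
    congr strain_sq; apply/seteqP; split => [x [[bx /andP[x1 x2]]|[bx /andP[x1 x2]]]|x [bx /andP[x1 x2]]].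
    - by split => //; apply/andP; split => //; have := dy_le K; lra.
    - by split => //; apply/andP; split => //; have := dy0 K; lra.
    - by case: (leP (d x) (8 * dy K)) => hx; [left|right]; split => //; apply/andP; split.
  by apply/seteqP; split => // x [[_ /andP[_ h3]] [_ /andP[h4 _]]]; lra.
lra.
Qed.

(** Summing the decay gives S <= q(0) + 3/4 S plus strain terms. The partial sum S is finite, so 3/4
    S can be absorbed, and the resulting factor 4 does not depend on the number of layers. *)
Let sum_layers K : \sum_(k < K) grad_sq g (slab (dy k) (2 * dy k)) <=
  4 * grad_sq g (slab s0 (2 * s0)) + 16 * CE * strain_sq g Omega.
Proof.
pose q k := grad_sq g (slab (dy k) (2 * dy k)).
pose E k := strain_sq g (band (dy k / 2) (8 * dy k)).
have q0 k : 0 <= q k by exact: grad_sq_ge0.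
have qS k : q k.+1 <= 3 / 4 * q k + CE * E k.+1.
  have := @layer_decay (dy k.+1); rewrite dy0 dy_le => /(_ isT).
  have e1 : slab (dy k) (2 * dy k) = slab (2 * dy k.+1) (4 * dy k.+1).
    by rewrite (dyS k); congr slab; ring.
  by rewrite /q e1.
have H : \sum_(k < K) q k <= q 0%N + 3 / 4 * \sum_(k < K) q k + CE * \sum_(k < K) E k.
  case: K => [|K]; first by rewrite !big_ord0 !mulr0 !addr0.
  rewrite {1}big_ord_recl/= -addrA lerD2l [X in 3 / 4 * X]big_ord_recr/= big_ord_recl/=.
  apply: (@le_trans _ _ (\sum_(k < K) (3 / 4 * q k + CE * E k.+1))).
    by apply: ler_sum => k _; exact: qS.
  rewrite big_split/= -!mulr_sumr mulrDr mulrDr.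
  rewrite -[X in X <= _]addrC -[leRHS]addrA.
  have h1 : 0 <= 3 / 4 * q K by rewrite mulr_ge0.
  have h2 : 0 <= CE * E 0%N by rewrite mulr_ge0// strain_sq_ge0.
  have -> : \sum_(i < K) E (bump 0 i) = \sum_(i < K) E i.+1 by [].
  lra.
have H2 := strain_layers K.
have h3 : CE * \sum_(k < K) E k <= CE * (4 * strain_sq g Omega) by exact: ler_wpM2l.
have h4 : q 0%N = grad_sq g (slab s0 (2 * s0)) by rewrite /q /dy expr0 divr1.
rewrite -h4; move: H h3; rewrite /q; lra.
Qed.

(** The dyadic slabs are disjoint and fill the slab down to the boundary, so countable additivity
    applies; the entries of the gradient are bounded one at a time. *)
Let grad_slab_le (c : R) : (forall K, \sum_(k < K) grad_sq g (slab (dy k) (2 * dy k)) <= c) ->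
  grad_sq g (slab 0 (2 * s0)) <= NN * c.
Proof.
move=> hc; rewrite [leRHS](_ : _ = \sum_(p : II) c); last by rewrite sumr_const mulr_natl.
apply: ler_sum => p _; have [mg _] := Lg p.2 p.1.
pose F k := slab (dy k) (2 * dy k).
have mF k : measurable (F k) by exact: measurable_slab.
have UF : slab 0 (2 * s0) = \bigcup_k F k.
  apply/seteqP; split => [x [fx /andP[x1 x2]]|x [k _ [fx /andP[x1 x2]]]]; last first.
    split => //; apply/andP; split; first exact: lt_trans x1.
    by apply: le_trans x2 _; rewrite ler_pM2l// dy_le.
  have [k hk] : exists k, dy k < d x.
    have [k hk] : exists k : nat, s0 / d x < k%:R.
      by exists (Num.Def.archi_bound (s0 / d x)); apply: archi_boundP; rewrite divr_ge0// ltW.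
    exists k; rewrite /dy ltr_pdivrMr ?exprn_gt0// -ltr_pdivrMl// mulrC.
    apply: lt_trans hk _; rewrite -natrX ltr_nat; exact: ltn_expl.
  (* The least such k also satisfies d x <= 2 dy k, by minimality if k > 0 and by the upper face of
     the slab if k = 0. *)
  pose P k := dy k < d x.
  have exP : exists k, P k by exists k.
  exists (ex_minn exP) => //; case: ex_minnP => j Pj jmin; split => //.
  apply/andP; split; first exact: Pj.
  case: j Pj jmin => [|j] Pj jmin; first by rewrite /dy expr0 divr1.
  by rewrite -dyS leNgt; apply/negP => /jmin; rewrite ltnn.
have tF : trivIset setT F.
  have half : forall i j, (i < j)%N -> F i `&` F j = set0.
    move=> i j ij; apply/seteqP; split => // x [[_ /andP[x1 _]] [_ /andP[_ x2]]].
    have : 2 * dy j <= dy i.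
      elim: j ij {x2} => // j ih; rewrite ltnS leq_eqVlt => /orP[/eqP->|/ih h]; first by rewrite -dyS.
      by apply: le_trans h; rewrite ler_pM2l// [leRHS]dyS; have := dy0 j.+1; lra.
    by move=> h; have := lt_le_trans x1 (le_trans x2 h); rewrite ltxx.
  apply/trivIsetP => i j _ _ ij; have [h|h] := ltnP i j; first exact: half.
  by rewrite setIC; apply: half; rewrite ltn_neqAle eq_sym ij.
rewrite -lee_fin -rqE//; last exact: measurable_slab.
rewrite UF /qint ge0_integral_bigcup//; last 2 first.
- by apply: measurable_sqrE; apply: measurable_funTS.
- by move=> x _; rewrite lee_fin sqr_ge0.
apply: lime_le; first by apply: is_cvg_nneseries => k _ _; exact: qint_ge0.
apply: nearW => K; rewrite big_mkord.
have -> : (\sum_(k < K) \int[leb]_(x in F k) ((g p.2 p.1 x) ^+ 2)%:E =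
           (\sum_(k < K) rq (F k) (g p.2 p.1))%:E)%E.
  by rewrite -sumEFin; apply: eq_bigr => k _; rewrite -rqE.
rewrite lee_fin; apply: le_trans (hc K); apply: ler_sum => k _.
by rewrite /grad_sq (bigD1 p)//= lerDl sumr_ge0// => i _; exact: rq_ge0.
Qed.

(** The inner factor after 4 is the constant of [interior_korn] on the outermost slab with radius s0
    / (16 L); 4 and 16 come from [sum_layers], the outer factor from [grad_slab_le]. *)
Definition chart_const : R :=
  NN * (4 * (NN * (3 * NN * (54 * NN) + 32 * 4 ^+ n.+1 * NN * (4 / (s0 / (16 * L)) ^+ 2))) + 16 * CE).

Lemma chart_const_ge0 : 0 <= chart_const.
Proof.
rewrite /chart_const; have := sqr_ge0 (s0 / (16 * L)); rewrite -invr_ge0.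
have := exprn_ge0 n.+1 (ler0n R 4); move: (_ ^+ 2)^-1 (4 ^+ n.+1) => y z y0 z0.
move: (ler0n R #|{: II}|) (ler0n R 54) (ler0n R 32) CE0.
move: (NN) (54 : R) (32 : R) CE => q a b c q0 a0 b0 c0.
by rewrite mulr_ge0// addr_ge0 ?mulr_ge0// addr_ge0 ?mulr_ge0.
Qed.

Lemma slab_korn : grad_sq g (slab 0 (2 * s0)) <=
  chart_const * (strain_sq g Omega + \sum_j rq Omega (u j)).
Proof.
have u0 : 0 <= \sum_j rq Omega (u j) by apply: sumr_ge0 => j _; exact: rq_ge0.
have E0 := strain_sq_ge0 g Omega.
have ss : 0 < s0 <= s0 by rewrite s00 lexx.
have base := @interior_korn R n Omega u g Hu (slab s0 (2 * s0)) Omega (s0 / (16 * L)).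
have {}base := base (divr_gt0 s00 (mulr_gt0 (ltr0n R 16) L0)) (measurable_slab _ _) mO (@subset_refl _ Omega).
have sb : nb (slab s0 (2 * s0)) (8 * (s0 / (16 * L))) `<=` Omega.
  rewrite (_ : 8 * (s0 / (16 * L)) = s0 / (2 * L)); last by field; rewrite gt_eqF.
  move=> z [x sx xz].
  have : band (s0 / 2) (8 * s0) z.
    apply: (slab_nb ss); exists x => //; case: sx => fx /andP[x1 x2]; split => //.
    by rewrite x1/=; lra.
  by apply: band_sub; rewrite divr_ge0// ltW.
have {}base := base sb.
apply: le_trans (grad_slab_le sum_layers) _.
rewrite /chart_const -[leRHS]mulrA; apply: ler_wpM2l; first exact: ler0n.
set E := strain_sq g Omega in E0 base *; set U := \sum_j _ in u0 base *.
move: base; rewrite -/(grad_sq g (slab s0 (2 * s0))); set m1 := grad_sq _ _.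
have c2 : 0 <= 4 / (s0 / (16 * L)) ^+ 2 by rewrite divr_ge0// sqr_ge0.
rewrite -[4 * U / _]mulrAC.
move: (4 / _) c2 (ler0n R #|{: II}|) (exprn_ge0 n.+1 (ler0n R 4)) CE0.
move: (NN) (4 ^+ n.+1) CE => q a c b b0 q0 a0 c0 base.
rewrite [leRHS]mulrDl; apply: lerD; last by rewrite ler_wpM2l ?mulr_ge0// lerDl.
rewrite -[leRHS]mulrA ler_wpM2l//; apply: le_trans base _.
rewrite -[leRHS]mulrA ler_wpM2l// [leRHS]mulrDl; apply: lerD.
  by rewrite -[leRHS]mulrA ler_wpM2l ?mulr_ge0// ler_wpM2l ?mulr_ge0// lerDl.
by rewrite -[leRHS]mulrA ler_wpM2l ?mulr_ge0// ler_wpM2l// lerDr.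
Qed.

End fields.
End boundary_layer.

(** * From local to global Korn estimates *)

Section korn_control.
Variable Omega : set V.
Hypothesis oO : open Omega.

Definition korn_on X := [/\ measurable X, X `<=` Omega & exists2 K : R, 0 <= K &
  forall u g, (forall i, H1g Omega (u i) (g i)) ->
    grad_sq g X <= K * (strain_sq g Omega + \sum_j rq Omega (u j))].

Lemma korn_on0 : korn_on set0.
Proof.
split => //; exists 0 => // u g _; rewrite mul0r /grad_sq big1// => p _.
by rewrite /rq /qint integral_set0.
Qed.

Lemma korn_onS X Y : korn_on Y -> measurable X -> X `<=` Y -> korn_on X.
Proof.
move=> [mY YO [K K0 hK]] mX XY; split => //; first exact: subset_trans YO.
exists K => // u g Hu; apply: le_trans (hK u g Hu); apply: grad_sq_subset => // i j.
by case: (Hu i).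
Qed.

Lemma korn_onU X Y : korn_on X -> korn_on Y -> korn_on (X `|` Y).
Proof.
move=> [mX XO [K K0 hK]] [mY YO [K' K0' hK']]; split; first exact: measurableU.
  by rewrite subUset.
exists (K + K'); first exact: addr_ge0.
move=> u g Hu; have Lg i j : L2 leb setT (g i j) by case: (Hu i).
have -> : X `|` Y = X `|` (Y `\` X).
  apply/seteqP; split=> z; last by case=> [|[]]; [left|right].
  by have [Xz|nXz] := pselect (X z); [left|case=> // Yz; right].
have mYX : measurable (Y `\` X) by exact: measurableD.
rewrite grad_sq_setU//; last by apply/seteqP; split => // x [Xx [_ nXx]].
have h1 := hK u g Hu; have h2 := hK' u g Hu.
have h3 : grad_sq g (Y `\` X) <= grad_sq g Y by apply: grad_sq_subset => // x [].
rewrite mulrDl; lra.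
Qed.

Lemma korn_on_interior x : Omega x -> exists r, 0 < r /\ korn_on (Omega `&` ball x r).
Proof.
move=> Ox; have mO := open_measurable_rV oO.
have : nbhs x Omega by exact: open_nbhs_nbhs.
move=> /nbhs_ballP[q /= q0 hq]; pose r := q / 9.
have r0 : 0 < r by rewrite divr_gt0.
exists r; split => //.
have mB : measurable (Omega `&` ball x r) by apply: measurableI => //; exact: measurable_ball_rV.
split => //; exists (NN * (3 * NN * (54 * NN) + 32 * 4 ^+ n.+1 * NN * (4 / r ^+ 2))).
  have := sqr_ge0 r; rewrite -invr_ge0.
  have := exprn_ge0 n.+1 (ler0n R 4); move: (_ ^+ 2)^-1 (4 ^+ n.+1) => y z y0 z0.
  move: (ler0n R #|{: II}|) (ler0n R 54) (ler0n R 32).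
  move: (NN) (54 : R) (32 : R) => d a b d0 a0 b0.
  by rewrite mulr_ge0// addr_ge0 ?mulr_ge0.
move=> u g Hu.
have nO : nb (Omega `&` ball x r) (8 * r) `<=` Omega.
  move=> z [y [_ /ballP xy] /ballP yz]; apply: hq; apply/ballP.
  rewrite (_ : x - z = (x - y) + (y - z)); last by rewrite addrA subrK.
  apply: le_lt_trans (ler_normD _ _) _.
  have q9 : q = 9 * r by rewrite /r mulrC divfK.
  by rewrite q9; lra.
have base := interior_korn Hu r0 mB mO (@subset_refl _ Omega) nO.
have E0 := strain_sq_ge0 g Omega.
have u0 : 0 <= \sum_j rq Omega (u j) by apply: sumr_ge0 => j _; exact: rq_ge0.
set E := strain_sq g Omega in E0 base *; set U := \sum_j _ in u0 base *.
move: base; rewrite -/(grad_sq g _); set m1 := grad_sq _ _.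
have c2 : 0 <= 4 / r ^+ 2 by rewrite divr_ge0// sqr_ge0.
rewrite -[4 * U / _]mulrAC.
move: (4 / _) c2 (ler0n R #|{: II}|) (exprn_ge0 n.+1 (ler0n R 4)).
move: (NN) (4 ^+ n.+1) => q' a b b0 q0' a0 base.
apply: le_trans base _; rewrite -[leRHS]mulrA ler_wpM2l// [leRHS]mulrDl; apply: lerD.
  by rewrite -[leRHS]mulrA ler_wpM2l ?mulr_ge0// ler_wpM2l ?mulr_ge0// lerDl.
by rewrite -[leRHS]mulrA ler_wpM2l ?mulr_ge0// ler_wpM2l// lerDr.
Qed.

Lemma korn_on_boundary x0 : lipschitz_boundary Omega -> boundary Omega x0 ->
  exists r, 0 < r /\ korn_on (Omega `&` ball x0 r).
Proof.
move=> lO bx0; have [d [e [L [r ch]]]] := chart_exists oO lO bx0.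
have mO := open_measurable_rV oO.
have L1 : 1 <= L := chart_Lge1 ch; have L0 : 0 < L := lt_le_trans ltr01 L1.
have r0 : 0 < r := chart_rgt0 ch.
pose s0 := r / (16 * L); have s00 : 0 < s0 by rewrite divr_gt0// mulr_gt0.
have s0L : L * s0 = r / 16 by rewrite /s0; field; rewrite gt_eqF.
(* Within distance q of [x0] the height is at most L q = s0, and the foot lies within q + s0 L,
   hence within r/4, of [x0]. *)
pose q := s0 / L; have q0 : 0 < q by rewrite divr_gt0.
have qL : L * q = s0 by rewrite /q; field; rewrite gt_eqF.
have qs : q <= s0 by rewrite -qL ler_peMl// ltW.
have s0r : s0 <= r / 16 by rewrite -s0L ler_peMl// ltW.
exists q; split => //.
have sl : korn_on (slab x0 d e r 0 (2 * s0) `&` Omega).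
  split; [|by move=> x []|].
    by apply: measurableI => //; exact: (measurable_slab ch).
  exists (chart_const L r); first exact: chart_const_ge0.
  move=> u g Hu; apply: le_trans (slab_korn oO ch Hu).
  have Lg i j : L2 leb setT (g i j) by case: (Hu i).
  have ms := measurable_slab ch 0 (2 * s0).
  exact: (grad_sq_subset Lg (measurableI _ _ ms mO) ms (@subIsetl _ _ _)).
apply: (korn_onS sl); first by apply: measurableI => //; exact: measurable_ball_rV.
move=> x [Ox /ballP xq]; split => //.
have br : ball x0 r x by apply/ballP; lra.
have d0 := (chart_iff ch br).1 Ox.
have dq : d x <= s0.
  have := chart_lip ch x x0; rewrite (chart_center ch) subr0 distrC => h.
  apply: le_trans (ler_norm _) (le_trans h _).
  by rewrite -qL; apply: ler_wpM2l; exact: ltW.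
split; last by rewrite d0/=; lra.
have -> : x - d x *: e - x0 = - (x0 - x) - d x *: e by apply/rowP => i; rewrite !mxE; ring.
apply: le_lt_trans (ler_normB _ _) _; rewrite normrN normrZ gtr0_norm//.
have : d x * `|e| <= s0 * L by apply: ler_pM => //; [exact: ltW|exact: chart_dir ch].
by rewrite mulrC [s0 * L]mulrC s0L; lra.
Qed.

End korn_control.

Theorem korn Omega : lipschitz_domain Omega -> exists2 K : R, 0 <= K &
  forall u g, (forall i, H1g Omega (u i) (g i)) ->
    grad_sq g Omega <= K * (strain_sq g Omega + \sum_j rq Omega (u j)).
Proof.
move=> [_ oO _ bO lO].
have [X [[mX XO [K K0 hK]] clX]] : exists X, korn_on Omega X /\ closure Omega `&` Omega `<=` X.
  apply: compact_patch.
  - exact: compact_closure.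
  - exact: korn_on0.
  - by move=> A B; exact: korn_onU.
  move=> x cx; have [Ox|nOx] := pselect (Omega x); first exact: korn_on_interior.
  apply: korn_on_boundary => //; split => //.
  by rewrite ((interior_id _).1 oO).
have XE : X = Omega.
  by apply/seteqP; split => // x Ox; apply: clX; split => //; exact: subset_closure.
by exists K => // u g Hu; have := hK u g Hu; rewrite XE.
Qed.

End korn_inequality.

(** * The inequalities in Sobolev norms *)

Section constants.
Context {R : realType} (n : nat).
Local Notation V := 'rV[R]_n.+1.
Local Notation leb := (lebesgue_rV n.+1).
Variable Omega : set V.
Hypotheses (oO : open Omega) (bO : bounded_set Omega).
Let mO : measurable Omega := open_measurable_rV oO.
Let hL := @L2_closed R _ _ (lebesgue_rV n.+1) _ mO.
Let hs := @L2inner_semi R _ _ (lebesgue_rV n.+1) _ mO.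
Local Notation innO := (L2inner leb Omega).

Lemma derive_line (phi : V -> R) (x v : V) (t : R) : derivable phi (x + t *: v) v ->
  is_derive t (1 : R) (fun s => phi (x + s *: v)) ('D_v phi (x + t *: v)).
Proof.
move=> d.
have e : (fun h : R => h^-1 *: (((fun s : R => phi (x + s *: v)) \o shift t) (h *: (1 : R))
      - phi (x + t *: v))) =
    (fun h : R => h^-1 *: ((phi \o shift (x + t *: v)) (h *: v) - phi (x + t *: v))).
  apply/funext => h /=; congr (_ *: (phi _ - _)).
  by rewrite [h%:A]mulr1 scalerDl addrCA.
by split; rewrite /derivable /derive /= e.
Qed.

(** The integral of a translate of [phi] does not depend on the translation, and its derivative at 0
    is the integral of the partial derivative. As [inner_line_derive] asks for an L^2 factor, the
    constant 1 is replaced by the indicator of a ball containing the supports of all translates by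
    at most one unit vector. *)
Lemma pderiv_integral0 i (phi : V -> R) : test_function Omega phi ->
  \int[leb]_(x in Omega) pderiv i phi x = 0.
Proof.
move=> tphi; have [sphi _] := tphi; have tp := test_function_pderiv i tphi.
have [M [r hM]] := test_function_bounded tphi.
have [M' [r' hM']] := test_function_bounded tp.
have mphi : measurable_fun setT phi := test_function_measurable (D := setT) tphi.
pose k : V := delta_mx 0 i.
pose rho := Num.max r r' + `|k|.
pose B : set V := ball (0 : V) rho.
have mB : measurable B by exact: measurable_ball_rV.
pose u : V -> R := \1_B.
have mu : measurable_fun setT u by exact: measurable_indic.
have Lu : L2 leb setT u.
  apply: (@bounded_support_L2 _ _ _ 1 rho) => // x.
  by rewrite mul1r ger0_norm.
have dl x (t : R) : is_derive t (1 : R) (fun s => phi (x + s *: k)) (pderiv i phi (x + t *: k)).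
  by apply: derive_line; have [_] := sphi [::]; apply.
have vanish (f : V -> R) (m s : R) x (t : R) : (forall y, `|f y| <= m * \1_(ball (0 : V) s) y) ->
    s <= Num.max r r' -> `|t| <= 1 -> u x * f (x + t *: k) = f (x + t *: k).
  move=> hf sr t1; rewrite /u indicE; have [_|/negP xB] := boolP (_ \in _); first by rewrite mul1r.
  rewrite mul0r; apply/esym/eqP; rewrite -normr_le0; apply: le_trans (hf _) _.
  rewrite indicE; have [/set_mem/ball0P xr|_] := boolP (_ \in _); last by rewrite mulr0.
  exfalso; apply: xB; rewrite inE; apply/ball0P.
  rewrite [x](_ : _ = (x + t *: k) - t *: k); last by rewrite addrK.
  apply: le_lt_trans (ler_normB _ _) _; apply: ltr_leD; first exact: lt_le_trans sr.
  by rewrite normrZ ler_piMl.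
have D := inner_line_derive 0 Lu tphi tp dl.
have rm : r <= Num.max r r' by rewrite le_max lexx.
have rm' : r' <= Num.max r r' by rewrite le_max lexx orbT.
have E t : `|t| <= 1 -> L2inner leb setT u (fun x => phi (x + t *: k)) = \int[leb]_x phi x.
  move=> t1; rewrite -(Rintegral_translation (t *: k) mphi) /L2inner.
  by apply: eq_Rintegral => x _; exact: (vanish _ _ _ _ _ hM).
have : `|L2inner leb setT u (fun x => pderiv i phi (x + 0 *: k))| <= 0.
  apply: (derive_norm_le D ltr01) => t /andP[t0 t1].
  by rewrite mulr0 !E ?subrr ?normr0// ger0_norm ltW.
rewrite normr_le0 => /eqP <-.
rewrite /L2inner Rintegral_mkcond; apply: eq_Rintegral => x _.
rewrite (vanish _ _ _ _ _ hM')// ?normr0// scale0r addr0 patchE.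
case: ifPn => // /negP xO; have [_ [K [_ KO hK]]] := tp.
by rewrite hK// => /KO/mem_set.
Qed.

Lemma L2_cst (c : R) : L2 leb Omega (cst c).
Proof.
split; first exact: measurable_cst.
have [M [_ hM]] := bO.
have sub : Omega `<=` ball (0 : V) (M + 2).
  by move=> x Ox; apply/ball0P; apply: (@le_lt_trans _ _ (M + 1)); [apply: hM => //; lra|lra].
rewrite [X in (X < _)%E](_ : _ = (c ^+ 2)%:E * leb Omega)%E; last by rewrite -integral_cst.
by rewrite lte_mul_pinfty ?lee_fin ?sqr_ge0//; exact: lebesgue_sub_ball_lty sub.
Qed.

Lemma weak_pderiv_cst i (c : R) : weak_pderiv Omega i (cst c) 0.
Proof.
move=> phi tphi; have Lp : L2 leb Omega (pderiv i phi).
  by apply: test_function_L2 => //; exact: test_function_pderiv tphi.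
have L1 := L2_cst 1.
transitivity (c * \int[leb]_(x in Omega) pderiv i phi x).
  rewrite -RintegralZl//.
  have := L2_integrableM mO L1 Lp; apply: eq_integrable => // x _ /=.
  by rewrite /= mul1r.
have Lphi : L2 leb Omega phi by exact: test_function_L2 tphi.
have := semi_inner0l hL hs Lphi; rewrite /L2inner => ->.
by rewrite pderiv_integral0// mulr0 oppr0.
Qed.

Lemma H1_cst (c : R) : H1 Omega (cst c).
Proof.
split; first exact: L2_cst.
by move=> i; exists 0; split; [exact: L20|exact: weak_pderiv_cst].
Qed.

Lemma wder_cst i (c : R) : aeq leb Omega (wder Omega i (cst c)) 0.
Proof.
have [L w] := wderP i (H1_cst c).
by apply: (wder_unique oO L _ w); [exact: L20|exact: weak_pderiv_cst].
Qed.

#[local] Opaque wder.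

(** The extension by zero may jump across the boundary, but [weak_grad] tests only inside
    [Omega]. *)
Lemma H1g_wder u : H1 Omega u -> H1g Omega (u \_ Omega) (fun j => wder Omega j u \_ Omega).
Proof.
move=> Hu; have Lu := H1_L2 Hu; split.
- exact: L2_restrict.
- by move=> j; apply: L2_restrict => //; exact: L2_wder.
- move=> j phi tphi; rewrite !L2inner_restrict.
  by have [_] := wderP j Hu; apply.
Qed.

Lemma qint_restrict f : L2 leb Omega f ->
  qint Omega (f \_ Omega : V -> R) = (L2norm leb Omega f ^+ 2)%:E.
Proof.
move=> Lf; rewrite /qint (eq_integral (fun x => ((f x) ^+ 2)%:E)).
  by rewrite -sqr_L2norm.
by move=> x xO; rewrite patchE xO.
Qed.

Lemma rq_restrict f : L2 leb Omega f -> rq Omega (f \_ Omega : V -> R) = L2norm leb Omega f ^+ 2.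
Proof. by move=> Lf; rewrite /rq qint_restrict. Qed.

Lemma wder_sub_cst i u (c : R) : H1 Omega u ->
  L2norm leb Omega (wder Omega i (u - cst c)) = L2norm leb Omega (wder Omega i u).
Proof.
move=> Hu; have Hc := H1_cst c; have hH := H1_closed oO.
have Huc : H1 Omega (u - cst c) by exact: (lin_closedB hH Hu Hc).
apply: aeq_L2norm => //; try exact: L2_wder.
have e1 := wder_lin oO i (-1) Hc Hu; have e2 := wder_cst i c.
have -> : u - cst c = (-1) *: cst c + u by rewrite scaleN1r addrC.
apply: filterS2 e1 e2 => x h1 h2 Ox; rewrite h1//.
rewrite -[LHS]/(-1 * wder Omega i (cst c) x + wder Omega i u x) h2//.
by rewrite mulr0 add0r.
Qed.

End constants.

Section sobolev_inequalities.
Context {R : realType} (n : nat).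
Local Notation V := 'rV[R]_n.+1.
Local Notation leb := (lebesgue_rV n.+1).
Local Notation II := ('I_n.+1 * 'I_n.+1)%type.
Variable Omega : set V.
Hypothesis lip : lipschitz_domain Omega.
Let oO : open Omega. Proof. by case: lip. Qed.
Let bO : bounded_set Omega. Proof. by case: lip. Qed.
Let mO : measurable Omega := open_measurable_rV oO.
#[local] Opaque wder.

Definition gradnorm2 u : R := \sum_i L2norm leb Omega (wder Omega i u) ^+ 2.

Lemma gradnorm2_ge0 u : 0 <= gradnorm2 u.
Proof. by apply: sumr_ge0 => i _; exact: sqr_ge0. Qed.

Lemma poincare_mean : exists2 K : R, 0 <= K & forall u, H1 Omega u ->
  exists c, H1norm Omega (u - cst c) ^+ 2 <= K * gradnorm2 u.
Proof.
have [K K0 hK] := poincare lip; exists (K + 1); first exact: addr_ge0.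
move=> u Hu; have [c hc] := hK _ _ (H1g_wder oO Hu); exists c.
have Hc := H1_cst oO bO c.
have Huc : H1 Omega (u - cst c) by exact: (lin_closedB (H1_closed oO) Hu Hc).
have E := sqr_H1norm Huc.
have E2 : \sum_i L2norm leb Omega (wder Omega i (u - cst c)) ^+ 2 = gradnorm2 u.
  by apply: eq_bigr => i _; rewrite wder_sub_cst.
rewrite E E2 [leRHS]mulrDl [X in _ <= _ + X]mul1r lerD2r.
rewrite -lee_fin (sqr_L2norm mO); last by case: Huc.
rewrite (eq_integral (fun x => (((u \_ Omega : V -> R) x - c) ^+ 2)%:E)); last first.
  by move=> x xO; rewrite patchE xO.
have hG : Gq Omega (fun j => wder Omega j u \_ Omega) = (gradnorm2 u)%:E.
  rewrite /Gq /gradnorm2 -sumEFin; apply: eq_bigr => j _.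
  exact: (qint_restrict oO (L2_wder j Hu)).
by rewrite hG -EFinM in hc.
Qed.

(** When G u = 0, applying G to u - c gives -c G(1), so |c| is bounded by the norm of u - c; the
    factor [q] then bounds the norm of u by that of u - c. *)
Lemma poincare_functional (G : (V -> R) -> R) : bounded_linear_H1 Omega G -> G (cst 1) <> 0 ->
  exists2 C : R, 0 < C & forall u, H1 Omega u -> G u = 0 -> H1norm Omega u ^+ 2 <= C * gradnorm2 u.
Proof.
move=> [Glin [M hM]] G1; have [K K0 hK] := poincare_mean.
have hH := H1_closed oO; have hi := H1inner_semi oO.
have H1c c := H1_cst oO bO c.
pose N1 := H1norm Omega (cst 1 : V -> R).
pose q := 1 + `|M| / `|G (cst 1)| * N1.
have q1 : 1 <= q by rewrite lerDl mulr_ge0// ?divr_ge0// sqrtr_ge0.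
exists (q ^+ 2 * K + 1); first by rewrite ltr_wpDl// mulr_ge0// sqr_ge0.
move=> u Hu Gu; have [c hc] := hK u Hu.
have Huc : H1 Omega (u - cst c) by exact: (lin_closedB hH Hu (H1c c)).
have cE : cst c = c *: cst 1 :> (V -> R) by apply/funext => x; rewrite -[RHS]/(c * 1) mulr1.
have Gc : G (u - cst c) = - c * G (cst 1).
  have -> : u - cst c = (- c) *: cst 1 + u by rewrite scaleNr -cE addrC.
  by rewrite Glin// Gu addr0.
have nc : `|c| <= `|M| / `|G (cst 1)| * H1norm Omega (u - cst c).
  have G0 : 0 < `|G (cst 1)| by rewrite normr_gt0; exact/eqP.
  rewrite mulrAC ler_pdivlMr// -normrM -[X in X <= _]normrN -mulNr -Gc.
  apply: le_trans (hM _ Huc) _; apply: ler_wpM2r; first exact: sqrtr_ge0.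
  exact: ler_norm.
have tri : H1norm Omega u <= q * H1norm Omega (u - cst c).
  have -> : H1norm Omega u = snorm (H1inner Omega) ((u - cst c) + c *: cst 1).
    by rewrite -cE subrK H1normE.
  apply: le_trans (snormD hH hi Huc (lin_closedZ c hH (H1c 1))) _.
  rewrite (snormZ hH hi c (H1c 1)) -!H1normE// /q mulrDl mul1r lerD2l.
  by rewrite -mulrA [N1 * _]mulrC mulrA; apply: ler_wpM2r => //; exact: sqrtr_ge0.
have g0 := gradnorm2_ge0 u.
apply: (@le_trans _ _ ((q * H1norm Omega (u - cst c)) ^+ 2)).
  by rewrite lerXn2r ?nnegrE ?mulr_ge0 ?sqrtr_ge0// (le_trans ler01).
have h := ler_wpM2l (sqr_ge0 q) hc.
by rewrite exprMn; apply: le_trans h _; rewrite mulrDl mul1r mulrA lerDl.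
Qed.

Definition strainnorm2 (w : V -> V) : R :=
  \sum_(p : II) L2norm leb Omega (fun x => strain Omega w x p.1 p.2) ^+ 2.

Lemma strain_entry (w : V -> V) i j :
  (fun x => strain Omega w x i j) =
  2^-1 *: (wder Omega j (component w i) + wder Omega i (component w j)).
Proof. by apply/funext => x; rewrite /strain mxE. Qed.

Lemma L2_strain (w : V -> V) i j : H1v Omega w -> L2 leb Omega (fun x => strain Omega w x i j).
Proof.
move=> Hw; have hL := L2_closed leb mO; rewrite strain_entry.
by apply: (lin_closedZ _ hL); apply: (lin_closedD hL); apply: L2_wder; exact: Hw.
Qed.

Lemma sqr_H1normv (w : V -> V) : H1v Omega w ->
  H1normv Omega w ^+ 2 = \sum_i H1norm Omega (component w i) ^+ 2.
Proof. by move=> Hw; rewrite sqr_sqrtr// sumr_ge0// => i _; exact: sqr_ge0. Qed.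

Lemma sqr_L2normv (w : V -> V) :
  L2normv Omega w ^+ 2 = \sum_i L2norm leb Omega (component w i) ^+ 2.
Proof. by rewrite sqr_sqrtr// sumr_ge0// => i _; exact: sqr_ge0. Qed.

Lemma korn_H1 : exists2 C : R, 0 < C & forall w, H1v Omega w ->
  H1normv Omega w ^+ 2 <= C * (strainnorm2 w + L2normv Omega w ^+ 2).
Proof.
have [K K0 hK] := korn lip; exists (4 * K + 1); first by lra.
move=> w Hw; pose u i := component w i \_ Omega : V -> R.
pose g i j := wder Omega j (component w i) \_ Omega : V -> R.
have Hu i : H1g Omega (u i) (g i) by exact: H1g_wder.
have := hK u g Hu.
have -> : \sum_j rq Omega (u j) = L2normv Omega w ^+ 2.
  by rewrite sqr_L2normv; apply: eq_bigr => j _; rewrite rq_restrict//; exact: H1_L2.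
have -> : grad_sq g Omega = \sum_i gradnorm2 (component w i).
  rewrite /grad_sq -(pair_bigA _ (fun i j => rq Omega (g j i)))/= exchange_big/=.
  apply: eq_bigr => j _; apply: eq_bigr => i _.
  by rewrite rq_restrict//; exact: L2_wder.
have -> : strain_sq g Omega = 4 * strainnorm2 w.
  rewrite /strain_sq /strainnorm2 mulr_sumr; apply: eq_bigr => p _.
  have Ls := L2_strain p.1 p.2 Hw.
  rewrite -rq_restrict// /rq /qint.
  rewrite (eq_integral (fun x => 4%:E * ((((fun x => strain Omega w x p.1 p.2) \_ Omega : V -> R) x) ^+ 2)%:E)%E).
    rewrite ge0_integralZl_EFin//.
    - rewrite fineM//; rewrite ge0_fin_numE; last exact: qint_ge0.
      have [mf f2] := L2_restrict oO Ls.
      by apply: le_lt_trans f2; exact: qint_subset.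
    - by move=> x _; rewrite lee_fin sqr_ge0.
    - have [mf _] := L2_restrict oO Ls.
      by apply: measurable_sqrE; exact: measurable_funTS.
  move=> x xO; rewrite -EFinM patchE xO; congr EFin.
  have gE i j : g i j x = wder Omega j (component w i) x by rewrite /g patchE xO.
  have -> : (g p.1 p.2 + g p.2 p.1) x = g p.1 p.2 x + g p.2 p.1 x by [].
  rewrite !gE [strain Omega w x _ _]mxE; move: (wder _ _ _ x) (wder _ _ _ x) => a b.
  by field.
have -> : H1normv Omega w ^+ 2 = L2normv Omega w ^+ 2 + \sum_i gradnorm2 (component w i).
  rewrite sqr_H1normv// sqr_L2normv -big_split/=; apply: eq_bigr => i _.
  by rewrite sqr_H1norm.
have s0 : 0 <= strainnorm2 w by apply: sumr_ge0 => p _; exact: sqr_ge0.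
have l0 := sqr_ge0 (L2normv Omega w).
move: (\sum_i _) (strainnorm2 w) (_ ^+ 2) s0 l0 => a b c b0 c0 h.
have : 0 <= K * c by rewrite mulr_ge0.
by rewrite mulrDl mulrDr; lra.
Qed.

End sobolev_inequalities.

(** * Measurability of the boundary *)

Section metric_outer_measure.
Context {R : realType} (n s : nat).
Local Notation V := 'rV[R]_n.+1.
Implicit Types (A B C F X : set V).

Lemma norm_le_enorm (x : V) : `|x| <= enorm x.
Proof.
rewrite [leLHS]/Num.Def.normr/= mx_normrE; apply: bigmax_le => [|[i j] _ /=]; first exact: sqrtr_ge0.
rewrite -sqrtr_sqr ler_wsqrtr// /dotv (bigD1 j)//= ord1 expr2 lerDl.
by apply: sumr_ge0 => k _; rewrite -expr2 sqr_ge0.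
Qed.

(** Unless c is infinite all values are finite, and the two suprema can be taken one after the other
    by subtraction. *)
Lemma ereal_sup_add_le (I : Type) (D : set I) (a b : I -> \bar R) (c : \bar R) :
  D !=set0 -> (forall i, D i -> 0 <= a i)%E -> (forall i, D i -> 0 <= b i)%E ->
  (forall i j, D i -> D j -> a i + b j <= c)%E ->
  (ereal_sup [set a i | i in D] + ereal_sup [set b i | i in D] <= c)%E.
Proof.
move=> [i0 Di0] a0 b0 h; case: (eqVneq c +oo%E) => [->|coo]; first by rewrite leey.
have ab0 : (0 <= a i0 + b i0)%E by rewrite adde_ge0 ?a0 ?b0.
have cfin : c \is a fin_num.
  rewrite ge0_fin_numE; first by rewrite ltey.
  exact: le_trans (h _ _ Di0 Di0).
have afin i : D i -> a i \is a fin_num.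
  move=> Di; rewrite ge0_fin_numE ?a0//.
  apply: (@le_lt_trans _ _ (a i + b i0)%E); first by rewrite leeDl// b0.
  by apply: le_lt_trans (h _ _ Di Di0) _; rewrite ltey.
have h1 i : D i -> (a i + ereal_sup [set b i | i in D] <= c)%E.
  move=> Di; rewrite addeC -leeBrDr ?afin//.
  apply: ge_ereal_sup => _ [j Dj <-]; rewrite leeBrDr ?afin// addeC.
  exact: h.
have sb0 : (0 <= ereal_sup [set b i | i in D])%E.
  by apply: le_trans (b0 _ Di0) _; apply: ereal_sup_ubound; exists i0.
have sbfin : ereal_sup [set b i | i in D] \is a fin_num.
  rewrite ge0_fin_numE//; apply: (@le_lt_trans _ _ c); last by rewrite ltey.
  by apply: le_trans (h1 _ Di0); rewrite leeDr// a0.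
rewrite -leeBrDr//; apply: ge_ereal_sup => _ [i Di <-].
by rewrite leeBrDr// h1.
Qed.

Lemma sum_parity (f : nat -> \bar R) K :
  (\sum_(k < K.*2) f k = \sum_(k < K) f (k.*2 + 0)%N + \sum_(k < K) f (k.*2 + 1)%N)%E.
Proof.
elim: K => [|K ih]; first by rewrite !big_ord0 adde0.
by rewrite doubleS !big_ord_recr/= ih addn0 addn1 -addeA addeACA.
Qed.

(** A set meeting both [A] and [B] has diameter at least eta > delta, hence infinite size; any other
    set is charged to at most one of the two. *)
Lemma hausdorff_size_split delta eta A B F : delta < eta ->
  (forall a b, A a -> B b -> eta <= enorm (a - b)) ->
  (hausdorff_size s delta (if `[< F `&` A = set0 >] then set0 else F) +
   hausdorff_size s delta (if `[< F `&` B = set0 >] then set0 else F) <= hausdorff_size s delta F)%E.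
Proof.
move=> de AB; have z : hausdorff_size s delta (set0 : set V) = 0%E by exact: hausdorff_size0.
case: asboolP => [_|/eqP/set0P[a [Fa Aa]]].
  by rewrite z add0e; case: asboolP => _; rewrite ?z ?hausdorff_size_ge0.
case: asboolP => [_|/eqP/set0P[b [Fb Bb]]]; first by rewrite z adde0.
have -> : hausdorff_size s delta F = +oo%E; last by rewrite leey.
rewrite /hausdorff_size; case: asboolP => [F0|_]; first by move: Fa; rewrite F0.
case: ifPn => // Fd; exfalso; move: Fd; apply/negP; rewrite -ltNge.
apply: (@lt_le_trans _ _ (enorm (a - b))%:E).
  by rewrite lte_fin; apply: lt_le_trans de (AB _ _ Aa Bb).
by apply: ereal_sup_ubound; exists (a, b).
Qed.

Lemma hausdorff_delta_separated delta eta A B : delta < eta ->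
  (forall a b, A a -> B b -> eta <= enorm (a - b)) ->
  (hausdorff_delta s delta A + hausdorff_delta s delta B <= hausdorff_delta s delta (A `|` B))%E.
Proof.
move=> de AB; apply: le_ereal_inf_tmp => _ [F [mF cF] <-].
pose FA k := if `[< F k `&` A = set0 >] then set0 else F k.
pose FB k := if `[< F k `&` B = set0 >] then set0 else F k.
have sz X : (0 <= hausdorff_size s delta X)%E by exact: hausdorff_size_ge0.
apply: (@le_trans _ _ (\sum_(k <oo) (hausdorff_size s delta (FA k) + hausdorff_size s delta (FB k)))%E); last first.
  by apply: lee_nneseries => [k _ _|k _]; [exact: adde_ge0|exact: hausdorff_size_split de AB].
rewrite nneseriesD//; apply: leeD.
  apply: ereal_inf_lbound; exists FA => //; split => [i|x Ax]; first exact: sub_sigma_algebra.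
  have [k _ Fx] := cF x (or_introl Ax); exists k => //; rewrite /FA.
  by case: asboolP => // E; have : (F k `&` A) x by []; rewrite E.
apply: ereal_inf_lbound; exists FB => //; split => [i|x Bx]; first exact: sub_sigma_algebra.
have [k _ Fx] := cF x (or_intror Bx); exists k => //; rewrite /FB.
by case: asboolP => // E; have : (F k `&` B) x by []; rewrite E.
Qed.

Lemma hausdorff_delta_anti delta1 delta2 A : delta1 <= delta2 ->
  (hausdorff_delta s delta2 A <= hausdorff_delta s delta1 A)%E.
Proof.
move=> d12; apply: le_ereal_inf_tmp => _ [F cF <-].
apply: (@le_trans _ _ (\sum_(k <oo) hausdorff_size s delta2 (F k))%E).
  by apply: ereal_inf_lbound; exists F.
apply: lee_nneseries => [k _ _|k _]; first exact: hausdorff_size_ge0.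
rewrite /hausdorff_size; case: asboolP => // _.
have [h1|h1] := boolP (ediam (F k) <= delta1%:E)%E; last by rewrite leey.
by rewrite (le_trans h1)// lee_fin.
Qed.

Local Notation H := (@hausdorff R n.+1 s).

Lemma hausdorff_separated eta A B : 0 < eta ->
  (forall a b, A a -> B b -> eta <= `|a - b|) -> (H A + H B <= H (A `|` B))%E.
Proof.
move=> eta0 AB; apply: ereal_sup_add_le.
- by exists 1 => /=.
- by move=> i _; apply: mu_ext_ge0 => X; exact: hausdorff_size_ge0.
- by move=> i _; apply: mu_ext_ge0 => X; exact: hausdorff_size_ge0.
(* The contents increase as the scale decreases, so both scales may be replaced by a common smaller
   one, below the separation. *)
move=> d1 d2 /= d10 d20; pose d := Num.min (Num.min d1 d2) (eta / 2).
have d0 : 0 < d by rewrite !lt_min d10 d20 divr_gt0.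
have dd1 : d <= d1 by rewrite /d !ge_min lexx.
have dd2 : d <= d2 by rewrite /d !ge_min lexx orbT.
have de : d < eta by rewrite /d gt_min; apply/orP; right; lra.
apply: (@le_trans _ _ (hausdorff_delta s d A + hausdorff_delta s d B)%E).
  by apply: leeD; exact: hausdorff_delta_anti.
apply: le_trans (hausdorff_delta_separated de _) _.
  by move=> a b Aa Bb; apply: le_trans (AB _ _ Aa Bb) (norm_le_enorm _).
by apply: ereal_sup_ubound; exists d.
Qed.

(** * Caratheodory's criterion for closed sets *)

Section closed_measurable.
Variable C : set V.
Hypothesis cC : closed C.

Let D (k : nat) : set V := [set x | forall c, C c -> k.+1%:R^-1 <= `|x - c|].

Let D_nondecreasing j k : (j <= k)%N -> D j `<=` D k.
Proof.
move=> jk x Dx c Cc; apply: le_trans (Dx c Cc).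
by rewrite lef_pV2 ?posrE// ler_nat ltnS.
Qed.

Let D_cover x : ~ C x -> exists k, D k x.
Proof.
move=> nC; have : nbhs x (~` C) by apply: open_nbhs_nbhs; split => //; exact: closed_openC.
move=> /nbhs_ballP[e /= e0 he].
exists (Num.Def.archi_bound e^-1) => c Cc; rewrite leNgt; apply/negP => xc.
apply: (he c) => //; apply/ballP; apply: lt_trans xc _.
rewrite -[ltRHS]invrK ltf_pV2 ?posrE ?invr_gt0//.
have := archi_boundP (ltW (_ : 0 < e^-1)); rewrite invr_gt0 => /(_ e0) h.
by apply: lt_trans h _; rewrite ltr_nat.
Qed.

Variable X : set V.
Hypothesis Xoo : (H X < +oo)%E.

Let Rg (k : nat) : set V := X `&` (D k.+1 `\` D k).

Let Rg_separated i j a b : (i.+2 <= j)%N -> Rg i a -> Rg j b ->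
  i.+2%:R^-1 - i.+3%:R^-1 <= `|a - b|.
Proof.
move=> ij [_ [Da _]] [_ [_ nDb]].
have [c [Cc bc]] : exists c, C c /\ `|b - c| < j.+1%:R^-1.
  apply: contrapT => h; apply: nDb => c Cc; rewrite leNgt; apply/negP => bc.
  by apply: h; exists c.
have ac := Da c Cc.
have ji : j.+1%:R^-1 <= i.+3%:R^-1 :> R by rewrite lef_pV2 ?posrE// ler_nat ltnS.
have : `|a - c| <= `|a - b| + `|b - c|.
  by rewrite (_ : a - c = (a - b) + (b - c)) ?ler_normD// addrA subrK.
by move: (i.+2%:R^-1) (i.+3%:R^-1) (j.+1%:R^-1) ac ji bc => p q t; lra.
Qed.

(** Neighbouring rings may touch, but rings whose indices differ by 2 or more are at positive
    distance, so the outer measure is additive over rings of the same parity. *)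
Let parity_sum (e K : nat) : (\sum_(k < K) H (Rg (k.*2 + e)%N) <= H X)%E.
Proof.
apply: (@le_trans _ _ (H (\big[setU/set0]_(k < K) Rg (k.*2 + e)%N))); last first.
  by apply: le_outer_measure; rewrite -(bigcup_mkord K (fun k => Rg (k.*2 + e)%N)) => x [k _ []].
elim: K => [|K ih]; first by rewrite !big_ord0 outer_measure0.
rewrite !big_ord_recr/=.
apply: (@le_trans _ _ (H (\big[setU/set0]_(k < K) Rg (k.*2 + e)%N) + H (Rg (K.*2 + e)%N))%E).
  exact: leeD2r.
case: K {ih} => [|K]; first by rewrite big_ord0 outer_measure0 add0e set0U.
pose m := (K.*2 + e)%N.
apply: (@hausdorff_separated (m.+2%:R^-1 - m.+3%:R^-1)).
  by rewrite subr_gt0 ltf_pV2 ?posrE// ltr_nat.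
move=> a b; rewrite -(bigcup_mkord K.+1 (fun k => Rg (k.*2 + e)%N)) => -[k /= kK Ra] Rb.
have km : (k.*2 + e <= m)%N by rewrite leq_add2r leq_double -ltnS.
have h := @Rg_separated (k.*2 + e)%N (K.+1.*2 + e)%N a b _ Ra Rb.
apply: le_trans (h _); last by rewrite doubleS !addSn !ltnS; exact: km.
have pos (i : nat) : 0 < i.+1%:R :> R by [].
have E (i : nat) : i.+2%:R^-1 - i.+3%:R^-1 = (i.+2%:R * i.+3%:R)^-1 :> R.
  have -> : i.+3%:R = i.+2%:R + 1 :> R by rewrite natr1.
  have x0 : 0 < i.+2%:R :> R by [].
  move: (i.+2%:R : R) x0 => x x0; field.
  by apply/andP; split; rewrite gt_eqF//; move: x0; lra.
rewrite !E lef_pV2 ?posrE ?mulr_gt0// ler_pM// ler_nat !ltnS; exact: km.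
Qed.

Let sum_Rg_fin : (\sum_(k <oo) H (Rg k) < +oo)%E.
Proof.
apply: (@le_lt_trans _ _ (H X + H X)%E); last by rewrite lte_add_pinfty.
have Rg0 k : (0 <= H (Rg k))%E by exact: outer_measure_ge0.
apply: lime_le; first by apply: is_cvg_nneseries => k _ _.
apply: nearW => K; rewrite big_mkord.
apply: (@le_trans _ _ (\sum_(k < K.*2) H (Rg k))%E).
  rewrite -!(big_mkord xpredT (fun k => H (Rg k))).
  by apply: lee_sum_nneg_natr => //; rewrite -addnn leq_addr.
rewrite (sum_parity (fun k => H (Rg k))).
by apply: leeD; exact: parity_sum.
Qed.

(** The part of [X] outside [C] is its part at distance at least 1/(k+1), separated from [C],
    together with the rings from k on, whose total measure is the tail of a convergent series. *)
Lemma closed_caratheodory_lty : (H (X `&` C) + H (X `&` ~` C) <= H X)%E.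
Proof.
have Rg0 k : (0 <= H (Rg k))%E by exact: outer_measure_ge0.
have step k : (H (X `&` C) + H (X `&` ~` C) <= H X + \sum_(k <= i <oo) H (Rg i))%E.
  have sub : X `&` ~` C `<=` (X `&` D k) `|` \bigcup_(i in ~` `I_k) Rg i.
    move=> x [Xx nCx]; have [Dk|nDk] := pselect (D k x); first by left.
    right; pose P i := `[< D i x >].
    have exP : exists i, P i by have [i Di] := D_cover nCx; exists i; exact/asboolP.
    case: (ex_minnP exP) => i /asboolP Di imin.
    have ki : (k < i)%N.
      rewrite ltnNge; apply/negP => ik; apply: nDk; exact: D_nondecreasing Di.
    case: i Di imin ki => // i Di imin ki; exists i => /=; first by apply/negP; rewrite -leqNgt.
    split => //; split => // Di'; have := imin i; rewrite /P ltnn => h.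
    by have : false by apply: h; exact/asboolP.
  apply: (@le_trans _ _ (H (X `&` C) + (H (X `&` D k) + \sum_(k <= i <oo) H (Rg i)))%E).
    apply: leeD2l; apply: le_trans (le_outer_measure H _ _ sub) _.
    apply: le_trans (outer_measureU2 _ _ _) _; apply: leeD2l.
    exact: outer_measure_sigma_subadditive_tail.
  rewrite addeA; apply: leeD2r.
  have sep : forall a b, (X `&` C) a -> (X `&` D k) b -> k.+1%:R^-1 <= `|a - b|.
    by move=> a b [_ Ca] [_ Db]; rewrite distrC; exact: Db.
  have kpos : 0 < k.+1%:R^-1 :> R by rewrite invr_gt0.
  apply: le_trans (hausdorff_separated kpos sep) _.
  by apply: le_outer_measure => x [[]|[]].
have tl := @nneseries_tail_cvg R (fun k => H (Rg k)) xpredT sum_Rg_fin (fun k _ => Rg0 k).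
have cv : (H X + \sum_(k <= i <oo) H (Rg i) @[k --> \oo] --> H X + 0)%E.
  apply: cvgeD => //; last exact: cvg_cst.
  by rewrite fin_num_adde_defl.
rewrite adde0 in cv.
rewrite -(cvg_lim _ cv)//; apply: lime_ge; first by apply/cvg_ex; exists (H X).
exact: nearW.
Qed.

End closed_measurable.

Lemma closed_caratheodory C : closed C -> H.-caratheodory C.
Proof.
move=> cC; apply: le_caratheodory_measurable => X.
have [Xoo|] := ltP (H X) +oo%E; first exact: closed_caratheodory_lty.
by move=> h; apply: le_trans h; exact: leey.
Qed.

End metric_outer_measure.

Section boundary_measurable.
Context {R : realType} (n : nat).
Local Notation V := 'rV[R]_n.+1.
Implicit Types (Omega : set V).

Lemma closed_boundary Omega : closed (boundary Omega).
Proof.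
by rewrite /boundary; apply: closedI; [exact: closed_closure|apply: open_closedC; exact: open_interior].
Qed.

Lemma measurable_closed_surface (C : set V) : closed C ->
  measurable (C : set (caratheodory_type (@surface_outer_measure R n))).
Proof. exact: closed_caratheodory. Qed.

Lemma measurable_boundary Omega :
  measurable (boundary Omega : set (caratheodory_type (@surface_outer_measure R n))).
Proof. exact: measurable_closed_surface (closed_boundary (Omega := Omega)). Qed.

End boundary_measurable.

(** * Linear differential equations *)

Section finite_sums.
Context {R : realType}.

Lemma cvg_bigsum (T I : Type) (F : set_system T) {FF : Filter F} (r : seq I) (f : I -> T -> R) (l : I -> R) :
  (forall i, f i x @[x --> F] --> l i) ->
  (\sum_(i <- r) f i x) @[x --> F] --> \sum_(i <- r) l i.
Proof.
move=> h; elim: r => [|i r ih].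
  under eq_fun do rewrite big_nil.
  by rewrite big_nil; exact: cvg_cst.
under eq_fun do rewrite big_cons.
by rewrite big_cons; apply: cvgD.
Qed.

Lemma is_derive_bigsum (I : Type) (r : seq I) (f : I -> R -> R) (df : I -> R) (x : R) :
  (forall i, is_derive x (1 : R) (f i) (df i)) ->
  is_derive x (1 : R) (fun t => \sum_(i <- r) f i t) (\sum_(i <- r) df i).
Proof.
move=> h; elim: r => [|i r ih].
  under eq_fun do rewrite big_nil.
  by rewrite big_nil; exact: is_derive_cst.
under eq_fun do rewrite big_cons.
by rewrite big_cons; exact: (is_deriveD (h i) ih).
Qed.

Lemma is_derive_mul (f g : R -> R) (x a b : R) :
  is_derive x (1 : R) f a -> is_derive x (1 : R) g b ->
  is_derive x (1 : R) (fun t => f t * g t) (a * g x + f x * b).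
Proof.
move=> df dg; apply: (is_derive_eq (is_deriveM df dg)).
by rewrite /GRing.scale/= addrC [g x * _]mulrC.
Qed.

Lemma is_derive_mulc (f : R -> R) (x a c : R) : is_derive x (1 : R) f a ->
  is_derive x (1 : R) (fun t => c * f t) (c * a).
Proof. by move=> df; exact: (is_deriveZ c df). Qed.

Lemma is_derive_neg (f : R -> R) (x a : R) : is_derive (- x) (1 : R) f a ->
  is_derive x (1 : R) (fun t => f (- t)) (- a).
Proof.
move=> df; have d1 : is_derive x (1 : R) (fun t : R => - t) (- 1).
  by exact: (is_deriveN (is_derive_id x (1 : R))).
by apply: (is_derive_eq (is_derive1_comp df d1)); rewrite mulrN1.
Qed.

Lemma is_derive_continuous (f : R -> R) (x a : R) : is_derive x (1 : R) f a -> {for x, continuous f}.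
Proof. by move=> [d _]; apply: differentiable_continuous; exact/derivable1_diffP. Qed.

Lemma continuous_bigsum (I : Type) (r : seq I) (f : I -> R -> R) :
  (forall i, continuous (f i)) -> continuous (fun t => \sum_(i <- r) f i t).
Proof. by move=> h x; apply: cvg_bigsum => i; exact: h. Qed.

End finite_sums.

Section matrix_exponential.
Context {R : realType} (N : nat).
Local Notation M := 'M[R]_N.
Implicit Types (B D : M) (i j k l : 'I_N) (x t : R).

(** Coefficients of the entry (i, j) of D exp(x B). The left factor [D] makes the family closed
    under derivation, which replaces [D] by D B. *)
Definition expcoef B D i j (m : nat) : R := (D *m B ^+ m) i j / m`!%:R.

Definition mexp B D i j x : R := limn (pseries (expcoef B D i j) x).

Let mxsum D : R := \sum_i \sum_j `|D i j|.

Let mxsum_ge0 D : 0 <= mxsum D.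
Proof. by apply: sumr_ge0 => i _; exact: sumr_ge0. Qed.

Let entry_le D i j : `|D i j| <= mxsum D.
Proof.
rewrite /mxsum (bigD1 i)//= (bigD1 j)//= -addrA lerDl addr_ge0//; first exact: sumr_ge0.
by apply: sumr_ge0 => k _; exact: sumr_ge0.
Qed.

Lemma expr_entry_le B D m i j : `|(D *m B ^+ m) i j| <= mxsum D * mxsum B ^+ m.
Proof.
elim: m j => [|m ih] j; first by rewrite (_ : B ^+ 0 = 1%:M)// mulmx1 expr0 mulr1; exact: entry_le.
rewrite exprSr mulmxA mxE; apply: le_trans (ler_norm_sum _ _ _) _.
apply: (@le_trans _ _ (\sum_k (mxsum D * mxsum B ^+ m) * `|B k j|)).
  by apply: ler_sum => k _; rewrite normrM ler_wpM2r.
rewrite -mulr_sumr exprSr mulrA ler_wpM2l//; first by rewrite mulr_ge0// exprn_ge0.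
rewrite /mxsum exchange_big/= [leRHS](bigD1 j)//= lerDl.
by apply: sumr_ge0 => k _; exact: sumr_ge0.
Qed.

Lemma cvg_expcoef B D i j x : cvgn (pseries (expcoef B D i j) x).
Proof.
apply: normed_cvg.
apply: (@series_le_cvg _ _ (fun m => mxsum D * exp_coeff (mxsum B * `|x|) m)).
- by move=> m /=.
- by move=> m; rewrite mulr_ge0// exp_coeff_ge0// mulr_ge0.
- move=> m /=; rewrite /expcoef /exp_coeff /= normrM normrX normrM.
  rewrite [`|_^-1|]ger0_norm ?invr_ge0// exprMn.
  rewrite (_ : mxsum D * (mxsum B ^+ m * `|x| ^+ m / m`!%:R) =
     mxsum D * mxsum B ^+ m / m`!%:R * `|x| ^+ m); last by ring.
  rewrite ler_wpM2r ?exprn_ge0// ler_wpM2r ?invr_ge0//; exact: expr_entry_le.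
have -> : (fun m => mxsum D * exp_coeff (mxsum B * `|x|) m) =
    mxsum D *: (exp_coeff (mxsum B * `|x|)) by [].
apply: is_cvg_seriesZ; exact: is_cvg_series_exp_coeff.
Qed.

Lemma expcoef_diffs B D i j : pseries_diffs (expcoef B D i j) = expcoef B (D *m B) i j.
Proof.
apply/funext => m; rewrite /pseries_diffs /expcoef factS natrM exprS mulmxA.
by field; rewrite pnatr_eq0 -lt0n fact_gt0 addrC natr1 pnatr_eq0.
Qed.

Lemma mexp_derive B D i j x : is_derive x (1 : R) (mexp B D i j) (mexp B (D *m B) i j x).
Proof.
rewrite /mexp -expcoef_diffs; apply: (@pseries_snd_diffs _ _ (`|x| + 1)).
- exact: cvg_expcoef.
- by rewrite expcoef_diffs; exact: cvg_expcoef.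
- by rewrite !expcoef_diffs; exact: cvg_expcoef.
- by rewrite [ltRHS]ger0_norm ?addr_ge0// ltrDl.
Qed.

Lemma mexp_mull B A D i j x : mexp B (A *m D) i j x = \sum_l A i l * mexp B D l j x.
Proof.
apply: cvg_lim => //.
have -> : pseries (expcoef B (A *m D) i j) x = fun m => \sum_l A i l * pseries (expcoef B D l j) x m.
  apply/funext => m; under [RHS]eq_bigr do rewrite /pseries /series/= mulr_sumr.
  rewrite exchange_big/= /pseries /series/=; apply: eq_bigr => q _.
  rewrite /expcoef -mulmxA mxE !mulr_suml; apply: eq_bigr => l _.
  by rewrite !mulrA.
by apply: cvg_bigsum => l; apply: cvgMr; exact: cvg_expcoef.
Qed.

Lemma mexp_comm B i j x : mexp B B i j x = \sum_l mexp B 1%:M i l x * B l j.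
Proof.
apply: cvg_lim => //.
have -> : pseries (expcoef B B i j) x = fun m => \sum_l pseries (expcoef B 1%:M i l) x m * B l j.
  apply/funext => m; under [RHS]eq_bigr do rewrite /pseries /series/= mulr_suml.
  rewrite exchange_big/= /pseries /series/=; apply: eq_bigr => q _.
  rewrite /expcoef.
  have -> : B *m B ^+ q = B ^+ q *m B by rewrite -[LHS]exprS exprSr.
  rewrite mxE !mulr_suml; apply: eq_bigr => l _.
  by rewrite mul1mx; ring.
by apply: cvg_bigsum => l; apply: cvgMl; exact: cvg_expcoef.
Qed.

Lemma mexp0 B i j : mexp B 1%:M i j 0 = (i == j)%:R.
Proof.
apply: cvg_lim => //; rewrite -(cvg_shiftn 1).
have -> : (fun m => pseries (expcoef B 1%:M i j) 0 (m + 1)%N) = fun=> (i == j)%:R.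
  apply/funext => m; rewrite addn1 /pseries /series/= big_nat_recl// big1 ?addr0; last first.
    by move=> q _; rewrite expr0n/= mulr0.
  by rewrite /expcoef (_ : B ^+ 0 = 1%:M)// mulmx1 mxE fact0 divr1 expr0 mulr1.
exact: cvg_cst.
Qed.

(** The product exp(x B) exp(-x B) has zero derivative, because [B] commutes with its exponential,
    and is the identity at 0. *)
Lemma mexp_inv B i j x : \sum_l mexp B 1%:M i l x * mexp B 1%:M l j (- x) = (i == j)%:R.
Proof.
pose e := mexp B 1%:M; pose f x := \sum_l e i l x * e l j (- x).
have df t : is_derive t (1 : R) f 0.
  have d l : is_derive t (1 : R) (fun s => e i l s * e l j (- s))
      (mexp B B i l t * e l j (- t) + e i l t * - mexp B B l j (- t)).
    have d1 := mexp_derive B 1%:M i l t; rewrite mul1mx in d1.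
    have d2 := is_derive_neg (mexp_derive B 1%:M l j (- t)); rewrite mul1mx in d2.
    exact: (is_derive_mul d1 d2).
  apply: (is_derive_eq (is_derive_bigsum _ d)).
  rewrite big_split/=.
  under eq_bigr do rewrite mexp_comm mulr_suml.
  rewrite exchange_big/=.
  under [X in _ + X]eq_bigr do rewrite -[X in mexp B X]mulmx1 mexp_mull mulrN mulr_sumr.
  rewrite sumrN; apply/eqP; rewrite subr_eq0; apply/eqP.
  by apply: eq_bigr => l _; apply: eq_bigr => k _; rewrite mulrA.
have -> : \sum_l mexp B 1%:M i l x * mexp B 1%:M l j (- x) = f x by [].
rewrite (is_derive_0_is_cst x 0 df) /f.
under eq_bigr do rewrite oppr0 /e !mexp0.
by rewrite (bigD1 i)//= eqxx mul1r big1 ?addr0// => l li; rewrite eq_sym (negbTE li) mul0r.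
Qed.

End matrix_exponential.

Section linear_ode.
Context {R : realType}.

Lemma primitive (f : R -> R) (T : R) : continuous f -> exists F : R -> R, F T = 0 /\
  forall t, 0 <= t <= T -> is_derive t (1 : R) F (f t).
Proof.
(* Integrating from -1, and working up to T + 1, makes 0 and T interior points, where the
   fundamental theorem gives two-sided derivatives. *)
move=> cf; pose F x := \int[lebesgue_measure]_(t in [set` `[-1, x]]) f t.
exists (fun x => F x - F T); split; first by rewrite subrr.
move=> t /andP[t0 tT].
have fi : lebesgue_measure.-integrable `[-1, T + 1] (EFin \o f).
  apply: continuous_compact_integrable; first exact: segment_compact.
  exact: continuous_subspaceT.
have tT1 : t < T + 1 by rewrite ltr_pwDr.
have t1 : -1 < t by apply: lt_le_trans t0; rewrite oppr_lt0.
have [d e] := continuous_FTC1_closed tT1 fi t1 (cf t).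
have dF : is_derive t (1 : R) F (f t) by apply: DeriveDef; rewrite -?derive1E.
apply: (is_derive_eq (is_deriveB dF (is_derive_cst (F T) t (1 : R)))).
by rewrite subr0.
Qed.

(** Variation of constants with final data: y(t) = exp(t B) F(t), where F(T) = 0 and F'(s) = exp(-s
    B) f(s). *)
Lemma linear_ode (N : nat) (B : 'M[R]_N) (f : 'I_N -> R -> R) (T : R) :
  (forall i, continuous (f i)) ->
  exists y : 'I_N -> R -> R, (forall i, y i T = 0) /\
    forall i t, 0 <= t <= T -> is_derive t (1 : R) (y i) (\sum_j B i j * y j t + f i t).
Proof.
move=> cf; pose e := mexp B 1%:M.
have ce i j : continuous (e i j).
  by move=> x; exact: (is_derive_continuous (mexp_derive B 1%:M i j x)).
pose g j (s : R) := \sum_l e j l (- s) * f l s.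
have cg j : continuous (g j).
  apply: continuous_bigsum => l x; apply: cvgM; last exact: cf.
  apply: (@continuous_comp _ _ _ (fun t : R => - t) (e j l)); last exact: ce.
  exact: opp_continuous.
have /choice[F hF] : forall j, exists F : R -> R, F T = 0 /\
    forall t, 0 <= t <= T -> is_derive t (1 : R) F (g j t).
  by move=> j; exact: primitive.
exists (fun i t => \sum_j e i j t * F j t); split.
  by move=> i; rewrite big1// => j _; rewrite (hF j).1 mulr0.
move=> i t tT.
have d j : is_derive t (1 : R) (fun s => e i j s * F j s) (mexp B B i j t * F j t + e i j t * g j t).
  have d1 := mexp_derive B 1%:M i j t; rewrite mul1mx in d1.
  exact: (is_derive_mul d1 ((hF j).2 t tT)).
apply: (is_derive_eq (is_derive_bigsum _ d)); rewrite big_split/=; congr (_ + _).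
  under eq_bigr do rewrite -[X in mexp B X]mulmx1 mexp_mull mulr_suml.
  rewrite exchange_big/=; apply: eq_bigr => l _; rewrite mulr_sumr.
  by apply: eq_bigr => j _; rewrite mulrA.
under eq_bigr do rewrite /g mulr_sumr.
rewrite exchange_big/= (bigD1 i)//= [X in _ + X]big1 ?addr0.
  under eq_bigr do rewrite mulrA.
  by rewrite -mulr_suml mexp_inv eqxx mul1r.
move=> l li; under eq_bigr do rewrite mulrA.
by rewrite -mulr_suml mexp_inv eq_sym (negbTE li) mul0r.
Qed.

(** Reduction to a first order system for (y, y') with a two by two block matrix. *)
Lemma second_order_ode (r : nat) (A : 'M[R]_r) (f : 'I_r -> R -> R) (T : R) :
  (forall i, continuous (f i)) ->
  exists y z : 'I_r -> R -> R, [/\ forall i, y i T = 0, forall i, z i T = 0,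
    forall i t, 0 <= t <= T -> is_derive t (1 : R) (y i) (z i t) &
    forall i t, 0 <= t <= T -> is_derive t (1 : R) (z i) (f i t - \sum_j A i j * y j t)].
Proof.
move=> cf; pose B : 'M[R]_(r + r) := block_mx 0 1%:M (- A) 0.
pose h (i : 'I_(r + r)) (t : R) := match fintype.split i with inl _ => 0 | inr k => f k t end.
have ch i : continuous (h i).
  by rewrite /h; case: fintype.split => k; [exact: cst_continuous|exact: cf].
have [y [yT dy]] := linear_ode B T ch.
exists (fun i => y (lshift r i)), (fun i => y (rshift r i)); split => //.
- move=> i t tT; apply: (is_derive_eq (dy (lshift r i) t tT)).
  rewrite /h (unsplitK (inl i)) addr0 big_split_ord/= big1 ?add0r; last first.
    by move=> j _; rewrite /B block_mxEul mxE mul0r.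
  rewrite (bigD1 i)//= /B block_mxEur mxE eqxx mul1r big1 ?addr0// => j ji.
  by rewrite block_mxEur mxE eq_sym (negbTE ji) mul0r.
- move=> i t tT; apply: (is_derive_eq (dy (rshift r i) t tT)).
  rewrite /h (unsplitK (inr i)) addrC big_split_ord/= [X in _ + (_ + X)]big1 ?addr0; last first.
    by move=> j _; rewrite /B block_mxEdr mxE mul0r.
  congr (_ + _); rewrite -sumrN; apply: eq_bigr => j _.
  by rewrite /B block_mxEdl mxE mulNr.
Qed.

End linear_ode.

(** * The abstract energy estimate *)

Section seminormed.
Context {R : realType}.

Record seminormed (U : lmodType R) (P : set U) (N : U -> R) : Prop := Seminormed {
  sn_lin : lin_closed P;
  sn_ge0 : forall u, P u -> 0 <= N u;
  sn_tri : forall u v, P u -> P v -> N (u + v) <= N u + N v;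
  sn_scale : forall c u, P u -> N (c *: u) = `|c| * N u }.

Lemma seminormed_semi_inner (U : lmodType R) (P : set U) i (N : U -> R) : lin_closed P ->
  semi_inner P i -> (forall u, P u -> N u = snorm i u) -> seminormed P N.
Proof.
move=> hP hi hN; split => //.
- by move=> u Pu; rewrite hN// snorm_ge0.
- by move=> u v Pu Pv; rewrite (hN _ Pu) (hN _ Pv) hN; [exact: (snormD hP hi)|exact: lin_closedD].
- by move=> c u Pu; rewrite (hN _ Pu) hN; [exact: (snormZ hP hi)|exact: lin_closedZ].
Qed.

Section one_space.
Variables (U : lmodType R) (P : set U) (N : U -> R).
Hypothesis sN : seminormed P N.

Lemma sn0 : N 0 = 0.
Proof. by have [P0 _] := sn_lin sN; rewrite -(scale0r (0 : U)) (sn_scale sN)// normr0 mul0r. Qed.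

Lemma snN u : P u -> N (- u) = N u.
Proof. by move=> Pu; rewrite -scaleN1r (sn_scale sN)// normrN normr1 mul1r. Qed.

Lemma sn_subC u v : P u -> P v -> N (u - v) = N (v - u).
Proof. by move=> Pu Pv; rewrite -opprB snN//; apply: lin_closedB => //; exact: sn_lin sN. Qed.

Lemma sn_le u v : P u -> P v -> N u <= N v + N (u - v).
Proof.
move=> Pu Pv; rewrite -{1}(subrK v u) addrC; apply: (sn_tri sN) => //.
by apply: lin_closedB => //; exact: sn_lin sN.
Qed.

Lemma sn_dist u v : P u -> P v -> `|N u - N v| <= N (u - v).
Proof.
move=> Pu Pv; rewrite ler_norml; have := sn_le Pu Pv; have := sn_le Pv Pu.
by rewrite sn_subC// => h1 h2; apply/andP; split; lra.
Qed.

End one_space.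

Section bounded_bilinear.
Variables (U W : lmodType R) (P : set U) (Q : set W) (N : U -> R) (M : W -> R).
Hypotheses (sN : seminormed P N) (sM : seminormed Q M).

Record bbil (B : U -> W -> R) : Prop := Bbil {
  bbil_linl : forall c u v w, P u -> P v -> Q w -> B (c *: u + v) w = c * B u w + B v w;
  bbil_linr : forall c u w z, P u -> Q w -> Q z -> B u (c *: w + z) = c * B u w + B u z;
  bbil_bound : exists2 C : R, 0 <= C & forall u w, P u -> Q w -> `|B u w| <= C * N u * M w }.

Variable B : U -> W -> R.
Hypothesis hB : bbil B.

Lemma bbilDl u v w : P u -> P v -> Q w -> B (u + v) w = B u w + B v w.
Proof. by move=> Pu Pv Qw; rewrite -[u in LHS]scale1r (bbil_linl hB)// mul1r. Qed.

Lemma bbilBl u v w : P u -> P v -> Q w -> B (u - v) w = B u w - B v w.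
Proof. by move=> Pu Pv Qw; rewrite addrC -scaleN1r (bbil_linl hB)// mulN1r addrC. Qed.

Lemma bbilDr u w z : P u -> Q w -> Q z -> B u (w + z) = B u w + B u z.
Proof. by move=> Pu Qw Qz; rewrite -[w in LHS]scale1r (bbil_linr hB)// mul1r. Qed.

Lemma bbilBr u w z : P u -> Q w -> Q z -> B u (w - z) = B u w - B u z.
Proof. by move=> Pu Qw Qz; rewrite addrC -scaleN1r (bbil_linr hB)// mulN1r addrC. Qed.

Lemma bbil0l w : Q w -> B 0 w = 0.
Proof.
move=> Qw; have [P0 _] := sn_lin sN.
by have := bbilBl P0 P0 Qw; rewrite subrr => ->; rewrite subrr.
Qed.

Lemma bbil0r u : P u -> B u 0 = 0.
Proof.
move=> Pu; have [Q0 _] := sn_lin sM.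
by have := bbilBr Pu Q0 Q0; rewrite subrr => ->; rewrite subrr.
Qed.

Lemma bbilZl c u w : P u -> Q w -> B (c *: u) w = c * B u w.
Proof.
move=> Pu Qw; have [P0 _] := sn_lin sN.
by rewrite -[c *: u]addr0 (bbil_linl hB)// bbil0l// addr0.
Qed.

Lemma bbilZr c u w : P u -> Q w -> B u (c *: w) = c * B u w.
Proof.
move=> Pu Qw; have [Q0 _] := sn_lin sM.
by rewrite -[c *: w]addr0 (bbil_linr hB)// bbil0r// addr0.
Qed.

Lemma bbil_suml (I : Type) (r : seq I) (c : I -> R) (F : I -> U) w :
  (forall i, P (F i)) -> Q w -> B (\sum_(i <- r) c i *: F i) w = \sum_(i <- r) c i * B (F i) w.
Proof.
move=> PF Qw; have hP := sn_lin sN; elim: r => [|i r ih]; first by rewrite !big_nil bbil0l.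
rewrite !big_cons (bbil_linl hB) ?ih//.
by apply: lin_closed_sum => // j _; exact: lin_closedZ.
Qed.

Lemma bbil_sumr (I : Type) (r : seq I) (c : I -> R) (F : I -> W) u :
  (forall i, Q (F i)) -> P u -> B u (\sum_(i <- r) c i *: F i) = \sum_(i <- r) c i * B u (F i).
Proof.
move=> QF Pu; have hQ := sn_lin sM; elim: r => [|i r ih]; first by rewrite !big_nil bbil0r.
rewrite !big_cons (bbil_linr hB) ?ih//.
by apply: lin_closed_sum => // j _; exact: lin_closedZ.
Qed.

Lemma bbil_null_l u w : P u -> Q w -> N u = 0 -> B u w = 0.
Proof.
move=> Pu Qw u0; have [C _ hC] := bbil_bound hB.
by have := hC u w Pu Qw; rewrite u0 mulr0 mul0r normr_le0 => /eqP.
Qed.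

Lemma bbil_null_r u w : P u -> Q w -> M w = 0 -> B u w = 0.
Proof.
move=> Pu Qw w0; have [C _ hC] := bbil_bound hB.
by have := hC u w Pu Qw; rewrite w0 mulr0 normr_le0 => /eqP.
Qed.

Lemma cvg_bbil (T : Type) (F : set_system T) {FF : Filter F} (u : T -> U) (w : T -> W) u0 w0 :
  (\forall s \near F, P (u s)) -> (\forall s \near F, Q (w s)) -> P u0 -> Q w0 ->
  N (u s - u0) @[s --> F] --> (0 : R) -> M (w s - w0) @[s --> F] --> (0 : R) ->
  B (u s) (w s) @[s --> F] --> B u0 w0.
Proof.
move=> Pu Qw Pu0 Qw0 cu cw; have [C C0 hC] := bbil_bound hB.
have hP := sn_lin sN; have hQ := sn_lin sM.
apply/subr_cvg0; apply: norm_cvg0.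
pose G s := C * N (u s - u0) * (M (w s - w0) + M w0) + C * N u0 * M (w s - w0).
apply: (@squeeze_cvgr _ _ _ _ (fun=> 0) G).
- near=> s.
  have Pus : P (u s) by near: s. have Qws : Q (w s) by near: s.
  have Puu : P (u s - u0) by exact: lin_closedB.
  have Qww : Q (w s - w0) by exact: lin_closedB.
  rewrite normr_ge0/=.
  have -> : B (u s) (w s) - B u0 w0 = B (u s - u0) (w s) + B u0 (w s - w0).
    by rewrite bbilBl// bbilBr//; ring.
  apply: le_trans (ler_normD _ _) _; apply: lerD; last exact: hC.
  apply: le_trans (hC _ _ Puu Qws) _; apply: ler_wpM2l; first by rewrite mulr_ge0// (sn_ge0 sN).
  by rewrite [leRHS]addrC; exact: (sn_le sM).
- exact: cvg_cst.
- have -> : (0 : R) = C * 0 * (0 + M w0) + C * N u0 * 0 by rewrite !mulr0 mul0r addr0.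
  apply: cvgD; first by apply: cvgM; [apply: cvgMr|apply: cvgD => //; exact: cvg_cst].
  exact: cvgMr.
Unshelve. all: by end_near. Qed.

End bounded_bilinear.

End seminormed.

(** * Derivatives in time and decay of square roots *)

Section time_calculus.
Context {R : realType}.

Lemma is_derive_quotient (f : R -> R) (t a : R) :
  (s - t)^-1 * (f s - f t) @[s --> t^'] --> a -> is_derive t (1 : R) f a.
Proof.
move=> h; apply/is_derive1_caratheodory.
exists (fun z => if z == t then a else (z - t)^-1 * (f z - f t)); split.
- move=> z; case: eqVneq => [->|zt]; first by rewrite !subrr mulr0.
  by rewrite mulrAC mulVf ?mul1r// subr_eq0.
- apply/continuous_withinNx; rewrite eqxx; apply: cvg_trans h; apply: near_eq_cvg.
  by near=> z; rewrite ifF//; apply/negbTE; near: z; exact: nbhs_dnbhs_neq.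
- by rewrite eqxx.
Unshelve. all: by end_near. Qed.

Lemma cvg_within_oo (a b t : R) (f : R -> R) (l : R) : t \in `]a, b[ ->
  f s @[s --> within [set` `[a, b]] t^'] --> l -> f s @[s --> t^'] --> l.
Proof.
move=> tab h; apply: cvg_trans h => A h.
have {}h : \forall s \near t^', s \in `[a, b] -> A (f s) by exact: h.
have nt : \forall s \near t^', s \in `[a, b].
  apply: nbhs_dnbhs; near=> s; apply: subset_itv_oo_cc; near: s; exact: near_in_itvoo.
by apply: filterS2 h nt => s hs sI; exact: hs.
Unshelve. all: by end_near. Qed.

(** Where e > 0, the derivative of sqrt e is at least -s, so sqrt e + g does not decrease up to T,
    where e vanishes. *)
Lemma sqrt_decay (e de g s : R -> R) (t0 T : R) : t0 < T ->
  (forall t, t \in `]t0, T[ -> is_derive t (1 : R) e (de t)) ->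
  (forall t, t \in `]t0, T[ -> is_derive t (1 : R) g (s t)) ->
  {within `[t0, T], continuous e} -> {within `[t0, T], continuous g} ->
  (forall t, t \in `[t0, T] -> 0 <= e t) -> e T = 0 ->
  (forall t, t \in `]t0, T[ -> 0 <= s t) ->
  (forall t, t \in `]t0, T[ -> `|de t| <= 2 * s t * Num.sqrt (e t)) ->
  Num.sqrt (e t0) <= g T - g t0.
Proof.
move=> tT dE dG cE cG e0 eT s0 hde; apply/ler_addgt0Pr => eta eta0.
(* The square root is not differentiable at zeros of e; this shift costs eta at time T, and eta is
   arbitrary. *)
pose q t := e t + eta ^+ 2.
have q0 t : t \in `[t0, T] -> 0 < q t.
  by move=> /e0 et; rewrite /q ltr_wpDl// exprn_gt0.
pose H t := Num.sqrt (q t) + g t.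
pose dH t := de t / (2 * Num.sqrt (q t)) + s t.
have dHt t : t \in `]t0, T[ -> is_derive t (1 : R) H (dH t).
  move=> tI; have qt := q0 t (subset_itv_oo_cc tI).
  have dq : is_derive t (1 : R) q (de t).
    apply: (is_derive_eq (is_deriveD (dE t tI) (is_derive_cst (eta ^+ 2) t (1 : R)))).
    by rewrite addr0.
  have d1 := is_derive1_comp (is_derive1_sqrt qt) dq.
  by apply: (is_derive_eq (is_deriveD d1 (dG t tI))); rewrite /dH mulrC.
have cH : {within `[t0, T], continuous H}.
  apply/subspace_continuousP => x xI; apply: cvgD; last first.
    by move/subspace_continuousP : cG; apply.
  apply: (@cvg_comp _ _ _ q Num.sqrt _ (nbhs (q x))); last exact: (sqrt_continuous (x := q x)).
  apply: cvgD; last exact: cvg_cst.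
  by move/subspace_continuousP : cE; apply.
have [c cI hc] := MVT tT dHt cH.
have dHc : 0 <= dH c.
  have qc := q0 c (subset_itv_oo_cc cI); have ec := e0 c (subset_itv_oo_cc cI).
  have sq : 0 < Num.sqrt (q c) by rewrite sqrtr_gt0.
  have hq : Num.sqrt (e c) <= Num.sqrt (q c) by rewrite ler_wsqrtr// lerDl sqr_ge0.
  have := hde c cI; rewrite ler_norml => /andP[h1 _].
  have sc : - (2 * s c * Num.sqrt (q c)) <= de c.
    by apply: le_trans h1; rewrite lerN2 ler_wpM2l// mulr_ge0// s0.
  rewrite /dH -lerBlDr sub0r ler_pdivlMr ?mulr_gt0//.
  by apply: le_trans sc; rewrite le_eqVlt; apply/orP; left; apply/eqP; ring.
have : H t0 <= H T.
  by rewrite -subr_ge0 hc mulr_ge0// subr_ge0 ltW.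
rewrite /H {2}/q eT add0r sqrtr_sqr gtr0_norm//.
have : Num.sqrt (e t0) <= Num.sqrt (q t0) by rewrite ler_wsqrtr// lerDl sqr_ge0.
lra.
Qed.

End time_calculus.

Section evolution_calculus.
Context {R : realType}.

Lemma near_within (T : Type) (F : set_system T) {FF : Filter F} (A : set T) :
  \forall s \near within A F, A s.
Proof. by rewrite near_withinE; exact: nearW. Qed.

Lemma cvg_within_dnbhs (I : set R) (t : R) (g : R -> R) (l : R) : g t = l ->
  g s @[s --> within I t^'] --> l -> g s @[s --> within I (nbhs t)] --> l.
Proof.
move=> gt h A Al; have hA : \forall s \near t, s != t -> I s -> A (g s) by exact: (h A Al).
have goal : \forall s \near t, I s -> A (g s); last by exact: goal.
apply: filterS hA => s hs Is; have [->|st] := eqVneq s t; last exact: hs.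
by rewrite gt; exact: nbhs_singleton.
Qed.

Lemma cvg_within_sub (I : set R) (t : R) (g : R -> R) (l : R) :
  g s @[s --> t] --> l -> g s @[s --> within I t^'] --> l.
Proof.
move=> h A Al; have goal : \forall s \near t^', I s -> A (g s); last by exact: goal.
have h' : \forall s \near t, A (g s) by exact: (h A Al).
by apply: nbhs_dnbhs; apply: filterS h' => s hs _; exact: hs.
Qed.

Lemma cvg_dist_self (t : R) : `|s - t| @[s --> t] --> (0 : R).
Proof.
have : (s - t) @[s --> t] --> t - t by apply: cvgB; [exact: cvg_id|exact: cvg_cst].
by rewrite subrr => /cvg_norm; rewrite normr0.
Qed.

Section one_space.
Variables (U : lmodType R) (P : set U) (N : U -> R).
Hypothesis sN : seminormed P N.
Variables (T : R) (u v : R -> U).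
Hypothesis Pu : forall t, t \in `[0, T] -> P (u t).
Hypothesis Pv : forall t, t \in `[0, T] -> P (v t).
Hypothesis duv : derivative_in_time N T u v.
Local Notation I := ([set` `[0, T]] : set R).
Let hP := sn_lin sN.

Lemma derivative_continuous_in_time : continuous_in_time N T u.
Proof.
move=> t tI; apply: cvg_within_dnbhs; first by rewrite subrr (sn0 sN).
have h := duv tI; have Put := Pu tI; have Pvt := Pv tI.
pose G s := `|s - t| * (N ((s - t)^-1 *: (u s - u t) - v t) + N (v t)).
apply: (@squeeze_cvgr _ _ _ _ (fun=> 0) G).
- near=> s; have sI : s \in `[0, T] by near: s; exact: near_within.
  have Pus := Pu sI; have Pd : P (u s - u t) by exact: lin_closedB.
  rewrite (sn_ge0 sN)//= /G.
  have [->|st] := eqVneq s t; first by rewrite subrr (sn0 sN) subrr normr0 mul0r.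
  have -> : N (u s - u t) = `|s - t| * N ((s - t)^-1 *: (u s - u t)).
    by rewrite -(sn_scale sN) ?scalerA ?mulfV ?subr_eq0 ?scale1r//; exact: lin_closedZ.
  rewrite ler_wpM2l// [leRHS]addrC; apply: (sn_le sN) => //; exact: lin_closedZ.
- exact: cvg_cst.
- rewrite /G -[X in _ --> X](mul0r (0 + N (v t))); apply: cvgM; last first.
    by apply: cvgD; [exact: h|exact: cvg_cst].
  exact: cvg_within_sub (@cvg_dist_self t).
Unshelve. all: by end_near. Qed.

Lemma cvg_punctured t : t \in `[0, T] -> N (u s - u t) @[s --> within I t^'] --> (0 : R).
Proof.
move=> tI A Al; have h := derivative_continuous_in_time tI Al.
have {}h : \forall s \near t, I s -> A (N (u s - u t)) by exact: h.
have goal : \forall s \near t^', I s -> A (N (u s - u t)); last by exact: goal.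
exact: nbhs_dnbhs.
Qed.

End one_space.
Section quadratic.
Variables (U : lmodType R) (P : set U) (N : U -> R) (B : U -> U -> R).
Hypotheses (sN : seminormed P N) (hB : bbil P P N N B) (Bs : semi_inner P B).
Variables (T : R) (u v : R -> U).
Hypothesis Pu : forall t, t \in `[0, T] -> P (u t).
Hypothesis Pv : forall t, t \in `[0, T] -> P (v t).
Hypothesis duv : derivative_in_time N T u v.
Local Notation I := ([set` `[0, T]] : set R).
Let hP := sn_lin sN.

Lemma quadratic_continuous : {within I, continuous (fun s => B (u s) (u s))}.
Proof.
apply/subspace_continuousP => t tI.
have c := derivative_continuous_in_time sN Pu Pv duv tI.
have Put : P (u t) by exact: Pu.
apply: (cvg_bbil sN sN hB) => //; near=> s; apply: Pu; near: s; exact: near_within.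
Unshelve. all: by end_near. Qed.

(** By symmetry the increment of the quadratic form is [B (u s - u t) (u s + u t)], a difference
    quotient paired with a continuous factor. *)
Lemma quadratic_derive t : t \in `]0, T[ ->
  is_derive t (1 : R) (fun s => B (u s) (u s)) (2 * B (v t) (u t)).
Proof.
move=> tI; have tI' : t \in `[0, T] := subset_itv_oo_cc tI.
have Put := Pu tI'; have Pvt := Pv tI'.
apply: is_derive_quotient; apply: (cvg_within_oo tI).
have -> : 2 * B (v t) (u t) = B (v t) (u t + u t) by rewrite (bbilDr hB)//; ring.
apply: (@cvg_trans _ (B ((s - t)^-1 *: (u s - u t)) (u s + u t) @[s --> within I t^'])).
  apply: near_eq_cvg; near=> s.
  have sI : s \in `[0, T] by near: s; exact: near_within.
  have Pus := Pu sI; have Pd : P (u s - u t) by exact: lin_closedB.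
  have Pa : P (u s + u t) by exact: lin_closedD.
  rewrite (bbilZl sN hB)// (bbilBl hB)// !(bbilDr hB)//.
  by rewrite (semi_innerC Bs Put Pus); congr (_ * _); ring.
apply: (cvg_bbil sN sN hB) => //.
- near=> s; have sI : s \in `[0, T] by near: s; exact: near_within.
  by apply: lin_closedZ => //; apply: lin_closedB => //; exact: Pu.
- near=> s; have sI : s \in `[0, T] by near: s; exact: near_within.
  by apply: lin_closedD => //; exact: Pu.
- exact: lin_closedD.
- exact: (duv tI').
- have E s : u s + u t - (u t + u t) = u s - u t by rewrite opprD addrACA subrr addr0.
  under eq_fun do rewrite E; exact: (cvg_punctured sN Pu Pv duv tI').
Unshelve. all: by end_near. Qed.

End quadratic.

Section energy.
Variables (U W : lmodType R) (PU : set U) (PW : set W) (NU : U -> R) (NW : W -> R).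
Variables (m a : U -> U -> R) (b : W -> U -> R) (k : W -> W -> R).
Hypotheses (sU : seminormed PU NU) (sW : seminormed PW NW).
Hypotheses (hm : semi_inner PU m) (ha : semi_inner PU a) (hk : semi_inner PW k).
Hypotheses (bm : bbil PU PU NU NU m) (ba : bbil PU PU NU NU a).
Hypotheses (bb : bbil PW PU NW NU b) (bk : bbil PW PW NW NW k).
Variables (T : R) (p p1 p2 f : R -> U) (xi : R -> W).
Hypothesis T0 : 0 < T.
Hypothesis Pp : forall t, t \in `[0, T] -> PU (p t).
Hypothesis Pp1 : forall t, t \in `[0, T] -> PU (p1 t).
Hypothesis Pp2 : forall t, t \in `[0, T] -> PU (p2 t).
Hypothesis Pf : forall t, t \in `[0, T] -> PU (f t).
Hypothesis Pxi : forall t, t \in `[0, T] -> PW (xi t).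
Hypothesis dp : derivative_in_time NU T p p1.
Hypothesis dp1 : derivative_in_time NU T p1 p2.
Hypothesis cxi : continuous_in_time NW T xi.
Hypothesis motion : forall t, t \in `[0, T] ->
  m (p2 t) (p1 t) + a (p t) (p1 t) + b (xi t) (p1 t) = m (f t) (p1 t).
Hypothesis gauss : forall s t, s \in `[0, T] -> t \in `[0, T] -> k (xi s) (xi t) = b (xi t) (p s).
Hypothesis pT : NU (p T) = 0.
Hypothesis p1T : NU (p1 T) = 0.
Local Notation I := ([set` `[0, T]] : set R).
Let hU := sn_lin sU.
Let hW := sn_lin sW.

Definition energy t := m (p1 t) (p1 t) + a (p t) (p t) + k (xi t) (xi t).

Let TI : T \in `[0, T]. Proof. by rewrite in_itv/= lexx ltW. Qed.

Lemma energy_ge0 t : t \in `[0, T] -> 0 <= energy t.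
Proof.
move=> tI; rewrite /energy !addr_ge0//.
- exact: (semi_inner_ge0 hm (Pp1 tI)).
- exact: (semi_inner_ge0 ha (Pp tI)).
- exact: (semi_inner_ge0 hk (Pxi tI)).
Qed.

Lemma energyT : energy T = 0.
Proof.
rewrite /energy (bbil_null_l bm)//; last 2 first; try exact: Pp1.
rewrite (bbil_null_l ba)//; try exact: Pp.
(* No final condition is imposed on xi; Gauss's law at time T expresses its energy through [p T],
   which is null. *)
by rewrite gauss// (bbil_null_r bb) ?addr0//; [exact: Pxi|exact: Pp].
Qed.

Let cvg_xi t : t \in `[0, T] -> NW (xi s - xi t) @[s --> within I (nbhs t)] --> (0 : R).
Proof. exact: cxi. Qed.

Let cvg_xi' t : t \in `[0, T] -> NW (xi s - xi t) @[s --> within I t^'] --> (0 : R).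
Proof.
move=> tI A Al; have h := cvg_xi tI Al.
have {}h : \forall s \near t, I s -> A (NW (xi s - xi t)) by exact: h.
have goal : \forall s \near t^', I s -> A (NW (xi s - xi t)); last by exact: goal.
exact: nbhs_dnbhs.
Qed.

Lemma energy_continuous : {within I, continuous energy}.
Proof.
have c1 := quadratic_continuous sU bm Pp1 Pp2 dp1.
have c2 := quadratic_continuous sU ba Pp Pp1 dp.
apply/subspace_continuousP => t tI; apply: cvgD; first apply: cvgD.
- by move/subspace_continuousP : c1; apply.
- by move/subspace_continuousP : c2; apply.
have Pxt : PW (xi t) by exact: Pxi.
have c := cvg_xi tI.
apply: (cvg_bbil sW sW bk) => //; near=> s; apply: Pxi; near: s; exact: near_within.
Unshelve. all: by end_near. Qed.

(** Since xi is merely continuous, the increment of k(xi, xi) is rewritten by Gauss's law at the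
    four pairs of times s, t as b(xi(s) + xi(t), p(s) - p(t)): only p is differentiated. The
    resulting term 2 b(xi, p') completes the equation of motion. *)
Lemma energy_derive t : t \in `]0, T[ -> is_derive t (1 : R) energy (2 * m (f t) (p1 t)).
Proof.
move=> tI; have tI' : t \in `[0, T] := subset_itv_oo_cc tI.
have Put := Pp tI'; have Pvt := Pp1 tI'; have Pxt := Pxi tI'.
have d1 := quadratic_derive sU bm hm Pp1 Pp2 dp1 tI.
have d2 := quadratic_derive sU ba ha Pp Pp1 dp tI.
have d3 : is_derive t (1 : R) (fun s => k (xi s) (xi s)) (2 * b (xi t) (p1 t)).
  apply: is_derive_quotient; apply: (cvg_within_oo tI).
  have -> : 2 * b (xi t) (p1 t) = b (xi t + xi t) (p1 t) by rewrite (bbilDl bb)//; ring.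
  apply: (@cvg_trans _ (b (xi s + xi t) ((s - t)^-1 *: (p s - p t)) @[s --> within I t^'])).
    apply: near_eq_cvg; near=> s.
    have sI : s \in `[0, T] by near: s; exact: near_within.
    have Pus := Pp sI; have Pxs := Pxi sI; have Pd : PU (p s - p t) by exact: lin_closedB.
    have Pa : PW (xi s + xi t) by exact: lin_closedD.
    rewrite (bbilZr sU bb)// (bbilDl bb)// !(bbilBr bb)//.
    rewrite -!gauss// (semi_innerC hk Pxs Pxt); congr (_ * _); ring.
  apply: (cvg_bbil sW sU bb) => //.
  - near=> s; have sI : s \in `[0, T] by near: s; exact: near_within.
    by apply: lin_closedD => //; exact: Pxi.
  - near=> s; have sI : s \in `[0, T] by near: s; exact: near_within.
    by apply: lin_closedZ => //; apply: lin_closedB => //; exact: Pp.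
  - exact: lin_closedD.
  - have E s : xi s + xi t - (xi t + xi t) = xi s - xi t by rewrite opprD addrACA subrr addr0.
    under eq_fun do rewrite E; exact: cvg_xi'.
  - exact: (dp tI').
apply: (is_derive_eq (is_deriveD (is_deriveD d1 d2) d3)).
rewrite -(motion tI') (semi_innerC ha Pvt Put); ring.
Unshelve. all: by end_near. Qed.

Variables (S Phi : R -> R).
Hypothesis S0 : forall t, t \in `[0, T] -> 0 <= S t.
Hypothesis fS : forall t, t \in `[0, T] -> snorm m (f t) <= S t.
Hypothesis dPhi : forall t, 0 <= t <= T -> is_derive t (1 : R) Phi (S t).

Let cPhi t0 : 0 <= t0 -> {within `[t0, T], continuous Phi}.
Proof.
move=> t00; apply/subspace_continuousP => t; rewrite /= in_itv/= => /andP[h1 h2].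
have c : {for t, continuous Phi}.
  by apply: (is_derive_continuous (dPhi _)); rewrite h2 (le_trans t00).
by move=> A /c h; have : \forall s \near t, A (Phi s) by []; apply: filterS => s.
Qed.

Let sub_itv t0 t : 0 <= t0 -> t \in `[t0, T] -> t \in `[0, T].
Proof. by rewrite !in_itv/= => h /andP[h1 ->]; rewrite (le_trans h). Qed.

Let within_sub t0 (g : R -> R) : 0 <= t0 -> {within I, continuous g} -> {within `[t0, T], continuous g}.
Proof.
move=> t00; apply: continuous_subspaceW => t /=; exact: sub_itv.
Qed.

Lemma Phi_nondecreasing t t' : 0 <= t -> t <= t' -> t' <= T -> Phi t <= Phi t'.
Proof.
move=> t0 tt' t'T; have [->//|ne] := eqVneq t t'.
have lt : t < t' by rewrite lt_neqAle ne.
have dG x : x \in `]t, t'[ -> is_derive x (1 : R) Phi (S x).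
  rewrite in_itv/= => /andP[h1 h2]; apply: dPhi; apply/andP; split; lra.
have cG : {within `[t, t'], continuous Phi}.
  apply: (continuous_subspaceW _ (cPhi t0)) => x /=; rewrite !in_itv/= => /andP[-> h].
  exact: le_trans h t'T.
have [c cI hc] := MVT lt dG cG.
rewrite -subr_ge0 hc mulr_ge0//; last by rewrite subr_ge0.
by apply: S0; move: cI; rewrite !in_itv/= => /andP[h1 h2]; apply/andP; split; lra.
Qed.

Theorem energy_estimate t : t \in `[0, T] -> Num.sqrt (energy t) <= Phi T - Phi t.
Proof.
move=> tI; have := tI; rewrite in_itv/= => /andP[t0 tT].
have [->|ne] := eqVneq t T; first by rewrite energyT sqrtr0 subrr.
have lt : t < T by rewrite lt_neqAle ne.
apply: (@sqrt_decay _ energy (fun s => 2 * m (f s) (p1 s)) Phi S) => //.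
- move=> s; rewrite in_itv/= => /andP[h1 h2]; apply: energy_derive.
  by rewrite in_itv/= h2 andbT; lra.
- move=> s; rewrite in_itv/= => /andP[h1 h2]; apply: dPhi; apply/andP; split; lra.
- exact: within_sub energy_continuous.
- exact: cPhi.
- by move=> s sI; apply: energy_ge0; exact: sub_itv sI.
- exact: energyT.
- by move=> s sI; apply: S0; apply: (sub_itv t0); exact: subset_itv_oo_cc.
- move=> s sI; have sI' : s \in `[0, T] by apply: (sub_itv t0); exact: subset_itv_oo_cc.
  have Pfs := Pf sI'; have Pvs := Pp1 sI'.
  rewrite normrM ger0_norm// -mulrA ler_wpM2l//.
  apply: le_trans (semi_inner_le hU hm Pfs Pvs) _.
  apply: ler_pM; rewrite ?snorm_ge0//; first exact: fS.
  rewrite /snorm ler_wsqrtr// /energy -addrA lerDl addr_ge0//.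
    exact: (semi_inner_ge0 ha (Pp sI')).
  exact: (semi_inner_ge0 hk (Pxi sI')).
Qed.

(** The energy bounds the velocity but contains no L^2 norm of p, which Korn's inequality requires.
    The same decay lemma is applied to m(p, p), with the bound of the velocity on [t, T] as a
    constant rate. *)
Theorem displacement_estimate t : t \in `[0, T] -> snorm m (p t) <= T * (Phi T - Phi t).
Proof.
move=> tI; have := tI; rewrite in_itv/= => /andP[t0 tT].
have ph0 : 0 <= Phi T - Phi t by rewrite subr_ge0; exact: Phi_nondecreasing.
have [->|ne] := eqVneq t T.
  have PT := Pp TI; rewrite /snorm (bbil_null_l bm)// sqrtr0.
  by rewrite subrr mulr0.
have lt : t < T by rewrite lt_neqAle ne.
pose c := Phi T - Phi t.
apply: (@le_trans _ _ (c * T - c * t)); last first.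
  by rewrite -mulrBr mulrC -/c ler_wpM2r// gerBl.
apply: (@sqrt_decay _ (fun s => m (p s) (p s)) (fun s => 2 * m (p1 s) (p s)) ( *%R c) (fun=> c)) => //.
- move=> s; rewrite in_itv/= => /andP[h1 h2]; apply: (quadratic_derive sU bm hm Pp Pp1 dp).
  by rewrite in_itv/= h2 andbT; lra.
- move=> s _; apply: (is_derive_eq (is_derive_mulc c (is_derive_id s (1 : R)))).
  by rewrite mulr1.
- exact: within_sub (quadratic_continuous sU bm Pp Pp1 dp).
- by apply: continuous_subspaceT => s; apply: cvgMr; exact: cvg_id.
- by move=> s sI; apply: (semi_inner_ge0 hm); apply: Pp; exact: sub_itv sI.
- by rewrite (bbil_null_l bm)//; exact: Pp.
- move=> s sI; have sI' : s \in `[0, T] by apply: (sub_itv t0); exact: subset_itv_oo_cc.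
  have Pus := Pp sI'; have Pvs := Pp1 sI'.
  rewrite normrM ger0_norm// -mulrA ler_wpM2l//.
  apply: le_trans (semi_inner_le hU hm Pvs Pus) _.
  rewrite ler_wpM2r ?snorm_ge0//.
  apply: (@le_trans _ _ (Num.sqrt (energy s))).
    rewrite /snorm ler_wsqrtr// /energy -addrA lerDl addr_ge0//.
      exact: (semi_inner_ge0 ha Pus).
    exact: (semi_inner_ge0 hk (Pxi sI')).
  apply: le_trans (energy_estimate sI') _; rewrite /c lerD2l lerN2.
  move: sI; rewrite in_itv/= => /andP[h1 h2].
  by apply: Phi_nondecreasing => //; exact: ltW.
Qed.

End energy.

End evolution_calculus.

(** * The piezoelectric forms *)

Section coefficient_forms.
Context {R : realType} d (T : measurableType d).
Variables (mu : {measure set T -> \bar R}) (D : set T).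
Hypothesis mD : measurable D.
Let hL := L2_closed mu mD.
Let hs := L2inner_semi mu mD.

Lemma L2_le (f g : T -> R) : measurable_fun D f -> L2 mu D g ->
  {ae mu, forall x, D x -> `|f x| <= `|g x|} ->
  L2 mu D f /\ L2norm mu D f <= L2norm mu D g.
Proof.
move=> mf Lg fg; have [mg g2] := Lg.
have le : (\int[mu]_(x in D) ((f x) ^+ 2)%:E <= \int[mu]_(x in D) ((g x) ^+ 2)%:E)%E.
  apply: ae_ge0_le_integral => //.
  - by move=> x _; rewrite lee_fin sqr_ge0.
  - by apply/measurable_EFinP; exact: measurable_funX.
  - by move=> x _; rewrite lee_fin sqr_ge0.
  - by apply/measurable_EFinP; exact: measurable_funX.
  - apply: filterS fg => x h Dx; rewrite lee_fin -[f x ^+ 2]real_normK ?num_real//.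
    by rewrite -[g x ^+ 2]real_normK ?num_real// ler_pXn2r ?nnegrE// h.
have Lf : L2 mu D f by split => //; exact: le_lt_trans g2.
split => //; rewrite -(@ler_pXn2r _ 2)// ?nnegrE ?L2norm_ge0// -lee_fin.
by rewrite (sqr_L2norm mD Lf) (sqr_L2norm mD Lg).
Qed.

Lemma ae_le_integral (f g : T -> \bar R) : mu.-integrable D f -> mu.-integrable D g ->
  {ae mu, forall x, D x -> (f x <= g x)%E} ->
  (\int[mu]_(x in D) f x <= \int[mu]_(x in D) g x)%E.
Proof.
move=> intf intg fg; have mf := measurable_int _ intf; have mg := measurable_int _ intg.
rewrite integralE [leRHS]integralE leeB//; apply: (ae_ge0_le_integral mD).
- by move=> x _; exact: funepos_ge0.
- exact: measurable_funepos.
- by move=> x _; exact: funepos_ge0.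
- exact: measurable_funepos.
- apply: filterS fg => x h Dx; apply: (@funepos_le _ _ [set x]); last exact: mem_set.
  by move=> y /set_mem ->; exact: h.
- by move=> x _; exact: funeneg_ge0.
- exact: measurable_funeneg.
- by move=> x _; exact: funeneg_ge0.
- exact: measurable_funeneg.
- apply: filterS fg => x h Dx; apply: (@funeneg_le _ _ [set x]); last exact: mem_set.
  by move=> y /set_mem ->; exact: h.
Qed.

Lemma Linfty_mul (k : T -> R) : Linfty mu D k -> exists2 M : R, 0 <= M & forall f, L2 mu D f ->
  L2 mu D (k \* f) /\ L2norm mu D (k \* f) <= M * L2norm mu D f.
Proof.
move=> [mk [M hM]]; exists `|M| => // f Lf; have [mf _] := Lf.
have LM : L2 mu D (`|M| *: f) by exact: (lin_closedZ _ hL).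
have [||L le] := @L2_le (k \* f) (`|M| *: f) _ LM; first exact: measurable_funM.
  apply: filterS hM => x h Dx; rewrite /= [(_ *: f) x]/(`|M| * f x) !normrM normr_id.
  by rewrite ler_wpM2r//; apply: le_trans (h Dx) _; exact: ler_norm.
split => //; apply: le_trans le _.
by rewrite !L2normE (snormZ hL hs)// normr_id.
Qed.

Section one_form.
Variables (I J : finType) (K : I -> J -> T -> R).
Hypothesis LK : forall i j, Linfty mu D (K i j).

(** Common shape of the mass, stiffness, coupling and permittivity forms: bounded coefficients
    between two finite families of L^2 functions, with different index types for vectors and
    matrices. *)
Definition cform (F : I -> T -> R) (F' : J -> T -> R) : R :=
  \sum_i \sum_j L2inner mu D (K i j \* F i) (F' j).

Lemma L2_coef i j f : L2 mu D f -> L2 mu D (K i j \* f).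
Proof. by move=> Lf; have [M _ /(_ f Lf)[]] := Linfty_mul (LK i j). Qed.

Lemma integrable_cform F F' : (forall i, L2 mu D (F i)) -> (forall j, L2 mu D (F' j)) ->
  mu.-integrable D (EFin \o (fun x => \sum_i \sum_j K i j x * F i x * F' j x)).
Proof.
move=> LF LF'; apply: (eq_integrable mD (fun x => \sum_i \sum_j (K i j x * F i x * F' j x)%:E)%E).
  by move=> x _; rewrite /= -sumEFin; apply: eq_bigr => i _; rewrite -sumEFin.
apply: integrable_sum => // i _; apply: integrable_sum => // j _.
exact: (L2_integrableM mD (L2_coef i j (LF i)) (LF' j)).
Qed.

Lemma cformE F F' : (forall i, L2 mu D (F i)) -> (forall j, L2 mu D (F' j)) ->
  \int[mu]_(x in D) (\sum_i \sum_j K i j x * F i x * F' j x) = cform F F'.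
Proof.
move=> LF LF'; rewrite /cform /Rintegral.
have int i j := L2_integrableM mD (L2_coef i j (LF i)) (LF' j).
under eq_integral => x _ do rewrite -sumEFin.
rewrite (integral_sum mD); last first.
  move=> i; apply: (eq_integrable mD (fun x => \sum_j (K i j x * F i x * F' j x)%:E)%E).
    by move=> x _; rewrite -sumEFin.
  by apply: integrable_sum => // j _; exact: int.
rewrite -sum_fine; last first.
  move=> i _; apply: integrable_fin_num => //.
  apply: (eq_integrable mD (fun x => \sum_j (K i j x * F i x * F' j x)%:E)%E).
    by move=> x _; rewrite -sumEFin.
  by apply: integrable_sum => // j _; exact: int.
apply: eq_bigr => i _.
under eq_integral => x _ do rewrite -sumEFin.
rewrite (integral_sum mD); last by move=> j; exact: int.
rewrite -sum_fine//.
by move=> j _; apply: integrable_fin_num => //; exact: int.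
Qed.

Lemma cform_linl (c : R) F1 F2 F3 F' : (forall i, L2 mu D (F1 i)) -> (forall i, L2 mu D (F2 i)) ->
  (forall i, L2 mu D (F3 i)) -> (forall j, L2 mu D (F' j)) ->
  (forall i, aeq mu D (F3 i) (c *: F1 i + F2 i)) ->
  cform F3 F' = c * cform F1 F' + cform F2 F'.
Proof.
move=> L1 L2' L3 LF' h; rewrite /cform; apply: sum_linE => i; apply: sum_linE => j.
have [bl _ _] := hs; rewrite -bl; try exact: L2_coef; last exact: LF'.
apply: (aeq_L2inner mD) => //; first exact: L2_coef.
  by apply: (proj2 hL); exact: L2_coef.
apply: filterS (h i) => x hx Dx; rewrite /= hx//.
have -> : (c *: F1 i + F2 i) x = c * F1 i x + F2 i x by [].
by rewrite mulrDr mulrCA.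
Qed.

Lemma cform_linr (c : R) F F1 F2 F3 : (forall i, L2 mu D (F i)) -> (forall i, L2 mu D (F1 i)) ->
  (forall i, L2 mu D (F2 i)) -> (forall j, L2 mu D (F3 j)) ->
  (forall i, aeq mu D (F3 i) (c *: F1 i + F2 i)) ->
  cform F F3 = c * cform F F1 + cform F F2.
Proof.
move=> LF L1 L2' L3 h; rewrite /cform; apply: sum_linE => i; apply: sum_linE => j.
have [bl _ _] := hs; have LKF := L2_coef i j (LF i).
rewrite (semi_innerC hs LKF (L3 j)) (semi_innerC hs LKF (L1 j)) (semi_innerC hs LKF (L2' j)).
rewrite -bl//; try exact: L1; try exact: L2'.
apply: (aeq_L2inner mD) => //; try exact: L3.
  by apply: (proj2 hL); [exact: L1|exact: L2'].
Qed.

Lemma cform_bound : exists2 M : R, 0 <= M & forall F F' (a b : R),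
  (forall i, L2 mu D (F i)) -> (forall j, L2 mu D (F' j)) ->
  (forall i, L2norm mu D (F i) <= a) -> (forall j, L2norm mu D (F' j) <= b) ->
  0 <= a -> 0 <= b -> `|cform F F'| <= M * a * b.
Proof.
have [M hM] : exists M : I -> J -> R, forall i j, 0 <= M i j /\ forall f, L2 mu D f ->
    L2norm mu D (K i j \* f) <= M i j * L2norm mu D f.
  have h i j : exists M : R, 0 <= M /\ forall f, L2 mu D f ->
      L2norm mu D (K i j \* f) <= M * L2norm mu D f.
    by have [M M0 hM] := Linfty_mul (LK i j); exists M; split => // f /hM[].
  by exists (fun i j => projT1 (cid (h i j))) => i j; exact: (projT2 (cid (h i j))).
exists (\sum_i \sum_j M i j).
  by apply: sumr_ge0 => i _; apply: sumr_ge0 => j _; have [] := hM i j.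
move=> F F' a b LF LF' ha hb a0 b0; rewrite /cform !mulr_suml.
apply: le_trans (ler_norm_sum _ _ _) _; apply: ler_sum => i _; rewrite !mulr_suml.
apply: le_trans (ler_norm_sum _ _ _) _; apply: ler_sum => j _.
apply: le_trans (semi_inner_le hL hs (L2_coef i j (LF i)) (LF' j)) _.
rewrite -!L2normE; have [M0 hMf] := hM i j.
apply: ler_pM; rewrite ?L2norm_ge0//; apply: le_trans (hMf _ (LF i)) _.
exact: ler_wpM2l.
Qed.

End one_form.

Lemma cform_sym (I J : finType) (K : I -> J -> T -> R) (K' : J -> I -> T -> R) F F' :
  (forall i j, Linfty mu D (K i j)) -> (forall i j, Linfty mu D (K' i j)) ->
  (forall i, L2 mu D (F i)) -> (forall j, L2 mu D (F' j)) ->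
  {ae mu, forall x, D x -> \sum_i \sum_j K i j x * F i x * F' j x =
                           \sum_j \sum_i K' j i x * F' j x * F i x} ->
  cform K F F' = cform K' F' F.
Proof.
move=> LK LK' LF LF' h; rewrite -!cformE// /Rintegral; congr fine.
have m1 := measurable_int _ (integrable_cform LK LF LF').
have m2 := measurable_int _ (integrable_cform LK' LF' LF).
apply: ae_eq_integral => //.
by apply: filterS h => x hx Dx; rewrite /= hx.
Qed.

Lemma cform_coercive (I : finType) (K : I -> I -> T -> R) (c : R) F :
  (forall i j, Linfty mu D (K i j)) -> (forall i, L2 mu D (F i)) ->
  {ae mu, forall x, D x -> c * \sum_i F i x ^+ 2 <= \sum_i \sum_j K i j x * F i x * F j x} ->
  c * \sum_i L2norm mu D (F i) ^+ 2 <= cform K F F.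
Proof.
move=> LK LF h; rewrite -cformE//.
have -> : c * \sum_i L2norm mu D (F i) ^+ 2 = \int[mu]_(x in D) (c * \sum_i F i x ^+ 2).
  rewrite RintegralZl//; last first.
    apply: (eq_integrable mD (fun x => \sum_i (F i x ^+ 2)%:E)%E); first by move=> x _; rewrite /= -sumEFin.
    by apply: integrable_sum => // i _; exact: L2_integrable_sqr.
  congr (_ * _); rewrite /Rintegral; under eq_integral => x _ do rewrite -sumEFin.
  rewrite (integral_sum mD); last by move=> i; exact: L2_integrable_sqr.
  rewrite -sum_fine; last by move=> i _; apply: integrable_fin_num => //; exact: L2_integrable_sqr.
  by apply: eq_bigr => i _; rewrite -(sqr_L2norm mD (LF i)).
have i1 : mu.-integrable D (EFin \o (fun x => c * \sum_i F i x ^+ 2)).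
  apply: (eq_integrable mD (fun x => c%:E * (\sum_i (F i x ^+ 2)%:E))%E).
    by move=> x _; rewrite /= EFinM -sumEFin.
  by apply: integrableZl => //; apply: integrable_sum => // i _; exact: L2_integrable_sqr.
have i2 := integrable_cform LK LF LF.
rewrite /Rintegral fine_le//; try exact: integrable_fin_num.
apply: (ae_le_integral i1 i2).
by apply: filterS h => x hx Dx; rewrite lee_fin; exact: hx.
Qed.

Section operators.
Variables (U : lmodType R) (P : set U) (N : U -> R).

(** Abstracts the gradient, the strain and the list of components: families of L^2 functions, linear
    up to null sets and bounded by the norm. *)
Record L2op (I : finType) (A : U -> I -> T -> R) : Prop := MkL2op {
  L2op_L2 : forall u i, P u -> L2 mu D (A u i);
  L2op_lin : forall c u v i, P u -> P v -> aeq mu D (A (c *: u + v) i) (c *: A u i + A v i);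
  L2op_bound : forall u i, P u -> L2norm mu D (A u i) <= N u }.

End operators.

Lemma cform_bbil (U W : lmodType R) (P : set U) (Q : set W) (N : U -> R) (M : W -> R)
  (I J : finType) (K : I -> J -> T -> R) (A : U -> I -> T -> R) (B : W -> J -> T -> R) :
  seminormed P N -> seminormed Q M -> (forall i j, Linfty mu D (K i j)) ->
  L2op P N A -> L2op Q M B -> bbil P Q N M (fun u w => cform K (A u) (B w)).
Proof.
move=> sN sM LK hA hB; have hP := sn_lin sN; have hQ := sn_lin sM; split.
- move=> c u v w Pu Pv Qw; have Puv := proj2 hP c _ _ Pu Pv.
  apply: (cform_linl LK) => i; try exact: (L2op_L2 hA); first exact: (L2op_L2 hB).
  exact: (L2op_lin hA).
- move=> c u w z Pu Qw Qz; have Qwz := proj2 hQ c _ _ Qw Qz.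
  apply: (cform_linr LK) => i; try exact: (L2op_L2 hB); first exact: (L2op_L2 hA).
  exact: (L2op_lin hB).
- have [C C0 hC] := cform_bound LK; exists C => // u w Pu Qw; apply: hC.
  + by move=> i; exact: (L2op_L2 hA).
  + by move=> i; exact: (L2op_L2 hB).
  + by move=> i; exact: (L2op_bound hA).
  + by move=> i; exact: (L2op_bound hB).
  + exact: (sn_ge0 sN).
  + exact: (sn_ge0 sM).
Qed.

End coefficient_forms.

(** * Vector-valued Sobolev spaces *)

Section vector_sobolev.
Context {R : realType} (n : nat).
Local Notation V := 'rV[R]_n.+1.
Local Notation leb := (lebesgue_rV n.+1).
Local Notation II := ('I_n.+1 * 'I_n.+1)%type.
Variable Omega : set V.
Hypothesis oO : open Omega.
Implicit Types (u psi phi : V -> R) (w : V -> V).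
Let mO : measurable Omega := open_measurable_rV oO.
Let hL := L2_closed leb mO.
#[local] Opaque wder.

Lemma component_lin (c : R) (v w : V -> V) i :
  component (c *: v + w) i = c *: component v i + component w i.
Proof. by apply/funext => x; rewrite /component /= !mxE. Qed.

Lemma H1v_lin (c : R) (v w : V -> V) : H1v Omega v -> H1v Omega w -> H1v Omega (c *: v + w).
Proof. by move=> Hv Hw i; rewrite component_lin; exact: H1_lin. Qed.

Lemma component0 i : component (0 : V -> V) i = 0.
Proof. by apply/funext => x; rewrite /component mxE. Qed.

Lemma H1v_closed : lin_closed [set w | H1v Omega w].
Proof. by split; [move=> i; rewrite component0; exact: H1_0|exact: H1v_lin]. Qed.

Definition H1vinner v w : R := \sum_i H1inner Omega (component v i) (component w i).

Lemma H1vinner_semi : semi_inner [set w | H1v Omega w] H1vinner.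
Proof.
have [bl bs bp] := H1inner_semi oO; split.
- move=> c u v w Hu Hv Hw; apply: sum_linE => i.
  by rewrite component_lin; exact: bl (Hu i) (Hv i) (Hw i).
- by move=> u v Hu Hv; apply: eq_bigr => i _; exact: bs (Hu i) (Hv i).
- by move=> u Hu; apply: sumr_ge0 => i _; exact: bp (Hu i).
Qed.

Lemma H1normvE w : H1v Omega w -> H1normv Omega w = snorm H1vinner w.
Proof.
move=> Hw; congr Num.sqrt; apply: eq_bigr => i _.
by rewrite (H1normE oO (Hw i)) (sqr_snorm (H1inner_semi oO) (Hw i)).
Qed.

Lemma seminormed_H1v : seminormed [set w | H1v Omega w] (H1normv Omega).
Proof. exact: seminormed_semi_inner H1v_closed H1vinner_semi H1normvE. Qed.

Lemma seminormed_H1 : seminormed [set u | H1 Omega u] (H1norm Omega).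
Proof. exact: seminormed_semi_inner (H1_closed oO) (H1inner_semi oO) (H1normE oO). Qed.

Lemma H1norm_ge0 u : 0 <= H1norm Omega u. Proof. exact: sqrtr_ge0. Qed.
Lemma H1normv_ge0 w : 0 <= H1normv Omega w. Proof. exact: sqrtr_ge0. Qed.
Lemma L2normv_ge0 w : 0 <= L2normv Omega w. Proof. exact: sqrtr_ge0. Qed.

Lemma H1norm_component w i : H1v Omega w -> H1norm Omega (component w i) <= H1normv Omega w.
Proof.
move=> Hw; rewrite -(@ler_pXn2r _ 2)// ?nnegrE ?H1norm_ge0 ?H1normv_ge0// (sqr_H1normv Hw).
by rewrite (bigD1 i)//= lerDl; apply: sumr_ge0 => j _; exact: sqr_ge0.
Qed.

Lemma L2norm_le_H1norm u : H1 Omega u -> L2norm leb Omega u <= H1norm Omega u.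
Proof.
move=> Hu; rewrite -(@ler_pXn2r _ 2)// ?nnegrE ?H1norm_ge0 ?L2norm_ge0// (sqr_H1norm Hu).
by rewrite lerDl; apply: sumr_ge0 => j _; exact: sqr_ge0.
Qed.

Lemma L2norm_wder_le u i : H1 Omega u -> L2norm leb Omega (wder Omega i u) <= H1norm Omega u.
Proof.
move=> Hu; rewrite -(@ler_pXn2r _ 2)// ?nnegrE ?H1norm_ge0 ?L2norm_ge0// (sqr_H1norm Hu).
rewrite (bigD1 i)//= addrCA lerDl addr_ge0 ?sqr_ge0//.
by apply: sumr_ge0 => j _; exact: sqr_ge0.
Qed.

Lemma L2op_grad : L2op leb Omega [set u | H1 Omega u] (H1norm Omega)
  (fun u (i : 'I_n.+1) => wder Omega i u).
Proof.
split => [u i Hu|c u v i Hu Hv|u i Hu]; first exact: L2_wder.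
- exact: (wder_lin oO i c Hu Hv).
- exact: L2norm_wder_le.
Qed.

Lemma L2op_component : L2op leb Omega [set w | H1v Omega w] (H1normv Omega)
  (fun w (i : 'I_n.+1) => component w i).
Proof.
split => [u i Hu|c u v i Hu Hv|u i Hu]; first exact: H1_L2 (Hu i).
- by rewrite component_lin; exact: aeW.
- by apply: le_trans (L2norm_le_H1norm (Hu i)) _; exact: H1norm_component.
Qed.

Definition strains w (p : II) : V -> R := fun x => strain Omega w x p.1 p.2.

Lemma half_sum_le (f g : V -> R) (b : R) : L2 leb Omega f -> L2 leb Omega g ->
  L2norm leb Omega f <= b -> L2norm leb Omega g <= b ->
  L2norm leb Omega (2^-1 *: (f + g)) <= b.
Proof.
move=> Lf Lg; have hs := L2inner_semi leb mO; rewrite !L2normE => fb gb.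
have Ls := lin_closedD hL Lf Lg; rewrite (@snormZ _ _ _ _ hL hs 2^-1 (f + g) Ls).
have le := snormD hL hs Lf Lg; rewrite ger0_norm//; lra.
Qed.

Lemma L2op_strain : L2op leb Omega [set w | H1v Omega w] (H1normv Omega) strains.
Proof.
split => [u i Hu|c u v [i j] Hu Hv|u [i j] Hu].
- rewrite /strains/= strain_entry.
  by apply: (lin_closedZ _ hL); apply: (lin_closedD hL); apply: L2_wder; exact: Hu.
- have h1 := wder_lin oO j c (Hu i) (Hv i); have h2 := wder_lin oO i c (Hu j) (Hv j).
  rewrite /strains/= !strain_entry !component_lin.
  apply: filterS2 h1 h2 => x h1 h2 Ox; have {}h1 := h1 Ox; have {}h2 := h2 Ox.
  move: h1 h2; move: (wder _ _ (c *: component u i + _)) (wder _ _ (c *: component u j + _)) => a b.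
  move=> h1 h2; rewrite [LHS]/(2^-1 * (a x + b x)) h1 h2.
  set p := wder _ _ _; set q := wder _ _ _; set r := wder _ _ _; set s := wder _ _ _.
  change (2^-1 * ((c * p x + q x) + (c * r x + s x)) =
    c * (2^-1 * (p x + r x)) + 2^-1 * (q x + s x)); ring.
- rewrite /strains/= strain_entry.
  have L1 := L2_wder j (Hu i); have L2' := L2_wder i (Hu j).
  have l1 := L2norm_wder_le j (Hu i); have l2 := L2norm_wder_le i (Hu j).
  have l3 := H1norm_component i Hu; have l4 := H1norm_component j Hu.
  apply: (half_sum_le L1 L2'); [exact: le_trans l3|exact: le_trans l4].
Qed.

Lemma L2vinner_semi : semi_inner [set w | H1v Omega w]
  (fun v w => \sum_i L2inner leb Omega (component v i) (component w i)).
Proof.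
have [bl bs bp] := L2inner_semi leb mO; split.
- move=> c u v w Hu Hv Hw; apply: sum_linE => i.
  by rewrite component_lin; exact: bl (H1_L2 (Hu i)) (H1_L2 (Hv i)) (H1_L2 (Hw i)).
- by move=> u v Hu Hv; apply: eq_bigr => i _; exact: bs (H1_L2 (Hu i)) (H1_L2 (Hv i)).
- by move=> u Hu; apply: sumr_ge0 => i _; exact: bp (H1_L2 (Hu i)).
Qed.

Lemma seminormed_L2v : seminormed [set w | H1v Omega w] (L2normv Omega).
Proof.
apply: seminormed_semi_inner H1v_closed L2vinner_semi _ => w Hw.
congr Num.sqrt; apply: eq_bigr => i _.
by rewrite L2normE (sqr_snorm (L2inner_semi leb mO) (H1_L2 (Hw i))).
Qed.

Lemma L2normv_le_H1normv w : H1v Omega w -> L2normv Omega w <= H1normv Omega w.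
Proof.
move=> Hw; rewrite ler_wsqrtr//; apply: ler_sum => i _.
by rewrite ler_pXn2r// ?nnegrE ?L2norm_ge0 ?H1norm_ge0// L2norm_le_H1norm.
Qed.

Lemma aeq_component v w i : aeq leb Omega v w ->
  aeq leb Omega (component v i) (component w i).
Proof. by apply: filterS => x h Ox; rewrite /component h. Qed.

Lemma aeq_components v w :
  (forall i, aeq leb Omega (component v i) (component w i)) -> aeq leb Omega v w.
Proof.
move=> h; have {}h : \forall x \ae leb, forall i : 'I_n.+1, Omega x -> component v i x = component w i x.
  by apply: filter_forall => i; exact: h.
by apply: filterS h => x h Ox; apply/rowP => i; exact: h.
Qed.

Lemma H1normv0_aeq w : H1v Omega w -> H1normv Omega w = 0 -> aeq leb Omega w 0.
Proof.
move=> Hw w0; apply: aeq_components => i; rewrite component0.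
apply: (H1norm0_aeq oO) => //; apply/eqP; rewrite eq_le H1norm_ge0 andbT -w0.
exact: H1norm_component.
Qed.

Lemma aeq0_H1normv w : H1v Omega w -> aeq leb Omega w 0 -> H1normv Omega w = 0.
Proof.
move=> Hw w0; rewrite /H1normv big1 ?sqrtr0// => i _.
rewrite (aeq0_H1norm oO (Hw i)) ?expr0n//.
by rewrite -(component0 i); exact: aeq_component.
Qed.

Lemma aeq_sub (U : lmodType R) (v w : V -> U) : aeq leb Omega (v - w) 0 -> aeq leb Omega v w.
Proof.
by apply: filterS => x h Ox; have {}h : v x - w x = 0 := h Ox; apply/eqP; rewrite -subr_eq0 h.
Qed.

Lemma aeq_subr (U : lmodType R) (v w : V -> U) : aeq leb Omega v w -> aeq leb Omega (v - w) 0.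
Proof.
by apply: filterS => x h Ox; have -> : (v - w) x = v x - w x by []; rewrite h// subrr.
Qed.

End vector_sobolev.

Section piezoelectric_forms.
Context {R : realType} (n : nat).
Local Notation V := 'rV[R]_n.+1.
Local Notation M := 'M[R]_n.+1.
Local Notation leb := (lebesgue_rV n.+1).
Local Notation I := 'I_n.+1.
Local Notation II := ('I_n.+1 * 'I_n.+1)%type.
Variables (Omega : set V) (rho : V -> R).
Variables (C : V -> {linear M -> M}) (E : V -> {linear V -> M}) (kappa : V -> M).
Variables (c0 k0 rho0 : R).
Hypothesis oO : open Omega.
Hypothesis hC : stiffness_coef Omega C c0.
Hypothesis hE : piezoelectric_coef Omega E.
Hypothesis hk : permittivity_coef Omega kappa k0.
Hypothesis hr : density_coef Omega rho rho0.
Let mO : measurable Omega := open_measurable_rV oO.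
Local Notation cf := (cform leb Omega).
Local Notation strains := (strains Omega).
Local Notation comps := (fun w (i : I) => component w i).
Local Notation grads := (fun u (i : I) => wder Omega i u).
Local Notation H1 := [set u | H1 Omega u].
Local Notation H1v := [set w | H1v Omega w].
#[local] Opaque wder.

Definition stiffness_entry (p q : II) : V -> R := fun x => C x (delta_mx p.1 p.2) q.1 q.2.
Definition piezo_entry (i : I) (q : II) : V -> R := fun x => E x (delta_mx 0 i) q.1 q.2.
(** The indices are swapped because row vectors are multiplied by the transpose of [kappa]. *)
Definition permittivity_entry (i j : I) : V -> R := fun x => kappa x j i.
Definition density_entry (i j : I) : V -> R := fun x => rho x * (i == j)%:R.

Lemma frobE (A B : M) : frob A B = \sum_(p : II) A p.1 p.2 * B p.1 p.2.
Proof. by rewrite /frob pair_bigA. Qed.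

Lemma frob_stiffness x (A B : M) : frob (C x A) B =
  \sum_(p : II) \sum_(q : II) stiffness_entry p q x * A p.1 p.2 * B q.1 q.2.
Proof.
rewrite frobE exchange_big/=; apply: eq_bigr => q _.
have -> : C x A = \sum_(p : II) A p.1 p.2 *: C x (delta_mx p.1 p.2).
  rewrite {1}[A]matrix_sum_delta pair_bigA linear_sum; apply: eq_bigr => p _.
  exact: linearZ.
rewrite summxE mulr_suml; apply: eq_bigr => p _.
by rewrite mxE [_ * C x _ _ _]mulrC.
Qed.

Lemma frob_piezo x (g : V) (B : M) : frob (E x g) B =
  \sum_(i : I) \sum_(q : II) piezo_entry i q x * g 0 i * B q.1 q.2.
Proof.
rewrite frobE exchange_big/=; apply: eq_bigr => q _.
have -> : E x g = \sum_(i : I) g 0 i *: E x (delta_mx 0 i).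
  rewrite {1}[g]row_sum_delta linear_sum; apply: eq_bigr => p _.
  exact: linearZ.
rewrite summxE mulr_suml; apply: eq_bigr => p _.
by rewrite mxE [_ * E x _ _ _]mulrC.
Qed.

Lemma dot_transpose_coef x (A : M) (g : V) : dotv (transpose_coef (E x) A) g =
  \sum_(i : I) \sum_(q : II) piezo_entry i q x * g 0 i * A q.1 q.2.
Proof.
apply: eq_bigr => i _; rewrite /transpose_coef mxE frobE mulr_suml.
by apply: eq_bigr => q _; rewrite /piezo_entry; ring.
Qed.

Lemma dot_permittivity x (g h : V) : dotv (g *m (kappa x)^T) h =
  \sum_(i : I) \sum_(j : I) permittivity_entry i j x * g 0 i * h 0 j.
Proof.
rewrite exchange_big/=; apply: eq_bigr => j _; rewrite mxE mulr_suml.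
by apply: eq_bigr => i _; rewrite mxE [g 0 i * _]mulrC.
Qed.

Lemma dot_density x (v w : V) : rho x * dotv v w =
  \sum_(i : I) \sum_(j : I) density_entry i j x * v 0 i * w 0 j.
Proof.
rewrite mulr_sumr; apply: eq_bigr => i _; rewrite (bigD1 i)//= big1 => [|j ji].
  by rewrite /density_entry eqxx mulr1 addr0 mulrA.
by rewrite /density_entry eq_sym (negPf ji) mulr0 !mul0r.
Qed.

Lemma Linfty_stiffness p q : Linfty leb Omega (stiffness_entry p q).
Proof. by have [+ _ _ _] := hC; apply. Qed.

Lemma Linfty_piezo i q : Linfty leb Omega (piezo_entry i q).
Proof. by have [+ _] := hE; apply. Qed.

Lemma Linfty_permittivity i j : Linfty leb Omega (permittivity_entry i j).
Proof. by have [+ _ _] := hk; apply. Qed.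

Lemma Linfty_density i j : Linfty leb Omega (density_entry i j).
Proof.
have [[mr [B hB]] _] := hr; split; first exact: measurable_funM.
exists B; apply: filterS hB => x h Ox; apply: le_trans (h Ox).
by rewrite /density_entry; case: (_ == _); rewrite ?mulr1 ?mulr0// normr0.
Qed.

Let L2s w p : H1v w -> L2 leb Omega (strains w p). Proof. exact: (L2op_L2 (L2op_strain oO)). Qed.
Let L2g u i : H1 u -> L2 leb Omega (wder Omega i u). Proof. exact: (L2op_L2 (L2op_grad oO)). Qed.
Let L2c w i : H1v w -> L2 leb Omega (component w i). Proof. by move=> Hw; exact: H1_L2 (Hw i). Qed.

Definition stiffness_form u w := cf stiffness_entry (strains u) (strains w).
Definition piezo_form psi w := cf piezo_entry (grads psi) (strains w).
Definition permittivity_form psi phi := cf permittivity_entry (grads psi) (grads phi).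

Lemma weighted_innerE u w : H1v u -> H1v w ->
  weighted_inner Omega rho u w = cf density_entry (comps u) (comps w).
Proof.
move=> Hu Hw; rewrite -(cformE mO Linfty_density); try by move=> i; exact: L2c.
by apply: eq_Rintegral => x _; exact: dot_density.
Qed.

(** The coupling enters skew-symmetrically, through one form and with opposite signs; this is why
    its contributions combine into the electric energy instead of having to be estimated. *)
Lemma bilinear_aE u psi w phi : H1v u -> H1 psi -> H1v w -> H1 phi ->
  bilinear_a Omega C E kappa u psi w phi =
  stiffness_form u w + piezo_form psi w - piezo_form phi u + permittivity_form psi phi.
Proof.
move=> Hu Hpsi Hw Hphi.
have LC := Linfty_stiffness; have LE := Linfty_piezo; have Lk := Linfty_permittivity.
have Lu p : L2 leb Omega (strains u p) by exact: L2s.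
have Lw p : L2 leb Omega (strains w p) by exact: L2s.
have Lpsi i : L2 leb Omega (wder Omega i psi) by exact: L2g.
have Lphi i : L2 leb Omega (wder Omega i phi) by exact: L2g.
have i1 := integrable_cform mO LC Lu Lw; have i2 := integrable_cform mO LE Lpsi Lw.
have i3 := integrable_cform mO LE Lphi Lu; have i4 := integrable_cform mO Lk Lpsi Lphi.
rewrite /stiffness_form /piezo_form /permittivity_form -(cformE mO LC Lu Lw) -(cformE mO LE Lpsi Lw).
rewrite -(cformE mO LE Lphi Lu) -(cformE mO Lk Lpsi Lphi) -addrA.
rewrite /bilinear_a; congr (_ + _).
  rewrite -RintegralD//; apply: eq_Rintegral => x _.
  have -> (A B D : M) : frob (A + B) D = frob A D + frob B D.
    by rewrite !frobE -big_split; apply: eq_bigr => p _; rewrite mxE mulrDl.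
  rewrite frob_stiffness frob_piezo; congr (_ + _).
  by apply: eq_bigr => i _; apply: eq_bigr => q _; rewrite /grad mxE.
rewrite [RHS]addrC -RintegralB//; apply: eq_Rintegral => x _.
have -> (a b g : V) : dotv (- a + b) g = dotv b g - dotv a g.
  by rewrite -sumrB; apply: eq_bigr => i _; rewrite !mxE; ring.
rewrite dot_transpose_coef dot_permittivity; congr (_ - _).
  by apply: eq_bigr => i _; apply: eq_bigr => j _; rewrite /grad !mxE.
by apply: eq_bigr => i _; apply: eq_bigr => q _; rewrite /grad mxE.
Qed.

Lemma frobC (A B : M) : frob A B = frob B A.
Proof. by rewrite !frobE; apply: eq_bigr => p _; rewrite mulrC. Qed.

Lemma bbil_stiffness : bbil H1v H1v (H1normv Omega) (H1normv Omega) stiffness_form.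
Proof.
by apply: (cform_bbil mO) Linfty_stiffness (L2op_strain oO) (L2op_strain oO); exact: seminormed_H1v.
Qed.

Lemma bbil_piezo : bbil H1 H1v (H1norm Omega) (H1normv Omega) piezo_form.
Proof.
by apply: (cform_bbil mO) Linfty_piezo (L2op_grad oO) (L2op_strain oO);
  [exact: seminormed_H1|exact: seminormed_H1v].
Qed.

Lemma bbil_permittivity : bbil H1 H1 (H1norm Omega) (H1norm Omega) permittivity_form.
Proof.
by apply: (cform_bbil mO) Linfty_permittivity (L2op_grad oO) (L2op_grad oO); exact: seminormed_H1.
Qed.

Lemma bbil_weighted : bbil H1v H1v (H1normv Omega) (H1normv Omega) (weighted_inner Omega rho).
Proof.
have hP := H1v_closed oO.
have [h1 h2 [B B0 hB]] := cform_bbil mO (seminormed_H1v oO) (seminormed_H1v oO)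
  Linfty_density (L2op_component Omega) (L2op_component Omega).
split.
- move=> c u v w Hu Hv Hw; have Huv := proj2 hP c _ _ Hu Hv.
  by rewrite !weighted_innerE//; exact: h1.
- move=> c u v w Hu Hv Hw; have Huv := proj2 hP c _ _ Hv Hw.
  by rewrite !weighted_innerE//; exact: h2.
- by exists B => // u w Hu Hw; rewrite weighted_innerE//; exact: hB.
Qed.

Hypotheses (c0_gt0 : 0 < c0) (k0_gt0 : 0 < k0) (rho0_gt0 : 0 < rho0).

Lemma stiffness_coercive w : H1v w -> c0 * strainnorm2 Omega w <= stiffness_form w w.
Proof.
move=> Hw; have [_ _ _ h] := hC.
apply: (cform_coercive mO Linfty_stiffness) => [p|]; first exact: L2s.
apply: filterS h => x h Ox; rewrite -frob_stiffness.
apply: le_trans (h Ox (strain Omega w x) _); last first.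
  apply/matrixP => i j; rewrite mxE.
  have e : (fun x => strain Omega w x j i) = (fun x => strain Omega w x i j).
    apply: etrans (strain_entry Omega w j i) _; apply: etrans (esym (strain_entry Omega w i j)).
    by move: (wder _ i _) (wder _ j _) => a b; rewrite addrC.
  by have e1 := congr1 (@^~ x) e; exact: e1.
by rewrite frobE.
Qed.

Lemma permittivity_coercive u : H1 u -> k0 * gradnorm2 Omega u <= permittivity_form u u.
Proof.
move=> Hu; have [_ _ h] := hk.
apply: (cform_coercive mO Linfty_permittivity) => [p|]; first exact: L2g.
apply: filterS h => x h Ox; have := h Ox (grad Omega u x).
rewrite /enorm sqr_sqrtr; last by apply: sumr_ge0 => i _; rewrite -expr2 sqr_ge0.
rewrite dot_permittivity /dotv; congr (_ * _ <= _).
  by apply: eq_bigr => i _; rewrite mxE.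
by apply: eq_bigr => i _; apply: eq_bigr => j _; rewrite !mxE.
Qed.

Lemma weighted_coercive w : H1v w -> rho0 * L2normv Omega w ^+ 2 <= weighted_inner Omega rho w w.
Proof.
move=> Hw; have [_ h] := hr; rewrite weighted_innerE// sqr_L2normv.
apply: (cform_coercive mO Linfty_density) => [p|]; first exact: L2c.
apply: filterS h => x h Ox; rewrite -dot_density.
have -> : \sum_i component w i x ^+ 2 = dotv (w x) (w x) by [].
by rewrite ler_wpM2r ?h//; apply: sumr_ge0 => i _; rewrite -expr2 sqr_ge0.
Qed.

Lemma weighted_upper : exists2 B : R, 0 <= B & forall w, H1v w ->
  weighted_inner Omega rho w w <= B * L2normv Omega w ^+ 2.
Proof.
have [B B0 hB] := cform_bound mO Linfty_density; exists B => // w Hw.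
rewrite weighted_innerE//; apply: le_trans (ler_norm _) _; rewrite expr2 mulrA.
have le i : L2norm leb Omega (component w i) <= L2normv Omega w.
  rewrite -(@ler_pXn2r _ 2)// ?nnegrE ?L2norm_ge0 ?L2normv_ge0// sqr_L2normv.
  by rewrite (bigD1 i)//= lerDl; apply: sumr_ge0 => j _; exact: sqr_ge0.
by apply: hB => //; try (by move=> i; exact: L2c); exact: L2normv_ge0.
Qed.

Lemma semi_inner_stiffness : semi_inner H1v stiffness_form.
Proof.
split; first exact: (bbil_linl bbil_stiffness).
- move=> u w Hu Hw; apply: (cform_sym mO) => //; try exact: Linfty_stiffness.
  + by move=> i; exact: L2s.
  + by move=> i; exact: L2s.
  have [_ _ h _] := hC; apply: filterS h => x h Ox.
  by rewrite -!frob_stiffness h// frobC.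
- move=> w Hw; apply: le_trans (stiffness_coercive Hw); apply: mulr_ge0; first exact: ltW.
  by apply: sumr_ge0 => p _; exact: sqr_ge0.
Qed.

Lemma semi_inner_permittivity : semi_inner H1 permittivity_form.
Proof.
split; first exact: (bbil_linl bbil_permittivity).
- move=> u w Hu Hw; apply: (cform_sym mO) => //; try exact: Linfty_permittivity.
  + by move=> i; exact: L2g.
  + by move=> i; exact: L2g.
  have [_ h _] := hk; apply: filterS h => x h Ox.
  rewrite [RHS]exchange_big/=; apply: eq_bigr => i _; apply: eq_bigr => j _.
  have := congr1 (fun A : M => A i j) (h Ox); rewrite mxE /permittivity_entry => ->.
  move: (wder _ _ _ _) (wder _ _ _ _) => a b; exact: mulrAC.
- move=> w Hw; apply: le_trans (permittivity_coercive Hw); apply: mulr_ge0; first exact: ltW.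
  exact: gradnorm2_ge0.
Qed.

Lemma semi_inner_weighted : semi_inner H1v (weighted_inner Omega rho).
Proof.
split; first exact: (bbil_linl bbil_weighted).
- move=> u w Hu Hw; apply: eq_Rintegral => x _; congr (_ * _).
  by apply: eq_bigr => i _; rewrite mulrC.
- move=> w Hw; apply: le_trans (weighted_coercive Hw); apply: mulr_ge0; first exact: ltW.
  exact: sqr_ge0.
Qed.

End piezoelectric_forms.

(** * Stability and uniqueness *)

Section time_functions.
Context {R : realType} (U : lmodType R) (P : set U) (N : U -> R) (T : R).
Hypothesis sN : seminormed P N.
Hypothesis T0 : 0 < T.
Let hP := sn_lin sN.

(** The retraction onto [0, T]. Composing with it turns data that are controlled only on [0, T] into
    continuous functions on the line, as needed to take primitives. *)
Definition clamp (t : R) : R := Num.max 0 (Num.min t T).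

Lemma clamp_in t : clamp t \in `[0, T].
Proof. by rewrite in_itv/= /clamp le_max lexx/= ge_max (ltW T0) ge_min lexx orbT. Qed.

Lemma clamp_id t : t \in `[0, T] -> clamp t = t.
Proof. by rewrite in_itv/= => /andP[t0 tT]; rewrite /clamp (min_idPl tT) (max_idPr t0). Qed.

Lemma continuous_clamp : continuous clamp.
Proof.
move=> t; apply: (@continuous_max R R (fun=> 0) (fun s => Num.min s T)); first exact: cvg_cst.
by apply: (@continuous_min R R id (fun=> T)); [exact: cvg_id|exact: cvg_cst].
Qed.

Lemma cvg_clamp (u : R -> U) t : continuous_in_time N T u ->
  N (u (clamp s) - u (clamp t)) @[s --> t] --> (0 : R).
Proof.
move=> cu A Al.
have h : \forall s \near clamp t, s \in `[0, T] -> A (N (u s - u (clamp t))).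
  exact: (cu (clamp t) (clamp_in t) A Al).
have h' : \forall s \near t, clamp s \in `[0, T] -> A (N (u (clamp s) - u (clamp t))).
  exact: (continuous_clamp h).
have goal : \forall s \near t, A (N (u (clamp s) - u (clamp t))); last by exact: goal.
by apply: filterS h' => s; apply; exact: clamp_in.
Qed.

Lemma continuous_clamp_comp (u : R -> U) (M : U -> R) (B : R) : continuous_in_time N T u ->
  (forall t, t \in `[0, T] -> P (u t)) ->
  (forall v w, P v -> P w -> `|M v - M w| <= B * N (v - w)) ->
  continuous (fun t => M (u (clamp t))).
Proof.
move=> cu Pu hM t; apply/subr_cvg0; apply: norm_cvg0; pose G s := B * N (u (clamp s) - u (clamp t)).
apply: (@squeeze_cvgr _ _ _ _ (fun=> 0) G).
- by apply: nearW => s; rewrite normr_ge0/=; apply: hM; apply: Pu; exact: clamp_in.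
- exact: cvg_cst.
- by rewrite /G -[X in _ --> X](mulr0 B); apply: cvgMr; exact: cvg_clamp.
Qed.

Lemma cvg_seminorm_lin (X : Type) (F : set_system X) {FF : Filter F} (c : R) (a b : X -> U) :
  (\forall s \near F, P (a s)) -> (\forall s \near F, P (b s)) ->
  N (a s) @[s --> F] --> (0 : R) -> N (b s) @[s --> F] --> (0 : R) ->
  N (c *: a s + b s) @[s --> F] --> (0 : R).
Proof.
move=> Pa Pb ha hb; pose G s := `|c| * N (a s) + N (b s).
apply: (@squeeze_cvgr _ _ _ _ (fun=> 0) G).
- near=> s; have Pas : P (a s) by near: s.
  have Pbs : P (b s) by near: s.
  have Pc := lin_closedZ c hP Pas; have Pcb := lin_closedD hP Pc Pbs.
  by rewrite (sn_ge0 sN Pcb)/= /G -(sn_scale sN)//; exact: (sn_tri sN).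
- exact: cvg_cst.
- rewrite /G -[X in _ --> X](addr0 0) -[X in _ --> X + _](mulr0 `|c|).
  by apply: cvgD => //; apply: cvgMr.
Unshelve. all: by end_near. Qed.

Lemma continuous_in_time_lin (c : R) (u v : R -> U) :
  (forall t, t \in `[0, T] -> P (u t)) -> (forall t, t \in `[0, T] -> P (v t)) ->
  continuous_in_time N T u -> continuous_in_time N T v -> continuous_in_time N T (c *: u + v).
Proof.
move=> Pu Pv cu cv t tI.
have E s : (c *: u + v) s - (c *: u + v) t = c *: (u s - u t) + (v s - v t).
  by rewrite [(c *: u + v) s]/(c *: u s + v s) [(c *: u + v) t]/(c *: u t + v t)
    opprD addrACA -scalerBr.
under eq_fun do rewrite E.
apply: cvg_seminorm_lin; last 2 first.
- exact: cu.
- exact: cv.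
- near=> s; have sI : s \in `[0, T] by near: s; exact: near_within.
  by apply: lin_closedB => //; exact: Pu.
- near=> s; have sI : s \in `[0, T] by near: s; exact: near_within.
  by apply: lin_closedB => //; exact: Pv.
Unshelve. all: by end_near. Qed.

Lemma derivative_in_time_lin (c : R) (u v du dv : R -> U) :
  (forall t, t \in `[0, T] -> P (u t)) -> (forall t, t \in `[0, T] -> P (v t)) ->
  (forall t, t \in `[0, T] -> P (du t)) -> (forall t, t \in `[0, T] -> P (dv t)) ->
  derivative_in_time N T u du -> derivative_in_time N T v dv ->
  derivative_in_time N T (c *: u + v) (c *: du + dv).
Proof.
move=> Pu Pv Pdu Pdv cu cv t tI.
have E s : (s - t)^-1 *: ((c *: u + v) s - (c *: u + v) t) - (c *: du + dv) t =
    c *: ((s - t)^-1 *: (u s - u t) - du t) + ((s - t)^-1 *: (v s - v t) - dv t).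
  rewrite [(c *: u + v) s]/(c *: u s + v s) [(c *: u + v) t]/(c *: u t + v t).
  rewrite [(c *: du + dv) t]/(c *: du t + dv t).
  by rewrite opprD addrACA -scalerBr scalerDr scalerA mulrC -scalerA opprD addrACA -scalerBr.
under eq_fun do rewrite E.
apply: cvg_seminorm_lin; last 2 first.
- exact: cu.
- exact: cv.
- near=> s; have sI : s \in `[0, T] by near: s; exact: near_within.
  apply: lin_closedB => //; last exact: Pdu.
  by apply: lin_closedZ => //; apply: lin_closedB => //; exact: Pu.
- near=> s; have sI : s \in `[0, T] by near: s; exact: near_within.
  apply: lin_closedB => //; last exact: Pdv.
  by apply: lin_closedZ => //; apply: lin_closedB => //; exact: Pv.
Unshelve. all: by end_near. Qed.

End time_functions.

Lemma primitive_integral {R : realType} (S Phi : R -> R) (T : R) : continuous S ->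
  (forall t, 0 <= t <= T -> is_derive t (1 : R) Phi (S t)) ->
  forall t, t \in `[0, T] -> \int[lebesgue_measure]_(tau in `[t, T]) S tau = Phi T - Phi t.
Proof.
move=> cS dPhi t; rewrite in_itv/= => /andP[t0 tT].
have [->|ne] := eqVneq t T; first by rewrite set_itv1 Rintegral_set1 subrr.
have lt : t < T by rewrite lt_neqAle ne.
have cP x : 0 <= x <= T -> {for x, continuous Phi} by move=> /dPhi/is_derive_continuous.
rewrite /Rintegral (@continuous_FTC2 _ S Phi _ _ lt)//.
- exact: continuous_subspaceT.
- split.
  + move=> x; rewrite in_itv/= => /andP[h1 h2].
    by have [] := dPhi x; [rewrite (ltW h2) (le_trans t0 (ltW h1))|].
  + by apply: cvg_at_right_filter; apply: cP; rewrite t0.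
  + by apply: cvg_at_left_filter; apply: cP; rewrite lexx (le_trans t0).
- move=> x; rewrite in_itv/= => /andP[h1 h2]; rewrite derive1E.
  by have [] := dPhi x; [rewrite (ltW h2) (le_trans t0 (ltW h1))|].
Qed.

Lemma sum3_le {R : realDomainType} (x y z d : R) : 0 <= x -> 0 <= y -> 0 <= z ->
  x + y + z <= d -> y <= d /\ z <= d.
Proof. by move=> x0 y0 z0 h; split; lra. Qed.

Section semidiscrete.
Context {R : realType} (n : nat).
Local Notation V := 'rV[R]_n.+1.
Local Notation M := 'M[R]_n.+1.
Local Notation leb := (lebesgue_rV n.+1).
Variables (Omega GammaD GammaN : set V) (T : R).
Variables (C : V -> {linear M -> M}) (E : V -> {linear V -> M}) (kappa : V -> M) (rho : V -> R).
Variables (c0 k0 rho0 : R) (gamma : (V -> R) -> V -> R) (G : (V -> R) -> R).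
Hypothesis lip : lipschitz_domain Omega.
Hypothesis bp : boundary_partition Omega GammaD GammaN.
Hypotheses (T0 : 0 < T) (c0_gt0 : 0 < c0) (k0_gt0 : 0 < k0) (rho0_gt0 : 0 < rho0).
Hypothesis hC : stiffness_coef Omega C c0.
Hypothesis hE : piezoelectric_coef Omega E.
Hypothesis hk : permittivity_coef Omega kappa k0.
Hypothesis hr : density_coef Omega rho rho0.
Hypothesis hG : bounded_linear_H1 Omega G.
Hypothesis G1 : G (cst 1) <> 0.
Let oO : open Omega. Proof. by case: lip. Qed.
Local Notation H1 := [set u | H1 Omega u].
Local Notation H1v := [set w | H1v Omega w].
Local Notation H1n := (H1norm Omega).
Local Notation H1vn := (H1normv Omega).
Local Notation m := (weighted_inner Omega rho).
Local Notation a := (stiffness_form Omega C).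
Local Notation b := (piezo_form Omega E).
Local Notation k := (permittivity_form Omega kappa).
Local Notation sol := (semidiscrete_solution Omega rho C E kappa G T).
Local Notation source := (source_space Omega gamma GammaD T).
Local Notation spaces := (discrete_spaces Omega gamma GammaD).
#[local] Opaque wder.

Let sV := seminormed_H1v oO.
Let sH := seminormed_H1 oO.
Let bm := bbil_weighted oO hr.
Let ba := bbil_stiffness oO hC.
Let bb := bbil_piezo oO hE.
Let bk := bbil_permittivity oO hk.
Let hP := sn_lin sV.
Let hQ := sn_lin sH.

Lemma functional0 : G 0 = 0.
Proof.
have [Gl _] := hG; have [H0 _] := hQ.
by have := Gl (- 1) 0 0 H0 H0; rewrite scaler0 addr0 mulN1r addNr.
Qed.

Section spaces.
Variables (Vh : set (V -> V)) (Wh : set (V -> R)).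
Hypothesis sp : spaces Vh Wh.

Lemma Vh_H1v w : Vh w -> H1v w.
Proof. by have [[h _ _ _ _] _ _] := sp; move=> /h []. Qed.

Lemma Vh_lin : lin_closed Vh.
Proof. by have [[_ h1 h2 _ _] _ _] := sp; split. Qed.

Lemma Wh_H1 u : Wh u -> H1 u.
Proof. by have [_ [h _ _ _ _] _] := sp; move=> /h. Qed.

Lemma kerG_H1 u : kerG G Wh u -> H1 u.
Proof. by case=> /Wh_H1. Qed.

Lemma kerG_lin : lin_closed (kerG G Wh).
Proof.
have [_ [h h1 h2 _ _] _] := sp; have [Gl _] := hG.
split; first by split => //; exact: functional0.
move=> c u v [Wu Gu] [Wv Gv]; split; first exact: h2.
by rewrite /= Gl ?Gu ?Gv ?mulr0 ?addr0//; exact: Wh_H1.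
Qed.

Lemma weak_form u psi w phi : H1v u -> H1 psi -> H1v w -> H1 phi ->
  bilinear_a Omega C E kappa u psi w phi = a u w + b psi w - b phi u + k psi phi.
Proof. exact: (bilinear_aE oO hC hE hk). Qed.

(** Testing with (w, 0) and with (0, phi) separates the equation of motion from Gauss's law. *)
Lemma weak_formP p2 p xi f : H1v p2 -> H1v p -> H1 xi -> H1v f ->
  (forall w phi, Vh w -> kerG G Wh phi -> m p2 w + bilinear_a Omega C E kappa p xi w phi = m f w) <->
  (forall w, Vh w -> m p2 w + a p w + b xi w = m f w) /\
  (forall phi, kerG G Wh phi -> k xi phi = b phi p).
Proof.
move=> Hp2 Hp Hxi Hf; have [V0 _] := Vh_lin; have [W0 _] := kerG_lin.
have [H0 _] := hP; have [K0 _] := hQ; split; last first.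
  move=> [h1 h2] w phi Vw Wphi; rewrite weak_form//; last 2 first.
  - exact: Vh_H1v.
  - exact: kerG_H1.
  by rewrite h2// subrK addrA h1.
move=> h; split=> [w Vw|phi Wphi].
  have Hw := Vh_H1v Vw; have := h w 0 Vw W0; rewrite weak_form// addrA.
  by rewrite (bbil0l sH bb)// (bbil0r sH bk)// subr0 addr0 addrA.
have Hphi := kerG_H1 Wphi; have := h 0 phi V0 Wphi; rewrite weak_form//.
rewrite !(bbil0r sV bm)// (bbil0r sV ba)// (bbil0r sV bb)// !add0r addrC => /eqP.
by rewrite subr_eq0 => /eqP.
Qed.

End spaces.

Lemma source_H1v f t : source f -> t \in `[0, T] -> H1v (f t).
Proof. by move=> [h _] /h []. Qed.

Lemma L2normv_dist (v w : V -> V) : H1v v -> H1v w ->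
  `|L2normv Omega v - L2normv Omega w| <= 1 * H1vn (v - w).
Proof.
move=> Hv Hw; rewrite mul1r; have Hvw := lin_closedB hP Hv Hw.
apply: le_trans (sn_dist (seminormed_L2v oO) Hv Hw) _.
exact: L2normv_le_H1normv.
Qed.

Lemma continuous_L2normv_source f : source f ->
  continuous (fun t => L2normv Omega (f (clamp T t))).
Proof.
move=> sf; have [_ cf] := sf.
apply: (continuous_clamp_comp T0 cf _ L2normv_dist) => t tI; exact: source_H1v sf tI.
Qed.

Lemma H1normv_dist (v w : V -> V) : H1v v -> H1v w -> `|H1vn v - H1vn w| <= 1 * H1vn (v - w).
Proof. by move=> Hv Hw; rewrite mul1r; exact: (sn_dist sV). Qed.

Lemma continuous_H1normv_source f : source f ->
  continuous (fun t => H1vn (f (clamp T t))).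
Proof.
move=> sf; have [_ cf] := sf.
apply: (continuous_clamp_comp T0 cf _ H1normv_dist) => t tI; exact: source_H1v sf tI.
Qed.

Lemma source_integral f (t : R) : t \in `[0, T] ->
  \int[lebesgue_measure]_(tau in `[t, T]) L2normv Omega (f (clamp T tau)) =
  \int[lebesgue_measure]_(tau in `[t, T]) L2normv Omega (f tau).
Proof.
rewrite in_itv/= => /andP[t0 tT]; apply: eq_Rintegral => tau /set_mem/=.
rewrite in_itv/= => /andP[h1 h2].
by rewrite clamp_id// in_itv/= h2 (le_trans t0).
Qed.

Theorem stability : exists2 K : R, 0 < K & forall Vh Wh f p xi,
  spaces Vh Wh -> source f -> sol Vh Wh f p xi -> forall t, t \in `[0, T] ->
    H1vn (p t) + H1n (xi t) <= K * \int[lebesgue_measure]_(tau in `[t, T]) L2normv Omega (f tau).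
Proof.
have [CK CK0 hCK] := korn_H1 lip; have [CP CP0 hCP] := poincare_functional lip hG G1.
have [B B0 hB] := weighted_upper oO hr.
have sm := semi_inner_weighted oO hr rho0_gt0; have sa := semi_inner_stiffness oO hC c0_gt0.
have sk := semi_inner_permittivity oO hk k0_gt0.
(* In [K1], Korn's constant multiplies the bounds of the strain by the energy, with 1/c0, and of the
   L^2 norm by the displacement estimate, with T^2/rho0. In [K2], Poincare's constant multiplies the
   bound 1/k0 of the electric field. [B] compares the weighted norm of f with its L^2 norm. *)
pose K1 := CK * (c0^-1 + T ^+ 2 / rho0); pose K2 := CP / k0.
have K10 : 0 <= K1.
  by rewrite mulr_ge0 ?ltW// addr_gt0 ?invr_gt0// divr_gt0// exprn_gt0.
have K20 : 0 <= K2 by rewrite divr_ge0 ?ltW.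
exists ((Num.sqrt K1 + Num.sqrt K2) * Num.sqrt B + 1).
  by rewrite ltr_wpDl// mulr_ge0 ?addr_ge0 ?sqrtr_ge0.
move=> Vh Wh f p xi sp sf [p1 [p2 [hin [dp dp1 cp2 cxi] heq pT p1T]]] t tI.
have Pp s : s \in `[0, T] -> H1v (p s) by move=> /hin [h _ _ _]; exact: Vh_H1v sp _ h.
have Pp1 s : s \in `[0, T] -> H1v (p1 s) by move=> /hin [_ h _ _]; exact: Vh_H1v sp _ h.
have Pp2 s : s \in `[0, T] -> H1v (p2 s) by move=> /hin [_ _ h _]; exact: Vh_H1v sp _ h.
have Pxi s : s \in `[0, T] -> H1 (xi s) by move=> /hin [_ _ _ h]; exact: kerG_H1 sp _ h.
have Pf s : s \in `[0, T] -> H1v (f s) := source_H1v sf.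
have TI : T \in `[0, T] by rewrite in_itv/= lexx ltW.
have eqs s (sI : s \in `[0, T]) := (weak_formP sp (Pp2 s sI) (Pp s sI) (Pxi s sI) (Pf s sI)).1 (heq s sI).
have motion s : s \in `[0, T] -> m (p2 s) (p1 s) + a (p s) (p1 s) + b (xi s) (p1 s) = m (f s) (p1 s).
  by move=> sI; have [h _] := eqs s sI; apply: h; have [] := hin s sI.
have gauss s s' : s \in `[0, T] -> s' \in `[0, T] -> k (xi s) (xi s') = b (xi s') (p s).
  by move=> sI s'I; have [_ h] := eqs s sI; apply: h; have [] := hin s' s'I.
have npT := aeq0_H1normv oO (Pp T TI) pT; have np1T := aeq0_H1normv oO (Pp1 T TI) p1T.
pose L s := L2normv Omega (f (clamp T s)).
have cL : continuous L := continuous_L2normv_source sf.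
have cS : continuous (fun s => Num.sqrt B * L s) by move=> s; apply: cvgMr; exact: cL.
have [Phi [_ dPhi]] := primitive T cS.
have S0 s : s \in `[0, T] -> 0 <= Num.sqrt B * L s by rewrite mulr_ge0 ?sqrtr_ge0.
have fS s : s \in `[0, T] -> snorm m (f s) <= Num.sqrt B * L s.
  move=> sI; rewrite /L clamp_id// -[L2normv _ _]ger0_norm ?L2normv_ge0// -sqrtr_sqr -sqrtrM//.
  by rewrite ler_wsqrtr//; apply: hB; exact: Pf.
pose D := Phi T - Phi t.
have e1 : Num.sqrt (energy m a k p p1 xi t) <= D :=
  energy_estimate sV sH sm sa sk bm ba bb bk T0 Pp Pp1 Pp2 Pf Pxi dp dp1 cxi motion gauss npT np1T S0 fS dPhi tI.
have e2 : snorm m (p t) <= T * D :=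
  displacement_estimate sV sH sm sa sk bm ba bb bk T0 Pp Pp1 Pp2 Pf Pxi dp dp1 cxi motion gauss npT np1T S0 fS dPhi tI.
have Hp := Pp t tI; have Hp1 := Pp1 t tI; have Hxi := Pxi t tI.
have D0 : 0 <= D by apply: le_trans e1; exact: sqrtr_ge0.
have m0 : 0 <= m (p1 t) (p1 t) := semi_inner_ge0 sm Hp1.
have a0 : 0 <= a (p t) (p t) := semi_inner_ge0 sa Hp.
have x0 : 0 <= k (xi t) (xi t) := semi_inner_ge0 sk Hxi.
have e1' : m (p1 t) (p1 t) + a (p t) (p t) + k (xi t) (xi t) <= D ^+ 2.
  by rewrite -(@sqr_sqrtr _ (_ + _)) ?addr_ge0// ler_pXn2r// nnegrE ?sqrtr_ge0.
have e2' : m (p t) (p t) <= (T * D) ^+ 2.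
  by rewrite -(sqr_snorm sm Hp) ler_pXn2r// nnegrE ?snorm_ge0// mulr_ge0// ltW.
have [a1 x1] : a (p t) (p t) <= D ^+ 2 /\ k (xi t) (xi t) <= D ^+ 2.
  exact: sum3_le m0 a0 x0 e1'.
have i1 : strainnorm2 Omega (p t) <= D ^+ 2 / c0.
  rewrite ler_pdivlMr// mulrC; exact: le_trans (stiffness_coercive oO hC Hp) a1.
have i2 : L2normv Omega (p t) ^+ 2 <= T ^+ 2 / rho0 * D ^+ 2.
  rewrite mulrAC ler_pdivlMr// mulrC; apply: le_trans (weighted_coercive oO hr Hp) _.
  by rewrite -exprMn.
have i3 : gradnorm2 Omega (xi t) <= D ^+ 2 / k0.
  rewrite ler_pdivlMr// mulrC; exact: le_trans (permittivity_coercive oO hk Hxi) x1.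
have j1 : H1vn (p t) <= Num.sqrt K1 * D.
  rewrite -(@ler_pXn2r _ 2)// ?nnegrE ?H1normv_ge0 ?mulr_ge0 ?sqrtr_ge0//.
  have -> : (Num.sqrt K1 * D) ^+ 2 = CK * ((c0^-1 + T ^+ 2 / rho0) * D ^+ 2).
    by rewrite exprMn (sqr_sqrtr K10) [RHS]mulrA.
  apply: le_trans (hCK _ Hp) _.
  apply: ler_wpM2l; first exact: ltW.
  by rewrite mulrDl [c0^-1 * _]mulrC; exact: lerD.
have j2 : H1n (xi t) <= Num.sqrt K2 * D.
  rewrite -(@ler_pXn2r _ 2)// ?nnegrE ?H1norm_ge0 ?mulr_ge0 ?sqrtr_ge0//.
  have Gxi : G (xi t) = 0 by have [_ _ _ []] := hin t tI.
  have -> : (Num.sqrt K2 * D) ^+ 2 = CP * (D ^+ 2 / k0).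
    by rewrite exprMn (sqr_sqrtr K20) /K2 -[LHS]mulrA [k0^-1 * _]mulrC.
  apply: le_trans (hCP _ Hxi Gxi) _.
  by apply: ler_wpM2l; first exact: ltW.
have DE : D = Num.sqrt B * \int[lebesgue_measure]_(tau in `[t, T]) L2normv Omega (f tau).
  rewrite -(source_integral f tI) /D -(primitive_integral cS dPhi tI).
  rewrite RintegralZl//.
  by apply: continuous_compact_integrable; [exact: segment_compact|exact: continuous_subspaceT].
have I0 : 0 <= \int[lebesgue_measure]_(tau in `[t, T]) L2normv Omega (f tau).
  by apply: Rintegral_ge0 => s _; exact: L2normv_ge0.
apply: le_trans (lerD j1 j2) _; rewrite -mulrDl DE.
move: (Num.sqrt K1 + _) (Num.sqrt B) (Rintegral _ _ _) I0 => x y z z0.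
by rewrite mulrA [leRHS]mulrDl mul1r lerDl.
Qed.

Lemma solution_lin Vh Wh (c : R) f g p q xi eta : spaces Vh Wh -> source f -> source g ->
  sol Vh Wh f p xi -> sol Vh Wh g q eta -> sol Vh Wh (c *: f + g) (c *: p + q) (c *: xi + eta).
Proof.
move=> sp sf sg [p1 [p2 [pin [dp dp1 cp2 cxi] peq pT p1T]]] [q1 [q2 [qin [dq dq1 cq2 ceta] qeq qT q1T]]].
have hV := Vh_lin sp; have hW := kerG_lin sp.
have Pp s : s \in `[0, T] -> H1v (p s) by move=> /pin [h _ _ _]; exact: Vh_H1v sp _ h.
have Pp1 s : s \in `[0, T] -> H1v (p1 s) by move=> /pin [_ h _ _]; exact: Vh_H1v sp _ h.
have Pp2 s : s \in `[0, T] -> H1v (p2 s) by move=> /pin [_ _ h _]; exact: Vh_H1v sp _ h.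
have Pxi s : s \in `[0, T] -> H1 (xi s) by move=> /pin [_ _ _ h]; exact: kerG_H1 sp _ h.
have Qp s : s \in `[0, T] -> H1v (q s) by move=> /qin [h _ _ _]; exact: Vh_H1v sp _ h.
have Qp1 s : s \in `[0, T] -> H1v (q1 s) by move=> /qin [_ h _ _]; exact: Vh_H1v sp _ h.
have Qp2 s : s \in `[0, T] -> H1v (q2 s) by move=> /qin [_ _ h _]; exact: Vh_H1v sp _ h.
have Qeta s : s \in `[0, T] -> H1 (eta s) by move=> /qin [_ _ _ h]; exact: kerG_H1 sp _ h.
have Pf s : s \in `[0, T] -> H1v (f s) := source_H1v sf.
have Pg s : s \in `[0, T] -> H1v (g s) := source_H1v sg.
exists (c *: p1 + q1), (c *: p2 + q2); split.
- move=> t tI; have [h1 h2 h3 h4] := pin t tI; have [h5 h6 h7 h8] := qin t tI.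
  by split; [exact: (proj2 hV)|exact: (proj2 hV)|exact: (proj2 hV)|exact: (proj2 hW)].
- split.
  + exact: (derivative_in_time_lin sV).
  + exact: (derivative_in_time_lin sV).
  + exact: (continuous_in_time_lin sV).
  + exact: (continuous_in_time_lin sH).
- move=> t tI.
  have Hp := Pp t tI; have Hp2 := Pp2 t tI; have Hxi := Pxi t tI; have Hf := Pf t tI.
  have Kp := Qp t tI; have Kp2 := Qp2 t tI; have Kxi := Qeta t tI; have Kg := Pg t tI.
  have [e1 e2] := (weak_formP sp Hp2 Hp Hxi Hf).1 (peq t tI).
  have [e3 e4] := (weak_formP sp Kp2 Kp Kxi Kg).1 (qeq t tI).
  apply: (weak_formP sp (proj2 hP c _ _ Hp2 Kp2) (proj2 hP c _ _ Hp Kp)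
    (proj2 hQ c _ _ Hxi Kxi) (proj2 hP c _ _ Hf Kg)).2; split=> [w Vw|phi Wphi].
  + have Hw := Vh_H1v sp Vw.
    rewrite (bbil_linl bm c Hp2 Kp2 Hw) (bbil_linl ba c Hp Kp Hw) (bbil_linl bb c Hxi Kxi Hw).
    rewrite (bbil_linl bm c Hf Kg Hw) -(e1 w Vw) -(e3 w Vw).
    move: (m _ _) (a _ _) (b _ _) (m _ _) (a _ _) (b _ _) => x1 x2 x3 x4 x5 x6; ring.
  + have Hphi := kerG_H1 sp Wphi.
    by rewrite (bbil_linl bk)// (bbil_linr bb)// e2// e4.
- apply: filterS2 pT qT => x hp hq Ox; have {}hp : p T x = 0 := hp Ox; have {}hq : q T x = 0 := hq Ox.
  have -> : (c *: p + q) T x = c *: p T x + q T x by [].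
  by rewrite hp hq scaler0 addr0.
- apply: filterS2 p1T q1T => x hp hq Ox; have {}hp : p1 T x = 0 := hp Ox; have {}hq : q1 T x = 0 := hq Ox.
  have -> : (c *: p1 + q1) T x = c *: p1 T x + q1 T x by [].
  by rewrite hp hq scaler0 addr0.
Qed.

Lemma source_lin (c : R) f g : is_trace Omega gamma -> source f -> source g -> source (c *: f + g).
Proof.
move=> tr [fin cf] [gin cg]; split; last first.
  by apply: (continuous_in_time_lin sV) => // t tI; [have [] := fin t tI|have [] := gin t tI].
move=> t tI; have [Hf f0] := fin t tI; have [Hg g0] := gin t tI.
split=> [|i]; first exact: (proj2 hP).
have [_ tl _ _] := tr.
have e : component ((c *: f + g) t) i = c *: component (f t) i + component (g t) i by exact: component_lin.
rewrite e; have h := tl c _ _ (Hf i) (Hg i).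
have [[OD _ eD] _ _ _] := bp.
apply: filterS3 h (f0 i) (g0 i) => x h h1 h2 Dx.
have -> := h _; last by move: Dx; rewrite eD => -[].
have -> : (c *: gamma (component (f t) i) + gamma (component (g t) i)) x =
   c * gamma (component (f t) i) x + gamma (component (g t) i) x by [].
by rewrite h1// h2// mulr0 addr0.
Qed.

(** The difference of two solutions solves the problem with the null source, so stability makes its
    norms vanish. *)
Theorem solution_unique Vh Wh f p q xi eta : spaces Vh Wh -> is_trace Omega gamma -> source f ->
  sol Vh Wh f p xi -> sol Vh Wh f q eta -> forall t, t \in `[0, T] ->
  aeq leb Omega (p t) (q t) /\ aeq leb Omega (xi t) (eta t).
Proof.
move=> sp tr sf sp1 sq1 t tI; have [K K0 hK] := stability.
have sd := solution_lin (- 1) sp sf sf sq1 sp1.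
have s0 := source_lin (- 1) tr sf sf.
have := hK _ _ _ _ _ sp s0 sd t tI.
have -> : \int[lebesgue_measure]_(tau in `[t, T]) L2normv Omega (((- 1) *: f + f) tau) = 0.
  rewrite (@eq_Rintegral _ _ _ _ _ (fun=> 0)) ?Rintegral_cst ?mul0r// => tau _.
  have -> : ((- 1) *: f + f) tau = 0.
    by have -> : ((- 1) *: f + f) tau = (- 1) *: f tau + f tau by []; rewrite scaleN1r addNr.
  exact: sn0 (seminormed_L2v oO).
rewrite mulr0 => h.
have [p1 [p2 [pin _ _ _ _]]] := sp1; have [q1 [q2 [qin _ _ _ _]]] := sq1.
have Hp : H1v (p t) by have [h1 _ _ _] := pin t tI; exact: Vh_H1v sp _ h1.
have Hq : H1v (q t) by have [h1 _ _ _] := qin t tI; exact: Vh_H1v sp _ h1.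
have Hx : H1 (xi t) by have [_ _ _ h1] := pin t tI; exact: kerG_H1 sp _ h1.
have He : H1 (eta t) by have [_ _ _ h1] := qin t tI; exact: kerG_H1 sp _ h1.
have e1 : ((- 1) *: q + p) t = p t - q t.
  by have -> : ((- 1) *: q + p) t = (- 1) *: q t + p t by []; rewrite scaleN1r addrC.
have e2 : ((- 1) *: eta + xi) t = xi t - eta t.
  by have -> : ((- 1) *: eta + xi) t = (- 1) *: eta t + xi t by []; rewrite scaleN1r addrC.
move: h; rewrite e1 e2 => h.
have [n1 n2] : H1vn (p t - q t) = 0 /\ H1n (xi t - eta t) = 0.
  have := H1normv_ge0 Omega (p t - q t); have := H1norm_ge0 Omega (xi t - eta t).
  by move=> g1 g2; split; apply/eqP; rewrite eq_le ?g1 ?g2 andbT; apply: le_trans h; rewrite ?lerDl ?lerDr.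
split; apply: aeq_sub.
- exact: (H1normv0_aeq oO (lin_closedB hP Hp Hq) n1).
- exact: (H1norm0_aeq oO (lin_closedB hQ Hx He) n2).
Qed.

End semidiscrete.

(** * Existence *)

Section orthonormal_families.
Context {R : realType} (U : lmodType R) (P : set U) (N : U -> R) (m : U -> U -> R).
Hypotheses (sN : seminormed P N) (hm : semi_inner P m) (bm : bbil P P N N m).
Let hP := sn_lin sN.

Definition proj_rest s (v : 'I_s -> U) (w : U) : U := w - \sum_i m w (v i) *: v i.

Variable V : set U.
Hypotheses (VP : V `<=` P) (hV : lin_closed V).
Hypothesis def_m : forall u, V u -> m u u = 0 -> N u = 0.

Let sum_V (I : finType) (c : I -> R) (v : I -> U) : (forall i, V (v i)) -> V (\sum_i c i *: v i).
Proof. by move=> Vv; apply: lin_closed_sum => // i _; exact: lin_closedZ. Qed.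

Lemma proj_rest_V s (v : 'I_s -> U) w : (forall i, V (v i)) -> V w -> V (proj_rest v w).
Proof. by move=> Vv Vw; apply: lin_closedB => //; exact: sum_V. Qed.

Definition orthonormal s (v : 'I_s -> U) := forall i j, m (v i) (v j) = (i == j)%:R.

Lemma inner_sum s (v : 'I_s -> U) (c : 'I_s -> R) j : (forall i, V (v i)) -> orthonormal v ->
  m (\sum_i c i *: v i) (v j) = c j.
Proof.
move=> Vv ov; have Pv i : P (v i) by exact: VP.
rewrite (bbil_suml sN bm)// (bigD1 j)//= ov eqxx mulr1 big1 ?addr0// => i ij.
by rewrite ov (negPf ij) mulr0.
Qed.

Lemma proj_rest_orth s (v : 'I_s -> U) w j : (forall i, V (v i)) -> orthonormal v -> V w ->
  m (proj_rest v w) (v j) = 0.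
Proof.
move=> Vv ov Vw; rewrite (bbilBl bm); first by rewrite inner_sum// subrr.
- exact: VP.
- exact/VP/sum_V.
- exact: VP.
Qed.

Lemma proj_rest_lin s (v : 'I_s -> U) c u w : (forall i, V (v i)) -> P u -> P w ->
  proj_rest v (c *: u + w) = c *: proj_rest v u + proj_rest v w.
Proof.
move=> Vv Pu Pw; have Pv i : P (v i) by exact: VP.
rewrite /proj_rest scalerBr addrACA; congr (_ + _).
rewrite scaler_sumr -opprD -big_split; congr (- _); apply: eq_bigr => i _.
by rewrite (bbil_linl bm)// scalerDl scalerA.
Qed.

Lemma proj_rest_null s (v : 'I_s -> U) w : (forall i, V (v i)) -> P w -> N w = 0 ->
  N (proj_rest v w) = 0.
Proof.
move=> Vv Pw w0; rewrite /proj_rest big1 ?subr0// => i _.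
by rewrite (bbil_null_l bm) ?scale0r//; exact: VP.
Qed.

(** Each generator is reduced by the family built so far. A rest of zero m-norm is null for [N] and
    is dropped; otherwise it is normalized and added. Dependence is expressed by [N] since
    generators span only up to null vectors. *)
Lemma gram_schmidt r (e : 'I_r -> U) : (forall i, V (e i)) ->
  exists s (v : 'I_s -> U), [/\ forall i, V (v i), orthonormal v &
    forall i, N (proj_rest v (e i)) = 0].
Proof.
elim: r e => [|r IH] e Ve.
  by exists 0%N, (fun=> 0); split => [|[]|[]]//; have [V0 _] := hV.
have [s [v [Vv ov hv]]] := IH (fun i => e (lift ord0 i)) (fun i => Ve _).
set x := e ord0; pose y := proj_rest v x.
have Vx : V x by exact: Ve.
have Vy : V y by exact: proj_rest_V.
have [y0|y0] := eqVneq (m y y) 0.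
  exists s, v; split => // i; case: (unliftP ord0 i) => [j|] ->; first exact: hv.
  exact: def_m.
have my : 0 < m y y by rewrite lt_def y0 (semi_inner_ge0 hm)//; exact: VP.
pose q := (Num.sqrt (m y y))^-1 *: y.
have Vq : V q by exact: lin_closedZ.
have Pq := VP Vq; have Py := VP Vy; have Px := VP Vx; have Pv i : P (v i) := VP (Vv i).
have sq0 : Num.sqrt (m y y) != 0 by rewrite sqrtr_eq0 -ltNge.
have mqv i : m q (v i) = 0.
  by rewrite (semi_innerZl hP hm)// proj_rest_orth// mulr0.
have mvq i : m (v i) q = 0 by rewrite (semi_innerC hm).
have mqq : m q q = 1.
  rewrite (semi_innerZl hP hm)// (semi_innerZr hP hm)// mulrA -expr2 exprVn sqr_sqrtr ?ltW//.
  by rewrite mulVf.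
pose v' (i : 'I_s.+1) := if unlift ord0 i is Some j then v j else q.
have v'0 : v' ord0 = q by rewrite /v' unlift_none.
have v'S j : v' (lift ord0 j) = v j by rewrite /v' liftK.
have restE w : proj_rest v' w = proj_rest v w - m w q *: q.
  rewrite /proj_rest big_ord_recl v'0 opprD addrA addrAC; congr (_ - _ - _).
  by apply: eq_bigr => i _; rewrite v'S.
exists s.+1, v'; split.
- by move=> i; case: (unliftP ord0 i) => [j|] ->; rewrite ?v'0 ?v'S.
- have l0 (j : 'I_s) : (lift ord0 j == ord0 :> 'I_s.+1) = false by [].
  have l0' (j : 'I_s) : (ord0 == lift ord0 j :> 'I_s.+1) = false by [].
  move=> i j; case: (unliftP ord0 i) => [i'|] ->; case: (unliftP ord0 j) => [j'|] ->;
    by rewrite ?v'S ?v'0 ?mqv ?mvq ?mqq ?ov ?l0 ?l0' ?eqxx ?(inj_eq lift_inj).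
- have mz w : V w -> m w q = m (proj_rest v w) q.
    move=> Vw; have Pw := VP Vw; have Ps : P (\sum_i m w (v i) *: v i) by exact/VP/sum_V.
    rewrite (bbilBl bm)// (bbil_suml sN bm)// big1 ?subr0// => i _.
    by rewrite mvq mulr0.
  move=> i; case: (unliftP ord0 i) => [j|] ->; rewrite restE mz//.
    rewrite (bbil_null_l bm)// ?scale0r ?subr0//.
    by apply/VP/proj_rest_V.
  rewrite -/x -/y (semi_innerZr hP hm)// /q scalerA.
  have -> : (Num.sqrt (m y y))^-1 * m y y * (Num.sqrt (m y y))^-1 = 1.
    by rewrite -{2}[m y y](@sqr_sqrtr _ (m y y)) ?ltW// expr2; field.
  by rewrite scale1r subrr (sn0 sN).
Qed.

Lemma orthonormal_basis r (e : 'I_r -> U) : (forall i, V (e i)) ->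
  (forall w, V w -> exists c : 'I_r -> R, N (w - \sum_i c i *: e i) = 0) ->
  exists s (v : 'I_s -> U), [/\ forall i, V (v i), orthonormal v &
    forall w, V w -> N (w - \sum_i m w (v i) *: v i) = 0].
Proof.
move=> Ve gen; have [s [v [Vv ov hv]]] := gram_schmidt Ve; exists s, v; split => // w Vw.
have [c hc] := gen w Vw; pose S := \sum_i c i *: e i.
have Pe i : P (e i) by exact: VP.
have VS : V S by exact: sum_V.
have Pw := VP Vw; have PS := VP VS; have PD := lin_closedB hP Pw PS.
have -> : w - \sum_i m w (v i) *: v i = proj_rest v (1 *: (w - S) + S).
  by rewrite scale1r subrK.
have Vr : V (proj_rest v (w - S)) by apply: proj_rest_V => //; exact: lin_closedB.
have VrS : V (proj_rest v S) by exact: proj_rest_V.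
rewrite proj_rest_lin// scale1r; apply/eqP; rewrite eq_le (sn_ge0 sN) ?andbT; last first.
  exact: VP (lin_closedD hV Vr VrS).
apply: le_trans (sn_tri sN (VP Vr) (VP VrS)) _; rewrite proj_rest_null// add0r.
suff h : forall l : seq 'I_r, N (proj_rest v (\sum_(i <- l) c i *: e i)) <= 0 by exact: h.
have P0 : P 0 by have [] := hP.
elim=> [|i l ih].
  by rewrite big_nil (_ : N (proj_rest v 0) = 0)//; apply: proj_rest_null => //; exact: sn0 sN.
have Vl : V (\sum_(j <- l) c j *: e j) by apply: lin_closed_sum => // j _; exact: lin_closedZ.
rewrite big_cons proj_rest_lin//; last exact: VP.
have V1 : V (proj_rest v (e i)) by exact: proj_rest_V.
have V2 : V (proj_rest v (\sum_(j <- l) c j *: e j)) by exact: proj_rest_V.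
have Pz := lin_closedZ (c i) hP (VP V1).
apply: le_trans (sn_tri sN Pz (VP V2)) _.
by rewrite (sn_scale sN) ?hv ?mulr0 ?add0r//; exact: VP.
Qed.

End orthonormal_families.

Lemma quotient_is_derive {R : realType} (f : R -> R) (t a : R) :
  is_derive t (1 : R) f a -> (s - t)^-1 * (f s - f t) @[s --> t^'] --> a.
Proof.
move=> /is_derive1_caratheodory[g [fg cg <-]].
have /continuous_withinNx h := cg.
apply: cvg_trans h; apply: near_eq_cvg; near=> s.
have st : s != t by near: s; exact: nbhs_dnbhs_neq.
by rewrite fg mulrC mulfK// subr_eq0.
Unshelve. all: by end_near. Qed.

Section coordinates_in_time.
Context {R : realType} (U : lmodType R) (P : set U) (N : U -> R) (T : R).
Hypothesis sN : seminormed P N.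
Variables (r : nat) (v : 'I_r -> U).
Hypothesis Pv : forall i, P (v i).
Let hP := sn_lin sN.

Lemma seminorm_sum_le (c : 'I_r -> R) : N (\sum_i c i *: v i) <= \sum_i `|c i| * N (v i).
Proof.
suff h : forall l : seq 'I_r, N (\sum_(i <- l) c i *: v i) <= \sum_(i <- l) `|c i| * N (v i).
  exact: h.
elim=> [|i l ih]; first by rewrite !big_nil (sn0 sN).
have P1 : P (c i *: v i) by exact: lin_closedZ.
have P2 : P (\sum_(j <- l) c j *: v j) by apply: lin_closed_sum => // j _; exact: lin_closedZ.
rewrite !big_cons; apply: le_trans (sn_tri sN P1 P2) _.
by rewrite (sn_scale sN)// lerD2l.
Qed.

Lemma cvg_coordinates (X : Type) (F : set_system X) {FF : Filter F} (c : 'I_r -> X -> R) :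
  (forall i, c i s @[s --> F] --> (0 : R)) -> N (\sum_i c i s *: v i) @[s --> F] --> (0 : R).
Proof.
move=> hc; apply: (@squeeze_cvgr _ _ _ _ (fun=> 0) (fun s => \sum_i `|c i s| * N (v i))).
- apply: nearW => s; rewrite seminorm_sum_le andbT; apply: (sn_ge0 sN).
  by apply: lin_closed_sum => // j _; exact: lin_closedZ.
- exact: cvg_cst.
- have h0 : \sum_(i < r) `|0 : R| * N (v i) = 0.
    by rewrite big1// => i _; rewrite normr0 mul0r.
  rewrite -[X in _ --> X]h0; apply: cvg_bigsum => i; apply: cvgMl; apply: cvg_norm; exact: hc.
Qed.

Lemma continuous_coordinates (c : 'I_r -> R -> R) :
  (forall i t, t \in `[0, T] -> {for t, continuous (c i)}) ->
  continuous_in_time N T (fun t => \sum_i c i t *: v i).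
Proof.
move=> cc t tI.
have E s : \sum_i c i s *: v i - \sum_i c i t *: v i = \sum_i (c i s - c i t) *: v i.
  by rewrite -sumrB; apply: eq_bigr => i _; rewrite scalerBl.
under eq_fun do rewrite E; apply: cvg_coordinates => i.
apply/subr_cvg0 => A Al; have h : \forall s \near t, A (c i s) by exact: (cc i t tI A Al).
have goal : \forall s \near t, s \in `[0, T] -> A (c i s); last by exact: goal.
by apply: filterS h.
Qed.

Lemma derivative_coordinates (c d : 'I_r -> R -> R) :
  (forall i t, t \in `[0, T] -> is_derive t (1 : R) (c i) (d i t)) ->
  derivative_in_time N T (fun t => \sum_i c i t *: v i) (fun t => \sum_i d i t *: v i).
Proof.
move=> cd t tI.
have E s : (s - t)^-1 *: (\sum_i c i s *: v i - \sum_i c i t *: v i) - \sum_i d i t *: v i =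
    \sum_i ((s - t)^-1 * (c i s - c i t) - d i t) *: v i.
  rewrite -sumrB scaler_sumr -sumrB; apply: eq_bigr => i _.
  by rewrite -scalerBl scalerA -scalerBl.
under eq_fun do rewrite E; apply: cvg_coordinates => i.
have h := quotient_is_derive (cd i t tI).
apply/subr_cvg0 => A Al; have {}h : \forall s \near t^', A ((s - t)^-1 * (c i s - c i t)) by exact: (h A Al).
have goal : \forall s \near t^', s \in `[0, T] -> A ((s - t)^-1 * (c i s - c i t)); last by exact: goal.
by apply: filterS h.
Qed.

End coordinates_in_time.

Section abstract_existence.
Context {R : realType} (U W : lmodType R) (P : set U) (Q : set W) (N : U -> R) (M : W -> R).
Variables (m a : U -> U -> R) (b : W -> U -> R) (k : W -> W -> R).
Hypotheses (sN : seminormed P N) (sM : seminormed Q M).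
Hypotheses (hm : semi_inner P m) (hk : semi_inner Q k).
Hypotheses (bm : bbil P P N N m) (ba : bbil P P N N a) (bb : bbil Q P M N b) (bk : bbil Q Q M M k).
Variables (VU : set U) (VW : set W).
Hypotheses (VP : VU `<=` P) (hV : lin_closed VU) (WQ : VW `<=` Q) (hW : lin_closed VW).
Hypothesis def_m : forall u, VU u -> m u u = 0 -> N u = 0.
Hypothesis def_k : forall u, VW u -> k u u = 0 -> M u = 0.
Hypothesis genU : exists r (e : 'I_r -> U), (forall i, VU (e i)) /\
  forall w, VU w -> exists c : 'I_r -> R, N (w - \sum_i c i *: e i) = 0.
Hypothesis genW : exists r (e : 'I_r -> W), (forall i, VW (e i)) /\
  forall w, VW w -> exists c : 'I_r -> R, M (w - \sum_i c i *: e i) = 0.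
Variables (T : R) (f : R -> U).
Hypothesis T0 : 0 < T.
Hypothesis Pf : forall t, t \in `[0, T] -> P (f t).
Hypothesis cf : continuous_in_time N T f.

(* The constraint is solved by the Riesz representative of b(., p) in the finite
   dimensional space VW; what is left is a linear system of second order for the
   coordinates of p in an orthonormal family. *)
Theorem galerkin_existence : exists (p p1 p2 : R -> U) (xi : R -> W),
  [/\ forall t, [/\ VU (p t), VU (p1 t), VU (p2 t) & VW (xi t)],
      [/\ derivative_in_time N T p p1, derivative_in_time N T p1 p2,
          continuous_in_time N T p2 & continuous_in_time M T xi],
      forall t, t \in `[0, T] -> (forall w, VU w -> m (p2 t) w + a (p t) w + b (xi t) w = m (f t) w) /\
        (forall phi, VW phi -> k (xi t) phi = b phi (p t)),
      p T = 0 & p1 T = 0].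
Proof.
have hP := sn_lin sN; have hQ := sn_lin sM.
have [rU [eU [eUV gU]]] := genU; have [rW [eW [eWV gW]]] := genW.
have [r [v [Vv ov hv]]] := orthonormal_basis sN hm bm VP hV def_m eUV gU.
have [q [z [Vz oz hz]]] := orthonormal_basis sM hk bk WQ hW def_k eWV gW.
have Pv i : P (v i) by exact: VP.
have Qz l : Q (z l) by exact: WQ.
(* The Schur complement of the electric block: the second term is b(xi, v_i) once xi is replaced by
   the sum of b(z_l, p) z_l. *)
pose A : 'M[R]_r := \matrix_(i, j) (a (v j) (v i) + \sum_l b (z l) (v j) * b (z l) (v i)).
pose g i t := m (f (clamp T t)) (v i).
have cg i : continuous (g i).
  have [B B0 hB] := bbil_bound bm.
  apply: (@continuous_clamp_comp _ _ P N T T0 f (fun u => m u (v i)) (B * N (v i)) cf Pf).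
  move=> u w Pu Pw; rewrite -(bbilBl bm)// [leRHS]mulrAC; apply: hB => //.
  exact: lin_closedB.
have [y [y1 [yT y1T dy dy1]]] := second_order_ode A T cg.
pose y2 i t := g i t - \sum_j A i j * y j t.
pose p t := \sum_i y i t *: v i.
pose p1 t := \sum_i y1 i t *: v i.
pose p2 t := \sum_i y2 i t *: v i.
pose xi t := \sum_l b (z l) (p t) *: z l.
have comb (c : 'I_r -> R) : VU (\sum_i c i *: v i).
  by apply: lin_closed_sum => // i _; exact: lin_closedZ.
have combW (c : 'I_q -> R) : VW (\sum_i c i *: z i).
  by apply: lin_closed_sum => // i _; exact: lin_closedZ.
have cy i t : t \in `[0, T] -> {for t, continuous (y i)}.
  by rewrite in_itv/= => tI; exact: is_derive_continuous (dy i t tI).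
have bzp l t : b (z l) (p t) = \sum_i y i t * b (z l) (v i) by rewrite (bbil_sumr sN bb).
exists p, p1, p2, xi; split.
- by move=> t; split; [exact: comb|exact: comb|exact: comb|exact: combW].
- split.
  + by apply: (derivative_coordinates sN Pv) => i t; rewrite in_itv/=; exact: dy.
  + by apply: (derivative_coordinates sN Pv) => i t; rewrite in_itv/=; exact: dy1.
  + apply: (continuous_coordinates sN Pv) => i t tI; apply: cvgB; first exact: cg.
    by apply: cvg_bigsum => j; apply: cvgMr; exact: cy.
  + apply: (continuous_coordinates sM Qz) => l t tI.
    have e : (fun s => \sum_i y i s * b (z l) (v i)) = (fun s => b (z l) (p s)).
      by apply/funext => s; rewrite bzp.
    by rewrite -e; apply: cvg_bigsum => j; apply: cvgMl; exact: cy.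
- move=> t tI; have Pp : P (p t) := VP (comb _); have Pp2 : P (p2 t) := VP (comb _).
  have Qx : Q (xi t) := WQ (combW _); have Pft := Pf tI; split.
  + have basis i : m (p2 t) (v i) + a (p t) (v i) + b (xi t) (v i) = m (f t) (v i).
      rewrite (inner_sum sN bm VP)// (bbil_suml sN ba)// (bbil_suml sM bb)// /y2 /g clamp_id//.
      rewrite -addrA addrAC -[RHS]addr0 -addrA; congr (_ + _).
      apply/eqP; rewrite subr_eq0; apply/eqP.
      have -> : \sum_l b (z l) (p t) * b (z l) (v i) =
          \sum_l \sum_j y j t * b (z l) (v j) * b (z l) (v i).
        by apply: eq_bigr => l _; rewrite bzp mulr_suml.
      rewrite exchange_big -big_split/=; apply: eq_bigr => j _.
      rewrite mxE mulrDl mulr_suml [a _ _ * _]mulrC; congr (_ + _).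
      by apply: eq_bigr => l _; ring.
    move=> w Vw; have Pw := VP Vw; pose s := \sum_i m w (v i) *: v i.
    have Ps : P s := VP (comb _); have Pd := lin_closedB hP Pw Ps.
    (* A bounded form does not distinguish [w] from its expansion in the orthonormal family, their
       difference being null for [N]. *)
    have dec (B : U -> U -> R) u : bbil P P N N B -> P u -> B u w = B u s.
      move=> hB Pu; apply/eqP; rewrite -subr_eq0 -(bbilBr hB)//.
      by rewrite (bbil_null_r hB)// hv.
    have decb : b (xi t) w = b (xi t) s.
      apply/eqP; rewrite -subr_eq0 -(bbilBr bb)//.
      by rewrite (bbil_null_r bb)// hv.
    rewrite (dec m)// (dec a)// decb (dec m (f t))// /s.
    rewrite !(bbil_sumr sN bm)// (bbil_sumr sN ba)// (bbil_sumr sN bb)//.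
    rewrite -!big_split/=; apply: eq_bigr => i _.
    by rewrite -basis; ring.
  + move=> phi Vphi; have Qphi := WQ Vphi; pose s := \sum_l k phi (z l) *: z l.
    have Qs : Q s := WQ (combW _); have Qd := lin_closedB hQ Qphi Qs.
    have -> : b phi (p t) = b s (p t).
      apply/eqP; rewrite -subr_eq0 -(bbilBl bb)//.
      by rewrite (bbil_null_l bb)// hz.
    rewrite (bbil_suml sM bk)// (bbil_suml sM bb)//; apply: eq_bigr => l _.
    by rewrite (semi_innerC hk)// mulrC.
- by rewrite /p big1// => i _; rewrite yT scale0r.
- by rewrite /p1 big1// => i _; rewrite y1T scale0r.
Qed.

End abstract_existence.

(** * Existence for the piezoelectric system *)

Section solvability.
Context {R : realType} (n : nat).
Local Notation V := 'rV[R]_n.+1.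
Local Notation M := 'M[R]_n.+1.
Local Notation leb := (lebesgue_rV n.+1).
Variables (Omega GammaD : set V) (T : R).
Variables (C : V -> {linear M -> M}) (E : V -> {linear V -> M}) (kappa : V -> M) (rho : V -> R).
Variables (c0 k0 rho0 : R) (gamma : (V -> R) -> V -> R) (G : (V -> R) -> R).
Hypothesis lip : lipschitz_domain Omega.
Hypotheses (T0 : 0 < T) (c0_gt0 : 0 < c0) (k0_gt0 : 0 < k0) (rho0_gt0 : 0 < rho0).
Hypothesis hC : stiffness_coef Omega C c0.
Hypothesis hE : piezoelectric_coef Omega E.
Hypothesis hk : permittivity_coef Omega kappa k0.
Hypothesis hr : density_coef Omega rho rho0.
Hypothesis hG : bounded_linear_H1 Omega G.
Hypothesis G1 : G (cst 1) <> 0.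
Let oO : open Omega. Proof. by case: lip. Qed.
Let bO : bounded_set Omega. Proof. by case: lip. Qed.
Local Notation H1 := [set u | H1 Omega u].
Local Notation H1v := [set w | H1v Omega w].
Local Notation H1n := (H1norm Omega).
Local Notation H1vn := (H1normv Omega).
Local Notation m := (weighted_inner Omega rho).
Local Notation k := (permittivity_form Omega kappa).
#[local] Opaque wder.

Let sV := seminormed_H1v oO.
Let sH := seminormed_H1 oO.
Let hP := sn_lin sV.
Let hQ := sn_lin sH.
Let sm := semi_inner_weighted oO hr rho0_gt0.
Let sk := semi_inner_permittivity oO hk k0_gt0.

Lemma weighted_definite w : H1v w -> m w w = 0 -> H1vn w = 0.
Proof.
move=> Hw w0; have := weighted_coercive oO hr Hw; rewrite w0 pmulr_rle0// => h.
have L0 : L2normv Omega w ^+ 2 = 0 by apply/eqP; rewrite eq_le h sqr_ge0.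
apply: (aeq0_H1normv oO Hw); apply: aeq_components => i; rewrite component0.
have Lw := H1_L2 (Hw i); apply: (L2norm0_aeq (open_measurable_rV oO) Lw).
move: L0; rewrite sqr_L2normv => /eqP; rewrite psumr_eq0 => [|j _]; last exact: sqr_ge0.
by move=> /allP /(_ i (mem_index_enum i)); rewrite implyTb sqrf_eq0 => /eqP.
Qed.

Lemma permittivity_definite u : H1 u -> G u = 0 -> k u u = 0 -> H1n u = 0.
Proof.
move=> Hu Gu u0; have [CP CP0 hCP] := poincare_functional lip hG G1.
have := permittivity_coercive oO hk Hu; rewrite u0 pmulr_rle0// => h.
have g0 : gradnorm2 Omega u = 0 by apply/eqP; rewrite eq_le h gradnorm2_ge0.
have := hCP u Hu Gu; rewrite g0 mulr0 => h2.
by apply/eqP; rewrite -sqrf_eq0 eq_le h2 sqr_ge0.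
Qed.

Section spaces.
Variables (Vh : set (V -> V)) (Wh : set (V -> R)).
Hypothesis sp : discrete_spaces Omega gamma GammaD Vh Wh.

Lemma Vh_generated : exists r (e : 'I_r -> V -> V), (forall i, Vh (e i)) /\
  forall w, Vh w -> exists c : 'I_r -> R, H1vn (w - \sum_i c i *: e i) = 0.
Proof.
have [[_ _ _ _ [r [e [eV h]]]] _ _] := sp; exists r, e; split => // w Vw.
have [c hc] := h w Vw; exists c.
have Vs : Vh (\sum_i c i *: e i).
  apply: lin_closed_sum => [|i _]; first exact: Vh_lin sp.
  by apply: lin_closedZ; [exact: Vh_lin sp|exact: eV].
have Hs : H1v (\sum_i c i *: e i) := Vh_H1v sp Vs.
have Hd := lin_closedB hP (Vh_H1v sp Vw) Hs.
by apply: (aeq0_H1normv oO Hd); exact: aeq_subr.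
Qed.

(* Subtracting from each generator the constant with the same value of G moves
   the generators into the kernel of G. *)
Lemma kerG_generated : exists r (e : 'I_r -> V -> R), (forall i, kerG G Wh (e i)) /\
  forall w, kerG G Wh w -> exists c : 'I_r -> R, H1n (w - \sum_i c i *: e i) = 0.
Proof.
have [_ [WH W0 Wl Wae [r [e [eW h]]]] Wc] := sp; have [Gl _] := hG.
have hW : lin_closed Wh by split.
pose one : V -> R := cst 1.
have W1 : Wh one := Wc 1.
have H1one := WH _ W1.
pose e' i := e i - (G (e i) / G one) *: one.
have He i := WH _ (eW i).
have GB u c : H1 u -> G (u - c *: one) = G u - c * G one.
  move=> Hu; have -> : u - c *: one = (- c) *: one + u by rewrite scaleNr addrC.
  by rewrite Gl// mulNr addrC.
have Ge i : G (e' i) = 0.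
  have G1' : G one != 0 by apply/eqP.
  by apply: etrans (GB _ _ (He i)) _; rewrite mulrVK ?unitfE// subrr.
have We i : Wh (e' i).
  by apply: (lin_closedB hW) => //; exact: (lin_closedZ _ hW).
exists r, e'; split=> [i|w [Ww Gw]]; first by split; [exact: We|exact: Ge].
have [c hc] := h w Ww; exists c.
have Hs : H1 (\sum_i c i *: e i).
  by apply: WH; apply: lin_closed_sum => // i _; exact: lin_closedZ.
have Hw := WH _ Ww.
pose d := \sum_i c i * (G (e i) / G one).
have sE : \sum_i c i *: e' i = \sum_i c i *: e i - d *: one.
  rewrite scaler_suml -sumrB; apply: eq_bigr => i _.
  by rewrite scalerBr scalerA.
have Gs : G (\sum_i c i *: e' i) = 0.
  suff : forall l : seq 'I_r, Wh (\sum_(i <- l) c i *: e' i) /\ G (\sum_(i <- l) c i *: e' i) = 0.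
    by move=> /(_ (index_enum _))[].
  elim=> [|i l [ihW ihG]]; first by rewrite big_nil; split => //; exact: functional0 lip hG.
  rewrite big_cons; split; first by apply: Wl.
  by rewrite Gl ?Ge ?ihG ?mulr0 ?addr0//; exact: WH.
have Hone := lin_closedZ d hQ H1one.
have wsG : G (w - \sum_i c i *: e i) = 0.
  have Hd := lin_closedB hQ Hw Hs.
  have nd : H1n (w - \sum_i c i *: e i) = 0.
    by apply: (aeq0_H1norm oO Hd); exact: aeq_subr.
  have [_ [B hB]] := hG; have := hB _ Hd; rewrite nd mulr0 normr_le0.
  by move=> /eqP.
have Gd : d * G one = 0.
  move: Gs; rewrite sE GB// => /eqP; rewrite subr_eq0 => /eqP <-.
  have : G (\sum_i c i *: e i) = G w - G (w - \sum_i c i *: e i).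
    have -> : w - \sum_i c i *: e i = (- 1) *: (\sum_i c i *: e i) + w by rewrite scaleN1r addrC.
    by rewrite Gl// mulN1r; ring.
  by move=> ->; rewrite wsG Gw subrr.
have d0 : d = 0 by move/eqP: Gd; rewrite mulf_eq0 => /orP[/eqP//|/eqP /G1].
rewrite sE d0 scale0r subr0.
by apply: (aeq0_H1norm oO (lin_closedB hQ Hw Hs)); exact: aeq_subr.
Qed.

Theorem solution_exists f : source_space Omega gamma GammaD T f -> exists p xi,
  semidiscrete_solution Omega rho C E kappa G T Vh Wh f p xi.
Proof.
move=> sf; have [_ cf] := sf; have Pf := source_H1v sf.
have [p [p1 [p2 [xi [pin [dp dp1 cp2 cxi] heq pT p1T]]]]] :=
  galerkin_existence sV sH sm sk (bbil_weighted oO hr) (bbil_stiffness oO hC)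
    (bbil_piezo oO hE) (bbil_permittivity oO hk)
    (fun w => @Vh_H1v _ _ _ _ _ _ _ sp w) (Vh_lin sp)
    (fun w => @kerG_H1 _ _ _ _ _ _ _ _ sp w) (kerG_lin lip hG sp)
    (fun w Vw => weighted_definite (Vh_H1v sp Vw))
    (fun w Ww => permittivity_definite (kerG_H1 sp Ww) Ww.2)
    Vh_generated kerG_generated T0 (fun t => Pf t) cf.
exists p, xi, p1, p2; split => //.
- move=> t tI; have [h1 h2 h3 h4] := pin t.
  apply: (weak_formP lip hC hE hk hr hG sp _ _ _ (Pf t tI)).2; last exact: heq.
  + exact: Vh_H1v sp _ h3.
  + exact: Vh_H1v sp _ h1.
  + exact: kerG_H1 sp _ h4.
- by rewrite pT; exact: aeW.
- by rewrite p1T; exact: aeW.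
Qed.

End spaces.

End solvability.

(** * The solution operator *)

Section traces_in_time.
Context {R : realType} (n : nat).
Local Notation V := 'rV[R]_n.+1.
Local Notation leb := (lebesgue_rV n.+1).
Local Notation mu := (@lebesgue_measure R).
Variables (Omega : set V) (gamma : (V -> R) -> V -> R) (T : R).
Hypotheses (oO : open Omega) (tr : is_trace Omega gamma) (T0 : 0 < T).
Local Notation H1 := [set u | H1 Omega u].
Local Notation H1n := (H1norm Omega).
Local Notation NG := (L2normGamma Omega).
#[local] Opaque wder.

Let mB := measurable_boundary Omega.
Let hL := L2_closed surface_measure mB.
Let hs := L2inner_semi surface_measure mB.
Let sH := seminormed_H1 oO.
Let hQ := sn_lin sH.

Lemma seminormed_L2Gamma : seminormed [set u | L2Gamma Omega u] NG.
Proof. by apply: (seminormed_semi_inner hL hs) => u Lu; rewrite /L2normGamma L2normE. Qed.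

Lemma trace_L2 u : H1 u -> L2Gamma Omega (gamma u).
Proof. by have [h _ _ _] := tr; exact: h. Qed.

Lemma trace_bound : exists2 B : R, 0 <= B & forall u, H1 u -> NG (gamma u) <= B * H1n u.
Proof.
have [_ _ [B hB] _] := tr; exists `|B| => // u Hu; apply: le_trans (hB u Hu) _.
by rewrite ler_wpM2r ?H1norm_ge0// ler_norm.
Qed.

Lemma trace_sub u v : H1 u -> H1 v -> NG (gamma u - gamma v) = NG (gamma (u - v)).
Proof.
move=> Hu Hv; have [_ tl _ _] := tr.
have Lu := trace_L2 Hu; have Lv := trace_L2 Hv.
have Hd := lin_closedB hQ Hu Hv; have Ld := trace_L2 Hd.
apply: (aeq_L2norm mB) => //; first exact: (lin_closedB hL Lu Lv).
have e : u - v = (- 1) *: v + u by rewrite scaleN1r addrC.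
rewrite e; have := tl (- 1) v u Hv Hu; apply: filterS => x h Bx; rewrite h//.
have -> : ((- 1) *: gamma v + gamma u) x = (- 1) * gamma v x + gamma u x by [].
by rewrite mulN1r addrC.
Qed.

Lemma trace_aeq u v : H1 u -> H1 v -> aeq leb Omega u v -> aeqGamma Omega (gamma u) (gamma v).
Proof.
move=> Hu Hv uv; have [B _ hB] := trace_bound.
have Hd := lin_closedB hQ Hu Hv.
have n0 : H1n (u - v) = 0 by apply: (aeq0_H1norm oO Hd); exact: aeq_subr.
have g0 : NG (gamma u - gamma v) = 0.
  rewrite trace_sub//; apply/eqP; rewrite eq_le L2norm_ge0 andbT.
  by apply: le_trans (hB _ Hd) _; rewrite n0 mulr0.
have Ld := lin_closedB hL (trace_L2 Hu) (trace_L2 Hv).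
have := L2norm0_aeq mB Ld g0; apply: filterS => x h Bx; have := h Bx.
by move=> {}h; apply/eqP; rewrite -subr_eq0; apply/eqP.
Qed.

Lemma trace_continuous_in_time xi : (forall t, t \in `[0, T] -> H1 (xi t)) ->
  continuous_in_time H1n T xi -> continuous_in_time NG T (fun t => gamma (xi t)).
Proof.
move=> Hxi cxi t tI; have [B _ hB] := trace_bound.
apply: (@squeeze_cvgr _ _ _ _ (fun=> 0) (fun s => B * H1n (xi s - xi t))).
- near=> s; have sI : s \in `[0, T] by near: s; exact: near_within.
  rewrite L2norm_ge0/= trace_sub; [|exact: Hxi|exact: Hxi].
  by apply: hB; apply: lin_closedB => //; exact: Hxi.
- exact: cvg_cst.
- by rewrite -[X in _ --> X](mulr0 B); apply: cvgMr; exact: (cxi t tI).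
Unshelve. all: by end_near. Qed.

Section steps.
Variable y : R -> V -> R.
Hypothesis Ly : forall t, t \in `[0, T] -> L2Gamma Omega (y t).
Hypothesis cy : continuous_in_time NG T y.

Let h k : R := T / k.+1%:R.
(** There are k+2 half-open intervals of length T/(k+1): the first k+1 miss the end point T, and the
    last one begins there. *)
Let A k (j : 'I_k.+2) : set R := `[j%:R * h k, j.+1%:R * h k[%classic.
Let g k (j : 'I_k.+2) : V -> R := y (clamp T (j%:R * h k)).

Let h_gt0 k : 0 < h k. Proof. by rewrite divr_gt0// ltr0n. Qed.

Let step_unique k (i j : nat) t : i%:R * h k <= t < i.+1%:R * h k ->
  j%:R * h k <= t < j.+1%:R * h k -> i = j.
Proof.
move=> /andP[i1 i2] /andP[j1 j2].
have := le_lt_trans i1 j2; have := le_lt_trans j1 i2.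
rewrite !ltr_pM2r ?h_gt0// !ltr_nat !ltnS => a b.
by apply/eqP; rewrite eqn_leq a b.
Qed.

Let step_exists k t : t \in `[0, T] -> exists j : 'I_k.+2, A j t.
Proof.
rewrite in_itv/= => /andP[t0 tT].
pose i := Num.truncn (t / h k).
have t0' : 0 <= t / h k by rewrite divr_ge0// ltW.
have /andP[i1 i2] : i%:R <= t / h k < i.+1%:R by exact: truncn_itv.
have ik : (i < k.+2)%N.
  rewrite ltnS -(ler_nat R); apply: le_trans i1 _.
  rewrite /h invf_div mulrA ler_pdivrMr// mulrC; exact: ler_wpM2l.
exists (Ordinal ik); rewrite /A/= in_itv/=; apply/andP; split.
  by rewrite -ler_pdivlMr.
by rewrite -ltr_pdivrMr.
Qed.

(** Exactly one interval contains t, and the step function takes there the value of y at a time at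
    most T/(k+1) before t. *)
Lemma step_functions_cvg t : t \in `[0, T] ->
  NG ((\sum_j \1_(@A k j) t *: @g k j) - y t) @[k --> \oo] --> (0 : R).
Proof.
move=> tI; apply/cvgrPdist_lt => e e0.
have := cy tI => /cvgrPdist_lt /(_ e e0) near_t.
have {}near_t : \forall s \near t, s \in `[0, T] -> `|0 - NG (y s - y t)| < e by exact: near_t.
have /nbhs_ballP[r r0 hr] := near_t.
have hk : \forall k \near \oo, h k < r.
  exists (Num.Def.archi_bound (T / r)) => // k /= kr; rewrite /h ltr_pdivrMr// mulrC -ltr_pdivrMr//.
  apply: lt_le_trans (archi_boundP _) _; first by rewrite divr_ge0// ltW.
  by rewrite ler_nat; exact: leqW.
apply: filterS hk => k kr.
have [j Aj] := step_exists k tI.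
have -> : \sum_i \1_(@A k i) t *: @g k i = g j.
  rewrite (bigD1 j)//= big1 ?addr0 => [|i ij].
    by rewrite indicE mem_set// scale1r.
  rewrite indicE memNset ?scale0r// => Ai; move/eqP: ij; apply; apply/val_inj.
  by apply: (@step_unique k _ _ t); [move: Ai|move: Aj]; rewrite /A/= in_itv.
apply: hr; last exact: clamp_in.
rewrite /ball/=; move: Aj tI; rewrite /A/= !in_itv/= => /andP[j1 j2] /andP[t0 tT].
have j0 : 0 <= j%:R * h k by rewrite mulr_ge0// ltW.
rewrite clamp_id; last by rewrite in_itv/= j0 (le_trans j1).
rewrite ger0_norm ?subr_ge0//.
move: j2; rewrite -addn1 natrD mulrDl mul1r => j2; lra.
Qed.

Lemma continuous_L2normGamma : continuous (fun t => NG (y (clamp T t))).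
Proof.
apply: (continuous_clamp_comp T0 cy Ly (B := 1)) => v w Lv Lw.
by rewrite mul1r; exact: (sn_dist seminormed_L2Gamma).
Qed.

Lemma integrable_continuous (F : R -> R) : continuous F -> mu.-integrable `[0, T] (EFin \o F).
Proof.
by move=> cF; apply: continuous_compact_integrable; [exact: segment_compact|exact: continuous_subspaceT].
Qed.

Lemma trace_space_continuous : trace_space Omega T y.
Proof.
split.
- by apply: aeW => t; exact: Ly.
- exists (fun k => k.+2), A, g; split=> [k j|]; last by apply: aeW => t; exact: step_functions_cvg.
  by split; [exact: measurable_itv|apply: Ly; exact: clamp_in].
- have cF : continuous (fun t => NG (y (clamp T t)) ^+ 2).
    by move=> t; apply: cvgM; exact: continuous_L2normGamma.
  have /integrableP[_] := integrable_continuous cF.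
  move=> h1; apply: le_lt_trans h1; rewrite le_eqVlt; apply/predU1P; left.
  by apply: eq_integral => t /set_mem tI; rewrite /= clamp_id// ger0_norm ?sqr_ge0.
Qed.

End steps.

(** Cauchy-Schwarz in L^2(0, T) against the constant 1. *)
Lemma sqr_integral_le (g : R -> R) : continuous g ->
  (\int[mu]_(t in `[0, T]) g t) ^+ 2 <= T * \int[mu]_(t in `[0, T]) (g t) ^+ 2.
Proof.
move=> cg; have mI : measurable (`[0, T]%classic : set (measurableTypeR R)) by exact: measurable_itv.
have L (F : R -> R) : continuous F -> L2 mu `[0, T] F.
  move=> cF; split.
    by apply: measurable_funS (continuous_measurable_fun cF).
  have cF2 : continuous (fun t => F t ^+ 2) by move=> t; apply: cvgM; exact: cF.
  have /integrableP[_] := integrable_continuous cF2.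
  move=> h1; apply: le_lt_trans h1; rewrite le_eqVlt; apply/predU1P; left.
  by apply: eq_integral => t _; rewrite /= ger0_norm ?sqr_ge0.
have Lg := L _ cg; have L1 : L2 mu `[0, T] (cst 1 : R -> R) by apply: L => t; exact: cvg_cst.
have := semi_inner_cs (L2_closed mu mI) (L2inner_semi mu mI) Lg L1.
rewrite /L2inner/=; under eq_Rintegral => t _ do rewrite mulr1.
move=> h; apply: le_trans h _; rewrite mulrC.
have -> : \int[mu]_(x in `[0, T]) (1 * 1 : R) = T.
  rewrite Rintegral_cst//= lebesgue_measure_itv/= lte_fin T0/= mulr1 mul1r.
  by rewrite subr0.
by under eq_Rintegral => t _ do rewrite -expr2.
Qed.

End traces_in_time.

Section solution_operator.
Context {R : realType} (n : nat).
Local Notation V := 'rV[R]_n.+1.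
Local Notation M := 'M[R]_n.+1.
Local Notation leb := (lebesgue_rV n.+1).
Local Notation mu := (@lebesgue_measure R).
Variables (Omega GammaD GammaN : set V) (T : R).
Variables (C : V -> {linear M -> M}) (E : V -> {linear V -> M}) (kappa : V -> M) (rho : V -> R).
Variables (c0 k0 rho0 : R) (gamma : (V -> R) -> V -> R) (G : (V -> R) -> R).
Hypothesis lip : lipschitz_domain Omega.
Hypothesis bp : boundary_partition Omega GammaD GammaN.
Hypotheses (T0 : 0 < T) (c0_gt0 : 0 < c0) (k0_gt0 : 0 < k0) (rho0_gt0 : 0 < rho0).
Hypothesis hC : stiffness_coef Omega C c0.
Hypothesis hE : piezoelectric_coef Omega E.
Hypothesis hk : permittivity_coef Omega kappa k0.
Hypothesis hr : density_coef Omega rho rho0.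
Hypothesis tr : is_trace Omega gamma.
Hypothesis hG : bounded_linear_H1 Omega G.
Hypothesis G1 : G (cst 1) <> 0.
Let oO : open Omega. Proof. by case: lip. Qed.
Local Notation H1 := [set u | H1 Omega u].
Local Notation H1n := (H1norm Omega).
Local Notation H1vn := (H1normv Omega).
Local Notation NG := (L2normGamma Omega).
Local Notation sol := (semidiscrete_solution Omega rho C E kappa G T).
Local Notation source := (source_space Omega gamma GammaD T).
Local Notation spaces := (discrete_spaces Omega gamma GammaD).
#[local] Opaque wder.

Let mB := measurable_boundary Omega.
Let hL := L2_closed surface_measure mB.

Lemma solution_xi_H1 Vh Wh f p xi t : spaces Vh Wh -> sol Vh Wh f p xi -> t \in `[0, T] -> H1 (xi t).
Proof. by move=> sp [p1 [p2 [pin _ _ _ _]]] /pin [_ _ _ h]; exact: kerG_H1 sp _ h. Qed.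

Lemma solution_xi_continuous Vh Wh f p xi : sol Vh Wh f p xi -> continuous_in_time H1n T xi.
Proof. by move=> [p1 [p2 [_ [_ _ _ h] _ _ _]]]. Qed.

(** Some solution is chosen whenever there is one, and uniqueness makes the choice immaterial up to
    null sets. The default value 0 is reached only when there is no solution, never for a source. *)
Definition Rh_of Vh Wh (f : R -> V -> V) : R -> V -> R :=
  match pselect (exists q, sol Vh Wh f q.1 q.2) with
  | left h => fun t => gamma ((projT1 (cid h)).2 t)
  | right _ => 0
  end.

Lemma Rh_ofE Vh Wh f : spaces Vh Wh -> source f -> exists p xi, sol Vh Wh f p xi /\
  Rh_of Vh Wh f = fun t => gamma (xi t).
Proof.
move=> sp sf; rewrite /Rh_of; case: pselect => [h|no].
  by exists (projT1 (cid h)).1, (projT1 (cid h)).2; split => //; exact: (projT2 (cid h)).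
have [p [xi hs]] := solution_exists lip T0 k0_gt0 rho0_gt0 hC hE hk hr hG G1 sp sf.
by case: no; exists (p, xi).
Qed.

Lemma Rh_of_solution Vh Wh : spaces Vh Wh ->
  is_solution_operator Omega rho C E kappa gamma GammaD G T Vh Wh (Rh_of Vh Wh).
Proof.
move=> sp f p xi sf hs t tI; have [q [eta [hq ->]]] := Rh_ofE sp sf.
have [_ h] := solution_unique lip bp T0 c0_gt0 k0_gt0 rho0_gt0 hC hE hk hr hG G1 sp tr sf hq hs tI.
by apply: (trace_aeq oO tr) => //; [exact: solution_xi_H1 sp hq tI|exact: solution_xi_H1 sp hs tI].
Qed.

(** The combination of the two chosen solutions solves the problem for the combined source, and
    [Rh_of_solution] compares it with the solution chosen there. *)
Lemma Rh_of_lin Vh Wh (c : R) f g : spaces Vh Wh -> source f -> source g ->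
  forall t, t \in `[0, T] ->
  aeqGamma Omega (Rh_of Vh Wh (c *: f + g) t) (c *: Rh_of Vh Wh f t + Rh_of Vh Wh g t).
Proof.
move=> sp sf sg t tI.
have [p [xi [hp ->]]] := Rh_ofE sp sf; have [q [eta [hq ->]]] := Rh_ofE sp sg.
have hs := solution_lin lip hC hE hk hr hG c sp sf sg hp hq.
have sfg := source_lin lip bp c tr sf sg.
have Hxi := solution_xi_H1 sp hp tI; have Heta := solution_xi_H1 sp hq tI.
have [_ tl _ _] := tr.
have h1 := Rh_of_solution sp sfg hs tI; have h2 := tl c _ _ Hxi Heta.
by apply: filterS2 h1 h2 => x h1 h2 Bx; rewrite h1// h2.
Qed.

Lemma integral_clamp (F : R -> R) :
  \int[mu]_(t in `[0, T]) F (clamp T t) = \int[mu]_(t in `[0, T]) F t.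
Proof. by apply: eq_Rintegral => t /set_mem tI; rewrite clamp_id. Qed.

Lemma integral_L2norm_source f t : source f -> t \in `[0, T] ->
  \int[mu]_(tau in `[t, T]) L2normv Omega (f tau) <=
  Num.sqrt T * L2time_norm H1vn T f.
Proof.
move=> sf tI; rewrite -(source_integral _ f tI).
have cL := continuous_L2normv_source lip T0 sf; have cH := continuous_H1normv_source lip T0 sf.
have Pf s : H1v Omega (f (clamp T s)) by apply: (source_H1v sf); exact: clamp_in.
have I0T (F : R -> R) : continuous F -> mu.-integrable `[0, T] (EFin \o F) by exact: integrable_continuous.
have mI : measurable (`[0, T]%classic : set (measurableTypeR R)) by exact: measurable_itv.
apply: (@le_trans _ _ (\int[mu]_(tau in `[0, T]) H1vn (f (clamp T tau)))).
  apply: (@le_trans _ _ (\int[mu]_(tau in `[0, T]) L2normv Omega (f (clamp T tau)))).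
    have sub : (`[t, T] `<=` `[0, T])%classic.
      move=> s/=; rewrite !in_itv/= => /andP[h ->]; rewrite andbT.
      by move: tI; rewrite in_itv/= => /andP[h0 _]; exact: le_trans h.
    rewrite /Rintegral fine_le//.
    - apply: integrable_fin_num => //; apply: integrableS (I0T _ cL) => //; exact: measurable_itv.
    - by apply: integrable_fin_num => //; exact: I0T.
    - apply: ge0_subset_integral => //; first by apply: measurable_int; exact: (I0T _ cL).
      by move=> s _; rewrite lee_fin L2normv_ge0.
  apply: le_Rintegral => //; [exact: I0T|exact: I0T|move=> s _].
  exact: L2normv_le_H1normv.
rewrite -(@ler_pXn2r _ 2)// ?nnegrE; last 2 first.
- by apply: Rintegral_ge0 => s _; exact: H1normv_ge0.
- by rewrite mulr_ge0 ?sqrtr_ge0.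
apply: le_trans (sqr_integral_le T0 cH) _.
rewrite exprMn (sqr_sqrtr (ltW T0)) ler_wpM2l ?(ltW T0)//.
rewrite sqr_sqrtr; last by apply: Rintegral_ge0 => s _; exact: sqr_ge0.
have eq_le (x y : R) : x = y -> x <= y by move=> ->.
apply: eq_le; apply: eq_Rintegral => s /set_mem sI.
by rewrite clamp_id.
Qed.

Lemma L2time_norm_le (N : (V -> R) -> R) (y : R -> V -> R) (B : R) :
  continuous (fun t => N (y (clamp T t))) -> (forall t, 0 <= N (y t)) -> 0 <= B ->
  (forall t, t \in `[0, T] -> N (y t) <= B) -> L2time_norm N T y <= Num.sqrt T * B.
Proof.
move=> cy y0 B0 yB; rewrite -(@ler_pXn2r _ 2)// ?nnegrE ?sqrtr_ge0 ?mulr_ge0 ?sqrtr_ge0//.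
rewrite sqr_sqrtr; last by apply: Rintegral_ge0 => s _; exact: sqr_ge0.
rewrite exprMn (sqr_sqrtr (ltW T0)).
have mI : measurable (`[0, T]%classic : set (measurableTypeR R)) by exact: measurable_itv.
have -> : T * B ^+ 2 = \int[mu]_(t in `[0, T]) (B ^+ 2).
  rewrite Rintegral_cst//= lebesgue_measure_itv/= lte_fin T0/= subr0.
  by rewrite mulrC.
rewrite -(integral_clamp (fun s => N (y s) ^+ 2)).
apply: le_Rintegral => //.
- by apply: integrable_continuous => // t; apply: cvgM; exact: cy.
- by apply: integrable_continuous => // t; exact: cvg_cst.
- by move=> t tI; rewrite ler_pXn2r// ?nnegrE// yB// clamp_in.
Qed.

Theorem Rh_of_bounded : exists B : R, forall Vh Wh, spaces Vh Wh ->
  bounded_linear_operator Omega gamma GammaD T (Rh_of Vh Wh) B.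
Proof.
have [K K0 hK] := stability GammaD gamma lip T0 c0_gt0 k0_gt0 rho0_gt0 hC hE hk hr hG G1.
have [B B0 hB] := trace_bound tr.
(* From right to left: Cauchy-Schwarz for the integral of the source, the stability constant, the
   bound of the trace, and the L^2 norm in time of a quantity bounded on [0, T]. *)
exists (Num.sqrt T * (B * (K * Num.sqrt T))) => Vh Wh sp; split.
- move=> f sf; have [p [xi [hp ->]]] := Rh_ofE sp sf.
  have Hxi t : t \in `[0, T] -> H1 (xi t) by exact: solution_xi_H1 sp hp.
  apply: (trace_space_continuous T0).
  + by move=> t tI; apply: (trace_L2 tr); exact: Hxi.
  + by apply: (trace_continuous_in_time oO tr) => //; exact: solution_xi_continuous hp.
- move=> c f g sf sg; apply: aeW => t tI; exact: Rh_of_lin.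
- move=> f sf; have [p [xi [hp ->]]] := Rh_ofE sp sf.
  have Hxi t : t \in `[0, T] -> H1 (xi t) by exact: solution_xi_H1 sp hp.
  rewrite -!mulrA; apply: L2time_norm_le.
  + apply: (@continuous_L2normGamma _ _ Omega T T0 (fun t => gamma (xi t))).
    * by move=> t tI; apply: (trace_L2 tr); exact: Hxi.
    * by apply: (trace_continuous_in_time oO tr) => //; exact: solution_xi_continuous hp.
  + by move=> t; exact: L2norm_ge0.
  + by rewrite !mulr_ge0 ?sqrtr_ge0// ltW.
  + move=> t tI; apply: le_trans (hB _ (Hxi t tI)) _; rewrite ler_wpM2l//.
    apply: (@le_trans _ _ (H1vn (p t) + H1n (xi t))); first by rewrite lerDr H1normv_ge0.
    apply: le_trans (hK _ _ _ _ _ sp sf hp t tI) _; rewrite ler_wpM2l ?(ltW K0)//.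
    exact: integral_L2norm_source.
Qed.

End solution_operator.

Theorem theorem3p7 (R : realType) (n : nat)
    (Omega GammaD GammaN : set 'rV[R]_n.+1) (T : R)
    (C : 'rV[R]_n.+1 -> {linear 'M[R]_n.+1 -> 'M[R]_n.+1})
    (E : 'rV[R]_n.+1 -> {linear 'rV[R]_n.+1 -> 'M[R]_n.+1})
    (kappa : 'rV[R]_n.+1 -> 'M[R]_n.+1) (rho : 'rV[R]_n.+1 -> R)
    (c0 k0 rho0 : R)
    (gamma : ('rV[R]_n.+1 -> R) -> 'rV[R]_n.+1 -> R)
    (G : ('rV[R]_n.+1 -> R) -> R) :
  lipschitz_domain Omega ->
  boundary_partition Omega GammaD GammaN ->
  0 < T -> 0 < c0 -> 0 < k0 -> 0 < rho0 ->
  stiffness_coef Omega C c0 ->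
  piezoelectric_coef Omega E ->
  permittivity_coef Omega kappa k0 ->
  density_coef Omega rho rho0 ->
  is_trace Omega gamma ->
  bounded_linear_H1 Omega G -> G (cst 1) <> 0 ->
  [/\ (* unique solvability *)
      forall Vh Wh f,
        discrete_spaces Omega gamma GammaD Vh Wh ->
        source_space Omega gamma GammaD T f ->
        (exists p xi,
           semidiscrete_solution Omega rho C E kappa G T Vh Wh f p xi) /\
        (forall p xi q eta,
           semidiscrete_solution Omega rho C E kappa G T Vh Wh f p xi ->
           semidiscrete_solution Omega rho C E kappa G T Vh Wh f q eta ->
           forall t, t \in `[0, T] ->
             aeq (lebesgue_rV n.+1) Omega (p t) (q t) /\
             aeq (lebesgue_rV n.+1) Omega (xi t) (eta t)),
      (* stability estimate *)
      exists2 K : R, 0 < K & forall Vh Wh f p xi,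
        discrete_spaces Omega gamma GammaD Vh Wh ->
        source_space Omega gamma GammaD T f ->
        semidiscrete_solution Omega rho C E kappa G T Vh Wh f p xi ->
        forall t, t \in `[0, T] ->
          H1normv Omega (p t) + H1norm Omega (xi t) <=
          K * \int[lebesgue_measure]_(tau in `[t, T]) L2normv Omega (f tau) &
      (* uniform boundedness of R_h *)
      exists B : R, forall Vh Wh,
        discrete_spaces Omega gamma GammaD Vh Wh ->
        exists2 Rh : (R -> 'rV[R]_n.+1 -> 'rV[R]_n.+1) -> R -> 'rV[R]_n.+1 -> R,
          is_solution_operator Omega rho C E kappa gamma GammaD G T Vh Wh Rh &
          bounded_linear_operator Omega gamma GammaD T Rh B].
Proof.
move=> lip bp T0 c0_gt0 k0_gt0 rho0_gt0 hC hE hk hr tr hG G1; split.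
- move=> Vh Wh f sp sf; split.
    exact: (solution_exists lip T0 k0_gt0 rho0_gt0 hC hE hk hr hG G1 sp sf).
  move=> p xi q eta; exact: (solution_unique lip bp T0 c0_gt0 k0_gt0 rho0_gt0 hC hE hk hr hG G1 sp tr sf).
- exact: (stability GammaD gamma lip T0 c0_gt0 k0_gt0 rho0_gt0 hC hE hk hr hG G1).
- have [B hB] := Rh_of_bounded lip bp T0 c0_gt0 k0_gt0 rho0_gt0 hC hE hk hr tr hG G1.
  exists B => Vh Wh sp; exists (Rh_of Omega T C E kappa rho gamma G Vh Wh); last exact: hB.
  exact: (Rh_of_solution lip bp T0 c0_gt0 k0_gt0 rho0_gt0 hC hE hk hr tr hG G1 sp).
Qed.
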